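(* Let $n\ge 2$ be an integer and let $K\subset\mathbb{R}^n$ be a convex body containing the origin in its interior. Then for any $p\in[1,n)$ and any $\tau\in[-1,1]$, $$\Big(\frac{S_p(K)}{S_p(B_n)}\Big)^{\frac1{n-p}}\ge\Big(\frac{C_p(K)}{C_p(B_n)}\Big)^{\frac1{n-p}}\ge\Big(\frac{C_{p,\tau}(K)}{C_{p,\tau}(B_n)}\Big)^{\frac1{n-p}}\ge\Big(\frac{V(K)}{V(B_n)}\Big)^{\frac1n}.$$
   Context: A convex body is a compact convex subset of $\mathbb{R}^n$ with nonempty interior; $V$ is volume; $B_n$ is the closed unit Euclidean ball; $du$ is the rotation-invariant probability measure on $S^{n-1}$; $\mathcal{H}^{n-1}$ is $(n-1)$-dimensional Hausdorff measure. For $p\ge1$ and $\tau\in[-1,1]$ let $\varphi_\tau(t)=\big(\tfrac{1+\tau}{2}\big)^{1/p}t_++\big(\tfrac{1-\tau}{2}\big)^{1/p}t_-$ for $t\in\mathbb{R}$, with $t_+=\max\{t,0\}$ and $t_-=\max\{-t,0\}$. For $f\in C_c^\infty(\mathbb{R}^n)$ let $$\mathcal{H}_{p,\tau}(f)=\Big(\int_{S^{n-1}}\Big(\int_{\mathbb{R}^n}[\varphi_\tau(u\cdot\nabla f(x))]^p\,dx\Big)^{-n/p}du\Big)^{-p/n}.$$ For a compact set $K\subset\mathbb{R}^n$ and $p\in[1,n)$, the general $p$-affine capacity is $$C_{p,\tau}(K)=\inf\{\mathcal{H}_{p,\tau}(f):\ f\in C_c^\infty(\mathbb{R}^n),\ f\ge1\text{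 on }K\},$$ and the $p$-variational capacity is $$C_p(K)=\inf\Big\{\int_{\mathbb{R}^n}|\nabla f|^p\,dx:\ f\in C_c^\infty(\mathbb{R}^n),\ f\ge1\text{ on }K\Big\}.$$ For a convex body $K$ with the origin in its interior, with outer unit normal $\nu_K(x)$ at $\mathcal{H}^{n-1}$-almost every $x\in\partial K$, the $p$-surface area is $S_p(K)=\int_{\partial K}|x\cdot\nu_K(x)|^{1-p}\,d\mathcal{H}^{n-1}(x)$. *)

(* Defs.v *)
From HB Require Import structures.
From mathcomp Require Import all_boot all_order all_algebra.
From mathcomp Require Import all_classical all_reals all_analysis.

Set Implicit Arguments.
Unset Strict Implicit.
Unset Printing Implicit Defensive.

Import Order.TTheory GRing.Theory Num.Theory.
Import numFieldNormedType.Exports.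

Local Open Scope classical_set_scope.
Local Open Scope ring_scope.

(* R^n is 'rV[R]_n.  The norm `|x| of the library on 'rV[R]_n is the sup norm:
   it gives the usual topology and derivatives, but metric notions below use
   the Euclidean norm enorm. *)

Section euclidean.
Context {R : realType} {n : nat}.
Implicit Types x y : 'rV[R]_n.

Definition dotp x y : R := \sum_(i < n) x 0 i * y 0 i.

Definition enorm x : R := Num.sqrt (dotp x x).

Definition unit_ball : set 'rV[R]_n := [set x | enorm x <= 1].

Definition unit_sphere : set 'rV[R]_n := [set x | enorm x = 1].

End euclidean.
Arguments unit_ball : clear implicits.
Arguments unit_sphere : clear implicits.

(* 'rV[R]_n carries the sigma-algebra generated by the coordinates, as
   n.-tuple R does in the library; these are the Borel sets of R^n. *)
Section measurable_rV.
Context {R : realType} {n : nat}.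

Definition rV_coord (i : 'I_n) (x : 'rV[R]_n) : measurableTypeR R := x 0 i.

Let rV_set0 : g_sigma_preimage rV_coord set0.
Proof. exact: sigma_algebra0. Qed.

Let rV_setC A : g_sigma_preimage rV_coord A -> g_sigma_preimage rV_coord (~` A).
Proof. exact: sigma_algebraC. Qed.

Let rV_bigcup (F : _^nat) : (forall i, g_sigma_preimage rV_coord (F i)) ->
  g_sigma_preimage rV_coord (\bigcup_i (F i)).
Proof. exact: sigma_algebra_bigcup. Qed.

HB.instance Definition _ := @isMeasurable.Build default_measure_display
  'rV[R]_n (g_sigma_preimage rV_coord) rV_set0 rV_setC rV_bigcup.

End measurable_rV.

Section measurable_rV_theory.
Context {R : realType}.

Lemma measurable_rV_coord n (i : 'I_n) :
  measurable_fun [set: 'rV[R]_n] (rV_coord i).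
Proof.
move=> _ Y mY; rewrite setTI; apply: sub_sigma_algebra => /=.
rewrite -bigcup_seq/=; exists i => /=; first by rewrite mem_index_enum.
by exists Y => //; rewrite setTI.
Qed.

Lemma measurable_fun_rVP d (T : measurableType d) n (f : T -> 'rV[R]_n) :
  (forall i, measurable_fun [set: T] (rV_coord i \o f)) ->
  measurable_fun [set: T] f.
Proof.
move=> mf _ A mA.
suff : g_sigma_preimage (fun i => @rV_coord R n i) `<=`
    [set B | measurable (f @^-1` B)].
  by rewrite setTI; apply.
apply: smallest_sub.
  split => /=.
  - by rewrite preimage_set0.
  - by move=> B mB; rewrite setTD preimage_setC; exact: measurableC.
  - by move=> F mF; rewrite preimage_bigcup; exact: bigcupT_measurable.
rewrite -bigcup_seq => B [i _ [Y mY <-]] /=.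
by rewrite setTI -comp_preimage -[_ @^-1` _]setTI; exact: mf.
Qed.

Definition rV_cons n (z : measurableTypeR R * 'rV[R]_n) : 'rV[R]_n.+1 :=
  row_mx (z.1)%:M z.2.

Definition rV_uncons n (x : 'rV[R]_n.+1) : measurableTypeR R * 'rV[R]_n :=
  (x 0 ord0, \row_i x 0 (lift ord0 i)).

Lemma rV_cons0 n z : @rV_cons n z 0 ord0 = z.1.
Proof.
transitivity (row_mx (z.1)%:M z.2 0 (lshift n (ord0 : 'I_1))).
  by congr (row_mx _ _ 0 _); exact: val_inj.
by rewrite row_mxEl mxE eqxx mulr1n.
Qed.

Lemma rV_consS n z i : @rV_cons n z 0 (lift ord0 i) = z.2 0 i.
Proof.
transitivity (row_mx (z.1)%:M z.2 0 (rshift 1 i)); last by rewrite row_mxEr.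
by congr (row_mx _ _ 0 _); exact: val_inj.
Qed.

Lemma rV_consK n : cancel (@rV_cons n) (@rV_uncons n).
Proof.
move=> [a v]; rewrite /rV_uncons rV_cons0; congr pair.
by apply/rowP => i; rewrite mxE rV_consS.
Qed.

Lemma rV_unconsK n : cancel (@rV_uncons n) (@rV_cons n).
Proof.
move=> x; apply/rowP => i; case: (unliftP ord0 i) => [j ->|->].
  by rewrite rV_consS mxE.
by rewrite rV_cons0.
Qed.

Lemma measurable_rV_cons n : measurable_fun setT (@rV_cons n).
Proof.
apply: measurable_fun_rVP => i; case: (unliftP ord0 i) => [j ->|->].
  rewrite (_ : _ \o _ = rV_coord j \o snd); last first.
    by apply/funext => z /=; rewrite /rV_coord rV_consS.
  by apply: measurableT_comp => //; exact: measurable_rV_coord.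
rewrite (_ : _ \o _ = fst); first exact: measurable_fst.
by apply/funext => z /=; rewrite /rV_coord rV_cons0.
Qed.

Lemma measurable_rV_uncons n : measurable_fun setT (@rV_uncons n).
Proof.
apply: measurable_fun_pair; first exact: measurable_rV_coord.
apply: measurable_fun_rVP => i.
rewrite (_ : _ \o _ = rV_coord (lift ord0 i)); first exact: measurable_rV_coord.
by apply/funext => x /=; rewrite /rV_coord mxE.
Qed.

End measurable_rV_theory.

Section lebesgue_rV.
Context {R : realType}.
Local Open Scope ereal_scope.

Section step.
Variables (n : nat) (m : {sigma_finite_measure set 'rV[R]_n -> \bar R}).

Definition lebesgue_rV_step : set 'rV[R]_n.+1 -> \bar R :=
  pushforward (@lebesgue_measure R \x m) (@rV_cons R n).

Let step0 : lebesgue_rV_step set0 = 0.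
Proof. by rewrite /lebesgue_rV_step /pushforward preimage_set0 measure0. Qed.

Let step_ge0 A : 0 <= lebesgue_rV_step A.
Proof. exact: (measure_ge0 (@lebesgue_measure R \x m)). Qed.

Let step_sigma_additive : semi_sigma_additive lebesgue_rV_step.
Proof.
move=> F mF tF mUF; rewrite /lebesgue_rV_step /pushforward preimage_bigcup.
apply: measure_semi_sigma_additive.
- by move=> k; rewrite -[X in measurable X]setTI; exact: measurable_rV_cons.
- apply/trivIsetP => /= i j _ _ ij; rewrite -preimage_setI.
  by move/trivIsetP : tF => /(_ _ _ _ _ ij) ->//; rewrite preimage_set0.
- rewrite -preimage_bigcup -[X in measurable X]setTI.
  exact: measurable_rV_cons.
Qed.

HB.instance Definition _ := isMeasure.Build _ _ _ lebesgue_rV_step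
  step0 step_ge0 step_sigma_additive.

Let lebesgue_rV_step_sigma_finite : sigma_finite setT lebesgue_rV_step.
Proof.
have [F TF mF] : sigma_finite setT (@lebesgue_measure R \x m).
  have /sigma_finiteP[F [TF ndF Foo]] := sigma_finiteT (@lebesgue_measure R).
  have /sigma_finiteP[G [TG ndG Goo]] := sigma_finiteT m.
  exists (fun k => F k `*` G k).
    rewrite -setXTT TF TG predeqE => -[x y]; split.
      move=> [/= [i _ Fx] [k _ Gy]]; exists (maxn i k) => //; split.
      - by move: x Fx; exact/subsetPset/ndF/leq_maxl.
      - by move: y Gy; exact/subsetPset/ndG/leq_maxr.
    by move=> [i _ []/= ? ?]; split; exists i.
  move=> k; have [? ?] := Foo k; have [? ?] := Goo k.
  split; first exact: measurableX.
  by rewrite product_measure1E// lte_mul_pinfty// ge0_fin_numE.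
exists (fun k => @rV_uncons R n @^-1` F k).
  by rewrite -preimage_bigcup -TF preimage_setT.
move=> k; have [mFk Fk] := mF k; split.
  by rewrite -[_ @^-1` _]setTI; exact: measurable_rV_uncons.
rewrite /lebesgue_rV_step /pushforward -comp_preimage.
rewrite (_ : _ \o _ = id) //; apply/funext => z /=; exact: rV_consK.
Qed.

HB.instance Definition _ := Measure_isSigmaFinite.Build _ _ _
  lebesgue_rV_step lebesgue_rV_step_sigma_finite.

End step.

(* Lebesgue measure on R^n, as an iterated product. *)
Fixpoint lebesgue_rV (n : nat) : {sigma_finite_measure set 'rV[R]_n -> \bar R} :=
  match n with
  | 0 => \d_(0%R : 'rV[R]_0)
  | k.+1 => lebesgue_rV_step (lebesgue_rV k)
  end.

End lebesgue_rV.

Section hausdorff.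
Context {R : realType} {n : nat}.
Local Open Scope ereal_scope.
Implicit Types A X : set 'rV[R]_n.

Definition diam A : \bar R :=
  ereal_sup [set (enorm (x - y)%R)%:E | x in A & y in A].

(* omega_d (diam A / 2)^d, where omega_d is the volume of the unit ball of R^d;
   with this normalization the Hausdorff measure of dimension d agrees with the
   d-dimensional area.  Note that diam set0 = -oo. *)
Definition hausdorff_weight (d : nat) A : \bar R :=
  if A == set0 then 0
  else lebesgue_rV d (unit_ball R d) * ((2^-1)%R%:E * diam A) ^+ d.

Definition hausdorff_delta (d : nat) (delta : R) X : \bar R :=
  ereal_inf [set \sum_(k <oo) hausdorff_weight d (E k) | E in
    [set E : (set 'rV[R]_n)^nat |
      (forall k, diam (E k) <= delta%:E) /\ X `<=` \bigcup_k E k]].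

Definition hausdorff (d : nat) X : \bar R :=
  ereal_sup [set hausdorff_delta d delta X | delta in [set r | (0 < r)%R]].

Lemma diam_ge0 A : A !=set0 -> 0 <= diam A.
Proof.
move=> [x Ax]; apply: (@le_trans _ _ (enorm (x - x)%R)%:E).
  by rewrite lee_fin sqrtr_ge0.
by apply: ereal_sup_ubound; exists x => //; exists x.
Qed.

Lemma hausdorff_weight0 d : hausdorff_weight d set0 = 0.
Proof. by rewrite /hausdorff_weight eqxx. Qed.

Lemma hausdorff_weight_ge0 d A : 0 <= hausdorff_weight d A.
Proof.
rewrite /hausdorff_weight; case: ifPn => // /set0P A0.
by rewrite mule_ge0// expe_ge0// mule_ge0// ?lee_fin ?invr_ge0// diam_ge0.
Qed.

(* hausdorff_delta is an instance of the outer measure construction mu_ext,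
   over the sigma-algebra of all subsets. *)
Section hausdorff_delta_outer.
Variables (d : nat) (delta : R).

Let T := g_sigma_algebraType [set: set 'rV[R]_n].

Let w (A : set T) : \bar R :=
  if diam (A : set 'rV[R]_n) <= delta%:E
  then hausdorff_weight d (A : set 'rV[R]_n) else +oo.

Let w0 : w set0 = 0.
Proof.
rewrite /w hausdorff_weight0.
have -> : diam (set0 : set 'rV[R]_n) = -oo.
  rewrite /diam (_ : [set _ | _ in _ & _ in _] = set0) ?ereal_sup0//.
  by apply/seteqP; split => // ? [].
by rewrite leNye.
Qed.

Let w_ge0 A : 0 <= w A.
Proof. by rewrite /w; case: ifP => // _; exact: hausdorff_weight_ge0. Qed.

Let hausdorff_deltaE X : hausdorff_delta d delta X = mu_ext w X.
Proof.
apply/eqP; rewrite eq_le; apply/andP; split; last first.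
  apply: le_ereal_inf_tmp => _ [E [dE XE] <-]; apply: ereal_inf_lbound.
  exists E; first by split => // i; exact: sub_sigma_algebra.
  by apply: eq_eseriesr => i _; rewrite /w dE.
apply: le_ereal_inf_tmp => _ [E [_ XE] <-].
have [dE|] := pselect (forall k, diam (E k : set 'rV[R]_n) <= delta%:E).
  apply: ereal_inf_lbound; exists E => //.
  by apply: eq_eseriesr => i _; rewrite /w dE.
move=> /existsNP[k dEk]; rewrite (@nneseries_pinfty _ _ _ k) ?leey//.
by rewrite /w ifN//; exact/negP.
Qed.

Lemma hausdorff_delta0 : hausdorff_delta d delta set0 = 0.
Proof. by rewrite hausdorff_deltaE mu_ext0. Qed.

Lemma hausdorff_delta_ge0 X : 0 <= hausdorff_delta d delta X.
Proof. by rewrite hausdorff_deltaE mu_ext_ge0. Qed.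

Lemma le_hausdorff_delta X Y : X `<=` Y ->
  hausdorff_delta d delta X <= hausdorff_delta d delta Y.
Proof. by move=> XY; rewrite !hausdorff_deltaE le_mu_ext. Qed.

Lemma hausdorff_delta_sigma_subadditive :
  sigma_subadditive (hausdorff_delta d delta).
Proof.
move=> F; rewrite hausdorff_deltaE.
under [leRHS]eq_eseriesr do rewrite hausdorff_deltaE.
exact: (@mu_ext_sigma_subadditive _ T R w w_ge0 F).
Qed.

End hausdorff_delta_outer.

Section hausdorff_outer.
Variable d : nat.

Let hausdorff0 : hausdorff d set0 = 0.
Proof.
apply/eqP; rewrite eq_le; apply/andP; split.
  by apply: ge_ereal_sup => _ [r _ <-]; rewrite hausdorff_delta0.
by apply: ereal_sup_ubound; exists 1%R => /=; rewrite ?hausdorff_delta0 ?ltr01.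
Qed.

Let hausdorff_ge0 X : 0 <= hausdorff d X.
Proof.
apply: (le_trans (hausdorff_delta_ge0 d 1 X)); apply: ereal_sup_ubound.
by exists 1%R => //=; rewrite ltr01.
Qed.

Let le_hausdorff : {homo hausdorff d : X Y / X `<=` Y >-> X <= Y}.
Proof.
move=> X Y XY; apply: ge_ereal_sup => _ [r r0 <-].
apply: (le_trans (le_hausdorff_delta d r XY)).
by apply: ereal_sup_ubound; exists r.
Qed.

Let hausdorff_sigma_subadditive : sigma_subadditive (hausdorff d).
Proof.
move=> F; apply: ge_ereal_sup => _ [r r0 <-].
apply: (le_trans (hausdorff_delta_sigma_subadditive d r F)).
apply: lee_nneseries => [i _ _|i _]; first exact: hausdorff_delta_ge0.
by apply: ereal_sup_ubound; exists r.
Qed.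

HB.instance Definition _ := isOuterMeasure.Build R 'rV[R]_n (hausdorff d)
  hausdorff0 hausdorff_ge0 le_hausdorff hausdorff_sigma_subadditive.

Definition hausdorff_outer : {outer_measure set 'rV[R]_n -> \bar R} :=
  hausdorff d.

(* the restriction to the Caratheodory measurable sets *)
Definition hausdorff_measure :
    {measure set (caratheodory_type hausdorff_outer) -> \bar R} :=
  (hausdorff_outer : set (caratheodory_type hausdorff_outer) -> \bar R).

End hausdorff_outer.

End hausdorff.

Section smooth.
Context {R : realType} {n : nat}.
Implicit Types f : 'rV[R]_n -> R.

Definition partial (i : 'I_n) f : 'rV[R]_n -> R := 'D_(delta_mx 0 i) f.

(* C^oo: all iterated partial derivatives exist and are continuous. *)
Definition smooth f : Prop := forall s : seq 'I_n,
  let g := foldr partial f s in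
  continuous g /\ forall i x, derivable g x (delta_mx 0 i).

Definition smooth_compact_support f : Prop :=
  smooth f /\ compact (closure [set x | f x != 0]).

Definition grad f (x : 'rV[R]_n) : 'rV[R]_n := \row_i partial i f x.

End smooth.

Section capacities.
Context {R : realType} {n : nat}.
Implicit Types (K : set 'rV[R]_n) (f : 'rV[R]_n -> R) (p tau : R).

Definition phi p tau (t : R) : R :=
  ((1 + tau) / 2) `^ p^-1 * Num.max t 0 +
  ((1 - tau) / 2) `^ p^-1 * Num.max (- t) 0.

(* sigma is the rotation-invariant probability measure on the sphere, seen as
   a probability measure on the Borel sets of R^n concentrated on the sphere. *)
Definition rotation_invariant_on_sphere (sigma : probability 'rV[R]_n R) :=
  sigma (unit_sphere R n) = 1%E /\
  forall Q : 'M[R]_n, Q *m Q^T = 1%:M -> \det Q = 1 ->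
  forall A : set 'rV[R]_n, measurable A ->
    sigma [set u *m Q | u in A] = sigma A.

Definition affine_energy (sigma : probability 'rV[R]_n R) p tau f : R :=
  (\int[sigma]_(u in unit_sphere R n)
     ((\int[lebesgue_rV n]_x (phi p tau (dotp u (grad f x)) `^ p))
        `^ (- (n%:R / p)))) `^ (- (p / n%:R)).

Definition admissible K : set ('rV[R]_n -> R) :=
  [set f | smooth_compact_support f /\ forall x, K x -> 1 <= f x].

Definition affine_capacity (sigma : probability 'rV[R]_n R) p tau K : R :=
  inf [set affine_energy sigma p tau f | f in admissible K].

Definition variational_capacity p K : R :=
  inf [set \int[lebesgue_rV n]_x (enorm (grad f x) `^ p) | f in admissible K].

Definition volume K : R := fine (lebesgue_rV n K).

Definition convex_body K : Prop :=
  [/\ compact K, convex_set (K : set (convex_lmodType 'rV[R]_n))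
    & K° !=set0].

Definition outer_unit_normal K (x nu : 'rV[R]_n) : Prop :=
  enorm nu = 1 /\ forall y, K y -> dotp (y - x) nu <= 0.

(* The outer unit normal of a convex body is unique at almost every boundary
   point; elsewhere one is chosen, which does not matter below. *)
Definition normal_vector K (x : 'rV[R]_n) : 'rV[R]_n :=
  xget 0 (outer_unit_normal K x).

Definition boundary K : set 'rV[R]_n := closure K `\` K°.

Definition surface_area p K : R :=
  \int[hausdorff_measure n.-1]_(x in boundary K)
    (`|dotp x (normal_vector K x)| `^ (1 - p)).

End capacities.

(* Main.v *)
Require Import Defs.
From HB Require Import structures.
From mathcomp Require Import all_boot all_order all_algebra.
From mathcomp Require Import all_classical all_reals all_analysis.
From mathcomp Require Import measurable_realfun.
From mathcomp Require Import ring lra zify.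
Set Implicit Arguments.
Unset Strict Implicit.
Unset Printing Implicit Defensive.
Import Order.TTheory GRing.Theory Num.Theory.
Import numFieldNormedType.Exports.
Local Open Scope classical_set_scope.
Local Open Scope ring_scope.

(** Write N for the dimension, om for the volume of the unit ball B, c for the mean of
    phi_tau (u.e)^p over the sphere, and let kap be as in [kap] below.  The inequalities
      c kap om (V(K)/om)^((N-p)/N) <= C_{p,tau}(K) <= c C_p(K)
      and C_p(K) <= kap om S_p(K)/S_p(B)
    imply the theorem, since they are forced to be equalities for K = B.

    Lower bound.  The function Z(u) = int phi_tau (u.grad f)^p is convex and homogeneous, and
    Phi = {Z < 1} is a convex body whose volume is a multiple of int_S Z^(-N/p).  Integrating Z
    over Phi turns the energy of f into int_x int_Phi phi_tau (u.grad f(x))^p du.  For L the set of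
    barycenters of the densities on Phi that are dual to this integrand, translates by h L of a
    superlevel set of f stay, to first order in h, in a superlevel set whose level is lowered by an
    amount controlled by the integrand.  Steiner symmetrization of the set and of Phi shows that
    the volume of such a neighbourhood is smallest for balls, which bounds the energy between two
    levels from below; the bounds add up to a Riemann sum.

    Middle inequality.  Jensen's inequality on the sphere.

    Upper bound.  For a profile of the gauge of K, the energy is at most a one-dimensional cost times
    W = int_K slope^p, where slope(x) is the largest norm of a subgradient of the gauge at x;
    geometric radii make the cost tend to kap.  Cones on which the subgradients oscillate little cut
    the boundary of K into patches.  Radial projection of a patch onto a tangent hyperplane is almost
    a contraction, and the area of a set in a hyperplane is a multiple of the volume of the cone over
    it, so that k W <= S_p(K) for a constant k, and the reverse inequality holds for the ball. *)

Local Notation mfun := (measurable_fun [set: _]).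
Local Notation integrableV f := ((lebesgue_rV _ : {measure set _ -> \bar _}).-integrable setT (EFin \o f)).

(** The lower bound rests on Young's inequality between the integrand and its dual densities. A
    density [lam] is known only through p int g lam <= int_Phi F(g) + C for every bounded g, not
    through a formula for a subgradient: in this form it survives measure-preserving maps, convex
    combinations and restriction to a smaller set, and it covers p = 1, where F has a corner. On a
    ball of radius rho, with C = (p - 1) E(s) and E(s) the integral of F(s u.e), the barycenters
    contain a ball of radius E(s) / s; the slope s is free and is chosen for each shell as the slope
    of the extremal radial profile. Finitely many symmetrizations need not produce a ball, so the
    bound on the sum is proved near balls, with a margin, and carried back to the given sets. The
    mean c and the ratio between area and cone volume are never evaluated: each enters a lower and
    an upper bound and cancels. Real-valued integrals and infima give 0 for an infinite integral or
    an empty set, so finiteness and the existence of admissible functions have to be proved. *)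

Lemma le_of_eq d (T : porderType d) (x y : T) : x = y -> (x <= y)%O.
Proof. by move->. Qed.

(** * Measurability and invariance of Lebesgue measure *)

Section measurability.
Context {R : realType}.

Lemma measurable_coord n (i : 'I_n) :
  measurable_fun [set: 'rV[R]_n] (fun x => x 0 i).
Proof. exact: measurable_rV_coord. Qed.

Lemma measurable_fun_coord d (T : measurableType d) n (f : T -> 'rV[R]_n) i :
  mfun f -> mfun (fun t => f t 0 i).
Proof. by move=> mf; apply: (measurableT_comp (measurable_coord i)). Qed.

Lemma measurable_rVP d (T : measurableType d) n (f : T -> 'rV[R]_n) :
  (forall i, mfun (fun t => f t 0 i)) ->
  mfun f.
Proof. by move=> mf; apply: measurable_fun_rVP => i; exact: mf. Qed.

Lemma rV_ballE n (x : 'rV[R]_n) (e : R) (y : 'rV[R]_n) :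
  ball x e y <-> 0 < e /\ forall i, `|x 0 i - y 0 i| < e.
Proof.
split=> [[e0 H]|[e0 H]]; split => // i; first exact: (H 0 i).
by move=> j; rewrite !ord1; exact: H.
Qed.

Lemma measurable_rV_ball n (x : 'rV[R]_n) (e : R) : measurable (ball x e).
Proof.
have [e0|e0] := ltP 0 e; last first.
  rewrite (_ : ball x e = set0) // -subset0 => y [/lt_le_trans /(_ e0)].
  by rewrite ltxx.
rewrite (_ : ball x e =
  \bigcap_(i in [set: 'I_n]) ((fun y : 'rV[R]_n => y 0 i) @^-1` ball (x 0 i) e)).
  apply: fin_bigcap_measurable => [|i _]//.
  rewrite -[X in measurable X]setTI; apply: measurable_coord => //.
  exact: measurable_ball.
apply/seteqP; split => y.
  by move=> /rV_ballE[_ H] i _; exact: H.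
by move=> H; apply/rV_ballE; split => // i; exact: (H i).
Qed.

(** Sup-norm balls are boxes, hence measurable for the sigma-algebra of the coordinates; the balls
    of radius 1/(k+1) with rational centre that lie in [U] are countably many and exhaust it. *)
Lemma open_measurable_rV n (U : set 'rV[R]_n) : open U -> measurable U.
Proof.
move=> oU.
pose c (q : 'rV[rat]_n) : 'rV[R]_n := map_mx ratr q.
pose F (qk : 'rV[rat]_n * nat) : set 'rV[R]_n :=
  if `[< ball (c qk.1) (qk.2.+1%:R^-1 : R) `<=` U >] then ball (c qk.1) (qk.2.+1%:R^-1 : R)
  else set0.
have -> : U = \bigcup_qk F qk.
  apply/seteqP; split => [x Ux|x [qk _]]; last first.
    by rewrite /F; case: ifP => // /asboolP; exact.
  have /nbhs_ballP[e e0 xeU] := open_nbhs_nbhs (conj oU Ux).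
  have [k ke] : exists k : nat, (k.+1%:R^-1 : R) < e / 2.
    have := near_infty_natSinv_lt (PosNum (divr_gt0 e0 (@ltr0n R 2))).
    by case=> k _ /(_ k (leqnn _)); exists k.
  have k0 : 0 < (k.+1%:R^-1 : R) by [].
  have H i : exists q : rat, `|ratr q - x 0 i| < k.+1%:R^-1.
    move: k0; set r := k.+1%:R^-1 => r0.
    have : x 0 i - r < x 0 i + r by lra.
    move=> /rat_in_itvoo[q]; rewrite in_itv/= => /andP[q1 q2].
    by exists q; rewrite ltr_norml; apply/andP; split; lra.
  have [q qP] := choice H.
  have cx : ball (c (\row_i q i)) (k.+1%:R^-1) x.
    by apply/rV_ballE; split => // i; rewrite !mxE.
  exists (\row_i q i, k) => //; rewrite /F/= ifT//.
  apply/asboolP => y /rV_ballE [_ yc]; apply: xeU; apply/rV_ballE; split => // i.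
  move/rV_ballE : cx => [_ /(_ i)]; move: (yc i) ke; set r := k.+1%:R^-1.
  rewrite !ltr_norml => /andP[? ?] ? /andP[? ?]; apply/andP; split; lra.
apply: countable_bigcupT_measurable => // qk; rewrite /F; case: ifP => // _.
exact: measurable_rV_ball.
Qed.

Lemma closed_measurable_rV n (U : set 'rV[R]_n) : closed U -> measurable U.
Proof. by move/closed_openC/open_measurable_rV/measurableC; rewrite setCK. Qed.

Lemma continuous_measurable_rV n (f : 'rV[R]_n -> R) :
  continuous f -> measurable_fun [set: 'rV[R]_n] f.
Proof.
move=> /continuousP cf; apply: (measurability _ (RGenOpens.measurableE R)).
move=> _ [_ [a [b ->] <-]]; rewrite setTI.
by apply: open_measurable_rV; apply: cf; exact: itv_open.
Qed.

Context d (T : measurableType d).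

Lemma measurable_add_rV n (f g : T -> 'rV[R]_n) : mfun f ->
  mfun g -> mfun (fun t => f t + g t).
Proof.
move=> mf mg; apply: measurable_rVP => i; under eq_fun do rewrite mxE.
by apply: measurable_funD; exact: measurable_fun_coord.
Qed.

Lemma measurable_opp_rV n (f : T -> 'rV[R]_n) : mfun f ->
  mfun (fun t => - f t).
Proof.
move=> mf; apply: measurable_rVP => i; under eq_fun do rewrite mxE.
by apply: measurableT_comp => //; exact: measurable_fun_coord.
Qed.

Lemma measurable_scale_rV n (c : T -> R) (f : T -> 'rV[R]_n) :
  mfun c -> mfun f ->
  mfun (fun t => c t *: f t).
Proof.
move=> mc mf; apply: measurable_rVP => i; under eq_fun do rewrite mxE.
by apply: measurable_funM => //; exact: measurable_fun_coord.
Qed.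

Lemma measurable_mul_rV n m (A : 'M[R]_(n, m)) (f : T -> 'rV[R]_n) :
  mfun f ->
  mfun (fun t => f t *m A).
Proof.
move=> mf; apply: measurable_rVP => i; under eq_fun do rewrite mxE.
apply: measurable_sum => j; apply: measurable_funM => //.
exact: measurable_fun_coord.
Qed.

Lemma measurable_dotp n (f g : T -> 'rV[R]_n) : mfun f ->
  mfun g -> mfun (fun t => dotp (f t) (g t)).
Proof.
move=> mf mg; apply: measurable_sum => j.
by apply: measurable_funM; exact: measurable_fun_coord.
Qed.

Lemma measurable_enorm n (f : T -> 'rV[R]_n) : mfun f ->
  mfun (fun t => enorm (f t)).
Proof.
move=> mf; apply: (@measurableT_comp _ _ _ _ _ _ (@Num.sqrt R) _ (fun t => dotp (f t) (f t))); last exact: measurable_dotp.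
by apply: continuous_measurable_fun; exact: sqrt_continuous.
Qed.

Lemma measurable_setP (P : T -> Prop) (b : T -> bool) :
  (forall t, P t <-> b t) -> mfun b -> measurable [set t | P t].
Proof.
move=> Pb mb; rewrite (_ : [set t | P t] = setT `&` b @^-1` [set true]); first exact: mb.
by apply/seteqP; split => t /=; [move=> /Pb ->|move=> [_ /Pb]].
Qed.

Lemma measurable_lt_set (f g : T -> R) : mfun f ->
  mfun g -> measurable [set t | f t < g t].
Proof.
by move=> mf mg; apply: (@measurable_setP _ (fun t => f t < g t)) => //;
  exact: measurable_fun_ltr.
Qed.

Lemma measurable_le_set (f g : T -> R) : mfun f ->
  mfun g -> measurable [set t | f t <= g t].
Proof.
by move=> mf mg; apply: (@measurable_setP _ (fun t => f t <= g t)) => //;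
  exact: measurable_fun_ler.
Qed.

Lemma measurable_lte_set (f g : T -> \bar R) : mfun f ->
  mfun g -> measurable [set t | (f t < g t)%E].
Proof. by move=> mf mg; rewrite -[X in measurable X]setTI; exact: measurable_lte. Qed.

End measurability.

Section preimage_measurable.
Context {R : realType} d d' (T : measurableType d) (U : measurableType d').

Lemma measurable_preim (f : T -> U) (A : set U) : mfun f ->
  measurable A -> measurable (f @^-1` A).
Proof. by move=> mf mA; rewrite -[X in measurable X]setTI; exact: mf. Qed.

Lemma measurable_indicE (A : set T) : measurable A ->
  mfun (fun x => (\1_A x : R)%:E).
Proof. by move=> mA; apply/measurable_EFinP; exact: measurable_indic. Qed.
End preimage_measurable.

Lemma measurable_andb d (T : measurableType d) (P Q : T -> bool) : measurable [set x | P x] -> measurable [set x | Q x] ->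
  measurable [set x | P x && Q x].
Proof.
move=> mP mQ; rewrite (_ : [set x | P x && Q x] = [set x | P x] `&` [set x | Q x]); first exact: measurableI.
by apply/seteqP; split=> x /= => [/andP[]|[-> ->]].
Qed.

Lemma measurable_indic_comp {R : realType} d d' (T : measurableType d) (U : measurableType d') (A : set U) (a : T -> U) :
  measurable A -> mfun a -> mfun (fun x => \1_A (a x) : R).
Proof. by move=> mA ma; apply: (@measurableT_comp _ _ _ _ _ _ (\1_A : U -> R) _ a) => //; exact: measurable_indic. Qed.

Create HintDb meas.

Ltac meas_leaf := first [assumption | solve [auto 3 with nocore meas]].

(** The head symbol of the function or set selects the rule, whose component functions are given
    explicitly rather than left to higher-order unification; leaves are closed by the hint database
    [meas]. *)
Ltac meas :=
  lazymatch goal with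
  | |- measurable_fun _ ?f => first [meas_leaf | meas_fun f]
  | |- measurable ?A => first [meas_leaf | meas_set A]
  | |- is_true _ => done
  | |- forall _, _ => intro; meas
  end
with meas_fun f :=
  lazymatch f with
  | fun x => x => exact: measurable_id
  | @id _ => exact: measurable_id
  | fun _ => ?c => exact: measurable_cst
  | cst _ => exact: measurable_cst
  | EFin => apply/measurable_EFinP; exact: measurable_id
  | fst => exact: measurable_fst
  | snd => exact: measurable_snd
  | fun x => fst x => exact: measurable_fst
  | fun x => snd x => exact: measurable_snd
  | fun x => EFin (@?a x) => apply/measurable_EFinP; change (mfun a); meas
  | EFin \o _ => apply/measurable_EFinP; meas
  | fun x => GRing.mul (@?a x) (@?b x) => apply: (measurable_funM (f := a) (g := b)); meas
  | fun x => GRing.add (@?a x) (GRing.opp (@?b x)) =>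
      first [apply: (measurable_funB (f := a) (g := b)); meas
        |apply: (measurable_add_rV (f := a) (g := fun x => - b x)); meas|apply: measurable_add_rV; meas]
  | fun x => GRing.add (@?a x) (@?b x) =>
      first [apply: (measurable_funD (f := a) (g := b)); meas |apply: (measurable_add_rV (f := a) (g := b)); meas
        |apply: measurable_add_rV; meas]
  | fun x => GRing.opp (@?a x) =>
      first [apply: (measurable_opp_rV (f := a)); meas|apply: measurable_opp_rV; meas|apply: (measurableT_comp (@oppr_measurable _ _) (g := a)); meas]
  | fun x => GRing.scale (@?a x) (@?b x) =>
      first [apply: (measurable_scale_rV (c := a) (f := b)); meas|apply: measurable_scale_rV; meas]
  | fun x => GRing.exp (@?a x) ?n => apply: (measurable_funX n (f := a)); meas
  | fun x => powR (@?a x) ?p => apply: (measurableT_comp (measurable_powR p) (g := a)); meas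
  | fun x => mule (@?a x) (@?b x) => apply: (emeasurable_funM (f := a) (g := b)); meas
  | fun x => adde (@?a x) (@?b x) => apply: (emeasurable_funD (f := a) (g := b)); meas
  | fun x => dotp (@?a x) (@?b x) => apply: (measurable_dotp (f := a) (g := b)); meas
  | fun x => enorm (@?a x) => apply: (measurable_enorm (f := a)); meas
  | enorm => apply: measurable_enorm; exact: measurable_id
  | fun x => Num.norm (@?a x) => apply: (measurableT_comp (@normr_measurable _ _) (g := a)); meas
  | fun x => Order.max (@?a x) (@?b x) => apply: (measurable_maxr (f := a) (g := b)); meas
  | fun x => mulmx (@?a x) ?A => apply: (measurable_mul_rV A (f := a)); meas
  | fun x => fun_of_matrix (@?a x) ord0 ?i => apply: (measurable_fun_coord i (f := a)); meas
  | fun x => fun_of_matrix (@?a x) 0 ?i => apply: (measurable_fun_coord i (f := a)); meas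
  | fun x => (@?a x, @?b x) => apply: (measurable_fun_pair (f := a) (g := b)); meas
  | fun x => rV_cons (@?a x) => apply: (measurableT_comp (@measurable_rV_cons _ _) (g := a)); meas
  | fun x => indic ?A (@?a x) => apply: (measurable_indic_comp (A := A) (a := a)); meas
  | indic ?A => apply: measurable_indic; meas
  | fun x => fst (@?a x) => apply: (measurableT_comp measurable_fst (g := a)); meas
  | fun x => snd (@?a x) => apply: (measurableT_comp measurable_snd (g := a)); meas
  | fun x => ?g (@?a x) => apply: (measurableT_comp (f := g) (g := a)); [meas_leaf|meas]
  | _ \o _ => apply: measurableT_comp; meas
  | _ \+ _ => first [apply: measurable_funD; meas|apply: emeasurable_funD; meas]
  | _ \* _ => first [apply: measurable_funM; meas|apply: emeasurable_funM; meas]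
  end
with meas_set A :=
  lazymatch A with
  | set0 => exact: measurable0
  | setT => exact: measurableT
  | set1 _ => exact: measurable_set1
  | setI _ _ => apply: measurableI; meas
  | setU _ _ => apply: measurableU; meas
  | setD _ _ => apply: measurableD; meas
  | setC _ => apply: measurableC; meas
  | mkset (fun x => is_true (Order.lt (@?a x) (@?b x))) =>
      first [apply: (measurable_lt_set (f := a) (g := b)); meas|apply: (measurable_lte_set (f := a) (g := b)); meas]
  | mkset (fun x => is_true (Order.le (@?a x) (@?b x))) =>
      apply: (measurable_le_set (f := a) (g := b)); meas
  | mkset (fun x => and (@?P x) (@?Q x)) =>
      change (measurable (setI (mkset P) (mkset Q))); apply: measurableI; meas
  | mkset (fun x => is_true (andb (@?P x) (@?Q x))) =>
      apply: (@measurable_andb _ _ P Q); meas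
  | mkset (fun x => ?C (@?a x)) => first [apply: (measurable_preim (f := a) (A := C)); meas | apply: (measurable_preim (A := C)); meas]
  | mkset (fun x => ?F ?R ?n ?r (@?a x)) => first [apply: (measurable_preim (f := a) (A := F R n r)); meas | apply: (measurable_preim (A := F R n r)); meas]
  | preimage ?f ?C => apply: (measurable_preim (f := f) (A := C)); meas
  | _ => first [exact: measurable_itv | is_var A; unfold A; meas]
  end.

(* The integral of a nonnegative function is a supremum over simple functions,
   so it is monotone even for functions that are not measurable. *)
Lemma ge0_le_integral_any d (T : measurableType d) (R : realType) (mu : {measure set T -> \bar R})
    (D : set T) (f g : T -> \bar R) :
  (forall x, D x -> 0 <= f x)%E -> (forall x, D x -> f x <= g x)%E ->
  (\int[mu]_(x in D) f x <= \int[mu]_(x in D) g x)%E.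
Proof.
move=> f0 fg; have g0 x : (D x -> 0 <= g x)%E by move=> Dx; apply: le_trans (fg x Dx); exact: f0.
rewrite !ge0_integralE//; apply: le_ereal_sup => _ [h hf <-]; exists h => // x.
apply: le_trans (hf x) _; rewrite /patch; case: (boolP (x \in D)) => // /set_mem; exact: fg.
Qed.

Section lebesgue1.
Context {R : realType}.
Local Notation mu := (@lebesgue_measure R).

Lemma lebesgue_measure_addr (v : R) (A : set R) : measurable A ->
  mu ((fun x => x + v) @^-1` A) = mu A.
Proof.
move=> mA; apply/esym.
have mf : measurable_fun [set: measurableTypeR R] (fun x : measurableTypeR R => (x + v : measurableTypeR R)) by meas.
apply: (@lebesgue_measure_unique R (pushforward mu (fun x : measurableTypeR R => (x + v : measurableTypeR R)))) => //.
move=> X [[a b] _ <-]; change (mu `]a, b]%classic = mu ((fun x : R => x + v) @^-1` `]a, b]%classic)).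
rewrite (_ : _ @^-1` _ = `]a - v, b - v]%classic).
  rewrite !lebesgue_measure_itv/= !lte_fin ltrD2r; case: ifP => // _.
  by rewrite -!EFinB; congr EFin; ring.
by apply/seteqP; split => x /=; rewrite !in_itv/= ltrBlDr lerBrDr.
Qed.

Lemma lebesgue_measure_mulr (c : R) (A : set R) : c != 0 -> measurable A ->
  mu ((fun x => c * x) @^-1` A) = (`|c|^-1%:E * mu A)%E.
Proof.
move=> c0 mA.
have mf : measurable_fun [set: measurableTypeR R] (fun x : measurableTypeR R => (c * x : measurableTypeR R)) by meas.
have c1 : 0 <= `|c| by [].
suff : mu A = mscale (NngNum c1) (pushforward mu (fun x : measurableTypeR R => (c * x : measurableTypeR R))) A.
  move=> ->; rewrite /mscale/= /pushforward muleA -EFinM mulVf ?mul1e ?normr_eq0//.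
move=> m; apply: lebesgue_measure_unique => // X [[a b] _ <-].
change (mu `]a, b]%classic = (`|c|%:E * mu ((fun x : R => (c * x)%R) @^-1` `]a, b]%classic))%E).
have [cp|cn|/esym/eqP] := ltgtP 0 c; last by rewrite (negbTE c0).
- rewrite (_ : _ @^-1` _ = `]a / c, b / c]%classic).
    rewrite !lebesgue_measure_itv/= !lte_fin ltr_pM2r ?invr_gt0//.
    case: ifP => _; last by rewrite mule0.
    by rewrite gtr0_norm// -!EFinB -EFinM; congr EFin; field.
  by apply/seteqP; split => x /=; rewrite !in_itv/= ltr_pdivrMr// ler_pdivlMr// ![x * c]mulrC.
- rewrite (_ : _ @^-1` _ = `[b / c, a / c[%classic).
    rewrite !lebesgue_measure_itv/= !lte_fin ltr_nM2r ?invr_lt0//.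
    case: ifP => _; last by rewrite mule0.
    by rewrite ltr0_norm// -!EFinB -EFinM; congr EFin; field.
  by apply/seteqP; split => x /=; rewrite !in_itv/= ler_ndivrMr// ltr_ndivlMr// ![x * c]mulrC andbC.
Qed.

Lemma ge0_integral_addr (v : R) (f : R -> \bar R) : mfun f ->
  (forall x, 0 <= f x)%E -> (\int[mu]_x f ((x : R) + v)%R = \int[mu]_x f x)%E.
Proof.
move=> mf f0.
have mF : measurable_fun [set: measurableTypeR R] (fun x : measurableTypeR R => (x + v : measurableTypeR R)) by meas.
rewrite -(@ge0_integral_pushforward _ _ _ _ R _ mF mu setT f)//.
apply: eq_measure_integral => A mA _; exact: lebesgue_measure_addr.
Qed.

Lemma ge0_integral_mulr (c : R) (f : R -> \bar R) : c != 0 -> mfun f ->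
  (forall x, 0 <= f x)%E ->
  (\int[mu]_x f (c * (x : R))%R = `|c|^-1%:E * \int[mu]_x f x)%E.
Proof.
move=> c0 mf f0.
have mF : measurable_fun [set: measurableTypeR R] (fun x : measurableTypeR R => (c * x : measurableTypeR R)) by meas.
rewrite -(@ge0_integral_pushforward _ _ _ _ R _ mF mu setT f)//.
have c1 : 0 <= `|c|^-1 by [].
rewrite -(@ge0_integral_mscale _ _ _ mu setT measurableT (NngNum c1) f) //.
apply: eq_measure_integral => A mA _; exact: lebesgue_measure_mulr.
Qed.

End lebesgue1.

Section lebesgueS.
Context {R : realType} (n : nat).
Local Notation leb := (@lebesgue_measure R).
Variable f : 'rV[R]_n.+1 -> \bar R.
Hypotheses (mf : mfun f) (f0 : forall x, (0 <= f x)%E).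

Lemma integral_rVS : (\int[lebesgue_rV n.+1]_z f z =
  \int[leb]_t \int[lebesgue_rV n]_x f (rV_cons (t, x)))%E.
Proof.
rewrite ge0_integral_pushforward//; last exact: measurable_rV_cons.
rewrite fubini_tonelli1//; first exact: measurableT_comp mf (@measurable_rV_cons _ _).
by move=> x; exact: f0.
Qed.

Lemma integral_rVS' : (\int[lebesgue_rV n.+1]_z f z =
  \int[lebesgue_rV n]_x \int[leb]_t f (rV_cons (t, x)))%E.
Proof.
rewrite ge0_integral_pushforward//; last exact: measurable_rV_cons.
rewrite fubini_tonelli2//; first exact: measurableT_comp mf (@measurable_rV_cons _ _).
by move=> x; exact: f0.
Qed.

Lemma measurable_rV_fiber1 (t : R) :
  measurable_fun [set: 'rV[R]_n] (fun x => f (rV_cons (t, x))).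
Proof.
meas.
Qed.

Lemma measurable_rV_fiber_integral :
  mfun (fun x => \int[leb]_t f (rV_cons (t, x)))%E.
Proof.
apply: (@measurable_fun_fubini_tonelli_G _ _ _ _ R leb (fun z => f (rV_cons z))) => [|x].
  meas.
by [].
Qed.

Lemma measurable_rV_fiber_integral1 :
  mfun (fun t => \int[lebesgue_rV n]_x f (rV_cons (t, x)))%E.
Proof.
apply: (@measurable_fun_fubini_tonelli_F _ _ _ _ R (lebesgue_rV n) (fun z => f (rV_cons z))) => [|x].
  meas.
by [].
Qed.
End lebesgueS.

Section lebesgue_rV_invariance.
Context {R : realType}.
Local Notation leb := (@lebesgue_measure R).

Lemma rV_consD n (t s : R) (x y : 'rV[R]_n) :
  rV_cons (t, x) + rV_cons (s, y) = rV_cons (t + s, x + y).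
Proof.
apply/rowP => i; rewrite mxE; case: (unliftP ord0 i) => [j ->|->].
  by rewrite !rV_consS mxE.
by rewrite !rV_cons0.
Qed.

Lemma rV_consZ n (c t : R) (x : 'rV[R]_n) : c *: rV_cons (t, x) = rV_cons (c * t, c *: x).
Proof.
apply/rowP => i; rewrite mxE; case: (unliftP ord0 i) => [j ->|->].
  by rewrite !rV_consS mxE.
by rewrite !rV_cons0.
Qed.

Lemma rV_cons_eta n (x : 'rV[R]_n.+1) : x = rV_cons (rV_uncons x).
Proof. by rewrite rV_unconsK. Qed.

Lemma rV_consN n (t : R) (x : 'rV[R]_n) : - rV_cons (t, x) = rV_cons (- t, - x).
Proof. by rewrite -scaleN1r rV_consZ scaleN1r mulN1r. Qed.

Lemma dotp_cons n (t s : R) (x y : 'rV[R]_n) :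
  dotp (rV_cons (t, x)) (rV_cons (s, y)) = t * s + dotp x y.
Proof.
rewrite /dotp big_ord_recl !rV_cons0; congr (_ + _).
by apply: eq_bigr => i _; rewrite !rV_consS.
Qed.

Lemma ge0_integral_rV_addr n (v : 'rV[R]_n) (f : 'rV[R]_n -> \bar R) :
  mfun f -> (forall x, 0 <= f x)%E ->
  (\int[lebesgue_rV n]_x f ((x : 'rV[R]_n) + v)%R = \int[lebesgue_rV n]_x f x)%E.
Proof.
elim: n v f => [v f mf f0|n ih v f mf f0].
  by apply: eq_integral => x _; congr f; apply/rowP => -[].
have mfv : measurable_fun [set: 'rV[R]_n.+1] (fun x => f (x + v)) by meas.
move: mfv; rewrite (rV_cons_eta v); case: (rV_uncons v) => s y mfv.
rewrite (integral_rVS mf f0) (integral_rVS mfv (fun x => f0 _)).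
transitivity (\int[leb]_t (fun t => \int[lebesgue_rV n]_x f (rV_cons (t, x)))%E ((t : R) + s)%R)%E.
  apply: eq_integral => t _; under eq_integral do rewrite rV_consD.
  by rewrite (ih y (fun x => f (rV_cons ((t : R) + s, x))))//; meas.
rewrite (@ge0_integral_addr R s (fun t => \int[lebesgue_rV n]_x f (rV_cons (t, x)))%E)//.
  exact: measurable_rV_fiber_integral1.
by move=> x; exact: integral_ge0.
Qed.

Lemma ge0_integral_rV_scale n (c : R) (f : 'rV[R]_n -> \bar R) : c != 0 ->
  mfun f -> (forall x, 0 <= f x)%E ->
  (\int[lebesgue_rV n]_x f (c *: (x : 'rV[R]_n)) = (`|c|^-1 ^+ n)%:E * \int[lebesgue_rV n]_x f x)%E.
Proof.
move=> c0; elim: n f => [f mf f0|n ih f mf f0].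
  by rewrite mul1e; apply: eq_integral => x _; congr f; apply/rowP => -[].
have mfv : measurable_fun [set: 'rV[R]_n.+1] (fun x => f (c *: x)) by meas.
rewrite (integral_rVS mf f0) (integral_rVS mfv (fun x => f0 _)).
transitivity (\int[leb]_t (fun t => (`|c|^-1 ^+ n)%:E * \int[lebesgue_rV n]_x f (rV_cons (t, x)))%E (c * (t : R))%R)%E.
  apply: eq_integral => t _; under eq_integral do rewrite rV_consZ.
  by rewrite (ih (fun x => f (rV_cons (c * (t : R), x))))//; meas.
rewrite (@ge0_integral_mulr R c (fun t => (`|c|^-1 ^+ n)%:E * \int[lebesgue_rV n]_x f (rV_cons (t, x)))%E)//; last 2 first.
- by apply: measurable_funeM; exact: measurable_rV_fiber_integral1.
- by move=> x; apply: mule_ge0; [by []|exact: integral_ge0].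
rewrite ge0_integralZl//.
- by rewrite muleA -EFinM exprS.
- exact: measurable_rV_fiber_integral1.
- by move=> x _; exact: integral_ge0.
Qed.

Lemma measure_indic d (T : measurableType d) (mu : {measure set T -> \bar R}) (A : set T) :
  measurable A -> mu A = (\int[mu]_x (\1_A x : R)%:E)%E.
Proof. by move=> mA; rewrite integral_indic// setIT. Qed.

Lemma measurable_rV_addr n (v : 'rV[R]_n) (A : set 'rV[R]_n) : measurable A ->
  measurable [set x | A (x + v)].
Proof. by move=> mA; apply: (@measurable_preim _ _ _ _ (fun x : 'rV[R]_n => x + v)); meas. Qed.

Lemma lebesgue_rV_addr n (v : 'rV[R]_n) (A : set 'rV[R]_n) : measurable A ->
  lebesgue_rV n [set x | A (x + v)] = lebesgue_rV n A.
Proof.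
move=> mA; rewrite !measure_indic//; last meas.
rewrite -(@ge0_integral_rV_addr n v (fun x => (\1_A x)%:E)) //.
meas.
Qed.

Lemma lebesgue_rV_scale n (c : R) (A : set 'rV[R]_n) : c != 0 -> measurable A ->
  lebesgue_rV n [set x | A (c *: x)] = ((`|c|^-1 ^+ n)%:E * lebesgue_rV n A)%E.
Proof.
move=> c0 mA; rewrite !measure_indic//; last meas.
rewrite -(@ge0_integral_rV_scale n c (fun x => (\1_A x)%:E)) //.
meas.
Qed.

Lemma lebesgue_rV_opp n (A : set 'rV[R]_n) : measurable A ->
  lebesgue_rV n [set x | A (- x)] = lebesgue_rV n A.
Proof.
move=> mA; have N0 : (-1 : R) != 0 by rewrite oppr_eq0.
have := @lebesgue_rV_scale n (-1) A N0 mA.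
rewrite normrN1 invr1 expr1n mul1e => <-; congr (lebesgue_rV n _).
by apply/funext => x /=; rewrite scaleN1r.
Qed.

Lemma indic_ge0 T (A : set T) (z : T) : (0 <= (\1_A z : R)%:E)%E.
Proof. by []. Qed.

Lemma indic_iff T U (A : set T) (B : set U) x y : (A x <-> B y) ->
  (\1_A x : R)%:E = (\1_B y : R)%:E.
Proof.
move=> AB; rewrite !indicE; have -> // : (x \in A) = (y \in B).
by apply/idP/idP => /set_mem /AB /mem_set.
Qed.

(* Comparing two invariant measures through their product (Tonelli). *)
Lemma invariant_measure_unique n (mu nu : {sigma_finite_measure set 'rV[R]_n -> \bar R}) :
  (forall (v : 'rV[R]_n) (A : set 'rV[R]_n), measurable A -> mu [set x | A (x + v)] = mu A) ->
  (forall (v : 'rV[R]_n) (A : set 'rV[R]_n), measurable A -> nu [set x | A (x + v)] = nu A) ->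
  forall A B : set 'rV[R]_n, measurable A -> measurable B ->
  (mu A * nu B = mu B * nu [set x | A (- x)%R])%E.
Proof.
move=> mui nui A B mA mB.
(* The indicator of the pairs with A x and B (y + x) is integrated in both orders: for fixed x a
   translation in y gives nu B; for fixed y a translation in x trades the condition for A (x - y)
   and B x, whose section at x is a translate of the reflected [A]. *)
have mAB : measurable [set z : 'rV[R]_n * 'rV[R]_n | A z.1 /\ B (z.2 + z.1)] by meas.
have := @fubini_tonelli _ _ _ _ R mu nu
  (fun z => (\1_[set z : 'rV[R]_n * 'rV[R]_n | A z.1 /\ B (z.2 + z.1)] z)%:E)
  (measurable_indicE mAB) (fun z => indic_ge0 _ z).
have E1 x : (\int[nu]_y (\1_[set z : 'rV[R]_n * 'rV[R]_n | A z.1 /\ B (z.2 + z.1)] (x, y))%:E = (\1_A x)%:E * nu B)%E.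
  rewrite [in RHS]indicE; have [Ax|Ax] := boolP (x \in A); last first.
    rewrite mul0e; apply: integral0_eq => y _; rewrite indicE memNset//=.
    by move=> [xA _]; rewrite mem_set in Ax.
  rewrite mul1e -(nui x B mB) measure_indic; last meas.
  by apply: eq_integral => y _; apply: indic_iff; split => [[]//|]; split => //; exact/set_mem.
have E2 y : (\int[mu]_x (\1_[set z : 'rV[R]_n * 'rV[R]_n | A z.1 /\ B (z.2 + z.1)] (x, y))%:E)%E =
   mu [set x | A (x - y) /\ B x].
  rewrite -(mui y); last first.
    meas.
  rewrite measure_indic; last first.
    apply: measurableI; last first.
      by rewrite (_ : (fun x => _) = [set x | B (x + y)])//; meas.
    by rewrite (_ : (fun x => _) = A)//; apply/funext => x; rewrite addrK.
  by apply: eq_integral => x _; apply: indic_iff => /=; rewrite addrK [y + x]addrC.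
under eq_integral do rewrite E1.
rewrite ge0_integralZr//; last meas.
rewrite -measure_indic// => ->.
under eq_integral do rewrite E2.
have mAB2 : measurable [set z : 'rV[R]_n * 'rV[R]_n | A (z.1 - z.2) /\ B z.1] by meas.
transitivity (\int[nu]_y \int[mu]_x (\1_[set z : 'rV[R]_n * 'rV[R]_n | A (z.1 - z.2) /\ B z.1] (x, y))%:E)%E.
  apply: eq_integral => y _; rewrite measure_indic.
    by [].
  meas.
rewrite -(@fubini_tonelli _ _ _ _ R mu nu (fun z => (\1_[set z : 'rV[R]_n * 'rV[R]_n | A (z.1 - z.2) /\ B z.1] z)%:E))//.
- transitivity (\int[mu]_x ((\1_B x)%:E * nu [set x | A (- x)%R]))%E.
    apply: eq_integral => x _; rewrite indicE.
    have mN : measurable [set x | A (- x)] by meas.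
    have [Bx|Bx] := boolP (x \in B); last first.
      rewrite mul0e; apply: integral0_eq => y _; rewrite indicE memNset//=.
      by move=> [_ xB]; rewrite mem_set in Bx.
    rewrite mul1e -(nui (- x))// measure_indic; last meas.
    apply: eq_integral => y _; apply: indic_iff => /=; rewrite opprB.
    by split => [[]//|]; split => //; exact/set_mem.
  rewrite ge0_integralZr//; last meas.
  by rewrite -measure_indic.
- meas.
Qed.

End lebesgue_rV_invariance.

(** * Euclidean norm, reflections and orthogonal invariance *)

Section euclid.
Context {R : realType} {n : nat}.
Implicit Types x y z : 'rV[R]_n.

Lemma dotpC x y : dotp x y = dotp y x.
Proof. by apply: eq_bigr => i _; rewrite mulrC. Qed.

Lemma dotpDl x y z : dotp (x + y) z = dotp x z + dotp y z.
Proof. by rewrite -big_split; apply: eq_bigr => i _; rewrite mxE mulrDl. Qed.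

Lemma dotpDr x y z : dotp z (x + y) = dotp z x + dotp z y.
Proof. by rewrite dotpC dotpDl !(dotpC z). Qed.

Lemma dotpZl c x y : dotp (c *: x) y = c * dotp x y.
Proof. by rewrite mulr_sumr; apply: eq_bigr => i _; rewrite mxE mulrA. Qed.

Lemma dotpZr c x y : dotp x (c *: y) = c * dotp x y.
Proof. by rewrite dotpC dotpZl dotpC. Qed.

Lemma dotpNl x y : dotp (- x) y = - dotp x y.
Proof. by rewrite -scaleN1r dotpZl mulN1r. Qed.

Lemma dotpNr x y : dotp x (- y) = - dotp x y.
Proof. by rewrite dotpC dotpNl dotpC. Qed.

Lemma dotpBl x y z : dotp (x - y) z = dotp x z - dotp y z.
Proof. by rewrite dotpDl dotpNl. Qed.

Lemma dotpBr x y z : dotp z (x - y) = dotp z x - dotp z y.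
Proof. by rewrite dotpDr dotpNr. Qed.

Lemma dotp0l x : dotp 0 x = 0.
Proof. by rewrite -(scale0r 0) dotpZl mul0r. Qed.

Lemma dotp0r x : dotp x 0 = 0.
Proof. by rewrite dotpC dotp0l. Qed.

Lemma dotp_ge0 x : 0 <= dotp x x.
Proof. by apply: sumr_ge0 => i _; rewrite sqr_ge0. Qed.

Lemma enorm_ge0 x : 0 <= enorm x.
Proof. exact: sqrtr_ge0. Qed.

Lemma enorm_sqr x : enorm x ^+ 2 = dotp x x.
Proof. by rewrite sqr_sqrtr// dotp_ge0. Qed.

Lemma dotp_eq0 x : dotp x x = 0 -> x = 0.
Proof.
move=> /psumr_eq0P H; apply/rowP => i; rewrite mxE; apply/eqP.
by rewrite -sqrf_eq0; apply/eqP; apply: H => // j _; rewrite sqr_ge0.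
Qed.

Lemma enorm0 : enorm (0 : 'rV[R]_n) = 0.
Proof. by rewrite /enorm dotp0l sqrtr0. Qed.

Lemma enorm_eq0 x : (enorm x == 0) = (x == 0).
Proof.
apply/eqP/eqP => [H|->]; last exact: enorm0.
by apply: dotp_eq0; rewrite -enorm_sqr H expr0n.
Qed.

Lemma enorm_gt0 x : (0 < enorm x) = (x != 0).
Proof. by rewrite lt_def enorm_ge0 enorm_eq0 andbT. Qed.

Lemma enormZ c x : enorm (c *: x) = `|c| * enorm x.
Proof. by rewrite /enorm dotpZl dotpZr mulrA sqrtrM -?expr2 ?sqr_ge0// sqrtr_sqr. Qed.

Lemma enormN x : enorm (- x) = enorm x.
Proof. by rewrite -scaleN1r enormZ normrN1 mul1r. Qed.

Lemma dotp_le x y : dotp x y <= enorm x * enorm y.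
Proof.
have [->|x0] := eqVneq x 0; first by rewrite dotp0l mulr_ge0// enorm_ge0.
have [->|y0] := eqVneq y 0; first by rewrite dotp0r mulr_ge0// enorm_ge0.
move: x0 y0; rewrite -!enorm_gt0 => x0 y0.
have := dotp_ge0 (enorm y *: x - enorm x *: y).
rewrite dotpBl !dotpBr !dotpZl !dotpZr -!enorm_sqr (dotpC y x).
set a := enorm x in x0 *; set b := enorm y in y0 *; set c := dotp x y => H.
have ab : 0 < a * b by rewrite mulr_gt0.
rewrite -(ler_pM2l ab) -subr_ge0 -(pmulr_rge0 _ (ltr0n _ 2)).
by apply: le_trans H _; apply: le_of_eq; ring.
Qed.

Lemma abs_dotp_le x y : `|dotp x y| <= enorm x * enorm y.
Proof.
rewrite ler_norml dotp_le andbT lerNl -dotpNl -(enormN x); exact: dotp_le.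
Qed.

Lemma enorm_triangle x y : enorm (x + y) <= enorm x + enorm y.
Proof.
rewrite -(@ler_pXn2r _ 2) ?nnegrE ?addr_ge0 ?enorm_ge0//.
rewrite enorm_sqr dotpDl !dotpDr (dotpC y x) -!enorm_sqr.
by have := dotp_le x y; lra.
Qed.

Lemma enormB x y : enorm (x - y) = enorm (y - x).
Proof. by rewrite -enormN opprB. Qed.

Lemma enorm_triangle2 x y z : enorm (x - z) <= enorm (x - y) + enorm (y - z).
Proof. by rewrite -[x - z](subrKA y); exact: enorm_triangle. Qed.

Lemma enorm_dist x y : `|enorm x - enorm y| <= enorm (x - y).
Proof.
rewrite ler_norml; apply/andP; split.
  by have := enorm_triangle (y - x) x; rewrite subrK enormB; lra.
by have := enorm_triangle (x - y) y; rewrite subrK; lra.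
Qed.

Lemma coord_le_enorm x i : `|x 0 i| <= enorm x.
Proof.
rewrite -sqrtr_sqr ler_wsqrtr// /dotp (bigD1 i)//= lerDl.
by apply: sumr_ge0 => j _; rewrite sqr_ge0.
Qed.

Lemma enorm_le_coord x (e : R) : 0 <= e -> (forall i, `|x 0 i| <= e) -> enorm x <= n%:R * e.
Proof.
move=> e0 H; have -> : n%:R * e = Num.sqrt ((n%:R * e) ^+ 2).
  by rewrite sqrtr_sqr ger0_norm// mulr_ge0.
apply: ler_wsqrtr; apply: (@le_trans _ _ (\sum_(i < n) e ^+ 2)).
  by apply: ler_sum => i _; rewrite -expr2 -real_normK ?num_real// ler_pXn2r.
rewrite [leLHS]sumr_const card_ord -[leLHS]mulr_natl exprMn; apply: ler_wpM2r; first exact: sqr_ge0.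
by rewrite -natrX ler_nat; case: (n) => // k; rewrite leq_pmulr.
Qed.

Lemma dotp_delta x i : dotp x (delta_mx 0 i) = x 0 i.
Proof.
rewrite /dotp (bigD1 i)//= mxE !eqxx mulr1 big1 ?addr0// => j ji.
by rewrite mxE (negbTE ji) mulr0.
Qed.

Lemma enorm_delta i : enorm (delta_mx 0 i : 'rV[R]_n) = 1.
Proof. by rewrite /enorm dotp_delta mxE !eqxx sqrtr1. Qed.

Lemma dotp_mx x y : dotp x y = (x *m y^T) 0 0.
Proof. by rewrite mxE; apply: eq_bigr => i _; rewrite mxE. Qed.

Lemma orthC (Q : 'M[R]_n) : Q *m Q^T = 1%:M -> Q^T *m Q = 1%:M.
Proof. exact: mulmx1C. Qed.

Lemma orth_dotp (Q : 'M[R]_n) x y : Q *m Q^T = 1%:M -> dotp (x *m Q) (y *m Q) = dotp x y.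
Proof. by move=> oQ; rewrite !dotp_mx trmx_mul mulmxA -(mulmxA x) oQ mulmx1. Qed.

Lemma orth_enorm (Q : 'M[R]_n) x : Q *m Q^T = 1%:M -> enorm (x *m Q) = enorm x.
Proof. by move=> oQ; rewrite /enorm orth_dotp. Qed.

Lemma orth_dotpl (Q : 'M[R]_n) x y : Q *m Q^T = 1%:M -> dotp (x *m Q) y = dotp x (y *m Q^T).
Proof. by move=> oQ; rewrite !dotp_mx trmx_mul trmxK mulmxA. Qed.

Lemma orth_tr (Q : 'M[R]_n) : Q *m Q^T = 1%:M -> Q^T *m (Q^T)^T = 1%:M.
Proof. by rewrite trmxK; exact: orthC. Qed.

Lemma enorm_continuous : continuous (@enorm R n).
Proof.
move=> x; apply/(@cvgrPdist_le _ _ _ (nbhs x)) => e e0.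
have en : 0 < e / n.+1%:R by rewrite divr_gt0.
near=> y; apply: le_trans (enorm_dist _ _) _.
have : enorm (x - y) <= n%:R * (e / n.+1%:R).
  apply: enorm_le_coord => [|i]; first exact: ltW.
  have : ball x (e / n.+1%:R) y by near: y; exact: nbhsx_ballx.
  by move=> /rV_ballE[_ /(_ i) /ltW]; rewrite !mxE.
move/le_trans; apply; rewrite mulrCA ger_pMr// ler_pdivrMr// mul1r ler_nat//.
Unshelve. all: by end_near. Qed.
End euclid.

Section householder.
Context {R : realType} {n : nat}.
Implicit Types w x : 'rV[R]_n.

(** Division by 0 gives 0, so for w = 0 this is the identity; hence orthogonality, and the transfer
    of a vector to another of the same norm, carry no condition w != 0. *)
Definition householder w : 'M[R]_n := 1%:M - (2 / dotp w w) *: (w^T *m w).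

Lemma householderE w x : x *m householder w = x - (2 * dotp x w / dotp w w) *: w.
Proof.
rewrite mulmxBr mulmx1 -scalemxAr mulmxA; congr (_ - _).
rewrite [x *m w^T]mx11_scalar -dotp_mx mul_scalar_mx scalerA; congr (_ *: _); ring.
Qed.

Lemma householder_sym w : (householder w)^T = householder w.
Proof. by rewrite /householder linearB/= trmx1 linearZ/= trmx_mul trmxK. Qed.

Lemma householder_orth w : householder w *m (householder w)^T = 1%:M.
Proof.
rewrite householder_sym; apply/row_matrixP => i.
rewrite row_mul [row i 1%:M]rowE (rowE i (householder w)) !householderE.
have [->|w0] := eqVneq w 0; first by rewrite !scaler0 !subr0 mulmx1.
have ww : dotp w w != 0 by apply: contra w0 => /eqP /dotp_eq0 ->.
rewrite mulmx1 dotpBl dotpZl -addrA -opprD -scalerDl.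
set a := dotp _ w; set b := dotp w w in ww *.
have -> : 2 * a / b + 2 * (a - 2 * a / b * b) / b = 0 by field.
by rewrite scale0r subr0.
Qed.

Lemma householder_swap x y : enorm x = enorm y -> x *m householder (x - y) = y.
Proof.
move=> xy; have [->|nxy] := eqVneq x y.
  by rewrite householderE subrr scaler0 subr0.
rewrite householderE (_ : _ / _ = 1) ?scale1r ?opprB ?subrKC//; last first.
have d0 : dotp (x - y) (x - y) != 0.
  by apply: contra nxy => /eqP /dotp_eq0 /eqP; rewrite subr_eq0.
apply: (mulIf d0); rewrite mulfVK// dotpBl !dotpBr (dotpC y x).
by rewrite -!enorm_sqr xy; ring.
Qed.

Lemma householder_fix w x : dotp x w = 0 -> x *m householder w = x.
Proof. by move=> xw; rewrite householderE xw mulr0 mul0r scale0r subr0. Qed.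
End householder.

Definition cube {R : realType} (n : nat) (r : R) : set 'rV[R]_n :=
  [set x | forall i, `|x 0 i| < r].
Arguments cube {R} n r.

Definition eball {R : realType} (n : nat) (r : R) : set 'rV[R]_n := [set x | enorm x < r].
Arguments eball {R} n r.

Section sigma_finite_of.
Context {R : realType} {n : nat} (nu : {measure set 'rV[R]_n -> \bar R}).

(** [nu] under a new name, to which a proof of sigma-finiteness can be attached as a structure; the
    comparison of invariant measures by Tonelli requires it. *)
Definition sigma_finite_of of sigma_finite setT nu : set 'rV[R]_n -> \bar R := nu.

Variable snu : sigma_finite setT nu.

HB.instance Definition _ := Measure.copy (sigma_finite_of snu) nu.

HB.instance Definition _ := Measure_isSigmaFinite.Build _ _ _ (sigma_finite_of snu) snu.

End sigma_finite_of.

Section lebesgue_orthogonal.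
Context {R : realType}.
Local Notation leb := (@lebesgue_measure R).

Lemma measurable_eball n (r : R) : measurable (eball n r).
Proof. by apply: measurable_lt_set => //; meas. Qed.

Lemma measurable_cube n (r : R) : measurable (cube n r).
Proof.
rewrite (_ : cube n r = \bigcap_(i in [set: 'I_n]) [set x | `|x 0 i| < r]).
  apply: fin_bigcap_measurable => [|i _]//.
  apply: measurable_lt_set => //; meas.
by apply/seteqP; split => x H i; [move=> _|]; exact: H.
Qed.

Lemma lebesgue_cube n (r : R) : 0 <= r -> lebesgue_rV n (cube n r) = ((2 * r) ^+ n)%:E.
Proof.
move=> r0; elim: n => [|n ih].
  by rewrite /= diracE mem_set// => -[].
have -> : lebesgue_rV n.+1 (cube n.+1 r) = (leb \x lebesgue_rV n)%E (`]-r, r[%classic `*` cube n r).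
  rewrite /= /lebesgue_rV_step /pushforward; congr (_ _).
  apply/seteqP; split => -[t x] /=.
    move=> H; split; first by have := H ord0; rewrite rV_cons0/= in_itv/= ltr_norml.
    by move=> i; have := H (lift ord0 i); rewrite rV_consS.
  rewrite in_itv/= => -[t1 H] i; case: (unliftP ord0 i) => [j ->|->].
    by rewrite rV_consS; exact: H.
  by rewrite rV_cons0/= ltr_norml.
rewrite product_measure1E//; last exact: measurable_cube.
have E : leb `]-r, r[%classic = (2 * r)%:E.
  rewrite lebesgue_measure_itv/= lte_fin; case: ltP => H.
    by rewrite -EFinB; congr EFin; ring.
  by congr EFin; lra.
by rewrite ih [X in (X * _)%E]E -EFinM exprS.
Qed.

Lemma eball_sub_cube n (r : R) : eball n r `<=` cube n r.
Proof. by move=> x xr i; apply: le_lt_trans (coord_le_enorm _ _) xr. Qed.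

Lemma cube_sub_eball n (r : R) : 0 < r -> cube n (r / n.+1%:R) `<=` eball n r.
Proof.
move=> r0 x xr; have rn : 0 < r / n.+1%:R by rewrite divr_gt0.
apply: le_lt_trans (enorm_le_coord (ltW rn) (fun i => ltW (xr i))) _.
by rewrite mulrCA gtr_pMr// ltr_pdivrMr// mul1r ltr_nat.
Qed.

Lemma lebesgue_eball_lty n (r : R) : (lebesgue_rV n (eball n r) < +oo)%E.
Proof.
have [r0|r0] := leP 0 r; last first.
  rewrite (_ : eball n r = set0) ?measure0// -subset0 => x xr.
  by have := enorm_ge0 x; rewrite leNgt (lt_trans xr r0).
apply: (@le_lt_trans _ _ (lebesgue_rV n (cube n r))); last by rewrite lebesgue_cube// ltry.
apply: le_measure; rewrite ?inE; [exact: measurable_eball|exact: measurable_cube|exact: eball_sub_cube].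
Qed.

Lemma lebesgue_eball_gt0 n (r : R) : 0 < r -> (0 < lebesgue_rV n (eball n r))%E.
Proof.
move=> r0; have rn : 0 < r / n.+1%:R by rewrite divr_gt0.
apply: (@lt_le_trans _ _ (lebesgue_rV n (cube n (r / n.+1%:R)))).
  by rewrite lebesgue_cube ?ltW// lte_fin exprn_gt0// mulr_gt0.
apply: le_measure; rewrite ?inE; [exact: measurable_cube|exact: measurable_eball|exact: cube_sub_eball].
Qed.

(** The comparison of two invariant measures involves a reflected set; taking the symmetric unit
    ball for it removes the reflection. Thus a translation-invariant measure is a multiple of
    Lebesgue measure, fixed by its value on the ball. *)
Lemma invariant_measure_eball n (nu : {measure set 'rV[R]_n -> \bar R}) (B : set 'rV[R]_n) :
  sigma_finite setT nu ->
  (forall (v : 'rV[R]_n) (A : set 'rV[R]_n), measurable A -> nu [set x | A (x + v)] = nu A) ->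
  measurable B ->
  (lebesgue_rV n (eball n 1) * nu B = lebesgue_rV n B * nu (eball n 1))%E.
Proof.
move=> snu nui mB.
have H : (lebesgue_rV n (eball n 1) * sigma_finite_of snu B =
    lebesgue_rV n B * sigma_finite_of snu [set x | eball n 1 (- x)%R])%E.
  by apply: invariant_measure_unique => //; [exact: lebesgue_rV_addr|exact: measurable_eball].
rewrite [LHS]H; congr (_ * _)%E; congr (nu _).
by apply/funext => x; rewrite /eball/= enormN.
Qed.

Lemma mulIe_pos (a b c : \bar R) : (0 < c)%E -> (c < +oo)%E -> (a * c = b * c)%E -> a = b.
Proof.
move: c => [r| |]//; rewrite lte_fin => r0 _ H.
have e := @lee_pmul2r R r%:E isT r0.
by apply/eqP; rewrite eq_le -(e a b) -(e b a) H lexx.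
Qed.

Lemma measurable_rV_mul n (Q : 'M[R]_n) (A : set 'rV[R]_n) : measurable A ->
  measurable [set x | A (x *m Q)].
Proof.
move=> mA; apply: (@measurable_preim _ _ _ _ (fun x : 'rV[R]_n => x *m Q)) => //.
meas.
Qed.

Lemma sigma_finite_rV n (nu : {measure set 'rV[R]_n -> \bar R}) :
  (forall r : R, nu (eball n r) < +oo)%E -> sigma_finite setT nu.
Proof.
move=> H; exists (fun k => eball n k%:R) => [|k]; last by split => //; exact: measurable_eball.
apply/seteqP; split => // x _; exists (Num.trunc (enorm x)).+1 => //=.
by rewrite /eball/=; exact: truncnS_gt.
Qed.

(** No determinant is involved: the image of Lebesgue measure under [Q] is translation invariant and
    gives the unit ball its own volume, because [Q] preserves the norm. *)
Lemma lebesgue_rV_orth n (Q : 'M[R]_n) (A : set 'rV[R]_n) : Q *m Q^T = 1%:M -> measurable A ->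
  lebesgue_rV n [set x | A (x *m Q)] = lebesgue_rV n A.
Proof.
move=> oQ mA.
have mf : measurable_fun [set: 'rV[R]_n] (fun x : 'rV[R]_n => x *m Q) by meas.
pose nu : {measure set 'rV[R]_n -> \bar R} :=
  @measure_function_pushforward__canonical__measure_function_Measure _ _ _ _ _ (lebesgue_rV n) _ mf.
have nuE B : nu B = lebesgue_rV n [set x | B (x *m Q)] by [].
have nub r : nu (eball n r) = lebesgue_rV n (eball n r).
  by rewrite nuE; congr (lebesgue_rV n _); apply/funext => x; rewrite /eball/= orth_enorm.
have := @invariant_measure_eball n nu A.
rewrite nub => /(_ _ _ mA) => H.
have {}H : (lebesgue_rV n (eball n 1) * nu A = lebesgue_rV n A * lebesgue_rV n (eball n 1))%E.
  apply: H.
    by apply: sigma_finite_rV => r; rewrite nub; exact: lebesgue_eball_lty.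
  move=> v B mB; rewrite !nuE -[RHS](@lebesgue_rV_addr R n (v *m Q^T) [set x | B (x *m Q)]); last meas.
  congr (lebesgue_rV n _); apply/funext => x /=.
  by rewrite mulmxDl -mulmxA (orthC oQ) mulmx1.
rewrite -nuE; move: H; rewrite muleC.
exact: mulIe_pos (lebesgue_eball_gt0 n ltr01) (lebesgue_eball_lty n 1).
Qed.

Lemma lebesgue_measure_fine_eball n (r : R) : lebesgue_rV n (eball n r) = (fine (lebesgue_rV n (eball n r)))%:E.
Proof. by rewrite fineK// ge0_fin_numE// lebesgue_eball_lty. Qed.

End lebesgue_orthogonal.

#[global] Hint Extern 0 (measurable (eball _ _)) => exact: measurable_eball : meas.
#[global] Hint Resolve measurable_rV_fiber1 measurable_rV_fiber_integral measurable_rV_fiber_integral1 : meas.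

(* Keeps conversion from unfolding the iterated product. *)
#[global] Opaque lebesgue_rV.

Create HintDb pos.

Ltac pos :=
  first [assumption | lazymatch goal with
  | |- is_true (0%R <= ?x)%R => first [pos_le x | apply/ltW; pos_lt x | done]
  | |- is_true (0%R < ?x)%R => pos_lt x
  | |- is_true (_ != 0) => apply: lt0r_neq0; pos
  | |- (_ == 0) = false => apply: gt_eqF; pos
  | |- is_true (_ \is Num.pos) => rewrite posrE; pos
  | |- is_true (_ \is Num.nneg) => rewrite nnegrE; pos
  | |- is_true (_ \in Num.pos) => rewrite posrE; pos
  | |- is_true (_ \in Num.nneg) => rewrite nnegrE; pos
  | |- is_true (Order.le _ _) => first [exact: ltW | rewrite lee_fin; pos | apply: mule_ge0; pos | apply: integral_ge0 => ? _; pos]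
  | |- is_true (Order.lt _ _) => rewrite lte_fin; pos
  end]
with pos_le x :=
  lazymatch x with
  | GRing.mul _ _ => apply: mulr_ge0; pos
  | GRing.add _ (GRing.opp _) => rewrite subr_ge0; first [assumption | exact: ltW | pos]
  | GRing.add _ _ => apply: addr_ge0; pos
  | GRing.inv _ => rewrite invr_ge0; pos
  | GRing.exp _ _ => apply: exprn_ge0; pos
  | powR _ _ => exact: powR_ge0
  | enorm _ => exact: enorm_ge0
  | Num.norm _ => exact: normr_ge0
  | indic _ _ => by rewrite indicE
  | GRing.natmul 1 _ => exact: ler0n
  | 1 => exact: ler01
  end
with pos_lt x :=
  lazymatch x with
  | GRing.mul _ _ => apply: mulr_gt0; pos
  | GRing.add _ (GRing.opp _) => rewrite subr_gt0; pos
  | GRing.add _ _ => first [apply: addr_gt0; pos | apply: ltr_wpDl; pos | apply: ltr_wpDr; pos]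
  | GRing.inv _ => rewrite invr_gt0; pos
  | GRing.exp _ _ => apply: exprn_gt0; pos
  | powR _ _ => apply: powR_gt0; pos
  | GRing.natmul 1 _ => done
  | _ => first [done | solve [auto 2 with nocore pos]]
  end.

(** * Steiner symmetrization *)

Section measure_preserving.
Context {R : realType} {n : nat}.
Local Notation mu := (@lebesgue_rV R n).

Definition measure_preserving (S : 'rV[R]_n -> 'rV[R]_n) :=
  measurable_fun [set: 'rV[R]_n] S /\
  forall A : set 'rV[R]_n, measurable A -> mu (S @^-1` A) = mu A.

Lemma ge0_integral_mpres S (f : 'rV[R]_n -> \bar R) : measure_preserving S ->
  mfun f -> (forall x, 0 <= f x)%E ->
  (\int[mu]_x f (S x) = \int[mu]_x f x)%E.
Proof.
move=> [mS SA] mf f0.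
rewrite -(@ge0_integral_pushforward _ _ _ _ R _ mS mu setT f)//.
by apply: eq_measure_integral => A mA _; exact: SA.
Qed.

Lemma Rintegral_mpres S (f : 'rV[R]_n -> R) : measure_preserving S ->
  mfun f -> \int[mu]_x f (S x) = \int[mu]_x f x.
Proof.
move=> Sm mf.
have mf' : mfun (EFin \o f) by meas.
pose g : 'rV[R]_n -> \bar R := EFin \o f.
have posE (h : 'rV[R]_n -> \bar R) : (\int[mu]_x h^\+ x = \int[mu]_x maxe (h x) 0)%E.
  by apply: eq_integral => x _; rewrite funeposE.
have negE (h : 'rV[R]_n -> \bar R) : (\int[mu]_x h^\- x = \int[mu]_x maxe (- h x) 0)%E.
  by apply: eq_integral => x _; rewrite funenegE.
have P : (\int[mu]_x (g \o S)^\+ x = \int[mu]_x g^\+ x)%E.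
  rewrite (posE (g \o S)) (posE g) -[RHS](@ge0_integral_mpres S (fun x => maxe (g x) 0)%E Sm)//.
    by apply: eq_measurable_fun (measurable_funepos mf') => x _; rewrite funeposE.
  by move=> x; rewrite le_max lexx orbT.
have N : (\int[mu]_x (g \o S)^\- x = \int[mu]_x g^\- x)%E.
  rewrite (negE (g \o S)) (negE g) -[RHS](@ge0_integral_mpres S (fun x => maxe (- g x) 0)%E Sm)//.
    by apply: eq_measurable_fun (measurable_funeneg mf') => x _; rewrite funenegE.
  by move=> x; rewrite le_max lexx orbT.
rewrite /Rintegral; congr fine.
by rewrite (@integralE _ _ _ mu setT (g \o S)) P N -integralE.
Qed.

Lemma integrable_bounded_support (f : 'rV[R]_n -> R) (D M : R) : mfun f ->
  (forall x, ~ eball n D x -> f x = 0) -> (forall x, `|f x| <= M) ->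
  mu.-integrable setT (EFin \o f).
Proof.
move=> mf f0 fM.
have mD := @measurable_eball R n D.
have : mu.-integrable setT (fun x => M%:E * (\1_(eball n D) x)%:E)%E.
  apply: integrableZl => //; apply/integrableP; split; first meas.
  under eq_integral do rewrite gee0_abs//.
  by rewrite -measure_indic//; exact: lebesgue_eball_lty.
apply: le_integrable => //; first meas.
move=> x _; rewrite lee_fin indicE.
have [xD|xD] := boolP (x \in eball n D).
  by rewrite mulr1; apply: le_trans (fM x) (ler_norm _).
rewrite f0 ?normr0//; move=> xD'; by rewrite mem_set in xD.
Qed.

Lemma orth_mpres (Q : 'M[R]_n) : Q *m Q^T = 1%:M -> measure_preserving (fun x => x *m Q).
Proof.
move=> oQ; split; first meas.
by move=> A mA; exact: lebesgue_rV_orth.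
Qed.

End measure_preserving.

Section fibers.
Context {R : realType} {n : nat}.
Local Notation leb := (@lebesgue_measure R).

Definition fiber (A : set 'rV[R]_n.+1) (x : 'rV[R]_n) : set R := [set t | A (rV_cons (t, x))].

(** The strict inequality makes every fibre an open interval centred at 0 with the length of the
    fibre of [A], without any convexity; fibres of length 0 become empty and those of infinite
    length the whole line. *)
Definition steiner (A : set 'rV[R]_n.+1) : set 'rV[R]_n.+1 :=
  [set z : 'rV[R]_n.+1 | ((2 * `|z 0 ord0|)%:E < leb (fiber A (rV_uncons z).2))%E].

Lemma steiner_cons A t x : steiner A (rV_cons (t, x)) <-> ((2 * `|t|)%:E < leb (fiber A x))%E.
Proof. by rewrite /steiner /mkset rV_consK rV_cons0. Qed.

Lemma measurable_cons_fiber d (T : measurableType d) (f : T -> R) (g : T -> 'rV[R]_n) :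
  mfun f -> mfun g ->
  mfun (fun z => rV_cons (f z, g z)).
Proof.
move=> mf mg; apply: (measurableT_comp (@measurable_rV_cons R n)).
meas.
Qed.

Lemma measurable_uncons2 : mfun (fun z : 'rV[R]_n.+1 => (rV_uncons z).2).
Proof. by apply: (measurableT_comp measurable_snd); exact: measurable_rV_uncons. Qed.

Lemma measurable_fiber A x : measurable A -> measurable (fiber A x).
Proof.
move=> mA; apply: (@measurable_preim _ _ _ _ (fun t : R => rV_cons (t, x))) => //.
meas.
Qed.

Lemma fiber_indic A x : measurable A ->
  (\int[leb]_t (\1_A (rV_cons (t, x)) : R)%:E)%E = leb (fiber A x).
Proof.
move=> mA; rewrite (measure_indic leb (measurable_fiber _ mA)).
by [].
Qed.

Lemma measurable_fiber_length A : measurable A -> mfun (fun x => leb (fiber A x)).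
Proof.
move=> mA.
have := @measurable_rV_fiber_integral R n (fun z => (\1_A z)%:E) (measurable_indicE mA) (indic_ge0 A).
by under eq_fun do rewrite fiber_indic//.
Qed.

Lemma lebesgue_rV_fiber A : measurable A ->
  lebesgue_rV n.+1 A = (\int[lebesgue_rV n]_x leb (fiber A x))%E.
Proof.
move=> mA; rewrite measure_indic// (integral_rVS' (measurable_indicE mA) (indic_ge0 A)).
by apply: eq_integral => x _; rewrite fiber_indic.
Qed.

Lemma measurable_steiner A : measurable A -> measurable (steiner A).
Proof.
move=> mA; apply: measurable_lte_set.
  apply/measurable_EFinP; apply: measurable_funM => //; apply: measurableT_comp => //.
  meas.
apply: (measurableT_comp (measurable_fiber_length mA)); exact: measurable_uncons2.
Qed.

Lemma leb_sym_itv (L : \bar R) : (0 <= L)%E -> leb [set t : R | ((2 * `|t|)%:E < L)%E] = L.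
Proof.
move: L => [r| |]//.
- rewrite lee_fin => r0; rewrite (_ : [set t | _] = `]- (r / 2), r / 2[%classic).
    rewrite lebesgue_measure_itv/= lte_fin; case: ltP => H.
      by rewrite -EFinB; congr EFin; field.
    by congr EFin; lra.
  apply/seteqP; split => t /=; rewrite in_itv/= lte_fin.
    by move=> H; rewrite -ltr_norml; lra.
  by rewrite -ltr_norml; lra.
- move=> _; rewrite (_ : [set t | _] = setT); last by apply/seteqP; split => t //= _; exact: ltry.
  by rewrite -set_itvNyy lebesgue_measure_itv/=.
Qed.

Lemma fiber_steiner A x : measurable A -> leb (fiber (steiner A) x) = leb (fiber A x).
Proof.
move=> mA; rewrite -[RHS]leb_sym_itv//; congr (leb _).
by apply/seteqP; split => t; rewrite /fiber/= steiner_cons.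
Qed.

Lemma lebesgue_steiner A : measurable A -> lebesgue_rV n.+1 (steiner A) = lebesgue_rV n.+1 A.
Proof.
move=> mA; rewrite !lebesgue_rV_fiber//; last exact: measurable_steiner.
by apply: eq_integral => x _; exact: fiber_steiner.
Qed.

Lemma enorm_cons t (x : 'rV[R]_n) : enorm (rV_cons (t, x)) = Num.sqrt (t ^+ 2 + dotp x x).
Proof. by rewrite /enorm dotp_cons. Qed.

Lemma eball_cons r t (x : 'rV[R]_n) : 0 < r ->
  eball n.+1 r (rV_cons (t, x)) <-> t ^+ 2 < r ^+ 2 - dotp x x.
Proof.
move=> r0; rewrite /eball/= enorm_cons -[X in _ < X](gtr0_norm r0) -sqrtr_sqr ltr_sqrt ?exprn_gt0//.
by rewrite ltrBrDr.
Qed.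

Lemma steiner_eball_sub A r : 0 < r -> measurable A -> A `<=` eball n.+1 r ->
  steiner A `<=` eball n.+1 r.
Proof.
move=> r0 mA Ar z; rewrite (rV_cons_eta z); case: (rV_uncons z) => t x.
rewrite steiner_cons eball_cons// => H.
rewrite ltNge; apply/negP => tr; move: H; apply/negP; rewrite -leNgt.
rewrite -(@leb_sym_itv (2 * `|t|)%:E)//.
apply: le_measure; rewrite ?inE; first exact: measurable_fiber.
  meas.
move=> s /Ar; rewrite eball_cons// => sr /=; rewrite lte_fin ltr_pM2l//.
by rewrite -(@ltr_pXn2r _ 2)// !real_normK ?num_real//; apply: lt_le_trans sr tr.
Qed.

Lemma steiner_mono_eball A r t (x : 'rV[R]_n) : 0 < r -> eball n.+1 r (rV_cons (t, x)) ->
  (leb (fiber (eball n.+1 r) x) <= leb (fiber A x))%E -> steiner A (rV_cons (t, x)).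
Proof.
move=> r0; rewrite eball_cons// => tr H; rewrite steiner_cons; apply: lt_le_trans H.
have c0 : 0 < r ^+ 2 - dotp x x by apply: le_lt_trans tr; exact: sqr_ge0.
set c := Num.sqrt (r ^+ 2 - dotp x x).
have -> : fiber (eball n.+1 r) x = [set s : R | ((2 * `|s|)%:E < (2 * c)%:E)%E].
  apply/seteqP; split => s; rewrite /fiber/= eball_cons// lte_fin ltr_pM2l//.
    by rewrite -sqrtr_sqr ltr_sqrt.
  by rewrite -sqrtr_sqr ltr_sqrt.
rewrite leb_sym_itv ?lee_fin ?mulr_ge0 ?sqrtr_ge0// lte_fin ltr_pM2l//.
by rewrite -sqrtr_sqr ltr_sqrt.
Qed.

Definition shear (c : R) (m : 'rV[R]_n -> R) (z : 'rV[R]_n.+1) : 'rV[R]_n.+1 :=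
  rV_cons (c * z 0 ord0 + m (rV_uncons z).2, (rV_uncons z).2).

Lemma shear_cons c m t x : shear c m (rV_cons (t, x)) = rV_cons (c * t + m x, x).
Proof. by rewrite /shear rV_consK rV_cons0. Qed.

(** [m] is merely measurable, so volume is preserved fibre by fibre, through Tonelli and the
    invariance of length under translation and reflection. *)
Lemma shear_mpres c m : `|c| = 1 -> mfun m -> measure_preserving (shear c m).
Proof.
move=> c1 mm.
have c0 : c != 0 by rewrite -normr_eq0 c1.
have mS : measurable_fun [set: 'rV[R]_n.+1] (shear c m).
  apply: measurable_cons_fiber; last exact: measurable_uncons2.
  apply: measurable_funD; first by apply: measurable_funM => //; meas.
  by apply: (measurableT_comp mm); exact: measurable_uncons2.
split => // A mA.
have mSA : measurable (shear c m @^-1` A) by meas.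
rewrite !lebesgue_rV_fiber//; apply: eq_integral => x _.
transitivity (leb ((fun t : R => c * t) @^-1` ((fun t : R => t + m x) @^-1` fiber A x))).
  by congr (leb _); apply/funext => t; rewrite /fiber/= shear_cons.
rewrite lebesgue_measure_mulr// ?c1 ?invr1 ?mul1e.
  by rewrite lebesgue_measure_addr//; exact: measurable_fiber.
by apply: (@measurable_preim _ _ _ _ (fun t : R => t + m x)) => //; [meas|exact: measurable_fiber].
Qed.

End fibers.

#[global] Hint Resolve measurable_fiber measurable_fiber_length measurable_steiner measurable_uncons2 : meas.

Section line.
Context {R : realType}.
Local Notation leb := (@lebesgue_measure R).

(** The one-dimensional Brunn-Minkowski inequality for an interval. Cut [A] at one of its points a:
    the part left of a moved by l, the interval from a + l to a + r, and the remaining part moved by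
    r are disjoint and contained in [B]. *)
Lemma leb_thickening (A B : set R) (l r : R) : measurable A -> measurable B -> A !=set0 ->
  l <= r -> (forall a s, A a -> l <= s <= r -> B (a + s)) ->
  (leb A + (r - l)%:E <= leb B)%E.
Proof.
move=> mA mB [a Aa] lr AB.
have lebU (X Y : set R) : measurable X -> measurable Y -> X `&` Y = set0 ->
  leb (X `|` Y) = (leb X + leb Y)%E by move=> ? ? ?; rewrite measureU.
pose A1 := A `&` `]-oo, a[%classic; pose A2 := A `&` `[a, +oo[%classic.
have mA1 : measurable A1 by exact: measurableI.
have mA2 : measurable A2 by exact: measurableI.
have -> : leb A = (leb A1 + leb A2)%E.
  rewrite -measureU//.
    congr (leb _); rewrite -setIUr (_ : _ `|` _ = setT) ?setIT//.
    by apply/seteqP; split => // x _ /=; rewrite !in_itv/=; case: (ltP x a); [left|right].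
  by rewrite -subset0 => x [[_ /=]]; rewrite in_itv/= => xa [_ /=]; rewrite in_itv/= leNgt xa.
have sh (v : R) (X : set R) : measurable X -> measurable [set t | X (t - v)].
  by move=> mX; meas.
have B1m := sh l _ mA1; have B2m := sh r _ mA2.
have -> : leb A1 = leb [set t | A1 (t - l)] by rewrite -(lebesgue_measure_addr (- l)).
have -> : leb A2 = leb [set t | A2 (t - r)] by rewrite -(lebesgue_measure_addr (- r)).
pose J := `[(a + l), (a + r)[%classic : set R.
have JE : leb J = (r - l)%:E.
  rewrite lebesgue_measure_itv/= lte_fin; case: ltP => H.
    by rewrite -EFinB; congr EFin; ring.
  by congr EFin; lra.
have mJ : measurable J by meas.
rewrite -JE -addeA -[X in (_ + X)%E](lebU _ _ B2m)//; last first.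
  rewrite -subset0 => x [[_ +] ]; rewrite /J/= !in_itv/= => xa /andP[_]; lra.
rewrite -lebU//; last 2 first.
- meas.
- rewrite -subset0 => x [[_ /=]]; rewrite in_itv/= => xa [[_ /=]|].
    by rewrite in_itv/=; lra.
  by rewrite /J/= in_itv/= => /andP[]; lra.
apply: le_measure; rewrite ?inE//; first by apply: measurableU => //; meas.
move=> x [[Ax _]|[[Ax _]|]].
- by rewrite -(subrK l x); apply: AB => //; lra.
- by rewrite -(subrK r x); apply: AB => //; lra.
- by rewrite /J/= in_itv/= => xJ; rewrite -(subrKC a x); apply: AB => //; lra.
Qed.

Definition is_convexR (I : set R) := forall x y z, I x -> I y -> x <= z <= y -> I z.

(** The centre of the interval is written as inf plus half the length because both are measurable
    functions of the base point when [I] runs through the fibres of a convex set. *)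
Lemma convexR_midpoint (I : set R) (L D : R) t : is_convexR I -> measurable I ->
  leb I = L%:E -> (forall x, I x -> `|x| <= D) -> 2 * `|t| < L -> I (t + (inf I + L / 2)).
Proof.
move=> cI mI IL ID tL.
have L0 : 0 < L by apply: le_lt_trans tL; rewrite mulr_ge0.
have I0 : I !=set0.
  apply/set0P; apply/eqP => I0; move: IL; rewrite I0 measure0 => -[L0'].
  by rewrite -L0' ltxx in L0.
have hI : has_inf I by split => //; exists (- D) => x /ID; rewrite ler_norml => /andP[].
set a := inf I; set s := t + (a + L / 2).
have [t1 t2] : - (L / 2) < t /\ t < L / 2 by move: tL; rewrite -ltr_pdivlMl// mulrC ltr_norml => /andP[].
have [i1 Ii1 i1s] : exists2 i1, I i1 & i1 < s.
  by apply: inf_lt => //; rewrite /s -/a; lra.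
have [[i2 Ii2 i2s]|H] := pselect (exists2 i2, I i2 & s <= i2).
  by apply: (cI i1 i2) => //; rewrite (ltW i1s).
have : (leb I <= leb `[a, s]%classic)%E.
  apply: le_measure; rewrite ?inE// => x Ix /=; rewrite in_itv/=.
  rewrite ge_inf//=; last by case: hI.
  by rewrite leNgt; apply/negP => sx; apply: H; exists x => //; pos.
rewrite IL lebesgue_measure_itv/= lte_fin (_ : a < s); last by rewrite /s; lra.
by rewrite -EFinB lee_fin /s; lra.
Qed.

(** Turns a bound on an infimum into positivity of a length, and lengths of fibres are measurable by
    Tonelli. *)
Lemma convexR_inf_lt (I : set R) (D r : R) : is_convexR I -> measurable I ->
  (0 < leb I)%E -> (forall x, I x -> `|x| <= D) ->
  inf I < r <-> (0 < leb (I `&` `]-oo, r[%classic))%E.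
Proof.
move=> cI mI I0 ID; split => [Ir|].
  have In0 : I !=set0.
    by apply/set0P; apply/eqP => I0'; move: I0; rewrite I0' measure0 ltxx.
  have [i1 Ii1 i1r] := inf_lt In0 Ir.
  have [[i2 Ii2 i2r]|H] := pselect (exists2 i2, I i2 & r <= i2).
    apply: (@lt_le_trans _ _ (leb `[i1, r[%classic)).
      by rewrite lebesgue_measure_itv/= lte_fin i1r -EFinB lte_fin subr_gt0.
    apply: le_measure; rewrite ?inE//; first exact: measurableI.
    move=> x /=; rewrite !in_itv/= => /andP[ix xr]; split => //.
    by apply: (cI i1 i2) => //; rewrite ix/= (le_trans (ltW xr)).
  rewrite (_ : I `&` _ = I)//; apply/seteqP; split => [x []//|x Ix]; split => //=.
  by rewrite in_itv/= ltNge; apply/negP => rx; apply: H; exists x.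
move=> H; have [x [Ix /=]] : (I `&` `]-oo, r[%classic) !=set0.
  by apply/set0P; apply/eqP => I0'; move: H; rewrite I0' measure0 ltxx.
rewrite in_itv/=; apply: le_lt_trans; apply: ge_inf => //.
by exists (- D) => y /ID; rewrite ler_norml => /andP[].
Qed.

End line.

Lemma integral_in_indic {R : realType} d (T : measurableType d) (mu : {measure set T -> \bar R})
    (D : set T) (f : T -> \bar R) :
  (\int[mu]_(x in D) f x = \int[mu]_x (f x * (\1_D x : R)%:E))%E.
Proof.
rewrite integral_mkcond; apply: eq_integral => x _; rewrite patchE indicE.
by case: ifP => _; rewrite ?mule1 ?mule0.
Qed.

(** * Dual densities and their barycenters *)

Section dual.
Context {R : realType} {n : nat}.
Local Notation mu := (@lebesgue_rV R n).
Variables (F : R -> R) (p C : R).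
Hypotheses (F0 : forall t, 0 <= F t) (mF : mfun F).

(** The inequality says that the convex conjugate of g -> int_Phi F(g), evaluated at p lam, is at
    most [C]. The model is lam = F'(g0) / p on Phi, for which, with the right [C], equality holds at
    g0. *)
Definition dual (Phi : set 'rV[R]_n) (lam : 'rV[R]_n -> R) :=
  [/\ mfun lam, exists M : R, forall x, `|lam x| <= M,
      forall x, ~ Phi x -> lam x = 0 &
      forall g : 'rV[R]_n -> R, mfun g -> (exists M : R, forall x, `|g x| <= M) ->
        ((p * \int[mu]_x (g x * lam x))%:E <= \int[mu]_(x in Phi) (F (g x))%:E + C%:E)%E].

Definition barycenter (lam : 'rV[R]_n -> R) : 'rV[R]_n := \row_i \int[mu]_x (x 0 i * lam x).

Definition dual_body Phi : set 'rV[R]_n := [set y | exists2 lam, dual Phi lam & y = barycenter lam].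

(** Substituting [S] moves a test function g to g o T, and turns the barycenter of lam o S into the
    integral of [T] against lam. *)
Lemma dual_transport (Phi Phi' : set 'rV[R]_n) (S T : 'rV[R]_n -> 'rV[R]_n) lam :
  measurable Phi -> measurable Phi' -> measure_preserving S -> mfun T ->
  cancel S T -> (forall x, Phi' x -> Phi (T x)) -> dual Phi' lam ->
  dual Phi (lam \o S) /\ forall i, barycenter (lam \o S) 0 i = \int[mu]_x ((T x) 0 i * lam x).
Proof.
move=> mPhi mPhi' Sm mT ST PT [ml [M lM] l0 ld].
have mS := Sm.1.
split; last first.
  move=> i; rewrite mxE -[RHS](Rintegral_mpres Sm); last first.
    meas.
  by apply: eq_Rintegral => x _; rewrite ST.
split; first meas.
- by exists M => x; exact: lM.
- by move=> x nPhi; apply: l0 => Sx; apply: nPhi; rewrite -(ST x); exact: PT.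
move=> g mg [Mg gM].
have mgT : mfun (g \o T) by meas.
have -> : \int[mu]_x (g x * (lam \o S) x) = \int[mu]_x ((g \o T) x * lam x).
  rewrite -[RHS](Rintegral_mpres Sm); last meas.
  by apply: eq_Rintegral => x _ /=; rewrite ST.
apply: le_trans (ld _ mgT _) _; first by exists Mg => x /=.
apply: leeD => //; rewrite (integral_in_indic mu Phi') (integral_in_indic mu Phi).
have mFT : mfun (fun x => (F (g (T x)))%:E * (\1_Phi' x)%:E)%E by meas.
rewrite -(@ge0_integral_mpres R n S _ Sm mFT); last by move=> x; rewrite mule_ge0 ?lee_fin.
apply: ge0_le_integral_any => x _; first by rewrite mule_ge0 ?lee_fin.
rewrite ST lee_wpmul2l ?lee_fin// !indicE.
have [/set_mem xS|//] := boolP (S x \in Phi').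
by rewrite mem_set// -(ST x); exact: PT.
Qed.

Definition isconvex (Phi : set 'rV[R]_n) := forall x y a, 0 <= a <= 1 -> Phi x -> Phi y ->
  Phi (a *: x + (1 - a) *: y).

Lemma dual_integrable (Phi : set 'rV[R]_n) D lam (g : 'rV[R]_n -> R) : Phi `<=` eball n D -> dual Phi lam ->
  mfun g -> (exists M : R, forall x, eball n D x -> `|g x| <= M) ->
  mu.-integrable setT (EFin \o (fun x => g x * lam x)).
Proof.
move=> PD [ml [M lM] l0 _] mg [Mg gM].
apply: (@integrable_bounded_support R n _ D (`|Mg| * M)).
- meas.
- by move=> x xD; rewrite l0 ?mulr0// => /PD.
- move=> x; rewrite normrM.
  have [/gM H|xD] := pselect (eball n D x).
    by apply: ler_pM => //; apply: le_trans H (ler_norm _).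
  rewrite l0; last by move=> /PD.
  by rewrite normr0 mulr0 mulr_ge0// (le_trans _ (lM x)).
Qed.

Lemma coord_bounded D i : exists M : R, forall x : 'rV[R]_n, eball n D x -> `|x 0 i| <= M.
Proof. by exists D => x xD; apply: le_trans (coord_le_enorm _ _) (ltW xD). Qed.

Lemma dual_body_convex (Phi : set 'rV[R]_n) D : Phi `<=` eball n D -> isconvex (dual_body Phi).
Proof.
move=> PD x y a /andP[a0 a1] [l1 d1 ->] [l2 d2 ->].
have I1 := dual_integrable PD d1; have I2 := dual_integrable PD d2.
have lin (g : 'rV[R]_n -> R) : mfun g -> (exists M : R, forall x, eball n D x -> `|g x| <= M) ->
    \int[mu]_x (g x * (a * l1 x + (1 - a) * l2 x)) =
    a * \int[mu]_x (g x * l1 x) + (1 - a) * \int[mu]_x (g x * l2 x).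
  move=> mg gM.
  have J1 := I1 g mg gM; have J2 := I2 g mg gM.
  rewrite -!RintegralZl// -RintegralD//; last 2 first.
  - by apply: eq_integrable (integrableZl measurableT a J1) => // z _.
  - by apply: eq_integrable (integrableZl measurableT (1 - a) J2) => // z _.
  by apply: eq_Rintegral => z _; ring.
exists (fun x => a * l1 x + (1 - a) * l2 x); last first.
  by apply/rowP => i; rewrite !mxE lin//; [meas|exact: coord_bounded].
move: d1 d2 => [ml1 [M1 lM1] l10 ld1] [ml2 [M2 lM2] l20 ld2]; split.
- meas.
- exists (`|a| * M1 + `|1 - a| * M2) => z; apply: le_trans (ler_normD _ _) _.
  by rewrite !normrM; apply: lerD; apply: ler_wpM2l.
- by move=> z nz; rewrite l10// l20// !mulr0 addr0.
move=> g mg [Mg gM]; rewrite lin//; last by exists Mg.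
have := ld1 g mg (ex_intro _ Mg gM); have := ld2 g mg (ex_intro _ Mg gM).
case: (_ + C%:E)%E => [r| |]; rewrite ?leey// !lee_fin => H1 H2.
have : a * (p * \int[mu]_x (g x * l1 x)) <= a * r by exact: ler_wpM2l.
have : (1 - a) * (p * \int[mu]_x (g x * l2 x)) <= (1 - a) * r by apply: ler_wpM2l => //; rewrite subr_ge0.
lra.
Qed.

Lemma dual0 Phi : 0 <= C -> dual Phi (fun=> 0).
Proof.
move=> C0; split => //; first by exists 0 => x; rewrite normr0.
move=> g mg gM; rewrite (_ : \int[mu]_x _ = 0).
  by rewrite mulr0 adde_ge0// integral_ge0// => x _; rewrite lee_fin.
by under eq_Rintegral do rewrite mulr0; rewrite /Rintegral integral0.
Qed.

Lemma barycenter0 : barycenter (fun=> 0) = 0.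
Proof.
apply/rowP => i; rewrite !mxE.
by under eq_Rintegral do rewrite mulr0; rewrite /Rintegral integral0.
Qed.

End dual.

Section steiner_dual.
Context {R : realType} {n : nat}.
Local Notation leb := (@lebesgue_measure R).
Local Notation mu := (@lebesgue_rV R n.+1).
Variables (F : R -> R) (p C : R).
Hypotheses (F0 : forall t, 0 <= F t) (mF : mfun F).
Variables (Phi : set 'rV[R]_n.+1) (D : R).
Hypotheses (mPhi : measurable Phi) (cPhi : isconvex Phi) (D0 : 0 < D) (PD : Phi `<=` eball n.+1 D).

Lemma fiber_bounded x t : fiber Phi x t -> `|t| <= D.
Proof.
move=> /PD tD; rewrite -[t]/((t, x).1) -(rV_cons0 (t, x)).
exact: le_trans (coord_le_enorm _ _) (ltW tD).
Qed.

Lemma fiber_convexR x : is_convexR (fiber Phi x).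
Proof.
move=> s t z Ps Pt /andP[sz zt].
have [st|st] := eqVneq s t; first by rewrite (_ : z = s)//; apply/le_anti; rewrite sz andbT st.
have st' : 0 < t - s by rewrite subr_gt0 lt_neqAle st (le_trans sz).
have a01 : 0 <= (t - z) / (t - s) <= 1.
  by rewrite divr_ge0 ?subr_ge0 ?(le_trans sz)//= ler_pdivrMr//; lra.
have := cPhi a01 Ps Pt; rewrite /fiber/= !rV_consZ rV_consD.
rewrite -scalerDl subrKC scale1r; congr (Phi (rV_cons (_, _))).
by field; rewrite gt_eqF.
Qed.

Lemma fiber_length_fin x : leb (fiber Phi x) = (fine (leb (fiber Phi x)))%:E.
Proof.
rewrite fineK// ge0_fin_numE//.
apply: (@le_lt_trans _ _ (leb `[- D, D]%classic)).
  apply: le_measure; rewrite ?inE//; first exact: measurable_fiber.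
  by move=> t /fiber_bounded; rewrite ler_norml.
by rewrite lebesgue_measure_itv/=; case: ifP => _; rewrite// -EFinB ltry.
Qed.

(** Over fibres of length 0 the symmetral has no points; the fixed value 0 there keeps the function
    bounded and measurable. *)
Definition fiber_inf (x : 'rV[R]_n) : R :=
  if (0 < leb (fiber Phi x))%E then inf (fiber Phi x) else 0.

Lemma measurable_fiber_inf : mfun fiber_inf.
Proof.
apply: (measurability _ (RGenInftyO.measurableE R)) => _ [_ [r ->] <-]; rewrite setTI.
pose A := Phi `&` [set z : 'rV[R]_n.+1 | z 0 ord0 < r].
have mA : measurable A.
  by apply: measurableI => //; meas.
have mP : measurable [set x | (0 < leb (fiber Phi x))%E].
  by apply: measurable_lte_set => //; exact: measurable_fiber_length.
have -> : fiber_inf @^-1` `]-oo, r[ =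
   ([set x | (0 < leb (fiber Phi x))%E] `&` [set x | (0 < leb (fiber A x))%E]) `|`
   (~` [set x | (0 < leb (fiber Phi x))%E] `&` [set x | 0 < r]).
  have fA x : fiber A x = fiber Phi x `&` `]-oo, r[%classic.
    apply/seteqP; split => t; rewrite /fiber/= /A/= rV_cons0 in_itv/=; first by case.
    by [].
  apply/seteqP; split => x /=; rewrite /fiber_inf in_itv/=.
    case: ifPn => [P|/negP P] H; [left; split => //|by right].
    rewrite fA; apply/(convexR_inf_lt _ _ _ P) => //; first exact: fiber_convexR.
      meas.
    exact: fiber_bounded.
  move=> [[P H]|[P r0]]; last by rewrite ifN//; apply/negP.
  rewrite P; apply/(convexR_inf_lt _ _ _ P) => //; first exact: fiber_convexR.
  - meas.
  - exact: fiber_bounded.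
  - by rewrite -fA.
apply: measurableU; apply: measurableI => //.
- by apply: measurable_lte_set => //; exact: measurable_fiber_length.
- meas.
- meas.
Qed.

Definition fiber_mid (x : 'rV[R]_n) : R := fiber_inf x + fine (leb (fiber Phi x)) / 2.

Lemma measurable_fiber_mid : mfun fiber_mid.
Proof.
apply: measurable_funD; first exact: measurable_fiber_inf.
apply: measurable_funM => //; apply: measurableT_comp => //.
exact: measurable_fiber_length.
Qed.

Lemma fiber_midP t x : steiner Phi (rV_cons (t, x)) -> fiber Phi x (t + fiber_mid x).
Proof.
rewrite steiner_cons => H.
have P : (0 < leb (fiber Phi x))%E by apply: le_lt_trans H; rewrite lee_fin.
rewrite /fiber_mid /fiber_inf P.
apply: convexR_midpoint => //.
- exact: fiber_convexR.
- meas.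
- exact: fiber_length_fin.
- exact: fiber_bounded.
- by move: H; rewrite fiber_length_fin.
Qed.

Lemma fiber_mid_bounded : exists M : R, forall x, `|fiber_mid x| <= M.
Proof.
exists (D + (2 * D) / 2) => x; apply: le_trans (ler_normD _ _) _; apply: lerD.
  rewrite /fiber_inf; case: ifPn => P; last by rewrite normr0 ltW.
  have [t Pt] : fiber Phi x !=set0.
    by apply/set0P; apply/eqP => I0'; move: P; rewrite I0' measure0 ltxx.
  rewrite ler_norml; apply/andP; split.
    by apply: lb_le_inf => [|s /fiber_bounded]; [exists t|rewrite ler_norml => /andP[]].
  apply: (@le_trans _ _ t); last by have := fiber_bounded Pt; rewrite ler_norml => /andP[].
  by apply: ge_inf => //; exists (- D) => s /fiber_bounded; rewrite ler_norml => /andP[].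
rewrite normrM (ger0_norm (_ : 0 <= 2^-1 :> R))// ler_pM2r// ger0_norm ?fine_ge0//.
rewrite -lee_fin -fiber_length_fin.
apply: (@le_trans _ _ (leb `[- D, D]%classic)).
  apply: le_measure; rewrite ?inE//; first exact: measurable_fiber.
  by move=> t /fiber_bounded; rewrite ler_norml.
rewrite lebesgue_measure_itv/= lte_fin gtrN//; rewrite -EFinB lee_fin; lra.
Qed.

(** Each of the two points at heights s and t comes with two points of its fibre of Phi at a
    distance exceeding 2|s| or 2|t|, by the strict inequality in [steiner]. Their combinations span
    an interval of the combined fibre longer than twice the combined height. *)
Lemma steiner_convex : isconvex (steiner Phi).
Proof.
move=> z1 z2 a; rewrite (rV_cons_eta z1) (rV_cons_eta z2).
case: (rV_uncons z1) => s x; case: (rV_uncons z2) => t y /andP[a0 a1] P1 P2.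
have rad u v : steiner Phi (rV_cons (u, v)) -> exists r, [/\ `|u| < r, fiber Phi v (r + fiber_mid v)
    & fiber Phi v (- r + fiber_mid v)].
  rewrite steiner_cons => H.
  have [L [fl L0]] : exists L, leb (fiber Phi v) = L%:E /\ 0 <= L.
    by exists (fine (leb (fiber Phi v))); split; [exact: fiber_length_fin|exact: fine_ge0].
  have u0 := normr_ge0 u; move: H; rewrite fl lte_fin => H.
  exists ((`|u| + L / 2) / 2); split; first by lra.
    by apply: fiber_midP; rewrite steiner_cons fl lte_fin ger0_norm//; lra.
  by apply: fiber_midP; rewrite steiner_cons fl lte_fin normrN ger0_norm//; lra.
have [r1 [sr1 A1 B1]] := rad _ _ P1; have [r2 [sr2 A2 B2]] := rad _ _ P2.
have a01 : 0 <= a <= 1 by rewrite a0.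
rewrite !rV_consZ rV_consD steiner_cons.
set w := a *: x + (1 - a) *: y.
have := cPhi a01 A1 A2; have := cPhi a01 B1 B2.
rewrite !rV_consZ !rV_consD -/w => W1 W2.
set l := a * (- r1 + fiber_mid x) + _ in W1; set r := a * (r1 + fiber_mid x) + _ in W2.
have lr : r - l = 2 * (a * r1 + (1 - a) * r2) by rewrite /r /l; ring.
have st : `|a * s + (1 - a) * t| < a * r1 + (1 - a) * r2.
  apply: le_lt_trans (ler_normD _ _) _; rewrite !normrM (ger0_norm a0) (@ger0_norm _ (1 - a)) ?subr_ge0//.
  have [a00|a00] := eqVneq a 0; first by rewrite a00 !mul0r !add0r subr0 !mul1r.
  apply: ltr_leD; first by rewrite ltr_pM2l// lt_neqAle eq_sym a00.
  by apply: ler_wpM2l; pos.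
apply: (@lt_le_trans _ _ (leb `[l, r]%classic)).
  rewrite lebesgue_measure_itv/= lte_fin (_ : l < r); last by rewrite -subr_gt0 lr mulr_gt0// (le_lt_trans _ st).
  by rewrite -EFinB lte_fin lr ltr_pM2l.
apply: le_measure; rewrite ?inE//; first exact: measurable_fiber.
by move=> u /=; rewrite in_itv/= => lur; exact: (fiber_convexR W1 W2).
Qed.

(** Undo the symmetrization by the two shears u -> [fiber_mid] + u and u -> [fiber_mid] - u, both of
    which carry the symmetral into Phi. The transported densities have barycenters c + t and c - t
    in the first coordinate, where c is the integral of [fiber_mid] against [lam], and the same
    remaining coordinates; convexity of the dual body gives the segment between them. *)
Lemma steiner_dual_body t y : dual_body F p C (steiner Phi) (rV_cons (t, y)) ->
  exists c, forall s, `|s| <= `|t| -> dual_body F p C Phi (rV_cons (c + s, y)).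
Proof.
move=> [lam dlam E].
have mSPhi := measurable_steiner mPhi.
have mm := measurable_fiber_mid.
have mmN : mfun (fun x => - fiber_mid x) by meas.
have sP := @shear_mpres R n 1 (fun x => - fiber_mid x) (normr1 _) mmN.
have sN := @shear_mpres R n (-1) fiber_mid (normrN1 _) mm.
have mT : mfun (shear 1 fiber_mid) := (@shear_mpres R n 1 fiber_mid (normr1 _) mm).1.
have [d1 b1] : dual F p C Phi (lam \o shear 1 (fun x => - fiber_mid x)) /\
    forall i, barycenter (lam \o shear 1 (fun x => - fiber_mid x)) 0 i = \int[mu]_x ((shear 1 fiber_mid x) 0 i * lam x).
  apply: dual_transport dlam => //.
    move=> z; rewrite (rV_cons_eta z); case: (rV_uncons z) => u x; rewrite !shear_cons.
    by congr (rV_cons (_, _)); ring.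
  move=> z; rewrite (rV_cons_eta z); case: (rV_uncons z) => u x; rewrite shear_cons mul1r.
  exact: fiber_midP.
have [d2 b2] : dual F p C Phi (lam \o shear (-1) fiber_mid) /\
    forall i, barycenter (lam \o shear (-1) fiber_mid) 0 i = \int[mu]_x ((shear (-1) fiber_mid x) 0 i * lam x).
  apply: dual_transport dlam => //; first exact: sN.1.
    move=> z; rewrite (rV_cons_eta z); case: (rV_uncons z) => u x; rewrite !shear_cons.
    by congr (rV_cons (_, _)); ring.
  move=> z; rewrite (rV_cons_eta z); case: (rV_uncons z) => u x; rewrite shear_cons mulN1r => H.
  by apply: fiber_midP; rewrite steiner_cons normrN -steiner_cons.
have SD : steiner Phi `<=` eball n.+1 D by exact: steiner_eball_sub.
pose m' (z : 'rV[R]_n.+1) := fiber_mid (rV_uncons z).2.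
have mm' : mfun m' by apply: (measurableT_comp mm); exact: measurable_uncons2.
have [Mm mM] := fiber_mid_bounded.
have I1 := dual_integrable SD dlam mm' (ex_intro _ Mm (fun x _ => mM _)).
have I0 i := dual_integrable SD dlam (measurable_coord i) (coord_bounded D i).
set c := \int[mu]_z (m' z * lam z).
have sign e (lam' : 'rV[R]_n.+1 -> R) : dual F p C Phi lam' ->
   (forall i, barycenter lam' 0 i = \int[mu]_x ((shear e fiber_mid x) 0 i * lam x)) ->
   dual_body F p C Phi (rV_cons (c + e * t, y)).
  move=> d b; exists lam' => //; apply/rowP => i; rewrite b.
  case: (unliftP ord0 i) => [j ->|->].
    rewrite rV_consS; move/rowP : (E) => /(_ (lift ord0 j)); rewrite rV_consS mxE => ->.
    by apply: eq_Rintegral => z _; rewrite /shear rV_consS mxE.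
  rewrite rV_cons0; move/rowP : (E) => /(_ ord0); rewrite rV_cons0 mxE /= => ->.
  rewrite /c -RintegralZl// -RintegralD//; last first.
    by apply: eq_integrable (integrableZl measurableT e (I0 ord0)) => // z _.
  by apply: eq_Rintegral => z _; rewrite /shear rV_cons0 /= /m'; ring.
have H1 := sign 1 _ d1 b1; have H2 := sign (-1) _ d2 b2.
exists c => s st.
have [t0|t0] := eqVneq t 0.
  have -> : s = 1 * t by rewrite t0 mul1r; apply/eqP; rewrite -normr_le0 (le_trans st)// t0 normr0.
  by [].
have a01 : 0 <= (1 + s / t) / 2 <= 1.
  have : `|s / t| <= 1 by rewrite normrM normfV ler_pdivrMr ?mul1r// normr_gt0.
  by rewrite ler_norml => /andP[? ?]; apply/andP; split; lra.
have := @dual_body_convex R n.+1 F p C Phi D PD _ _ _ a01 H1 H2.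
rewrite !rV_consZ rV_consD -scalerDl subrKC scale1r.
by congr (dual_body _ _ _ _ (rV_cons (_, _))); field.
Qed.

(* The heart of the symmetrization argument: if M contains A + h L_Phi then its symmetral contains
   the sum of the symmetrals. *)
Lemma steiner_sum (A M : set 'rV[R]_n.+1) h : measurable A -> measurable M -> 0 <= h ->
  (forall x y, A x -> dual_body F p C Phi y -> M (x + h *: y)) ->
  forall x y, steiner A x -> dual_body F p C (steiner Phi) y -> steiner M (x + h *: y).
Proof.
move=> mA mM h0 AM z1 z2; rewrite (rV_cons_eta z1) (rV_cons_eta z2).
case: (rV_uncons z1) => s x; case: (rV_uncons z2) => t y.
rewrite steiner_cons => As /steiner_dual_body[c cP].
rewrite rV_consZ rV_consD steiner_cons.
have A0 : fiber A x !=set0.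
  apply/set0P; apply/eqP => I0; move: As; rewrite I0 measure0 lte_fin.
  by rewrite ltNge mulr_ge0.
(* Over x + h y the fibre of [M] contains the fibre of [A] over x thickened by the interval h
   [c - |t|, c + |t|], whose length 2 h |t| accounts for the first coordinate h t added to s. *)
apply: lt_le_trans (@leb_thickening R (fiber A x) _ (h * (c - `|t|)) (h * (c + `|t|)) _ _ A0 _ _).
- have : ((2 * `|s|)%:E + (2 * (h * `|t|))%:E < leb (fiber A x) + (2 * (h * `|t|))%:E)%E.
    by rewrite lteD2rE.
  have -> : h * (c + `|t|) - h * (c - `|t|) = 2 * (h * `|t|) by ring.
  apply: le_lt_trans; rewrite -EFinD lee_fin -mulrDr ler_pM2l//.
  by apply: le_trans (ler_normD _ _) _; rewrite normrM ger0_norm.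
- meas.
- meas.
- by apply: ler_wpM2l => //; have := normr_ge0 t; lra.
move=> a r Aa /andP[r1 r2]; rewrite /fiber/=.
have [h00|h00] := eqVneq h 0.
  have -> : r = h * (c + 0) by apply/le_anti; move: r1 r2; rewrite h00 !mul0r => -> ->.
  rewrite -rV_consD -rV_consZ; apply: AM => //; apply: cP; by rewrite normr0.
have hp : 0 < h by rewrite lt_neqAle eq_sym h00.
have -> : r = h * (c + (r / h - c)) by field.
rewrite -rV_consD -rV_consZ; apply: AM => //; apply: cP.
have {}r1 : c - `|t| <= r / h by rewrite ler_pdivlMr// mulrC.
have {}r2 : r / h <= c + `|t| by rewrite ler_pdivrMr// mulrC.
by rewrite ler_norml; apply/andP; split; lra.
Qed.

End steiner_dual.

Section bounded_sets.
Context {R : realType} {n : nat}.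
Local Notation mu := (@lebesgue_rV R n).

Lemma le_lebesgue_rV (A B : set 'rV[R]_n) : measurable A -> measurable B -> A `<=` B ->
  (mu A <= mu B)%E.
Proof. by move=> mA mB AB; apply: le_measure; rewrite ?inE. Qed.

Lemma lebesgue_rVD (A B : set 'rV[R]_n) : measurable A -> measurable B -> (mu A < +oo)%E ->
  mu (A `\` B) = (mu A - mu (A `&` B))%E.
Proof. exact: measureD. Qed.

Lemma lebesgue_measureD (A B : set R) : measurable A -> measurable B ->
  (@lebesgue_measure R A < +oo)%E ->
  @lebesgue_measure R (A `\` B) = (@lebesgue_measure R A - @lebesgue_measure R (A `&` B))%E.
Proof. by move=> mA mB Af; rewrite measureD. Qed.

Lemma lebesgue_rV_fin (A : set 'rV[R]_n) D : measurable A -> A `<=` eball n D ->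
  mu A = (fine (mu A))%:E.
Proof.
move=> mA AD; rewrite fineK// ge0_fin_numE//.
by apply: le_lt_trans (lebesgue_eball_lty n D); apply: le_lebesgue_rV => //; meas.
Qed.

Lemma RintegralS (s : seq 'I_n) (f : 'I_n -> 'rV[R]_n -> R) :
  (forall i, mu.-integrable setT (EFin \o f i)) ->
  \int[mu]_x (\sum_(i <- s) f i x) = \sum_(i <- s) \int[mu]_x f i x.
Proof.
move=> fi; elim: s => [|i s ih].
  by under eq_Rintegral do rewrite big_nil; rewrite big_nil /Rintegral integral0.
under eq_Rintegral do rewrite big_cons.
rewrite big_cons RintegralD//; first by rewrite ih.
have := @integrable_sum _ _ R mu setT measurableT _ s xpredT (fun i x => (f i x)%:E).
move=> /(_ (fun i _ => fi i)); apply: eq_integrable => // x _.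
by rewrite sumEFin.
Qed.

Lemma barycenter_dotp (lam : 'rV[R]_n -> R) (w : 'rV[R]_n) :
  (forall i, mu.-integrable setT (EFin \o (fun x : 'rV[R]_n => x 0 i * lam x))) ->
  \int[mu]_x (dotp x w * lam x) = dotp (barycenter lam) w.
Proof.
move=> li; rewrite /dotp; under eq_Rintegral do rewrite mulr_suml.
have H i : mu.-integrable setT (EFin \o (fun x : 'rV[R]_n => x 0 i * w 0 i * lam x)).
  apply: eq_integrable (integrableZl measurableT (w 0 i) (li i)) => // x _.
  by congr EFin; ring.
rewrite (@RintegralS _ (fun i x => x 0 i * w 0 i * lam x))//.
apply: eq_bigr => i _; rewrite mxE mulrC -RintegralZl//.
by apply: eq_Rintegral => x _; ring.
Qed.

End bounded_sets.

(** * Loss of defect under symmetrization *)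

Section symmetrize.
Context {R : realType} {n : nat}.
Local Notation leb := (@lebesgue_measure R).
Local Notation V := (@lebesgue_rV R n.+1).
Local Notation B := (@eball R n.+1).
Implicit Types (A M Phi : set 'rV[R]_n.+1) (Q : 'M[R]_n.+1) (D r d a rho zeta : R).

Definition mx_image (Q : 'M[R]_n.+1) (A : set 'rV[R]_n.+1) : set 'rV[R]_n.+1 :=
  [set x | A (x *m Q^T)].

Lemma measurable_mx_image Q A : measurable A -> measurable (mx_image Q A).
Proof. exact: measurable_rV_mul. Qed.

Lemma lebesgue_mx_image Q A : Q *m Q^T = 1%:M -> measurable A -> V (mx_image Q A) = V A.
Proof. by move=> oQ mA; apply: lebesgue_rV_orth => //; exact: orth_tr. Qed.

Lemma mx_image_eball Q r : Q *m Q^T = 1%:M -> mx_image Q (B r) = B r.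
Proof.
by move=> oQ; apply/funext => x; rewrite /mx_image /eball/= orth_enorm//; exact: orth_tr.
Qed.

Lemma mx_image_convex Q A : isconvex A -> isconvex (mx_image Q A).
Proof.
move=> cA x y a a01 Ax Ay; rewrite /mx_image/= mulmxDl -!scalemxAl; exact: cA.
Qed.

(* Half of the defect lost by a symmetrization: points y of the ball outside A which are moved
   by z to points of A outside the ball. *)
Definition exchange r A z : set 'rV[R]_n.+1 :=
  [set y | (B r `\` A) y /\ (A `\` B r) (y - z)].

Lemma measurable_exchange r A z : measurable A -> measurable (exchange r A z).
Proof.
by move=> mA; apply: measurableI; [|apply: measurable_rV_addr]; meas.
Qed.

(** Fibre by fibre, let b and a be the fibres of the ball and of [A]. If b is not longer than a, the
    symmetral contains b, and only the exchange part remains, which lies in b \ a. Otherwise the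
    fibre of the symmetral lies in b, and the loss |b \ a| - (|b| - |a|) equals |a \ b|, which
    bounds the exchange fibre because a vertical translation carries the latter into a \ b. *)
Lemma steiner_defect r A zeta : 0 < r -> measurable A ->
  (V (B r `\` steiner A) + V (exchange r A (rV_cons (zeta, 0%R))) <= V (B r `\` A))%E.
Proof.
move=> r0 mA.
have mB := @measurable_eball R n.+1 r.
have mS := measurable_steiner mA.
have mE := @measurable_exchange r A (rV_cons (zeta, 0)) mA.
have m1 : measurable (B r `\` steiner A) by meas.
have m2 : measurable (B r `\` A) by meas.
rewrite !lebesgue_rV_fiber// -ge0_integralD//; last 2 first.
- exact: measurable_fiber_length.
- exact: measurable_fiber_length.
apply: ge0_le_integral_any => x _; first by rewrite adde_ge0.
set b := fiber (B r) x; set a := fiber A x.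
have mb : measurable b by exact: measurable_fiber.
have ma : measurable a by exact: measurable_fiber.
have Exb : fiber (exchange r A (rV_cons (zeta, 0))) x `<=` b `\` a.
  by move=> t [].
have [ba|ab] := leP (leb b) (leb a).
  rewrite (_ : fiber (B r `\` steiner A) x = set0) ?measure0 ?add0e.
    by apply: le_measure; rewrite ?inE//; [exact: measurable_fiber|exact: measurableD].
  rewrite -subset0 => t [tb]; apply; exact: (steiner_mono_eball r0 tb ba).
have bfin : (leb b < +oo)%E.
  apply: (@le_lt_trans _ _ (leb `[- r, r]%classic)).
    apply: le_measure; rewrite ?inE// => t tb.
    rewrite /= in_itv/= -ler_norml.
    have /= <- := rV_cons0 (t, x); exact: le_trans (coord_le_enorm _ _) (ltW tb).
  by rewrite lebesgue_measure_itv/=; case: ifP => _; rewrite// -EFinB ltry.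
set s := fiber (steiner A) x.
have ms : measurable s by exact: measurable_fiber.
have sE : leb s = leb a by exact: fiber_steiner.
have sb : s `<=` b.
  move=> t; rewrite /s /fiber/= steiner_cons => ta.
  have : ((2 * `|t|)%:E < leb b)%E by exact: lt_trans ab.
  have -> : leb b = leb (fiber (steiner (B r)) x) by rewrite fiber_steiner.
  move=> H; apply: (@steiner_eball_sub R n (B r) r) => //.
  by rewrite steiner_cons -fiber_steiner.
have vE : (leb (fiber (exchange r A (rV_cons (zeta, 0%R))) x) <= leb (a `\` b))%E.
  have -> : leb (a `\` b) = leb ((fun t : R => t + - zeta) @^-1` (a `\` b)).
    by rewrite lebesgue_measure_addr//; meas.
  apply: le_measure; rewrite ?inE; first exact: measurable_fiber.
    meas.
  by move=> t [_]; rewrite rV_consN rV_consD oppr0 addr0.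
apply: le_trans (leeD (lexx _) vE) _.
have -> : leb (fiber (B r `\` steiner A) x) = (leb b - leb s)%E.
  by rewrite measureD// (setIidr sb).
rewrite -[leRHS]/(leb (b `\` a)) (lebesgue_measureD mb ma bfin)
  [X in (_ + X <= _)%E](lebesgue_measureD ma mb (lt_trans ab bfin)) sE.
have afin := lt_trans ab bfin.
rewrite [a `&` b]setIC.
have ifin : (leb (b `&` a) < +oo)%E.
  by apply: le_lt_trans afin; apply: le_measure; rewrite ?inE//; meas.
have fin X : (leb X < +oo)%E -> leb X = (fine (leb X))%:E by move=> h; rewrite fineK// ge0_fin_numE.
rewrite (fin _ bfin) (fin _ afin) (fin _ ifin) -!EFinB -!EFinD lee_fin; lra.
Qed.

Lemma exchange0 r A : exchange r A 0 = set0.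
Proof. by rewrite -subset0 => y [[By _] [_]]; rewrite subr0. Qed.

Lemma steiner_defect_le r A : 0 < r -> measurable A -> (V (B r `\` steiner A) <= V (B r `\` A))%E.
Proof.
move=> r0 mA; have := @steiner_defect r A 0 r0 mA.
have -> : rV_cons (0, 0) = 0 :> 'rV[R]_n.+1 by rewrite -[(0, 0)]/((0:R), (0 : 'rV[R]_n)) -(scale0r (rV_cons (0,0))) rV_consZ mul0r scaler0.
by rewrite exchange0 measure0 adde0.
Qed.

Definition in_class D r A := [/\ measurable A, A `<=` B D & V A = V (B r)].

Lemma in_class_steiner D r A : 0 < D -> in_class D r A -> in_class D r (steiner A).
Proof.
move=> D0 [mA AD Ar]; split; first meas.
  exact: steiner_eball_sub.
by rewrite lebesgue_steiner.
Qed.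

Lemma in_class_image D r A Q : Q *m Q^T = 1%:M -> in_class D r A -> in_class D r (mx_image Q A).
Proof.
move=> oQ [mA AD Ar]; split; first exact: measurable_mx_image.
  by rewrite -(mx_image_eball D oQ) => x /AD.
by rewrite lebesgue_mx_image.
Qed.

Lemma in_class_defect D r A : r <= D -> in_class D r A -> V (A `\` B r) = V (B r `\` A).
Proof.
move=> rD [mA AD Ar].
have mB := @measurable_eball R n.+1 r.
have Bfin := lebesgue_eball_lty n.+1 r.
have Afin : (V A < +oo)%E by rewrite Ar.
by rewrite (lebesgue_rVD mA mB Afin) (lebesgue_rVD mB mA Bfin) Ar setIC.
Qed.

Lemma integral_overlap (X Y : set 'rV[R]_n.+1) : measurable X -> measurable Y ->
  mfun (fun z : 'rV[R]_n.+1 => V [set y | X y /\ Y (y - z)]) /\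
  (\int[V]_z V [set y | X y /\ Y (y - z)%R] = V X * V Y)%E.
Proof.
move=> mX mY.
pose S := [set zy : 'rV[R]_n.+1 * 'rV[R]_n.+1 | X zy.2 /\ Y (zy.2 - zy.1)].
have mXY : measurable S.
  apply: measurableI; first by apply: measurable_preim mX; meas.
  apply: (@measurable_preim _ _ _ _ (fun zy : 'rV[R]_n.+1 * 'rV[R]_n.+1 => zy.2 - zy.1)) mY.
  apply: measurable_add_rV; first meas.
  meas.
have mE z : measurable [set y | X y /\ Y (y - z)].
  by apply: measurableI; [|apply: measurable_rV_addr].
pose f (zy : 'rV[R]_n.+1 * 'rV[R]_n.+1) : \bar R := (\1_S zy)%:E.
have E1 z : (\int[V]_y f (z, y))%E = V [set y | X y /\ Y (y - z)].
  by rewrite (measure_indic V (mE z)); apply: eq_integral => y _; apply: indic_iff.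
have E2 y : (\int[V]_z f (z, y) = (\1_X y)%:E * V Y)%E.
  rewrite indicE; have [/set_mem Xy|Xy] := boolP (y \in X); last first.
    rewrite mul0e; apply: integral0_eq => z _; rewrite /f indicE memNset// => -[h _].
    by move/negP : Xy; apply; exact/mem_set.
  rewrite mul1e -(lebesgue_rV_opp mY).
  have mY' : measurable [set x | Y (- x)] by meas.
  rewrite -(lebesgue_rV_addr (- y) mY') measure_indic; last meas.
  apply: eq_integral => z _; apply: indic_iff => /=; rewrite opprB.
  by split => [[]//|].
have mf : mfun f by exact: measurable_indicE.
have f0 z : (0 <= f z)%E by pos.
split.
  have := @measurable_fun_fubini_tonelli_F _ _ _ _ R V f mf f0.
  by apply: eq_measurable_fun => z _; exact: E1.
transitivity (\int[V]_z \int[V]_y f (z, y))%E; first by apply: eq_integral => z _; rewrite E1.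
rewrite (@fubini_tonelli _ _ _ _ R V V f mf f0).
under eq_integral do rewrite E2.
have mi : mfun (fun y => (\1_X y : R)%:E) by meas.
by rewrite (ge0_integralZr V measurableT mi (fun x _ => indic_ge0 X x) (measure_ge0 V Y)) -measure_indic.
Qed.

(** Average over z: the overlaps integrate to V X * V Y >= d^2, and only z of norm below 2 D
    contribute, so some overlap reaches half of the mean value d^2 / V(B(2 D)). The half makes the
    contradiction strict. *)
Lemma overlap_exists D (X Y : set 'rV[R]_n.+1) d : 0 < D -> 0 < d -> measurable X -> measurable Y ->
  X `<=` B D -> Y `<=` B D -> (d%:E <= V X)%E -> V Y = V X ->
  exists z, ((d ^+ 2 / (2 * fine (V (B (2 * D)))))%:E <= V [set y | X y /\ Y (y - z)%R])%E.
Proof.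
move=> D0 d0 mX mY XD YD dX VY.
have mB := @measurable_eball R n.+1 (2 * D).
have [mO iO] := integral_overlap mX mY.
have Xfin := lebesgue_rV_fin mX XD.
have [W [WE W0]] : exists W, V (B (2 * D)) = W%:E /\ 0 < W.
  exists (fine (V (B (2 * D)))); rewrite -lte_fin -lebesgue_measure_fine_eball; split => //.
  by apply: lebesgue_eball_gt0; rewrite mulr_gt0.
have mi : mfun (fun y => (\1_(B (2 * D)) y : R)%:E) by meas.
have [c [c0 cW cE]] : exists c, [/\ 0 < c, c * W = d ^+ 2 / 2 & d ^+ 2 / (2 * W) = c].
  exists (d ^+ 2 / (2 * W)); split => //; first pos.
  by field; rewrite gt_eqF.
rewrite WE cE; apply: contrapT => /forallNP H.
have bound : (\int[V]_z V [set y | X y /\ Y (y - z)%R] <= \int[V]_z (c%:E * (\1_(B (2 * D)) z)%:E))%E.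
  apply: ge0_le_integral_any => z _ //; rewrite indicE; have [zD|zD] := boolP (z \in B (2 * D)).
    by rewrite mule1 leNgt; apply/negP => h; apply: (H z); pos.
  rewrite mule0 (_ : [set y | _] = set0) ?measure0//.
  rewrite -subset0 => y [/XD yX /YD yY]; move/negP : zD; apply; apply/mem_set.
  have : enorm (y - (y - z)) <= enorm y + enorm (y - z) by rewrite -(enormN (y - z)); exact: enorm_triangle.
  move: yX yY; rewrite /eball/= subKr => h1 h2 h3.
  by apply: le_lt_trans h3 _; rewrite mulr_natl; apply: ltrD.
move: bound; rewrite iO (ge0_integralZl V measurableT mi (fun x _ => _ x)) ?lee_fin ?(ltW c0)//.
have -> : (\int[V]_z (\1_(B (2 * D)) z)%:E = W%:E)%E by rewrite -WE (measure_indic V mB).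
rewrite VY Xfin -!EFinM lee_fin cW.
have {dX} : d <= fine (V X) by rewrite -lee_fin -Xfin.
set x := fine (V X) => dx.
have : d ^+ 2 <= x * x by rewrite expr2; apply: ler_pM => //; pos.
have : 0 < d ^+ 2 by pos.
lra.
Qed.

Lemma exchange_exists D r A d : 0 < r <= D -> 0 < d -> in_class D r A -> (d%:E <= V (B r `\` A))%E ->
  exists z, ((d ^+ 2 / (2 * fine (V (B (2 * D)))))%:E <= V (exchange r A z))%E.
Proof.
move=> /andP[r0 rD] d0 cA dA; have [mA AD Ar] := cA.
have mB := @measurable_eball R n.+1 r.
apply: (@overlap_exists D (B r `\` A) (A `\` B r)) => //.
- exact: lt_le_trans rD.
- meas.
- meas.
- by move=> x [xr _]; exact: lt_le_trans rD.
- by move=> x [/AD].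
- exact: in_class_defect cA.
Qed.

Lemma defect_image r A Q : Q *m Q^T = 1%:M -> measurable A ->
  V (B r `\` mx_image Q A) = V (B r `\` A).
Proof.
move=> oQ mA; have mBA : measurable (B r `\` A) by apply: measurableD => //; exact: measurable_eball.
rewrite -(lebesgue_mx_image oQ mBA); congr (V _).
by rewrite -[in LHS](mx_image_eball r oQ).
Qed.

(** A reflection turns the exchange vector z onto the first axis, so that the symmetrization that
    follows acts along z. The gain depends only on [d] and [D], which makes it uniform over all
    steps. *)
Lemma symmetrization_step D r A d : 0 < r <= D -> 0 < d -> in_class D r A ->
  (d%:E <= V (B r `\` A))%E ->
  exists2 Q, Q *m Q^T = 1%:M &
    (V (B r `\` steiner (mx_image Q A)) + (d ^+ 2 / (2 * fine (V (B (2 * D)))))%:E <= V (B r `\` A))%E.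
Proof.
move=> rD d0 cA dA; have [z zP] := exchange_exists rD d0 cA dA.
have r0 : 0 < r by case/andP : rD.
have [mA AD Ar] := cA.
pose e : 'rV[R]_n.+1 := rV_cons (enorm z, 0).
have eE : enorm z = enorm e.
  by rewrite /e enorm_cons dotp0l addr0 sqrtr_sqr ger0_norm// enorm_ge0.
pose Q := householder (z - e).
have oQ : Q *m Q^T = 1%:M by exact: householder_orth.
exists Q => //.
rewrite -[leRHS](defect_image r oQ mA).
apply: le_trans (steiner_defect (enorm z) r0 (measurable_mx_image Q mA)).
apply: leeD; first exact: lexx.
apply: le_trans zP _; rewrite -(lebesgue_mx_image oQ (measurable_exchange r z mA)).
apply: (le_lebesgue_rV (measurable_mx_image Q (measurable_exchange r z mA))
  (measurable_exchange r _ (measurable_mx_image Q mA))).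
move=> y [[By Ay] [Ayz Byz]].
have zE : z = e *m Q^T.
  by rewrite -(householder_swap eE) -mulmxA oQ mulmx1.
rewrite -/e; split; split => //.
- by move: By; rewrite /eball/= orth_enorm//; exact: orth_tr.
- by rewrite /mx_image/= mulmxBl -zE.
- by move=> H; apply: Byz; move: H; rewrite /eball/= zE -mulmxBl orth_enorm//; exact: orth_tr.
Qed.

Variables (F : R -> R) (p C : R).
Hypotheses (F0 : forall t, 0 <= F t) (mF : mfun F).
Variables (h c0 : R).
Hypothesis h0 : 0 <= h.

(** A lower bound for the volume of A + h L, stated for all measurable sets containing the sum
    because the sum itself may fail to be measurable. *)
Definition sum_bound A Phi := forall M, measurable M ->
  (forall x y, A x -> dual_body F p C Phi y -> M (x + h *: y)) -> (c0%:E <= V M)%E.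

Lemma sum_bound_steiner D A Phi : 0 < D -> measurable A -> measurable Phi -> isconvex Phi -> Phi `<=` B D ->
  sum_bound (steiner A) (steiner Phi) -> sum_bound A Phi.
Proof.
move=> D0 mA mPhi cPhi PD sb M mM AM; rewrite -lebesgue_steiner//.
apply: sb; first meas.
exact: (@steiner_sum R n F p C F0 mF Phi D).
Qed.

Lemma dual_body_image D Q Phi y : Q *m Q^T = 1%:M -> measurable Phi -> Phi `<=` B D ->
  dual_body F p C (mx_image Q Phi) y -> dual_body F p C Phi (y *m Q^T).
Proof.
move=> oQ mPhi PD [lam dlam ->].
have QD : mx_image Q Phi `<=` B D by rewrite -(mx_image_eball D oQ) => x /PD.
have [d b] : dual F p C Phi (lam \o (fun x => x *m Q)) /\
    forall i, barycenter (lam \o (fun x => x *m Q)) 0 i = \int[V]_x ((x *m Q^T) 0 i * lam x).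
  apply: (dual_transport F0 mF mPhi (measurable_mx_image Q mPhi) (orth_mpres oQ)) dlam.
  - meas.
  - by move=> x; rewrite -mulmxA oQ mulmx1.
  - by [].
exists (lam \o (fun x => x *m Q)) => //.
have oT := orth_tr oQ.
have li j : integrableV (fun x : 'rV[R]_n.+1 => x 0 j * lam x).
  by apply: (dual_integrable QD dlam); [meas|exact: coord_bounded].
apply/rowP => i; rewrite b -dotp_delta (orth_dotpl _ _ oT) -barycenter_dotp//.
by apply: eq_Rintegral => x _; rewrite -(dotp_delta (x *m Q^T)) (orth_dotpl _ _ oT).
Qed.

Lemma sum_bound_image D Q A Phi : Q *m Q^T = 1%:M -> measurable Phi -> Phi `<=` B D ->
  sum_bound (mx_image Q A) (mx_image Q Phi) -> sum_bound A Phi.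
Proof.
move=> oQ mPhi PD sb M mM AM; rewrite -(lebesgue_mx_image oQ)//.
apply: sb; first exact: measurable_mx_image.
move=> x y Ax Py; rewrite /mx_image/= mulmxDl -scalemxAl; apply: AM => //.
exact: (dual_body_image oQ mPhi PD).
Qed.

(* Repeated symmetrizations decrease the sum of the two defects by a fixed amount, until both are small. *)
Lemma symmetrization_induction D a rho d : 0 < a <= D -> 0 < rho <= D -> 0 < d ->
  (forall A Phi, in_class D a A -> in_class D rho Phi -> isconvex Phi ->
    (V (B a `\` A) < d%:E)%E -> (V (B rho `\` Phi) < d%:E)%E -> sum_bound A Phi) ->
  forall A Phi, in_class D a A -> in_class D rho Phi -> isconvex Phi -> sum_bound A Phi.
Proof.
move=> aD rD d0 base.
have a0 : 0 < a by case/andP : aD.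
have rho0 : 0 < rho by case/andP : rD.
have D0 : 0 < D by case/andP : aD => ?; exact: lt_le_trans.
set k := d ^+ 2 / (2 * fine (V (B (2 * D)))).
have k0 : 0 < k.
  rewrite divr_gt0// mulr_gt0// -lte_fin -lebesgue_measure_fine_eball.
  by apply: lebesgue_eball_gt0; rewrite mulr_gt0.
have main N A Phi : in_class D a A -> in_class D rho Phi -> isconvex Phi ->
    (V (B a `\` A) + V (B rho `\` Phi) <= (k * N%:R)%:E)%E -> sum_bound A Phi.
  elim: N A Phi => [|N ih] A Phi cA cP vP.
    rewrite mulr0 => H; apply: base => //.
      by apply: le_lt_trans (le_trans _ H) _ => //; exact: leeDl.
    by apply: le_lt_trans (le_trans _ H) _ => //; exact: leeDr.
  move=> H; have [mA AD _] := cA; have [mP PD _] := cP.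
  have next Q : Q *m Q^T = 1%:M ->
     (V (B a `\` steiner (mx_image Q A)) + V (B rho `\` steiner (mx_image Q Phi)) + k%:E <=
      V (B a `\` A) + V (B rho `\` Phi))%E -> sum_bound A Phi.
    move=> oQ H'.
    have cA' := in_class_image oQ cA; have cP' := in_class_image oQ cP.
    have vP' := @mx_image_convex Q Phi vP.
    apply: (@sum_bound_image D Q) => //.
    have [mA' AD' _] := cA'; have [mP' PD' _] := cP'.
    apply: (@sum_bound_steiner D) => //.
    apply: ih => //; [exact: in_class_steiner|exact: in_class_steiner|exact: (steiner_convex mP' vP' PD')|].
    rewrite -(@leeD2rE _ k%:E)//; apply: le_trans H' _; apply: le_trans H _.
    by rewrite -EFinD -natr1 mulrDr mulr1.
  (* Whichever defect is still at least [d] selects the direction; symmetrizing both sets in it does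
     not increase the other defect. *)
  have [dA|dA] := ltP (V (B a `\` A)) d%:E; last first.
    have [Q oQ H'] := symmetrization_step aD d0 cA dA.
    apply: (next Q) => //; rewrite -addeA [X in (_ + X)%E]addeC addeA; apply: leeD => //.
    rewrite -[leRHS](defect_image rho oQ mP); apply: steiner_defect_le => //.
    exact: measurable_mx_image.
  have [dP|dP] := ltP (V (B rho `\` Phi)) d%:E; last first.
    have [Q oQ H'] := symmetrization_step rD d0 cP dP.
    apply: (next Q) => //; rewrite -addeA; apply: leeD => //.
    rewrite -[leRHS](defect_image a oQ mA); apply: steiner_defect_le => //.
    exact: measurable_mx_image.
  exact: base.
move=> A Phi cA cP vP.
have [mA AD _] := cA; have [mP PD _] := cP.
have fA : V (B a `\` A) = (fine (V (B a `\` A)))%:E.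
  by apply: (@lebesgue_rV_fin R n.+1 _ a) => [|x []//]; apply: measurableD => //; exact: measurable_eball.
have fP : V (B rho `\` Phi) = (fine (V (B rho `\` Phi)))%:E.
  by apply: (@lebesgue_rV_fin R n.+1 _ rho) => [|x []//]; apply: measurableD => //; exact: measurable_eball.
set s := fine (V (B a `\` A)) in fA; set t := fine (V (B rho `\` Phi)) in fP.
apply: (main (Num.trunc ((s + t) / k)).+1) => //.
rewrite fA fP -EFinD lee_fin mulrC -ler_pdivrMr//; apply: ltW; exact: truncnS_gt.
Qed.

End symmetrize.

#[global] Hint Resolve measurable_mx_image measurable_exchange : meas.

Section net.
Context {R : realType} {n : nat}.
Implicit Types (x y : 'rV[R]_n) (r : R).

Lemma norm_le_enorm x : `|x| <= enorm x.
Proof.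
rewrite -[`|x|]/(mx_norm x) mx_normrE; apply/bigmax_leP; split; first pos.
by move=> [i j] _; rewrite ord1; exact: coord_le_enorm.
Qed.

Lemma enorm_le_norm x : enorm x <= n%:R * `|x|.
Proof.
apply: enorm_le_coord => // i.
by rewrite -[`|x|]/(mx_norm x) mx_normrE; apply/bigmax_geP; right; exists (0, i).
Qed.

Lemma closed_eball_compact r : compact [set x : 'rV[R]_n | enorm x <= r].
Proof.
apply: bounded_closed_compact.
  exists r; split; first exact: num_real.
  move=> M rM x xr; apply: le_trans (norm_le_enorm x) _.
  exact: le_trans xr (ltW rM).
rewrite (_ : [set x | _] = enorm @^-1` [set t | t <= r])//.
apply: preimage_closed; [by move=> x _; exact: enorm_continuous|exact: closed_le].
Qed.

Lemma eball_open y r : open [set x : 'rV[R]_n | enorm (x - y) < r].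
Proof.
apply: (@open_comp _ _ (fun x : 'rV[R]_n => enorm (x - y)) [set t | t < r]).
  move=> x _; apply: continuous_comp; last exact: enorm_continuous.
  by apply: (@cvgB _ _ _ (nbhs x) _ id (fun=> y)); [exact: cvg_id|exact: cvg_cst].
by [].
Qed.

Lemma finite_net r e : 0 < e -> exists2 s : seq 'rV[R]_n, (forall y, y \in s -> enorm y <= r) &
  forall x, enorm x <= r -> exists2 y, y \in s & enorm (x - y) < e.
Proof.
move=> e0; have := @closed_eball_compact r; rewrite compact_cover => cc.
have [] := cc _ [set x : 'rV[R]_n | enorm x <= r] (fun y => [set x | enorm (x - y) < e]).
- by move=> y _; exact: eball_open.
- by move=> x xr; exists x => //=; rewrite subrr enorm0.
move=> s sr xs; exists (finmap.enum_fset s) => [y ys|x /xs[y ys xy]].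
  by have /set_mem := sr y ys.
by exists y.
Qed.

End net.

(** * The volume bound for nearly round sets and for general ones *)

Section symmetrization_limit.
Context {R : realType} {n : nat}.
Local Notation V := (@lebesgue_rV R n.+1).
Local Notation B := (@eball R n.+1).
Implicit Types (A M Phi : set 'rV[R]_n.+1) (e u w y : 'rV[R]_n.+1) (a h D d r : R).
Variables (F G : R -> R) (p s rho : R).
Hypotheses (F0 : forall t, 0 <= F t) (F00 : F 0 = 0)
  (mF : mfun F) (mG : mfun G)
  (Gb : forall M : R, exists N : R, forall t, `|t| <= M -> `|G t| <= N)
  (Ftan : forall t a, F a + p * G a * (t - a) <= F t) (FG : forall a, a * G a = F a)
  (p1 : 1 <= p) (s0 : 0 < s) (rho0 : 0 < rho).

Lemma F_locally_bounded (M : R) : exists N : R, forall t, `|t| <= M -> `|F t| <= N.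
Proof.
have [N HN] := Gb M; exists (`|M| * N) => t tM; rewrite -FG normrM.
by apply: ler_pM => //; [exact: le_trans tM (ler_norm _)|exact: HN].
Qed.

(* K = int_(rho B) F(s u.e) du, independently of the unit vector e. *)
Definition ball_energy : R := \int[V]_u (F (s * dotp u (delta_mx 0 ord0)) * \1_(B rho) u).

(** [p * G] stands for the derivative of [F]; this density gives equality in the duality inequality
    at g = s (u.e). *)
Definition extremal e u : R := G (s * dotp u e) * \1_(B rho) u.

Lemma indic_eball_mul (Q : 'M[R]_n.+1) u : Q *m Q^T = 1%:M -> \1_(B rho) (u *m Q) = \1_(B rho) u :> R.
Proof.
move=> oQ; have := @indic_iff R _ _ (B rho) (B rho) (u *m Q) u.
by rewrite /eball/= orth_enorm// => /(_ (iff_refl _)) [].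
Qed.

Lemma bounded_on_eball (H : R -> R) e : (forall M : R, exists N : R, forall t, `|t| <= M -> `|H t| <= N) ->
  exists N : R, forall u, `|H (s * dotp u e) * \1_(B rho) u| <= N.
Proof.
move=> Hb; have [N HN] := Hb (s * (rho * enorm e)); exists `|N| => u.
rewrite normrM indicE; have [/set_mem uB|_] := boolP (u \in B rho); last by rewrite normr0 mulr0.
rewrite normr1 mulr1; apply: le_trans (HN _ _) (ler_norm _).
rewrite normrM gtr0_norm// ler_pM2l//; apply: le_trans (abs_dotp_le _ _) _.
by apply: ler_wpM2r; pos.
Qed.

Lemma measurable_on_eball (H : R -> R) e : mfun H ->
  mfun (fun u => H (s * dotp u e) * \1_(B rho) u).
Proof.
move=> mH; apply: measurable_funM; last by apply: measurable_indic; exact: measurable_eball.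
meas.
Qed.

Lemma integrable_on_eball (H : 'rV[R]_n.+1 -> R) : mfun H ->
  (exists N : R, forall u, `|H u * \1_(B rho) u| <= N) ->
  integrableV (fun u => H u * \1_(B rho) u).
Proof.
move=> mH [N HN]; apply: (@integrable_bounded_support R n.+1 _ rho N) => //.
  by apply: measurable_funM => //; apply: measurable_indic; exact: measurable_eball.
by move=> u uB; rewrite indicE memNset ?mulr0.
Qed.

Lemma ball_energy_unit e : enorm e = 1 -> \int[V]_u (F (s * dotp u e) * \1_(B rho) u) = ball_energy.
Proof.
move=> e1; pose d : 'rV[R]_n.+1 := delta_mx 0 ord0.
have ed : enorm e = enorm d by rewrite e1 enorm_delta.
pose Q := householder (e - d); have oQ : Q *m Q^T = 1%:M by exact: householder_orth.
have Qe : e *m Q = d by exact: householder_swap.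
rewrite -(Rintegral_mpres (orth_mpres (orth_tr oQ))); last exact: measurable_on_eball.
apply: eq_Rintegral => u _; rewrite indic_eball_mul; last exact: orth_tr.
by rewrite (orth_dotpl _ _ (orth_tr oQ)) trmxK Qe.
Qed.

(** Integrate the tangent inequality at a = s (u.e). Since a G(a) = F(a), it reads p g G(a) <= F(g)
    + (p - 1) F(a), whence the constant (p - 1) [ball_energy]. *)
Lemma extremal_dual e : enorm e = 1 -> dual F p ((p - 1) * ball_energy) (B rho) (extremal e).
Proof.
move=> e1; split.
- exact: measurable_on_eball.
- exact: bounded_on_eball.
- by move=> x xB; rewrite /extremal indicE memNset ?mulr0.
move=> g mg [M gM].
have I1 : integrableV (fun u => F (g u) * \1_(B rho) u).
  apply: integrable_on_eball; first meas.
  have [N HN] := F_locally_bounded M; exists `|N| => u.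
  rewrite normrM indicE; case: (_ \in _); last by rewrite normr0 mulr0.
  by rewrite normr1 mulr1; apply: le_trans (HN _ (gM _)) (ler_norm _).
have I2 : integrableV (fun u => F (s * dotp u e) * \1_(B rho) u).
  apply: integrable_on_eball; first meas.
  exact: (bounded_on_eball _ F_locally_bounded).
have I3 : integrableV (fun u => (g u * G (s * dotp u e)) * \1_(B rho) u).
  apply: integrable_on_eball; first meas.
  have [N HN] := bounded_on_eball e Gb; exists (M * N) => u.
  by rewrite -mulrA normrM; apply: ler_pM.
have -> : (\int[V]_(x in B rho) (F (g x))%:E = (\int[V]_u (F (g u) * \1_(B rho) u))%:E)%E.
  rewrite integral_in_indic /Rintegral fineK.
    by [].
  exact: (integrable_fin_num measurableT I1).
have -> : \int[V]_x (g x * extremal e x) = \int[V]_u ((g u * G (s * dotp u e)) * \1_(B rho) u).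
  by apply: eq_Rintegral => x _; rewrite /extremal mulrA.
rewrite -(ball_energy_unit e1) -EFinD -!RintegralZl// -RintegralD//; last first.
  by apply: eq_integrable (integrableZl measurableT (p - 1) I2).
apply: le_Rintegral => //.
- by apply: eq_integrable (integrableZl measurableT p I3).
- apply: eq_integrable (integrableD measurableT I1 (integrableZl measurableT (p - 1) I2)) => //.
move=> u _; set i := \1_(B rho) u : R.
have := Ftan (g u) (s * dotp u e); set a := s * dotp u e.
have := FG a; set x := F a; set y := G a; set z := F (g u); set w := g u => E T.
have : i * (p * (w * y)) <= i * (z + (p - 1) * x).
  by apply: ler_wpM2l => //; move: T; rewrite mulrBr -[p * y * a]mulrA [y * a]mulrC E; lra.
by rewrite [i * _]mulrC [i * _]mulrC mulrDl !mulrA.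
Qed.

(** A reflection in a hyperplane containing e fixes the density, so the barycenter is orthogonal to
    every w orthogonal to e and is a multiple of e; pairing with e and a G(a) = F(a) give the
    factor. *)
Lemma extremal_barycenter e : enorm e = 1 -> barycenter (extremal e) = (ball_energy / s) *: e.
Proof.
move=> e1; set b := barycenter _.
have ed := extremal_dual e1.
have li j : integrableV (fun x : 'rV[R]_n.+1 => x 0 j * extremal e x).
  by apply: (dual_integrable (@subset_refl _ (B rho)) ed); [meas|exact: coord_bounded].
have orth w : dotp w e = 0 -> dotp b w = 0.
  move=> we; rewrite -barycenter_dotp//.
  pose Q := householder w; have oQ : Q *m Q^T = 1%:M by exact: householder_orth.
  have Qs : Q^T = Q by exact: householder_sym.
  suff : \int[V]_x (dotp x w * extremal e x) = - \int[V]_x (dotp x w * extremal e x) by lra.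
  rewrite -{1}(Rintegral_mpres (orth_mpres oQ)); last first.
    by apply: measurable_funM; [meas|exact: measurable_on_eball].
  rewrite -[RHS]mulN1r -RintegralZl//; last first.
    have [N HN] := bounded_on_eball e Gb.
    have I : integrableV (fun u => (dotp u w * G (s * dotp u e)) * \1_(B rho) u).
      apply: integrable_on_eball.
        meas.
      exists (rho * enorm w * N) => u; rewrite -mulrA normrM.
      have [uB|uB] := pselect (B rho u).
        apply: ler_pM => //; apply: le_trans (abs_dotp_le _ _) _.
        by apply: ler_wpM2r; pos.
      rewrite indicE memNset// mulr0 normr0 mulr0 mulr_ge0//; last exact: le_trans (HN u).
      pos.
    by apply: eq_integrable I => // u _ /=; rewrite /extremal mulrA.
  apply: eq_Rintegral => x _; rewrite /extremal indic_eball_mul// !(orth_dotpl _ _ oQ) Qs.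
  rewrite (householder_fix (_ : dotp e w = 0)); last by rewrite dotpC.
  have -> : w *m Q = - w.
    rewrite /Q householderE; have [->|w0] := eqVneq w 0; first by rewrite scaler0 subr0 oppr0.
    have ww : dotp w w != 0 by apply: contra w0 => /eqP /dotp_eq0 ->.
    by rewrite mulfK// scaler_nat opprD addrA subrr add0r.
  by rewrite dotpNr; ring.
have be : dotp b e = ball_energy / s.
  rewrite -barycenter_dotp// mulrC -(ball_energy_unit e1) -RintegralZl//; last first.
    apply: integrable_on_eball; first meas.
    exact: (bounded_on_eball _ F_locally_bounded).
  apply: eq_Rintegral => u _; rewrite /extremal -FG; field; exact: lt0r_neq0.
have ee : dotp e e = 1 by rewrite -enorm_sqr e1 expr1n.
apply/eqP; rewrite -subr_eq0 -be; apply/eqP; apply: dotp_eq0.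
set w := b - _; have we : dotp w e = 0 by rewrite /w dotpBl dotpZl ee mulr1 subrr.
by rewrite {1}/w dotpBl dotpZl (dotpC e) we mulr0 subr0 orth.
Qed.

Lemma ball_energy_ge0 : 0 <= ball_energy.
Proof. by apply: Rintegral_ge0 => u _; rewrite mulr_ge0. Qed.

(** The barycenters of the extremal densities fill the sphere of radius [ball_energy / s]; the
    barycenter 0 of the zero density and convexity give the ball. *)
Lemma ball_dual_body y : enorm y <= ball_energy / s ->
  dual_body F p ((p - 1) * ball_energy) (B rho) y.
Proof.
move=> yb; have C0 : 0 <= (p - 1) * ball_energy by rewrite mulr_ge0 ?ball_energy_ge0// subr_ge0.
have z0 : dual_body F p ((p - 1) * ball_energy) (B rho) 0.
  by exists (fun=> 0); [exact: dual0|rewrite barycenter0].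
have [->//|y0] := eqVneq y 0.
have yp : 0 < enorm y by rewrite enorm_gt0.
have bp : 0 < ball_energy / s by exact: lt_le_trans yb.
pose e := (enorm y)^-1 *: y.
have e1 : enorm e = 1 by rewrite enormZ gtr0_norm ?invr_gt0// mulVf// gt_eqF.
have He : dual_body F p ((p - 1) * ball_energy) (B rho) ((ball_energy / s) *: e).
  by exists (extremal e); [exact: extremal_dual|rewrite extremal_barycenter].
have a01 : 0 <= enorm y / (ball_energy / s) <= 1.
  by rewrite divr_ge0 ?(ltW yp) ?(ltW bp)//= ler_pdivrMr// mul1r.
have := dual_body_convex (fun x H => H : B rho x) a01 He z0.
rewrite scaler0 addr0 !scalerA; congr (dual_body _ _ _ _ _).
by rewrite divfK ?gt_eqF// divff ?gt_eqF// scale1r.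
Qed.

Lemma lebesgue_eball_scale r : 0 < r -> V (B r) = ((r ^+ n.+1)%:E * V (B 1))%E.
Proof.
move=> r0; have r1 : r^-1 != 0 by rewrite invr_neq0// gt_eqF.
have := lebesgue_rV_scale r1 (@measurable_eball R n.+1 1).
rewrite gtr0_norm ?invr_gt0// invrK => <-; congr (V _).
apply/funext => x; rewrite /eball/= enormZ gtr0_norm ?invr_gt0//.
by rewrite mulrC ltr_pdivrMr// mul1r.
Qed.

Lemma union_bound (E : 'rV[R]_n.+1 -> set 'rV[R]_n.+1) (ys : seq 'rV[R]_n.+1) d :
  (forall y, measurable (E y)) -> (forall y, (V (E y) <= d%:E)%E) ->
  measurable [set x | exists2 y, y \in ys & E y x] /\
  (V [set x | exists2 y, y \in ys & E y x] <= ((size ys)%:R * d)%:E)%E.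
Proof.
move=> mE Ed; elim: ys => [|y ys [ih1 ih2]].
  rewrite (_ : [set x | _] = set0); first by rewrite measure0 mul0r.
  by rewrite -subset0 => x [].
rewrite (_ : [set x | _] = E y `|` [set x | exists2 y, y \in ys & E y x]); last first.
  apply/seteqP; split => x.
    by move=> [z]; rewrite inE => /orP[/eqP ->|zy] Ez; [left|right; exists z].
  by move=> [Ey|[z zy Ez]]; [exists y; rewrite ?inE ?eqxx|exists z; rewrite ?inE ?zy ?orbT].
split; first meas.
apply: le_trans (measureU2 V (mE y) ih1) _.
by rewrite /= -natr1 mulrDl mul1r addrC EFinD; apply: leeD.
Qed.

(** Test with g cut off outside Phi; as F(0) = 0, the integral over the ball does not see the
    rest. *)
Lemma dual_restrict C Phi lam : measurable Phi -> dual F p C (B rho) lam ->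
  dual F p C Phi (fun u => lam u * \1_Phi u).
Proof.
move=> mPhi [ml [N lN] l0 ld]; split.
- meas.
- exists N => u; rewrite normrM indicE; case: (_ \in _); rewrite ?normr1 ?mulr1// normr0 mulr0.
  exact: le_trans (lN u).
- by move=> u uP; rewrite indicE memNset ?mulr0.
move=> g mg [M gM].
have mgP : mfun (fun u => g u * \1_Phi u) by meas.
have := ld _ mgP; have -> : \int[V]_x (g x * \1_Phi x * lam x) = \int[V]_x (g x * (lam x * \1_Phi x)).
  by apply: eq_Rintegral => x _; ring.
have H : exists M : R, forall x, `|g x * \1_Phi x| <= M.
  exists M => u; rewrite normrM indicE; case: (_ \in _); rewrite ?normr1 ?mulr1// normr0 mulr0.
  exact: le_trans (gM u).
move=> /(_ H); move/le_trans; apply; apply: leeD => //.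
rewrite (integral_in_indic V (B rho)) (integral_in_indic V Phi).
have mB := @measurable_eball R n.+1 rho.
apply: ge0_le_integral_any => x _; first by rewrite mule_ge0 ?lee_fin.
rewrite -!EFinM lee_fin !indicE.
case: (x \in Phi); last by rewrite !mulr0 F00.
by rewrite !mulr1; case: (x \in B rho); rewrite ?mulr1// mulr0.
Qed.

Lemma barycenter_restrict C Phi lam (N : R) d : measurable Phi -> dual F p C (B rho) lam ->
  (forall u, `|lam u| <= N) -> (V (B rho `\` Phi) <= d%:E)%E ->
  enorm (barycenter lam - barycenter (fun u => lam u * \1_Phi u)) <= n.+1%:R * (rho * N * d).
Proof.
move=> mPhi dl lN Vd.
have mB := @measurable_eball R n.+1 rho.
have mBP : measurable (B rho `\` Phi) by meas.
have N0 : 0 <= N by exact: le_trans (lN 0).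
have d0 : 0 <= d by rewrite -lee_fin; exact: le_trans Vd.
have [ml _ l0 _] := dl.
have rN : 0 <= rho * N by pos.
apply: enorm_le_coord => [|i]; first pos.
have I1 : integrableV (fun x : 'rV[R]_n.+1 => x 0 i * lam x).
  by apply: (dual_integrable (@subset_refl _ (B rho)) dl); [meas|exact: coord_bounded].
have I2 : integrableV (fun x : 'rV[R]_n.+1 => x 0 i * (lam x * \1_Phi x)).
  apply: (@integrable_bounded_support R n.+1 _ rho (rho * N)).
  - meas.
  - by move=> x xB; rewrite l0// mul0r mulr0.
  - move=> x; have [xB|xB] := pselect (B rho x); last by rewrite l0// mul0r mulr0 normr0.
    rewrite normrM; apply: ler_pM => //.
      exact: le_trans (coord_le_enorm _ _) (ltW xB).
    rewrite normrM indicE; case: (_ \in _); rewrite ?normr1 ?mulr1// normr0 mulr0.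
    by [].
rewrite !mxE -RintegralB//.
have I3 := integrableB measurableT I1 I2.
apply: le_trans (le_normr_Rintegral measurableT _) _.
  by [].
rewrite -lee_fin /Rintegral.
have bound : (\int[V]_x (`|x 0 i * lam x - x 0 i * (lam x * \1_Phi x)|)%:E <=
    \int[V]_x ((rho * N)%:E * (\1_(B rho `\` Phi) x)%:E))%E.
  apply: ge0_le_integral_any => x _ //; rewrite -EFinM lee_fin.
  have [xB|xB] := pselect (B rho x); last first.
    by rewrite l0// mul0r subrr normr0 mulr_ge0//.
  rewrite !indicE; have [xP|xP] := pselect (Phi x).
    by rewrite (mem_set xP) mulr1 subrr normr0 mulr_ge0.
  rewrite (memNset xP) mulr0 mulr0 subr0 mem_set// mulr1 normrM.
  by apply: ler_pM => //; exact: le_trans (coord_le_enorm _ _) (ltW xB).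
move: bound; rewrite ge0_integralZl//; last meas.
rewrite -(measure_indic V mBP) => bound.
have fin : ((rho * N)%:E * V (B rho `\` Phi) <= (rho * N * d)%:E)%E.
  by rewrite [leRHS]EFinM; apply: lee_wpmul2l.
rewrite fineK; first exact: le_trans bound fin.
rewrite ge0_fin_numE; last pos.
by apply: le_lt_trans bound _; apply: le_lt_trans fin _; rewrite ltry.
Qed.

Lemma uniform_bound (ys : seq 'rV[R]_n.+1) (P : 'rV[R]_n.+1 -> R -> Prop) :
  (forall y, y \in ys -> exists N, P y N) -> (forall y N N', P y N -> N <= N' -> P y N') ->
  exists2 N, 0 <= N & forall y, y \in ys -> P y N.
Proof.
move=> PN mono; elim: ys PN => [|y ys ih] PN; first by exists 0.
have [N N0 HN] := ih (fun z zys => PN z (mem_behead (s := y :: ys) zys)).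
have [N' HN'] := PN y (mem_head _ _).
exists (Num.max N N'); first by rewrite le_max N0.
move=> z; rewrite inE => /orP[/eqP ->|zys].
  by apply: mono HN' _; rewrite le_max lexx orbT.
by apply: mono (HN z zys) _; rewrite le_max lexx.
Qed.

(** If [A] and Phi were the balls, every point of norm below a + h b, with b = [ball_energy / s],
    would be a sum. A finite net of the ball of radius h b is fixed first. Restricting the density
    of a net point y to Phi moves it to a nearby y', and x - y' can fail to be in [A] only on a set
    of volume at most d for each y. Hence [M] covers a slightly smaller ball up to d times the size
    of the net. *)
Lemma sum_bound_near a h c0 : 0 < a -> 0 <= h -> (c0%:E < V (B (a + h * (ball_energy / s))))%E ->
  exists2 d, 0 < d & forall A Phi, measurable A -> measurable Phi ->
    (V (B a `\` A) < d%:E)%E -> (V (B rho `\` Phi) < d%:E)%E ->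
    sum_bound F p ((p - 1) * ball_energy) h c0 A Phi.
Proof.
move=> a0 h0; set b := ball_energy / s; set C := (p - 1) * ball_energy.
have b0 : 0 <= b by rewrite divr_ge0 ?ball_energy_ge0// ltW.
set L := a + h * b; have L0 : 0 < L by rewrite ltr_wpDr// mulr_ge0.
have [om om0 omE] : exists2 om, 0 < om & V (B 1) = om%:E.
  exists (fine (V (B 1))); last by rewrite -lebesgue_measure_fine_eball.
  by rewrite -lte_fin -lebesgue_measure_fine_eball; exact: lebesgue_eball_gt0.
rewrite lebesgue_eball_scale// omE -EFinM => cL.
have [T [T0 TL cT]] : exists T, [/\ 0 < T, T < L & c0 < T ^+ n.+1 * om].
  have ct : {for L, continuous (fun t : R => t ^+ n.+1 * om)}.
    apply: cvgM; [exact: exprn_continuous|exact: cvg_cst].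
  have : \forall t \near L, c0 < t ^+ n.+1 * om by apply: cvgr_gt ct _ cL.
  move=> /nbhs_ballP[e e0 eP].
  exists (L - Num.min (e / 2) (L / 2)).
  have m1 : Num.min (e / 2) (L / 2) <= e / 2 by rewrite ge_min lexx.
  have m2 : Num.min (e / 2) (L / 2) <= L / 2 by rewrite ge_min lexx orbT.
  have m0 : 0 < Num.min (e / 2) (L / 2) by rewrite lt_min !divr_gt0.
  split; [lra|lra|apply: eP].
  by rewrite /ball/= opprB addrCA subrr addr0 gtr0_norm//; lra.
(* For |x| < T the point x is the sum of (a / L) x, of norm at most a T / L = a - 4 k, and of a
   vector in the ball of radius h b; the net and the restriction to Phi cost at most k each. *)
set k := a * (1 - T / L) / 4.
have TL1 : T / L < 1 by rewrite ltr_pdivrMr// mul1r.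
have k0 : 0 < k by rewrite divr_gt0// mulr_gt0// subr_gt0.
have [ys ysb ysn] := @finite_net R n.+1 (h * b) k k0.
have lamP y : exists lam, y \in ys -> dual F p C (B rho) lam /\ y = h *: barycenter lam :> 'rV[R]_n.+1.
  have [yy|yy] := boolP (y \in ys); last by exists (fun=> 0).
  have C0 : 0 <= C by rewrite mulr_ge0 ?ball_energy_ge0// subr_ge0.
  have [h00|h00] := eqVneq h 0.
    exists (fun=> 0) => _; split; first exact: dual0.
    have := ysb y yy; rewrite h00 mul0r scale0r => y0; apply/eqP.
    by rewrite -enorm_eq0 eq_le y0 enorm_ge0.
  have hp : 0 < h by rewrite lt_neqAle eq_sym h00.
  have [lam dl yE] : dual_body F p C (B rho) (h^-1 *: y).
    apply: ball_dual_body; rewrite enormZ gtr0_norm ?invr_gt0// mulrC ler_pdivrMr// mulrC.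
    exact: ysb.
  by exists lam => _; split => //; rewrite -yE scalerA divff// scale1r.
have {lamP}[lam lamP] := choice lamP.
have [N N0 HN] := @uniform_bound ys (fun y N => forall u, `|lam y u| <= N)
  (fun y yys => let: And4 _ H _ _ := (lamP y yys).1 in H)
  (fun y N N' H NN' u => le_trans (H u) NN').
set gap := T ^+ n.+1 * om - c0.
have gap0 : 0 < gap by rewrite subr_gt0.
pose w := h * (n.+1%:R * (rho * N)) + 1.
have w0 : 0 < w by rewrite ltr_wpDl// !mulr_ge0// ltW.
have sz0 : 0 < (size ys).+1%:R :> R by [].
(* The first bound keeps y' within k of y; the second keeps the total volume missed by [A] within
   the gap between T^(n+1) om and c0. *)
exists (Num.min (k / w) (gap / (size ys).+1%:R)).
  by rewrite lt_min (divr_gt0 k0 w0) (divr_gt0 gap0 sz0).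
set d := Num.min _ _.
have d1 : d <= k / w by rewrite ge_min lexx.
have d2 : d <= gap / (size ys).+1%:R by rewrite ge_min lexx orbT.
have d0 : 0 < d by rewrite lt_min (divr_gt0 k0 w0) (divr_gt0 gap0 sz0).
move=> A Phi mA mPhi dA dP M mM AM.
pose y' y := h *: barycenter (fun u => lam y u * \1_Phi u).
have yy' y : y \in ys -> enorm (y - y' y) <= k.
  move=> yys; have [dl yE] := lamP y yys.
  rewrite {1}yE /y' -scalerBr enormZ ger0_norm//.
  have H := barycenter_restrict mPhi dl (HN y yys) (ltW dP).
  apply: le_trans (ler_wpM2l h0 H) _.
  apply: (@le_trans _ _ (w * d)); last by rewrite mulrC -ler_pdivlMr.
  rewrite /w mulrDl mul1r !mulrA lerDl; pos.
have mB r : measurable (B r) by meas.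
have mBA : measurable (B a `\` A) by meas.
have [mU VU] := @union_bound (fun y => [set x | (B a `\` A) (x - y' y)]) ys d
  (fun y => measurable_rV_addr _ mBA)
  (fun y => eq_ind_r (fun z => (z <= d%:E)%E) (ltW dA) (lebesgue_rV_addr (- y' y) mBA)).
have cover : B T `<=` M `|` [set x | exists2 y, y \in ys & (B a `\` A) (x - y' y)].
  move=> x xT.
  pose x2 := (h * b / L) *: x.
  have x2b : enorm x2 <= h * b.
    rewrite enormZ ger0_norm; last by apply: divr_ge0; pos.
    rewrite mulrAC -[leRHS]mulr1 -mulrA; apply: ler_wpM2l; first pos.
    by rewrite ler_pdivrMr// mul1r; apply: ltW; exact: lt_trans TL.
  have [y yys xy] := ysn x2 x2b.
  have xyB : B a (x - y' y).
    have -> : x - y' y = (x - x2) + (x2 - y) + (y - y' y) by rewrite !subrKA.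
    apply: le_lt_trans (enorm_triangle _ _) _.
    apply: le_lt_trans (lerD (enorm_triangle _ _) (yy' y yys)) _.
    have -> : x - x2 = (a / L) *: x.
      rewrite /x2 -[in LHS](scale1r x) scalerA mulr1 -scalerBl; congr (_ *: _).
      by rewrite -(divff (lt0r_neq0 L0)) -mulrBl /L addrK.
    rewrite enormZ gtr0_norm ?divr_gt0//.
    have : a / L * enorm x <= a / L * T by apply: ler_wpM2l; pos.
    have -> : a / L * T = a - 4 * k by rewrite /k; field; exact: lt0r_neq0.
    by move=> H; move: xy k0; lra.
  have [Ay|nAy] := pselect (A (x - y' y)); last by right; exists y.
  left; rewrite -(subrK (y' y) x); apply: AM => //.
  exists (fun u => lam y u * \1_Phi u) => //.
  by apply: dual_restrict => //; exact: (lamP y yys).1.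
have : (V (B T) <= V M + ((size ys)%:R * d)%:E)%E.
  apply: le_trans (le_lebesgue_rV (mB T) (measurableU _ _ mM mU) cover) _.
  by apply: le_trans (measureU2 V mM mU) _; apply: leeD.
rewrite lebesgue_eball_scale// omE -EFinM -leeBlDr// -EFinB; apply: le_trans.
rewrite lee_fin lerBrDr -lerBrDl -/gap.
apply: (@le_trans _ _ ((size ys).+1%:R * d)); first by apply: ler_wpM2r; rewrite ?ler_nat// ltW.
by rewrite mulrC -ler_pdivlMr.
Qed.

(** By contradiction, take the value halfway between the two volumes: it lies below the volume of
    the ball, so it is a lower bound for nearly round pairs, and the induction carries it back to
    [A] and Phi, where it exceeds V M. *)
Lemma symmetrization_bound a h D A Phi M : 0 < a <= D -> 0 < rho <= D -> 0 <= h ->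
  in_class D a A -> in_class D rho Phi -> isconvex Phi -> measurable M ->
  (forall x y, A x -> dual_body F p ((p - 1) * ball_energy) Phi y -> M (x + h *: y)) ->
  (V (B (a + h * (ball_energy / s))) <= V M)%E.
Proof.
move=> aD rD h0 cA cP vP mM AM; rewrite leNgt; apply/negP => H.
have [v vE] : exists v, V (B (a + h * (ball_energy / s))) = v%:E.
  by eexists; exact: lebesgue_measure_fine_eball.
have [r rE] : exists r, V M = r%:E.
  exists (fine (V M)); rewrite fineK// ge0_fin_numE//; apply: lt_trans H _.
  by rewrite vE ltry.
have vr : (((r + v) / 2)%:E < V (B (a + h * (ball_energy / s))))%E.
  by move: H; rewrite vE rE !lte_fin; lra.
have a0 : 0 < a by case/andP : aD.
have [d d0 dP] := sum_bound_near a0 h0 vr.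
have := @symmetrization_induction R n F p ((p - 1) * ball_energy) F0 mF h ((r + v) / 2) h0 D a rho d aD rD d0.
move=> /(_ _ A Phi cA cP vP M mM AM).
rewrite rE; move: H; rewrite vE rE lte_fin => H.
move=> K; suff : (((r + v) / 2)%:E <= r%:E)%E by rewrite lee_fin; lra.
apply: K.
by move=> A' Phi' [mA' _ _] [mP' _ _] _ h1 h2; exact: dP.
Qed.

End symmetrization_limit.

(** * The energy of a smooth function between its level sets *)

Section powers.
Context {R : realType}.
Implicit Types (a b t p x : R).

(** Young's inequality for t and a^(p - 1) with exponents p and p / (p - 1); for p = 1, where the
    conjugate exponent is infinite, both sides coincide. *)
Lemma powR_tangent p a t : 1 <= p -> 0 < a -> 0 <= t ->
  a `^ p + p * a `^ (p - 1) * (t - a) <= t `^ p.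
Proof.
move=> p1 a0 t0; have p0 : 0 < p by exact: lt_le_trans p1.
have [->|pn1] := eqVneq p 1; first by rewrite subrr powRr0 (powRr1 (ltW a0)) (powRr1 t0); lra.
have p1' : 0 < p - 1 by rewrite subr_gt0 lt_neqAle eq_sym pn1.
have := @conjugate_powR R t (a `^ (p - 1)) p (p / (p - 1)) t0 (powR_ge0 _ _) p0 (divr_gt0 p0 p1').
have -> : p^-1 + (p / (p - 1))^-1 = 1 by field; rewrite !gt_eqF.
move=> /(_ erefl); rewrite -powRrM mulrCA divff ?gt_eqF// mulr1.
rewrite -(@mulr_powRB1 _ a p (ltW a0) p0) => H.
have : p * (t * a `^ (p - 1)) <= p * (t `^ p / p + a * a `^ (p - 1) / (p / (p - 1))) by rewrite ler_pM2l.
have -> : p * (t `^ p / p + a * a `^ (p - 1) / (p / (p - 1))) = t `^ p + (p - 1) * (a * a `^ (p - 1)).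
  by field; rewrite !gt_eqF.
move=> K; apply: le_trans (_ : p * (t * a `^ (p - 1)) - (p - 1) * (a * a `^ (p - 1)) <= _); last by lra.
by apply: le_of_eq; ring.
Qed.

Lemma ln_le_sub1 x : 0 < x -> ln x <= x - 1.
Proof. by move=> x0; have := expR_ge1Dx (ln x); rewrite lnK//; lra. Qed.

Lemma powR_ge_ln x b : 0 < x -> 1 + b * ln x <= x `^ b.
Proof. by move=> x0; rewrite /powR gt_eqF//; exact: expR_ge1Dx. Qed.

(** With x = t / a, this is the chain x^(-b) >= 1 - b ln x >= 1 - b (x - 1). *)
Lemma powRN_tangent b a t : 0 <= b -> 0 < a -> 0 < t ->
  a `^ (- b) - b * a `^ (- b - 1) * (t - a) <= t `^ (- b).
Proof.
move=> b0 a0 t0; have x0 : 0 < t / a by pos.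
have -> : t = t / a * a by rewrite divfK ?gt_eqF.
rewrite (powRM _ (ltW x0) (ltW a0)) -[X in X - _]mul1r.
have -> : b * a `^ (- b - 1) * (t / a * a - a) = b * (t / a - 1) * a `^ (- b).
  suff -> : a `^ (- b) = a `^ (- b - 1) * a by ring.
  by rewrite -{3}(powRr1 (ltW a0)) -powRD ?subrK// (gt_eqF a0) implybT.
rewrite -mulrBl; apply: ler_wpM2r; first pos.
apply: le_trans (powR_ge_ln _ x0); have := ler_wpM2l b0 (ln_le_sub1 x0); lra.
Qed.

Lemma powRK b t : 0 <= t -> b != 0 -> (t `^ b) `^ b^-1 = t.
Proof. by move=> t0 b0; rewrite -powRrM divff// powRr1. Qed.

Lemma powRVK b t : 0 <= t -> b != 0 -> (t `^ b^-1) `^ b = t.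
Proof. by move=> t0 b0; rewrite -powRrM mulVf// powRr1. Qed.

Lemma le_powRl b x t : 0 <= b -> 0 <= x -> x <= t -> x `^ b <= t `^ b.
Proof. by move=> b0 x0 xt; apply: ge0_ler_powR => //; rewrite nnegrE// (le_trans x0). Qed.

Lemma le_powRN b x t : 0 <= b -> 0 < x -> x <= t -> t `^ (- b) <= x `^ (- b).
Proof.
move=> b0 x0 xt; rewrite !powRN lef_pV2 ?posrE ?powR_gt0//; last exact: lt_le_trans xt.
by apply: le_powRl => //; pos.
Qed.

End powers.

Section asymmetric_power.
Context {R : realType}.
Variables (p cp cm : R).
Hypotheses (p1 : 1 <= p) (cp0 : 0 <= cp) (cm0 : 0 <= cm).
Implicit Types (a b t s : R).

Let p0 : 0 < p. Proof. exact: lt_le_trans p1. Qed.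
Let pn0 : p != 0. Proof. pos. Qed.

Definition apow t := cp * Num.max t 0 `^ p + cm * Num.max (- t) 0 `^ p.

(* apow' = p * dapow; at p = 1 the value at 0 is a subgradient. *)
Definition dapow t := if 0 < t then cp * t `^ (p - 1) else
  if t < 0 then - (cm * (- t) `^ (p - 1)) else 0.

Lemma apow_pos t : 0 <= t -> apow t = cp * t `^ p.
Proof. by move=> t0; rewrite /apow max_l// max_r ?oppr_le0// powR0// mulr0 addr0. Qed.

Lemma apow_neg t : t <= 0 -> apow t = cm * (- t) `^ p.
Proof. by move=> t0; rewrite /apow max_r// max_l ?oppr_ge0// powR0// mulr0 add0r. Qed.

Lemma apow0 : apow 0 = 0. Proof. by rewrite apow_pos// powR0// mulr0. Qed.

Lemma apow_ge0 t : 0 <= apow t.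
Proof. by rewrite addr_ge0// mulr_ge0 ?powR_ge0. Qed.

Lemma apowM s t : 0 <= s -> apow (s * t) = s `^ p * apow t.
Proof.
move=> s0; have [t0|/ltW t0] := leP 0 t.
  by rewrite !apow_pos ?mulr_ge0// powRM// mulrCA.
rewrite !apow_neg ?mulr_ge0_le0// -mulrN powRM ?oppr_ge0//; ring.
Qed.

Lemma mul_dapow a : a * dapow a = apow a.
Proof.
rewrite /dapow; case: ltgtP => [a0|a0|<-]; last by rewrite mulr0 apow0.
  by rewrite apow_pos ?ltW// mulrCA mulr_powRB1// ltW.
rewrite apow_neg ?ltW// -[in RHS]mulr_powRB1// ?oppr_ge0 1?ltW//; ring.
Qed.

(** When t and a have opposite signs, the tangent of the branch through a is at most its value at 0,
    which is nonpositive, while [apow] is nonnegative. *)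
Lemma apow_tangent t a : apow a + p * dapow a * (t - a) <= apow t.
Proof.
have aux c b s : 0 <= c -> 0 < b -> 0 <= s ->
    c * b `^ p + p * (c * b `^ (p - 1)) * (s - b) <= c * s `^ p.
  move=> c0 b0 s0; have := ler_wpM2l c0 (powR_tangent p1 b0 s0); lra.
have aux2 c b s : 0 <= c -> 0 < b -> s <= 0 ->
    c * b `^ p + p * (c * b `^ (p - 1)) * (s - b) <= 0.
  move=> c0 b0 s0; apply: le_trans (_ : c * b `^ p + p * (c * b `^ (p - 1)) * (0 - b) <= _).
    by rewrite lerD2l; apply: ler_wpM2l; [rewrite !mulr_ge0 ?powR_ge0// ltW|lra].
  by have := aux c b 0 c0 b0 (lexx _); rewrite powR0// mulr0.
rewrite /dapow; case: ltgtP => [a0|a0|<-]; last by rewrite apow0 mulr0 mul0r addr0 apow_ge0.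
- rewrite (apow_pos (ltW a0)); have [t0|/ltW t0] := leP 0 t; first by rewrite apow_pos//; exact: aux.
  by apply: le_trans (apow_ge0 _); exact: aux2.
- rewrite (apow_neg (ltW a0)).
  have -> : p * - (cm * (- a) `^ (p - 1)) * (t - a) = p * (cm * (- a) `^ (p - 1)) * (- t - - a) by ring.
  have a0' : 0 < - a by rewrite oppr_gt0.
  have [t0|/ltW t0] := leP 0 t; last by rewrite apow_neg//; apply: aux; rewrite ?oppr_ge0.
  by apply: le_trans (apow_ge0 _); apply: aux2; rewrite ?oppr_le0.
Qed.

Lemma measurable_apow : mfun apow.
Proof.
apply: measurable_funD; apply: measurable_funM => //.
  meas.
meas.
Qed.

Lemma measurable_dapow : mfun dapow.
Proof.
apply: measurable_fun_ifT; first exact: measurable_fun_ltr.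
  meas.
apply: measurable_fun_ifT => //; first exact: measurable_fun_ltr.
apply: measurableT_comp => //; apply: measurable_funM => //.
meas.
Qed.

Lemma dapow_bounded (M : R) : exists N : R, forall t, `|t| <= M -> `|dapow t| <= N.
Proof.
have q0 : 0 <= p - 1 by pos.
exists (cp * `|M| `^ (p - 1) + cm * `|M| `^ (p - 1)) => t tM.
have tM' : `|t| <= `|M| by exact: le_trans tM (ler_norm _).
have H : `|t| `^ (p - 1) <= `|M| `^ (p - 1) by exact: le_powRl.
have H1 := ler_wpM2l cp0 H; have H2 := ler_wpM2l cm0 H.
have H3 : 0 <= cp * `|M| `^ (p - 1) by pos.
have H4 : 0 <= cm * `|M| `^ (p - 1) by pos.
rewrite /dapow; case: ltgtP => [a0|a0|_]; last by rewrite normr0 addr_ge0.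
  by rewrite ger0_norm ?mulr_ge0 ?powR_ge0//; move: H1; rewrite (gtr0_norm a0); lra.
by rewrite normrN ger0_norm ?mulr_ge0 ?powR_ge0//; move: H2; rewrite (ltr0_norm a0); lra.
Qed.

(* a tangent line at each end of [a, b] *)
Lemma apow_lipschitz (M : R) : exists2 N : R, 0 <= N & forall t s, `|t| <= M -> `|s| <= M ->
  `|apow t - apow s| <= N * `|t - s|.
Proof.
have [N HN] := dapow_bounded M; exists (p * `|N|); first by pos.
have aux t s : `|t| <= M -> apow t - apow s <= p * `|N| * `|t - s|.
  move=> tM; have := apow_tangent s t.
  have : p * dapow t * (t - s) <= p * `|N| * `|t - s|.
    rewrite -!mulrA; apply: ler_wpM2l; first pos.
    apply: le_trans (ler_norm _) _; rewrite normrM; apply: ler_wpM2r => //.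
    by apply: le_trans (HN _ tM) (ler_norm _).
  lra.
move=> t s tM sM; rewrite ler_norml; apply/andP; split; last exact: aux.
by have := aux s t sM; rewrite distrC; lra.
Qed.

Lemma apow_convex a t s : 0 <= a <= 1 ->
  apow (a * t + (1 - a) * s) <= a * apow t + (1 - a) * apow s.
Proof.
move=> /andP[a0 a1]; set w := a * t + _.
have H1 := ler_wpM2l a0 (apow_tangent t w).
have a1' : 0 <= 1 - a by pos.
have H2 := ler_wpM2l a1' (apow_tangent s w).
apply: le_trans (lerD H1 H2); apply: le_of_eq; rewrite /w; ring.
Qed.

End asymmetric_power.

#[global] Hint Resolve measurable_apow measurable_dapow : meas.

Lemma phi_apow {R : realType} (p tau t : R) : 1 <= p -> -1 <= tau -> tau <= 1 ->
  phi p tau t `^ p = apow p ((1 + tau) / 2) ((1 - tau) / 2) t.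
Proof.
move=> p1 t1 t2; have p0 : 0 < p by exact: lt_le_trans p1.
have cp0 : 0 <= (1 + tau) / 2 by lra.
have cm0 : 0 <= (1 - tau) / 2 by lra.
have pn0 : p != 0 by pos.
rewrite /phi; have /orP[t0|t0] := le_total 0 t.
  rewrite (apow_pos _ _ p1 t0) (max_l t0) (max_r (_ : - t <= 0)) ?oppr_le0// mulr0 addr0.
  by rewrite powRM ?powR_ge0// powRVK.
rewrite (apow_neg _ _ p1 t0) (max_r t0) (max_l (_ : 0 <= - t)) ?oppr_ge0// mulr0 add0r.
by rewrite powRM ?powR_ge0 ?oppr_ge0// powRVK.
Qed.

(** * Taylor estimates for smooth functions *)

Section mean_value.
Context {R : realType} {n : nat}.
Implicit Types (g : 'rV[R]_n -> R) (x v e : 'rV[R]_n) (c t : R).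

Lemma is_derive_line g e x t : (forall y, derivable g y e) ->
  is_derive t 1 (fun s : R => g (x + s *: e)) ('D_e g (x + t *: e)).
Proof.
move=> dg.
have E : (fun h : R => h^-1 *: (((fun s : R => g (x + s *: e)) \o shift t) (h *: (1 : R)) - g (x + t *: e)))
    = (fun h : R => h^-1 *: ((g \o shift (x + t *: e)) (h *: e) - g (x + t *: e))).
  apply/funext => h; congr (_ *: (g _ - _)).
  by rewrite scaler1 scalerDl addrCA.
by split; rewrite /derivable ?/derive E//; exact: dg.
Qed.

Lemma mean_value_line g e x c : (forall y, derivable g y e) ->
  exists t, `|t| <= `|c| /\ g (x + c *: e) - g x = c * 'D_e g (x + t *: e).
Proof.
move=> dg.
have D t : is_derive t 1 (fun s : R => g (x + s *: e)) ('D_e g (x + t *: e)).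
  exact: is_derive_line.
have cts (i : interval R) : {within [set` i], continuous (fun s : R => g (x + s *: e))}.
  by apply: derivable_within_continuous => t _; case: (D t).
have [c0|c0|->] := ltgtP c 0; last first.
- by exists 0; rewrite !scale0r addr0 subrr mul0r.
- have [t + H] := MVT c0 (fun t _ => D t) (cts _).
  rewrite in_itv/= => /andP[t0 tc]; exists t; split; first by rewrite !gtr0_norm// ltW.
  by move: H; rewrite scale0r addr0 => ->; rewrite subr0 mulrC.
- have [t + H] := MVT c0 (fun t _ => D t) (cts _).
  rewrite in_itv/= => /andP[t0 tc]; exists t; split; first by rewrite !ltr0_norm// lerN2 ltW.
  by move: H; rewrite scale0r addr0 sub0r mulrN [X in _ = - X]mulrC => /eqP; rewrite -eqr_oppLR opprB => /eqP.
Qed.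

Lemma enorm_le_abs x v : (forall i, `|x 0 i| <= `|v 0 i|) -> enorm x <= enorm v.
Proof.
move=> H; apply: ler_wsqrtr; apply: ler_sum => i _.
by rewrite -!expr2 -(real_normK (num_real (x 0 i))) -(real_normK (num_real (v 0 i))) lerXn2r.
Qed.

Definition trunc_rV (k : nat) v : 'rV[R]_n := \row_i if (i < k)%N then v 0 i else 0.

Lemma trunc_rVS (i : 'I_n) v : trunc_rV i.+1 v = trunc_rV i v + v 0 i *: delta_mx 0 i.
Proof.
apply/rowP => j; rewrite !mxE ltnS leq_eqVlt -[(j == i :> nat)]/(j == i).
by have [->|ji] := eqVneq j i; rewrite ?ltnn ?mulr1 ?add0r//= mulr0 addr0.
Qed.

(** Smoothness is given by partial derivatives, so the increment is telescoped along a path parallel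
    to the axes, and the one-dimensional mean value theorem is applied to each edge. *)
Lemma mean_value_rV g x v : (forall i y, derivable g y (delta_mx 0 i)) ->
  exists xi : 'I_n -> 'rV[R]_n, (forall i, enorm (xi i - x) <= enorm v) /\
    g (x + v) - g x = \sum_i v 0 i * partial i g (xi i).
Proof.
move=> dg.
have H (i : 'I_n) : exists y, enorm (y - x) <= enorm v /\
    g (x + trunc_rV i.+1 v) - g (x + trunc_rV i v) = v 0 i * partial i g y.
  have [t [tv E]] := @mean_value_line g (delta_mx 0 i) (x + trunc_rV i v) (v 0 i) (dg i).
  exists (x + trunc_rV i v + t *: delta_mx 0 i); split; last by rewrite trunc_rVS addrA.
  rewrite -[x + _ + _]addrA [x + _]addrC addrK; apply: enorm_le_abs => j; rewrite !mxE.
  have [->|ji] := eqVneq j i; first by rewrite ltnn add0r mulr1.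
  by rewrite mulr0 addr0; case: ifP => //; rewrite normr0.
have [xi Hxi] := choice H; exists xi; split => [i|]; first by case: (Hxi i).
have -> : \sum_i v 0 i * partial i g (xi i) =
    \sum_(i < n) (g (x + trunc_rV i.+1 v) - g (x + trunc_rV i v)).
  by apply: eq_bigr => i _; case: (Hxi i).
rewrite -(big_mkord xpredT (fun i => g (x + trunc_rV i.+1 v) - g (x + trunc_rV i v))).
rewrite telescope_sumr//; congr (g _ - g _).
  by congr (_ + _); apply/rowP => i; rewrite mxE ltn_ord.
by rewrite (_ : trunc_rV 0 v = 0) ?addr0//; apply/rowP => i; rewrite !mxE.
Qed.

Lemma lipschitz_of_partial g (M : R) : (forall i y, derivable g y (delta_mx 0 i)) ->
  (forall i y, `|partial i g y| <= M) ->
  forall x v, `|g (x + v) - g x| <= n%:R * M * enorm v.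
Proof.
move=> dg gM x v; have [xi [_ ->]] := mean_value_rV x v dg.
apply: le_trans (ler_norm_sum _ _ _) _.
apply: le_trans (_ : \sum_(i < n) (M * enorm v) <= _); last by rewrite sumr_const card_ord -mulrA mulr_natl.
apply: ler_sum => i _; rewrite normrM mulrC; apply: ler_pM => //; exact: coord_le_enorm.
Qed.

Lemma taylor_of_partial g (M : R) : 0 <= M -> (forall i y, derivable g y (delta_mx 0 i)) ->
  (forall i j y, derivable (partial i g) y (delta_mx 0 j)) ->
  (forall i j y, `|partial j (partial i g) y| <= M) ->
  forall x v, `|g (x + v) - g x - dotp (grad g x) v| <= n%:R * (n%:R * M) * enorm v ^+ 2.
Proof.
move=> M0 dg dg2 gM x v; have [xi [xiv ->]] := mean_value_rV x v dg.
have -> : \sum_i v 0 i * partial i g (xi i) - dotp (grad g x) v =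
    \sum_(i < n) v 0 i * (partial i g (x + (xi i - x)) - partial i g x).
  rewrite -sumrB; apply: eq_bigr => i _; rewrite mxE subrKC; ring.
apply: le_trans (ler_norm_sum _ _ _) _.
apply: le_trans (_ : \sum_(i < n) (n%:R * M * enorm v ^+ 2) <= _); last by rewrite sumr_const card_ord -[leLHS]mulr_natl !mulrA.
apply: ler_sum => i _; rewrite normrM mulrC mulrA; apply: ler_pM => //; last exact: coord_le_enorm.
apply: le_trans (lipschitz_of_partial (dg2 i) (gM i) _ _) _.
by apply: ler_wpM2l => //; rewrite mulr_ge0.
Qed.

End mean_value.

Section continuity.
Context {R : realType} {n : nat}.
Implicit Types (g : 'rV[R]_n -> R) (x y : 'rV[R]_n).

Lemma nbhs_enormP x (A : set 'rV[R]_n) : nbhs x A <->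
  exists2 d : R, 0 < d & forall y, enorm (y - x) < d -> A y.
Proof.
split=> [/nbhs_ballP[d d0 dA]|[d d0 dA]].
  exists d => // y yx; apply: dA; apply/rV_ballE; split => // i.
  have := coord_le_enorm (x - y) i; rewrite !mxE enormB => H; exact: le_lt_trans yx.
have : nbhs x [set y | enorm (y - x) < d].
  by apply: open_nbhs_nbhs; split; [exact: eball_open|rewrite /= subrr enorm0].
by apply: filterS => y; exact: dA.
Qed.

Lemma continuous_enormP g : continuous g <-> forall x e, 0 < e ->
  exists2 d : R, 0 < d & forall y, enorm (y - x) < d -> `|g y - g x| < e.
Proof.
split=> [cg x e e0|H x].
  have /(@cvgrPdist_lt _ _ _ (nbhs x)) /(_ e e0)/nbhs_enormP[d d0 dP] := cg x.
  by exists d => // y /dP; rewrite distrC.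
apply/(@cvgrPdist_lt _ _ _ (nbhs x)) => e e0; apply/nbhs_enormP.
by have [d d0 dP] := H x e e0; exists d => // y /dP; rewrite distrC.
Qed.

Lemma locally_lipschitz_continuous g : (forall r : R, exists2 L : R, 0 <= L &
  forall x y, enorm x <= r -> enorm y <= r -> `|g x - g y| <= L * enorm (x - y)) -> continuous g.
Proof.
move=> H; apply/continuous_enormP => x e e0.
have [L L0 HL] := H (enorm x + 1).
have d0 : 0 < Num.min 1 (e / (L + 1)) by rewrite lt_min ltr01/= divr_gt0// ltr_pwDr.
exists (Num.min 1 (e / (L + 1))) => // y; rewrite lt_min => /andP[y1 ye].
apply: le_lt_trans (HL _ _ _ _) _.
- by rewrite -(subrK x y); apply: le_trans (enorm_triangle _ _) _; rewrite addrC lerD2l ltW.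
- by rewrite lerDl.
- apply: le_lt_trans (_ : (L + 1) * enorm (y - x) < e).
    by apply: ler_wpM2r; [pos|rewrite lerDl].
  by rewrite mulrC -ltr_pdivlMr// ltr_pwDr.
Qed.

End continuity.

Section smooth_functions.
Context {R : realType} {n : nat}.
Implicit Types (f g : 'rV[R]_n -> R) (x v : 'rV[R]_n) (D : R).

Lemma smooth_continuous f : smooth f -> continuous f.
Proof. by move=> /(_ [::])[]. Qed.

Lemma smooth_derivable f : smooth f -> forall i x, derivable f x (delta_mx 0 i).
Proof. by move=> /(_ [::])[]. Qed.

Lemma smooth_partial f i : smooth f -> smooth (partial i f).
Proof. by move=> sf s; have := sf (rcons s i); rewrite -cats1 foldr_cat. Qed.

Definition vanishes_outside D f := forall x, D <= enorm x -> f x = 0.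

Lemma smooth_compact_vanishes f : smooth_compact_support f ->
  exists2 D : R, 0 < D & vanishes_outside D f.
Proof.
move=> [_ /compact_bounded[M [_ HM]]].
have [N N0 HN] : exists2 N : R, 0 < N & forall x, f x != 0 -> `|x| <= N.
  exists (`|M| + 1) => [|x fx]//.
  apply: (HM (`|M| + 1)); first by rewrite ltr_pwDr// ler_norm.
  exact: subset_closure.
exists (n%:R * N + 1) => [|x Dx]; first pos.
apply: contra_leP Dx => /eqP/HN xN; apply: le_lt_trans (enorm_le_norm x) _.
by rewrite ltr_pwDr// ler_wpM2l.
Qed.

(** The strict increase of the radius provides a neighbourhood of x on which f vanishes, as the
    derivative at x requires. *)
Lemma partial_vanishes D D' f i : D < D' -> vanishes_outside D f ->
  vanishes_outside D' (partial i f).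
Proof.
move=> DD' fD x Dx; rewrite /partial.
rewrite (@near_eq_derive _ _ _ f (cst 0)) ?derive_cst//.
have xD : D < enorm x by exact: lt_le_trans Dx.
have : \forall y \near x, enorm y \in `]D, +oo[.
  have := @enorm_continuous R n x (`]D, +oo[%classic); apply.
  by apply: open_nbhs_nbhs; split; [exact: interval_open|rewrite /= in_itv/= andbT].
by apply: filterS => y; rewrite in_itv/= andbT => /ltW/fD.
Qed.

Lemma smooth_vanishes f (s : seq 'I_n) D D' : D < D' -> vanishes_outside D f ->
  vanishes_outside D' (foldr (@partial R n) f s).
Proof.
move=> DD' fD; elim: s D' DD' => [|i s IH] D' DD'.
  by move=> x Dx; apply: fD; exact: le_trans (ltW DD') Dx.
apply: (@partial_vanishes ((D + D') / 2)); first by lra.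
by apply: IH; lra.
Qed.

Lemma continuous_vanishes_bounded D g : continuous g -> vanishes_outside D g ->
  exists2 M : R, 0 <= M & forall x, `|g x| <= M.
Proof.
move=> cg gD; have := @closed_eball_compact R n `|D|; set A := [set x | _] => cA.
have cA' : {within A, continuous (fun x => `|g x|)}.
  apply: continuous_subspaceT => x; apply: continuous_comp; [exact: cg|exact: norm_continuous].
have A0 : A !=set0 by exists 0; rewrite /A/= enorm0.
have [c _ cP] := EVT_max_rV A0 cA cA'.
exists `|g c| => // x; have [xD|/ltW xD] := leP (enorm x) `|D|; first by apply: cP; rewrite inE.
by rewrite gD ?normr0//; exact: le_trans (ler_norm _) xD.
Qed.

Lemma smooth_compact_bounds f : smooth_compact_support f ->
  exists D M C : R, [/\ 0 < D, 0 <= M, 0 <= C, vanishes_outside D f & vanishes_outside D (fun x => enorm (grad f x))] /\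
  [/\ forall x, `|f x| <= M, forall x, enorm (grad f x) <= M,
    forall x v, `|f (x + v) - f x - dotp (grad f x) v| <= C * enorm v ^+ 2 &
    forall x v, enorm (grad f (x + v) - grad f x) <= C * enorm v].
Proof.
move=> sf; have [D0 D00 fD0] := smooth_compact_vanishes sf; case: sf => sf _.
have DD : D0 < D0 + 1 by rewrite ltrDl.
have cts (s : seq 'I_n) : exists2 M : R, 0 <= M & forall x, `|foldr partial f s x| <= M.
  apply: (@continuous_vanishes_bounded (D0 + 1)); first by case: (sf s).
  exact: smooth_vanishes DD fD0.
have [M0 M00 fM0] := cts [::].
have [M1 M10 fM1] : exists2 M : R, 0 <= M & forall i x, `|partial i f x| <= M.
  have [M HM] := choice (fun i => (let: ex_intro2 M a b := cts [:: i] in ex_intro _ M (conj a b))).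
  exists (\sum_i M i) => [|i x]; first by apply: sumr_ge0 => i _; case: (HM i).
  apply: le_trans (_ : M i <= _); first by case: (HM i) => _; exact.
  by rewrite (bigD1 i)//= lerDl sumr_ge0// => j _; case: (HM j).
have [M2 M20 fM2] : exists2 M : R, 0 <= M & forall i j x, `|partial j (partial i f) x| <= M.
  have [M HM] := choice (fun ij : 'I_n * 'I_n =>
    (let: ex_intro2 M a b := cts [:: ij.2; ij.1] in ex_intro _ M (conj a b))).
  exists (\sum_ij M ij) => [|i j x]; first by apply: sumr_ge0 => i _; case: (HM i).
  apply: le_trans (_ : M (i, j) <= _); first by case: (HM (i, j)) => _; exact.
  by rewrite (bigD1 (i, j))//= lerDl sumr_ge0// => k _; case: (HM k).
exists (D0 + 1), (M0 + n%:R * M1), (n%:R * (n%:R * M2)); split; split => //.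
- pos.
- pos.
- pos.
- by move=> x Dx; apply: fD0; exact: le_trans (ltW DD) Dx.
- move=> x Dx; rewrite (_ : grad f x = 0) ?enorm0//; apply/rowP => i; rewrite !mxE.
  exact: (@smooth_vanishes f [:: i] D0 (D0 + 1)).
- by move=> x; apply: le_trans (fM0 x) _; rewrite lerDl mulr_ge0.
- move=> x; apply: le_trans (_ : n%:R * M1 <= _); last by rewrite lerDr.
  by apply: enorm_le_coord => // i; rewrite mxE.
- apply: taylor_of_partial => //; first exact: smooth_derivable.
  by move=> i j y; apply: smooth_derivable; exact: smooth_partial.
- move=> x v; rewrite -mulrA; apply: enorm_le_coord => [|i].
    pos.
  rewrite !mxE; apply: lipschitz_of_partial => // j y.
  by apply: smooth_derivable; exact: smooth_partial.
Qed.

Lemma measurable_grad f : smooth f -> mfun (grad f).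
Proof.
move=> sf; apply: measurable_rVP => i; rewrite (_ : (fun t => _) = partial i f); last first.
  by apply/funext => x; rewrite mxE.
by apply: continuous_measurable_rV; exact: smooth_continuous (smooth_partial i sf).
Qed.

End smooth_functions.

#[global] Hint Resolve measurable_grad : meas.

Section integral_indic.
Context {R : realType} {n : nat}.
Local Notation V := (@lebesgue_rV R n).

Lemma integrable_cst_indic (c D : R) (A : set 'rV[R]_n) : measurable A -> A `<=` eball n D ->
  integrableV (fun u : 'rV[R]_n => c * \1_A u).
Proof.
move=> mA AD; apply: (@integrable_bounded_support R n _ D `|c|).
- meas.
- by move=> x xD; rewrite indicE memNset ?mulr0// => /AD.
- by move=> u; rewrite indicE; case: (_ \in _); rewrite ?mulr1 ?mulr0 ?normr0.
Qed.

Lemma Rintegral_cst_indic (c D : R) (A : set 'rV[R]_n) : 0 <= c -> measurable A -> A `<=` eball n D ->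
  \int[V]_x (c * \1_A x) = c * fine (V A).
Proof.
move=> c0 mA AD; have VE : V A = (fine (V A))%:E by exact: lebesgue_rV_fin AD.
rewrite /Rintegral; under eq_integral do rewrite EFinM.
rewrite ge0_integralZl//; last meas.
have -> : (\int[V]_x (\1_A x : R)%:E)%E = (fine (V A))%:E.
  by apply: etrans VE; apply: esym; exact: measure_indic.
by [].
Qed.

End integral_indic.

(** * Directional energies and their pairing with the dual body *)

Section pairing.
Context {R : realType} {n : nat}.
Local Notation V := (@lebesgue_rV R n).
Variables (p cp cm : R).
Hypotheses (p1 : 1 <= p) (cp0 : 0 <= cp) (cm0 : 0 <= cm).
Local Notation F := (apow p cp cm).
Implicit Types (Phi : set 'rV[R]_n) (u w x y : 'rV[R]_n).

Definition directional_energy Phi w : R := \int[V]_u (F (dotp u w) * \1_Phi u).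

Lemma apow_bounded (M : R) : exists2 N : R, 0 <= N & forall t, `|t| <= M -> `|F t| <= N.
Proof.
have [N N0 HN] := apow_lipschitz p1 cp0 cm0 `|M|.
exists (N * `|M|) => [|t tM]; first pos.
have tM' : `|t| <= `|M| by exact: le_trans tM (ler_norm _).
have := HN t 0 tM'; rewrite normr0 (apow0 _ _ p1) !subr0 => /(_ (normr_ge0 _)).
by move=> H; apply: le_trans H _; apply: ler_wpM2l.
Qed.

Lemma measurable_apow_dotp (u w : 'rV[R]_n -> 'rV[R]_n) : mfun u -> mfun w ->
  mfun (fun x => F (dotp (u x) (w x))).
Proof. by move=> mu mw; apply: measurableT_comp; [exact: measurable_apow|meas]. Qed.

Lemma directional_energy_ge0 Phi w : 0 <= directional_energy Phi w.
Proof. by apply: Rintegral_ge0 => u _; rewrite mulr_ge0// ?apow_ge0//. Qed.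

Lemma apow_dotp_indic_bounded Phi D w (M : R) : Phi `<=` eball n D -> enorm w <= M ->
  forall N : R, (forall t, `|t| <= D * M -> `|F t| <= N) -> 0 <= N ->
  forall u, `|F (dotp u w) * \1_Phi u| <= N.
Proof.
move=> PD wM N HN N0 u; rewrite indicE; case: (boolP (u \in Phi)) => [/set_mem/PD uD|_].
  rewrite mulr1; apply: HN; apply: le_trans (abs_dotp_le _ _) _.
  by apply: ler_pM => //; pos.
by rewrite mulr0 normr0.
Qed.

Lemma measurable_apow_dotp_indic Phi w : measurable Phi ->
  mfun (fun u => F (dotp u w) * \1_Phi u).
Proof. by move=> mP; apply: measurable_funM; [exact: measurable_apow_dotp|meas]. Qed.

Lemma integrable_apow_dotp Phi D w : measurable Phi -> Phi `<=` eball n D ->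
  integrableV (fun u => F (dotp u w) * \1_Phi u).
Proof.
move=> mP PD; have [N N0 HN] := apow_bounded (D * enorm w).
apply: (@integrable_bounded_support R n _ D N); first exact: measurable_apow_dotp_indic.
- by move=> x xD; rewrite indicE memNset ?mulr0// => /PD.
- by move=> u; apply: (apow_dotp_indic_bounded PD (lexx _) HN).
Qed.

(** Test the duality inequality with u -> u.w, cut off outside Phi to be bounded; its integral
    against [lam] is the pairing of the barycenter with w. For w a gradient this bounds the
    first-order increment of a function along y. *)
Lemma dual_body_pairing C Phi D y w : measurable Phi -> Phi `<=` eball n D -> dual_body F p C Phi y ->
  p * dotp y w <= directional_energy Phi w + C.
Proof.
move=> mP PD [lam dl ->]; have [ml [M lM] l0 lP] := dl.
pose g u := dotp u w * \1_Phi u.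
have mg : mfun g.
  by apply: measurable_funM; meas.
have gM : exists M : R, forall x, `|g x| <= M.
  exists (`|D| * enorm w) => x; rewrite /g indicE; case: (boolP (x \in Phi)) => [/set_mem/PD xD|_].
    rewrite mulr1; apply: le_trans (abs_dotp_le _ _) _; apply: ler_wpM2r; first pos.
    exact: le_trans (ltW xD) (ler_norm _).
  by rewrite mulr0 normr0 mulr_ge0 ?enorm_ge0.
have := lP g mg gM.
have -> : \int[V]_x (g x * lam x) = dotp (barycenter lam) w.
  rewrite -barycenter_dotp; last first.
    by move=> i; apply: (dual_integrable PD dl); [meas|exact: coord_bounded].
  apply: eq_Rintegral => u _; rewrite /g indicE; case: (boolP (u \in Phi)) => uP; first by rewrite mulr1.
  by rewrite l0 ?mulr0// => uP'; rewrite mem_set in uP.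
have -> : (\int[V]_(x in Phi) (F (g x))%:E)%E = (directional_energy Phi w)%:E.
  rewrite integral_in_indic /directional_energy /Rintegral fineK; last first.
    exact/integrable_fin_num/(integrable_apow_dotp w mP PD).
  apply: eq_integral => u _; rewrite -EFinM /g indicE; case: (_ \in _); first by rewrite !mulr1.
  by rewrite !mulr0.
by [].
Qed.

Lemma directional_energy_le Phi D (M : R) : measurable Phi -> Phi `<=` eball n D ->
  exists2 N : R, 0 <= N & forall w, enorm w <= M -> directional_energy Phi w <= N.
Proof.
move=> mP PD; have [N N0 HN] := apow_bounded (D * M).
exists (N * fine (V Phi)) => [|w wM]; first by rewrite mulr_ge0// fine_ge0.
apply: le_trans (_ : \int[V]_u (N * \1_Phi u) <= _).
  apply: le_Rintegral => //; [exact: (integrable_apow_dotp w mP PD)|exact: (integrable_cst_indic N mP PD)|].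
  move=> u _; rewrite indicE; case: (boolP (u \in Phi)) => uP; last by rewrite !mulr0.
  rewrite !mulr1; apply: le_trans (ler_norm _) _.
  by have := apow_dotp_indic_bounded PD wM HN N0 u; rewrite indicE uP mulr1.
by rewrite (Rintegral_cst_indic N0 mP PD).
Qed.

Lemma dual_body_bounded C Phi D : measurable Phi -> Phi `<=` eball n D ->
  exists2 Y : R, 0 <= Y & forall y, dual_body F p C Phi y -> enorm y <= Y.
Proof.
move=> mP PD; have [N N0 HN] := directional_energy_le 1 mP PD.
have p0 : 0 < p by exact: lt_le_trans p1.
exists ((N + `|C|) / p) => [|y yP]; first pos.
have [->|y0] := eqVneq y 0; first by rewrite enorm0 divr_ge0 ?addr_ge0// ltW.
have ey : 0 < enorm y by rewrite enorm_gt0.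
have := dual_body_pairing ((enorm y)^-1 *: y) mP PD yP.
rewrite dotpZr -enorm_sqr mulKf ?gt_eqF// => H.
rewrite ler_pdivlMr// mulrC; apply: le_trans H _; apply: lerD; last exact: ler_norm.
by apply: HN; rewrite enormZ gtr0_norm ?invr_gt0// mulVf ?gt_eqF.
Qed.

End pairing.

Section energy.
Context {R : realType} {n : nat}.
Local Notation V := (@lebesgue_rV R n).
Variables (p cp cm : R).
Hypotheses (p1 : 1 <= p) (cp0 : 0 <= cp) (cm0 : 0 <= cm) (cpm : 0 < cp + cm).
Local Notation F := (apow p cp cm).
Variable f : 'rV[R]_n -> R.
Hypothesis sf : smooth_compact_support f.
Implicit Types (u w x y : 'rV[R]_n).

Definition energy u : R := \int[V]_x (F (dotp u (grad f x))).

Let mg : mfun (grad f). Proof. by apply: measurable_grad; case: sf. Qed.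

Let p0 : 0 < p. Proof. exact: lt_le_trans p1. Qed.

Lemma measurable_energy_integrand u : mfun (fun x => F (dotp u (grad f x))).
Proof. exact: measurable_apow_dotp. Qed.

Lemma energy_integrable u :
  integrableV (fun x => F (dotp u (grad f x))).
Proof.
have [D [M [C [[D0 M0 _ _ gD] [_ gM _ _]]]]] := smooth_compact_bounds sf.
have [N N0 HN] := apow_bounded p1 cp0 cm0 (enorm u * M).
apply: integrable_bounded_support; first exact: measurable_energy_integrand.
- move=> x /negP; rewrite -leNgt => /gD/eqP; rewrite enorm_eq0 => /eqP ->.
  by rewrite dotp0r apow0.
- move=> x; apply: HN; apply: le_trans (abs_dotp_le _ _) _.
  by apply: ler_wpM2l => //; pos.
Qed.

Lemma energy_ge0 u : 0 <= energy u.
Proof. by apply: Rintegral_ge0 => x _; exact: apow_ge0. Qed.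

Lemma energyZ (s : R) u : 0 <= s -> energy (s *: u) = s `^ p * energy u.
Proof.
move=> s0; rewrite /energy -RintegralZl//; last exact: energy_integrable.
by apply: eq_Rintegral => x _; rewrite dotpZl apowM.
Qed.

Lemma energy_convex u w (a : R) : 0 <= a <= 1 ->
  energy (a *: u + (1 - a) *: w) <= a * energy u + (1 - a) * energy w.
Proof.
move=> a01.
have ia : integrableV (fun x => a * F (dotp u (grad f x))).
  have := integrableZl measurableT a (energy_integrable u).
  by [].
have ib : integrableV (fun x => (1 - a) * F (dotp w (grad f x))).
  have := integrableZl measurableT (1 - a) (energy_integrable w).
  by [].
rewrite /energy -RintegralZl//; last exact: energy_integrable.
rewrite -RintegralZl//; last exact: energy_integrable.
rewrite -RintegralD//; apply: le_Rintegral => //.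
- exact: energy_integrable.
- have := integrableD measurableT ia ib.
  by [].
- by move=> x _; rewrite dotpDl !dotpZl; apply: apow_convex.
Qed.

Lemma energy_lipschitz (r : R) : exists2 L : R, 0 <= L & forall u w, enorm u <= r -> enorm w <= r ->
  `|energy u - energy w| <= L * enorm (u - w).
Proof.
have [D [M [C [[D0 M0 _ _ gD] [_ gM _ _]]]]] := smooth_compact_bounds sf.
have [N N0 HN] := apow_lipschitz p1 cp0 cm0 (r * M).
have mB := @measurable_eball R n D.
exists (N * M * fine (V (eball n D))); first by rewrite !mulr_ge0// fine_ge0.
have aux u w : enorm u <= r -> enorm w <= r -> energy u - energy w <= N * M * fine (V (eball n D)) * enorm (u - w).
  move=> ur wr; pose c := N * M * enorm (u - w).
  have c0 : 0 <= c by rewrite !mulr_ge0 ?enorm_ge0.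
  have iB := integrable_cst_indic c mB (@subset_refl _ _).
  have -> : N * M * fine (V (eball n D)) * enorm (u - w) = \int[V]_x (c * \1_(eball n D) x).
    by rewrite (Rintegral_cst_indic c0 mB (@subset_refl _ _)) /c; ring.
  rewrite lerBlDr -RintegralD//; last exact: energy_integrable.
  apply: le_Rintegral => //; first exact: energy_integrable.
    have := integrableD measurableT iB (energy_integrable w).
    by [].
  move=> x _; rewrite -lerBlDr; have [xD|xD] := pselect (eball n D x); last first.
    move/negP : xD; rewrite -leNgt => /gD/eqP; rewrite enorm_eq0 => /eqP ->.
    by rewrite !dotp0r subrr mulr_ge0//.
  rewrite indicE mem_set// mulr1; apply: le_trans (ler_norm _) _.
  have bd v : enorm v <= r -> `|dotp v (grad f x)| <= r * M.
    by move=> vr; apply: le_trans (abs_dotp_le _ _) _; apply: ler_pM => //; pos.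
  apply: le_trans (HN _ _ (bd _ ur) (bd _ wr)) _; rewrite /c -mulrA; apply: ler_wpM2l => //.
  rewrite -dotpBl mulrC; apply: le_trans (abs_dotp_le _ _) _; apply: ler_wpM2l => //; pos.
move=> u w ur wr; rewrite ler_norml; apply/andP; split; last exact: aux.
by rewrite -[energy u - energy w]opprB lerN2 enormB; exact: aux.
Qed.

Lemma energy_continuous : continuous energy.
Proof.
by apply: locally_lipschitz_continuous => r; exact: energy_lipschitz.
Qed.

(* Along a segment on which f does not increase to first order, N Taylor steps lose at most O(1/N). *)
Lemma decreasing_along u x t : (forall y, dotp u (grad f y) <= 0) -> 0 <= t ->
  f (x + t *: u) <= f x.
Proof.
move=> ug t0; have [D [M [C [[D0 M0 C0 _ gD] [_ gM fC _]]]]] := smooth_compact_bounds sf.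
have step N h : 0 <= h -> f (x + (N%:R * h) *: u) <= f x + N%:R * (C * (h * enorm u) ^+ 2).
  move=> h0; elim: N => [|N IH]; first by rewrite !mul0r scale0r !addr0.
  have := fC (x + (N%:R * h) *: u) (h *: u).
  have -> : x + (N%:R * h) *: u + h *: u = x + (N.+1%:R * h) *: u.
    by rewrite -addrA -scalerDl -[N.+1]addn1 natrD mulrDl mul1r.
  rewrite ler_norml enormZ (ger0_norm h0) => /andP[_].
  have : dotp (grad f (x + (N%:R * h) *: u)) (h *: u) <= 0.
    by rewrite dotpZr mulr_ge0_le0// dotpC.
  move: IH; lra.
apply/ler_addgt0Pr => e e0.
pose K := C * (t * enorm u) ^+ 2.
have [N HN] : exists N : nat, K / e < N.+1%:R by exists (Num.trunc (K / e)); exact: truncnS_gt.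
have := step N.+1 (t / N.+1%:R) (divr_ge0 t0 (ler0n _ _)).
rewrite mulrCA divff// mulr1 => H; apply: le_trans H _; rewrite lerD2l.
have -> : N.+1%:R * (C * (t / N.+1%:R * enorm u) ^+ 2) = K / N.+1%:R.
  by rewrite /K; field.
by rewrite ler_pdivrMr// mulrC -ler_pdivrMr// ltW.
Qed.

(** Otherwise f would not increase along u, and a path along u that starts outside the support and
    ends at x would give f x <= 0. *)
Lemma exists_increasing u : u != 0 -> (exists x, 0 < f x) -> exists y, 0 < dotp u (grad f y).
Proof.
move=> u0 [x fx]; apply: contrapT => H.
have ug y : dotp u (grad f y) <= 0 by rewrite leNgt; apply/negP => ?; apply: H; exists y.
have [D [M [C [[D0 M0 C0 fD gD] _]]]] := smooth_compact_bounds sf.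
have eu : 0 < enorm u by rewrite enorm_gt0.
pose t := (enorm x + D) / enorm u.
have t0 : 0 <= t by rewrite divr_ge0 ?addr_ge0 ?enorm_ge0// ltW.
have := decreasing_along (x - t *: u) ug t0; rewrite subrK => H1.
suff : f (x - t *: u) = 0 by move=> E; move: H1; rewrite E leNgt fx.
apply: fD; have := enorm_triangle2 (t *: u) x 0.
rewrite !subr0 enormB enormZ ger0_norm// /t divfK//; lra.
Qed.

Lemma integral_continuous_gt0 (g : 'rV[R]_n -> R) y : continuous g -> (forall x, 0 <= g x) ->
  integrableV g -> 0 < g y -> 0 < \int[V]_x g x.
Proof.
move=> cg g0 ig gy.
have [r r0 rP] : exists2 r : R, 0 < r & forall x, enorm (x - y) < r -> g y / 2 <= g x.
  have /continuous_enormP/(_ y (g y / 2))[|r r0 rP] := cg; first pos.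
  by exists r => // x /rP; rewrite ltr_norml => /andP[]; lra.
pose A := [set x | eball n r (x - y)].
have mA : measurable A by meas.
have VA : V A = V (eball n r) by apply: lebesgue_rV_addr; meas.
have AD : A `<=` eball n (r + enorm y).
  move=> x xA; rewrite /eball/= -(subrK y x); apply: le_lt_trans (enorm_triangle _ _) _.
  by rewrite ltrD2r.
have gy2 : 0 <= g y / 2 by lra.
apply: (@lt_le_trans _ _ (g y / 2 * fine (V A))).
  apply: mulr_gt0; first lra.
  by rewrite VA fine_gt0// lebesgue_eball_gt0//= lebesgue_eball_lty.
rewrite -(Rintegral_cst_indic gy2 mA AD); apply: le_Rintegral => //; first exact: (integrable_cst_indic _ mA AD).
move=> x _; rewrite indicE; case: (boolP (x \in A)) => [/set_mem xA|_]; last by rewrite mulr0.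
by rewrite mulr1; exact: rP.
Qed.

Lemma apow_grad_continuous u : continuous (fun x => F (dotp u (grad f x))).
Proof.
have [D [M [C [[D0 M0 C0 _ _] [_ gM _ gC]]]]] := smooth_compact_bounds sf.
have [N N0 HN] := apow_lipschitz p1 cp0 cm0 (enorm u * M).
have ub x : `|dotp u (grad f x)| <= enorm u * M.
  by apply: le_trans (abs_dotp_le _ _) _; apply: ler_wpM2l; rewrite ?enorm_ge0.
apply: locally_lipschitz_continuous => r; exists (N * (enorm u * C)) => [|x y _ _].
  pos.
apply: le_trans (HN _ _ (ub x) (ub y)) _; rewrite -!mulrA; apply: ler_wpM2l => //.
rewrite -dotpBr; apply: le_trans (abs_dotp_le _ _) _; apply: ler_wpM2l; first pos.
by have := gC y (x - y); rewrite subrKC.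
Qed.

(** For cp = 0 only negative directional derivatives are charged; [exists_increasing] is then
    applied to - u. *)
Lemma energy_gt0 u : u != 0 -> (exists x, 0 < f x) -> 0 < energy u.
Proof.
move=> u0 fx.
have [y yP] : exists y, 0 < F (dotp u (grad f y)).
  have [c0|c0] := ltP 0 cp.
    have [y yP] := exists_increasing u0 fx; exists y; rewrite (apow_pos _ _ p1 (ltW yP)); pos.
  have cm' : 0 < cm by move: c0 cpm; lra.
  have u0' : - u != 0 by rewrite oppr_eq0.
  have [y] := exists_increasing u0' fx.
  rewrite dotpNl => yP; exists y; rewrite (apow_neg _ _ p1); last by rewrite -oppr_ge0 ltW.
  pos.
by apply: integral_continuous_gt0 (@apow_grad_continuous u) _ (energy_integrable u) yP => x; exact: apow_ge0.
Qed.

End energy.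

#[global] Hint Resolve measurable_apow_dotp measurable_energy_integrand : meas.

Section radius.
Context {R : realType} {n : nat}.
Local Notation V := (@lebesgue_rV R n.+1).
Local Notation B := (@eball R n.+1).
Implicit Types (a r : R).

Definition ball_volume : R := fine (V (B 1)).

Lemma ball_volume_gt0 : 0 < ball_volume.
Proof. by apply: fine_gt0; rewrite lebesgue_eball_gt0//= lebesgue_eball_lty. Qed.

Lemma lebesgue_eballE r : 0 < r -> V (B r) = (r ^+ n.+1 * ball_volume)%:E.
Proof. by move=> r0; rewrite lebesgue_eball_scale// lebesgue_measure_fine_eball -EFinM. Qed.

Lemma radius_exists (A : set 'rV[R]_n.+1) D : measurable A -> A `<=` B D -> (0 < V A)%E ->
  exists2 a : R, 0 < a & V A = V (B a).
Proof.
move=> mA AD VA0; have VE := lebesgue_rV_fin mA AD.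
have v0 : 0 < fine (V A) by rewrite -lte_fin -VE.
exists ((fine (V A) / ball_volume) `^ n.+1%:R^-1).
  by rewrite powR_gt0// divr_gt0// ball_volume_gt0.
rewrite lebesgue_eballE ?powR_gt0 ?divr_gt0 ?ball_volume_gt0//.
rewrite -powR_mulrn ?powR_ge0// powRVK//; last by rewrite divr_ge0// ?ltW// ball_volume_gt0.
by rewrite divfK ?gt_eqF ?ball_volume_gt0.
Qed.

Lemma le_radius a b : 0 < a -> 0 < b -> (V (B a) <= V (B b))%E -> a <= b.
Proof.
move=> a0 b0; rewrite !lebesgue_eballE// lee_fin ler_pM2r ?ball_volume_gt0//.
by rewrite ler_pXn2r// nnegrE ltW.
Qed.

End radius.

#[global] Hint Resolve ball_volume_gt0 : pos.

Lemma exprn_diff_ge {R : realDomainType} (a h : R) n : 0 <= a -> 0 <= h ->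
  n.+1%:R * a ^+ n * h <= (a + h) ^+ n.+1 - a ^+ n.+1.
Proof.
move=> a0 h0; elim: n => [|n IH]; first by rewrite expr0; lra.
have H1 : a ^+ n.+1 * h <= (a + h) ^+ n.+1 * h.
  by apply: ler_wpM2r => //; rewrite lerXn2r ?nnegrE ?addr_ge0// lerDl.
have H2 := ler_wpM2l a0 IH.
rewrite [(a + h) ^+ n.+2]exprS [a ^+ n.+2]exprS.
move: H1 H2; rewrite [a ^+ n.+1]exprS; set X := (a + h) ^+ _; set Y := a ^+ n; set m := n.+1%:R; nra.
Qed.

Lemma le_of_linear_error {R : realFieldType} (X Y c h0 : R) : 0 < h0 ->
  (forall h : R, 0 < h -> h <= h0 -> X <= Y + h * c) -> X <= Y.
Proof.
move=> h00 H; apply/ler_addgt0Pr => e e0.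
have h1 : 0 < Num.min h0 (e / (`|c| + 1)) by rewrite lt_min h00 divr_gt0.
apply: le_trans (H _ h1 _) _; first by rewrite ge_min lexx.
rewrite lerD2l; apply: le_trans (_ : e / (`|c| + 1) * (`|c| + 1) <= _); last by rewrite divfK.
apply: le_trans (ler_norm _) _; rewrite normrM (gtr0_norm h1); apply: ler_pM => //.
- pos.
- by rewrite ge_min lexx orbT.
- by rewrite lerDl.
Qed.

(** * Energy of the layer between two levels *)

Section shell.
Context {R : realType} {n : nat}.
Local Notation V := (@lebesgue_rV R n.+1).
Local Notation B := (@eball R n.+1).
Variables (p cp cm : R).
Hypotheses (p1 : 1 <= p) (cp0 : 0 <= cp) (cm0 : 0 <= cm).
Local Notation F := (apow p cp cm).
Local Notation om := (@ball_volume R n).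
Variable f : 'rV[R]_n.+1 -> R.
Hypothesis sf : smooth_compact_support f.
Variables (Phi : set 'rV[R]_n.+1) (rho : R).
Hypotheses (mPhi : measurable Phi) (cPhi : isconvex Phi) (rho0 : 0 < rho)
  (bPhi : exists D, Phi `<=` B D) (VPhi : V Phi = V (B rho)).
Implicit Types (x y u w : 'rV[R]_n.+1) (s a h r D : R).

Local Notation Z := (fun x => directional_energy p cp cm Phi (grad f x)).
Local Notation E := (@ball_energy R n F ^~ rho).

Let mg : mfun (grad f). Proof. by apply: measurable_grad; case: sf. Qed.
Let mf : mfun f.
Proof. by apply: continuous_measurable_rV; apply: smooth_continuous; case: sf. Qed.

Lemma directional_energy_continuous : continuous (directional_energy p cp cm Phi).
Proof.
apply: locally_lipschitz_continuous => r; have [D PD] := bPhi.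
have [N N0 HN] := apow_lipschitz p1 cp0 cm0 (`|D| * `|r|).
pose c w w' := N * `|D| * enorm (w - w').
have c0 w w' : 0 <= c w w' by rewrite !mulr_ge0// enorm_ge0.
exists (N * `|D| * fine (V Phi)) => [|w w' wr wr']; first by rewrite !mulr_ge0// fine_ge0.
have aux v v' : enorm v <= r -> enorm v' <= r ->
    directional_energy p cp cm Phi v - directional_energy p cp cm Phi v' <= N * `|D| * fine (V Phi) * enorm (v - v').
  move=> vr vr'; have iB := integrable_cst_indic (c v v') mPhi PD.
  have -> : N * `|D| * fine (V Phi) * enorm (v - v') = \int[V]_x (c v v' * \1_Phi x).
    by rewrite (Rintegral_cst_indic (c0 v v') mPhi PD) /c; ring.
  have iv := integrable_apow_dotp p1 cp0 cm0 v' mPhi PD.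
  rewrite lerBlDr -RintegralD//.
  apply: le_Rintegral => //; first exact: (integrable_apow_dotp p1 cp0 cm0 v mPhi PD).
    have := integrableD measurableT iB iv.
    by [].
  move=> u _; rewrite indicE; case: (boolP (u \in Phi)) => [/set_mem/PD uD|_]; last by rewrite !mulr0.
  have uD' : enorm u <= `|D| by exact: le_trans (ltW uD) (ler_norm _).
  have bd z : enorm z <= r -> `|dotp u z| <= `|D| * `|r|.
    move=> zr; apply: le_trans (abs_dotp_le _ _) _; apply: ler_pM => //; rewrite ?enorm_ge0//.
    exact: le_trans zr (ler_norm _).
  rewrite !mulr1 -lerBlDr; apply: le_trans (ler_norm _) _; apply: le_trans (HN _ _ (bd _ vr) (bd _ vr')) _.
  rewrite /c -mulrA; apply: ler_wpM2l => //; rewrite -dotpBr; apply: le_trans (abs_dotp_le _ _) _.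
  by apply: ler_wpM2r; rewrite ?enorm_ge0.
rewrite ler_norml; apply/andP; split; last exact: aux.
by rewrite -[X in _ <= X]opprB lerN2 enormB; exact: aux.
Qed.

Lemma measurable_directional_energy : mfun Z.
Proof.
by apply: (measurableT_comp _ mg); apply: continuous_measurable_rV; exact: directional_energy_continuous.
Qed.

(** Let y be in the dual body and f(z + h y) >= r. Taylor's formula at z and [dual_body_pairing] for
    the gradient at z bound r - f(z) by h (Z(z) + (p - 1) E) / p up to O(h^2), so the superlevel set
    at r, moved by - h y, stays in the lowered one. [symmetrization_bound] then compares with
    balls. *)
Lemma level_step s : 0 < s -> exists2 C : R, 0 <= C & forall h r a, 0 < r -> 0 <= h -> 0 < a ->
  V [set x | r <= f x] = V (B a) ->
  (V (B (a + h * (E s / s))) <= V [set x | (r <= f x + h * ((Z x + (p - 1) * E s) / p + C * h))%R])%E.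
Proof.
move=> s0; have [D0 [M [C [[D00 M0 C0 fD gD] [_ gM fC _]]]]] := smooth_compact_bounds sf.
have [D1 PD1] := bPhi.
have [Y Y0 HY] := dual_body_bounded p1 cp0 cm0 ((p - 1) * E s) mPhi PD1.
have p0 : 0 < p by exact: lt_le_trans p1.
exists (C * Y ^+ 2) => [|h r a r0 h0 a0 VA]; first pos.
have [D [D0D D1D rhoD aD]] : exists D : R, [/\ D0 <= D, D1 <= D, rho <= D & a <= D].
  by exists (Num.max (Num.max D0 D1) (Num.max rho a)); rewrite !le_max !lexx !orbT.
(* [symmetrization_bound] adds h y to the points of its set; the reflection turns this into a motion
   by - h y, so that Taylor's formula starts at the moved point, where [Z] is evaluated. *)
pose A := [set x | r <= f (- x)].
have mA0 : measurable [set x | r <= f x] by meas.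
have mA : measurable A by meas.
pose Q x := (Z x + (p - 1) * E s) / p + C * Y ^+ 2 * h.
pose M0' := [set x | r <= f x + h * Q x].
have mM0 : measurable M0'.
  apply: measurable_le_set => //; apply: measurable_funD => //; apply: measurable_funM => //.
  apply: measurable_funD => //; apply: measurable_funM => //; apply: measurable_funD => //.
  exact: measurable_directional_energy.
have mM : measurable [set x | M0' (- x)].
  by apply: (@measurable_preim _ _ _ _ (fun x : 'rV[R]_n.+1 => - x)); meas.
rewrite -[leRHS]/(V M0') -(lebesgue_rV_opp mM0).
have F1 : forall M : R, exists N : R, forall t, `|t| <= M -> `|dapow p cp cm t| <= N.
  by move=> M'; exact: dapow_bounded.
apply: (@symmetrization_bound R n F (dapow p cp cm) p s rho (apow_ge0 p cp0 cm0) (apow0 cp cm p1)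
  (measurable_apow _ _ _) (measurable_dapow _ _ _) F1 (apow_tangent p1 cp0 cm0) (mul_dapow cp cm p1) p1 s0 rho0
  a h D A Phi [set x | M0' (- x)]) => //.
- by rewrite a0.
- by rewrite rho0.
- split => //; last by rewrite (lebesgue_rV_opp mA0).
  move=> x Ax; rewrite /eball/=; apply: (@lt_le_trans _ _ D0) => //.
  rewrite ltNge; apply/negP => xD; have := fD (- x); rewrite enormN => /(_ xD) fx.
  by move: Ax; rewrite /A/= fx leNgt r0.
- by split => // x /PD1 xD; apply: lt_le_trans D1D.
- move=> x y Ax yP; rewrite /M0'/=; set z := - (x + h *: y).
  have zx : - x = z + h *: y by rewrite /z opprD subrK.
  have yY := HY _ yP.
  have := dual_body_pairing p1 cp0 cm0 (grad f z) mPhi PD1 yP.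
  have := fC z (h *: y); rewrite -zx => /(le_trans (ler_norm _)) H1 H2.
  apply: le_trans Ax _; rewrite /Q.
  have H3 : C * enorm (h *: y) ^+ 2 <= C * Y ^+ 2 * h * h.
    rewrite -!mulrA; apply: ler_wpM2l => //; rewrite enormZ ger0_norm// exprMn.
    have : h ^+ 2 * enorm y ^+ 2 <= h ^+ 2 * Y ^+ 2.
      by apply: ler_wpM2l; [pos|rewrite lerXn2r ?nnegrE ?enorm_ge0].
    by move/le_trans; apply; apply: le_of_eq; ring.
  have H4 : h * dotp y (grad f z) <= h * ((directional_energy p cp cm Phi (grad f z) + (p - 1) * E s) / p).
    by apply: ler_wpM2l => //; rewrite ler_pdivlMr// mulrC.
  move: H1; rewrite dotpZr dotpC; move: H3 H4; rewrite [_ * (_ + _)]mulrDr [C * _ * h]mulrC.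
  set T1 := h * (_ / p); set T2 := h * dotp _ _; rewrite !mulrA; lra.
Qed.

End shell.

#[global] Hint Resolve measurable_directional_energy : meas.

Section shell.
Context {R : realType} {n : nat}.
Local Notation V := (@lebesgue_rV R n.+1).
Local Notation B := (@eball R n.+1).
Local Notation leb := (@lebesgue_measure R).
Variables (p cp cm : R).
Hypotheses (p1 : 1 <= p) (cp0 : 0 <= cp) (cm0 : 0 <= cm).
Local Notation F := (apow p cp cm).
Local Notation om := (@ball_volume R n).
Variable f : 'rV[R]_n.+1 -> R.
Hypothesis sf : smooth_compact_support f.
Variables (Phi : set 'rV[R]_n.+1) (rho : R).
Hypotheses (mPhi : measurable Phi) (cPhi : isconvex Phi) (rho0 : 0 < rho)
  (bPhi : exists D, Phi `<=` B D) (VPhi : V Phi = V (B rho)).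
Implicit Types (x y u w : 'rV[R]_n.+1) (s a h r D : R).

Local Notation Z := (fun x => directional_energy p cp cm Phi (grad f x)).
Local Notation E := (@ball_energy R n F ^~ rho).

Let mg : mfun (grad f). Proof. by apply: measurable_grad; case: sf. Qed.
Let mf : mfun f.
Proof. by apply: continuous_measurable_rV; apply: smooth_continuous; case: sf. Qed.
Let p0 : 0 < p. Proof. exact: lt_le_trans p1. Qed.
Let mZ : mfun Z. Proof. meas. Qed.

Definition shell s0 s1 : set 'rV[R]_n.+1 := [set x | s0 < f x < s1].

Lemma measurable_shell s0 s1 : measurable (shell s0 s1).
Proof.
rewrite (_ : shell s0 s1 = [set x | s0 < f x] `&` [set x | f x < s1]); last first.
  by apply/seteqP; split => x; [move/andP|move=> [? ?]; apply/andP].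
meas.
Qed.

Lemma superlevel_bounded : exists2 D : R, 0 < D & forall r, 0 <= r -> [set x | r < f x] `<=` B D.
Proof.
have [D D0 fD] := smooth_compact_vanishes sf; exists D => // r r0 x rx; rewrite /eball/= ltNge.
by apply/negP => /fD fx; move: rx; rewrite /= fx ltNge r0.
Qed.

Lemma shell_bounded : exists2 D : R, 0 < D & forall s0 s1, 0 <= s0 -> shell s0 s1 `<=` B D.
Proof.
have [D D0 HD] := superlevel_bounded; exists D => // s0 s1 s00 x /andP[H _].
exact: HD H.
Qed.

Lemma Z_bounded : exists2 Zm : R, 0 <= Zm & forall x, Z x <= Zm.
Proof.
have [D0 [M [C [[D00 M0 C0 fD gD] [_ gM _ _]]]]] := smooth_compact_bounds sf.
have [D1 PD1] := bPhi.
have [N N0 HN] := directional_energy_le p1 cp0 cm0 M mPhi PD1.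
by exists N => // x; apply: HN.
Qed.

Lemma integrable_shell (g : 'rV[R]_n.+1 -> R) (M : R) s0 s1 : mfun g -> (forall x, `|g x| <= M) ->
  0 <= s0 -> integrableV (fun x => g x * \1_(shell s0 s1) x).
Proof.
move=> mg' gM s00; have [D D0 HD] := shell_bounded.
apply: (@integrable_bounded_support R n.+1 _ D M).
- by apply: measurable_funM => //; apply: measurable_indic; exact: measurable_shell.
- by move=> x xD; rewrite indicE memNset ?mulr0// => /(HD _ _ s00).
- move=> x; rewrite indicE; case: (_ \in _); rewrite ?mulr1 ?mulr0 ?normr0//.
  exact: le_trans (gM x).
Qed.

Let leb_itv_oc (a b : R) : a <= b -> leb `]a, b] = (b - a)%:E.
Proof.
rewrite le_eqVlt => /predU1P[->|ab]; rewrite lebesgue_measure_itv/= lte_fin ?ltxx ?subrr//.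
by rewrite ab -EFinB.
Qed.

Let E_ge0 s : 0 <= E s.
Proof. by apply: Rintegral_ge0 => u _; rewrite mulr_ge0 ?apow_ge0//. Qed.

(** The gain (a + h E/s)^(n+1) - a^(n+1) is at least (n+1) a^n h E/s. The radius a of the level r is
    replaced by the smaller radius a1 of the top level s1, which gives one bound for the whole
    shell. *)
Lemma level_gain s s1 a1 h r C : 0 < s -> 0 < r -> r <= s1 -> 0 < h -> 0 < a1 ->
  V [set x | s1 <= f x] = V (B a1) ->
  (forall h r a, 0 < r -> 0 <= h -> 0 < a -> V [set x | r <= f x] = V (B a) ->
    (V (B (a + h * (E s / s))) <= V [set x | (r <= f x + h * ((Z x + (p - 1) * E s) / p + C * h))%R])%E) ->
  ((h * (n.+1%:R * om * (E s / s) * a1 ^+ n))%:E <=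
   V [set x | (f x < r <= f x + h * ((Z x + (p - 1) * E s) / p + C * h))%R])%E.
Proof.
move=> s0 r0 rs1 h0 a10 Va1 HC.
have Eb0 : 0 <= E s / s by pos.
pose A := [set x | r <= f x]; have mA : measurable A by exact: measurable_le_set.
have [D D0 HD] := superlevel_bounded.
have AD : A `<=` B D.
  by move=> x rx; apply: (HD (r / 2)); [lra|rewrite /=; apply: lt_le_trans rx; lra].
have VA1 : (V (B a1) <= V A)%E.
  rewrite -Va1; apply: le_lebesgue_rV => //; first meas.
  by move=> x s1x; exact: le_trans s1x.
have VA0 : (0 < V A)%E by apply: lt_le_trans VA1; exact: lebesgue_eball_gt0.
have [a a0 Va] := radius_exists mA AD VA0.
have a1a : a1 <= a by move: VA1; rewrite Va; exact: le_radius.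
pose M := [set x | (r <= f x + h * ((Z x + (p - 1) * E s) / p + C * h))%R].
have mq : mfun (fun x => f x + h * ((Z x + (p - 1) * E s) / p + C * h)) by meas.
have mM : measurable M by exact: measurable_le_set.
have HM : (V (B (a + h * (E s / s))) <= V M)%E by apply: HC => //; pos.
set W := [set x | _].
have WE : W = M `\` A.
  apply/seteqP; split => x; rewrite /W/M/A/=.
    by move=> /andP[fr ->]; split => //; apply/negP; rewrite -ltNge.
  by move=> [-> /negP]; rewrite -ltNge => ->.
have mW : measurable W by rewrite WE; meas.
have MW : (V M <= V W + V A)%E.
  apply: le_trans (measureU2 V mW mA); apply: le_lebesgue_rV => //; first meas.
  by move=> x Mx; rewrite WE; have [Ax|nAx] := pselect (A x); [right|left].
have := le_trans HM MW; rewrite Va lebesgue_eballE; last by pos.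
rewrite lebesgue_eballE// -leeBlDr// -EFinB; apply: le_trans; rewrite -mulrBl.
apply: (@le_trans _ _ (n.+1%:R * a ^+ n * (h * (E s / s)) * om)); last first.
  apply: ler_wpM2r; first exact/ltW/ball_volume_gt0.
  by apply: exprn_diff_ge; pos.
have -> : h * (n.+1%:R * om * (E s / s) * a1 ^+ n) = (h * n.+1%:R * om * (E s / s)) * a1 ^+ n by ring.
have -> : n.+1%:R * a ^+ n * (h * (E s / s)) * om = (h * n.+1%:R * om * (E s / s)) * a ^+ n by ring.
apply: ler_wpM2l.
  by rewrite mulr_ge0// !mulr_ge0//// ltW// ball_volume_gt0.
by rewrite lerXn2r ?nnegrE// ltW.
Qed.

(** Integrate [level_gain] over the levels r and exchange the integrals: for fixed x the levels with
    f x < r <= f x + h q x form an interval of length h q x. Dividing by h and letting h tend to 0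
    leaves the integral of (Z + (p - 1) E) / p over the shell. *)
Lemma shell_estimate s s0 s1 a1 : 0 < s -> 0 <= s0 -> s0 < s1 -> 0 < a1 ->
  V [set x | s1 <= f x] = V (B a1) ->
  p * (s1 - s0) * (n.+1%:R * om * (E s / s) * a1 ^+ n) <=
  \int[V]_x ((Z x + (p - 1) * E s) * \1_(shell s0 s1) x).
Proof.
move=> sp s00 s01 a10 Va1; set K := n.+1%:R * om * (E s / s) * a1 ^+ n.
have [C C0 HC] := level_step p1 cp0 cm0 sf mPhi cPhi rho0 bPhi VPhi sp.
have [Zm Zm0 HZ] := Z_bounded.
have E0 : 0 <= E s by exact: E_ge0.
have G0 x : 0 <= Z x + (p - 1) * E s.
  by rewrite addr_ge0 ?directional_energy_ge0// mulr_ge0// subr_ge0.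
have [D D0 HD] := shell_bounded.
pose S := shell s0 s1; have mS : measurable S by exact: measurable_shell.
have SD : S `<=` B D by exact: HD.
set T := \int[V]_x _.
pose Qm := (Zm + (p - 1) * E s) / p + C.
pose vs := fine (V S).
suff H h : 0 < h -> h <= 1 -> (s1 - s0 - h * Qm) * K <= T / p + h * (C * vs).
  have : (s1 - s0) * K <= T / p.
    apply: (@le_of_linear_error R _ _ (Qm * K + C * vs) 1) => // h h0 h1.
    have -> : h * (Qm * K + C * vs) = h * (C * vs) + h * Qm * K by ring.
    by rewrite addrA -lerBlDr -mulrBl; exact: H.
  by rewrite ler_pdivlMr// -mulrA mulrC.
move=> h0 h1; pose q x := (Z x + (p - 1) * E s) / p + C * h.
have q0 x : 0 <= q x by rewrite addr_ge0 ?mulr_ge0// ?invr_ge0 ltW.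
have qQ x : q x <= Qm.
  apply: lerD; last by rewrite ler_piMr.
  by rewrite ler_pM2r ?invr_gt0// lerD2r.
have mq : mfun q.
  by apply: measurable_funD => //; apply: measurable_funM => //; apply: measurable_funD.
have Qm0 : 0 <= Qm by exact: le_trans (qQ 0).
have mfq : mfun (fun x => f x + h * q x).
  by apply: measurable_funD => //; apply: measurable_funM.
have RHS : \int[V]_x (h * q x * \1_S x) = h * (T / p + h * (C * vs)).
  have i1 : integrableV (fun x => (Z x + (p - 1) * E s) * \1_S x).
    apply: (@integrable_shell _ (Zm + (p - 1) * E s)) => //; first exact: measurable_funD.
    by move=> x; rewrite ger0_norm// lerD2r.
  have i2 := integrable_cst_indic (h * (C * h)) mS SD.
  have i3 : integrableV (fun x => h / p * ((Z x + (p - 1) * E s) * \1_S x)).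
    have := integrableZl measurableT (h / p) i1.
    by apply: eq_integrable => // x _; rewrite /= EFinM.
  transitivity (\int[V]_x (h / p * ((Z x + (p - 1) * E s) * \1_S x) + h * (C * h) * \1_S x)).
    by apply: eq_Rintegral => x _; rewrite /q; ring.
  rewrite RintegralD// RintegralZl// -/T (Rintegral_cst_indic _ mS SD); last by rewrite !mulr_ge0// ltW.
  by rewrite /vs; ring.
rewrite -(ler_pM2l h0) -RHS.
have [L0|L0] := leP (s1 - s0 - h * Qm) 0.
  apply: le_trans (_ : 0 <= _); last first.
    by apply: Rintegral_ge0 => x _; rewrite !mulr_ge0 ?indicE// ltW.
  rewrite pmulr_rle0//; apply: mulr_le0_ge0 => //.
  rewrite !mulr_ge0 ?exprn_ge0 ?invr_ge0//; try exact: ltW; exact/ltW/ball_volume_gt0.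
(* The levels start at s0 + h Qm, so that f x >= r - h q x exceeds s0 and x lies in the shell. *)
pose I : set R := `]s0 + h * Qm, s1]%classic.
have ihq : integrableV (fun x => h * q x * \1_S x).
  apply: (@integrable_shell _ (h * Qm)) => //; first exact: measurable_funM.
  by move=> x; rewrite ger0_norm; [rewrite ler_pM2l|rewrite mulr_ge0// ltW].
rewrite -lee_fin /Rintegral fineK; last exact: integrable_fin_num ihq.
pose W : set (R * 'rV[R]_n.+1) := [set z | I z.1 /\ (f z.2 < z.1 <= f z.2 + h * q z.2)].
have mW : measurable W.
  rewrite (_ : W = (fst @^-1` I) `&` ([set z | f z.2 < z.1] `&` [set z | z.1 <= f z.2 + h * q z.2])); last first.
    by apply/seteqP; split => z /=; [move=> [? /andP[]]|move=> [? [? ?]]; split => //; apply/andP].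
  apply: measurableI; first by apply: measurable_preim => //; exact: measurable_itv.
  apply: measurableI; first exact: (measurable_lt_set (measurableT_comp mf measurable_snd) measurable_fst).
  exact: (measurable_le_set measurable_fst (measurableT_comp mfq measurable_snd)).
have mWE : mfun (fun z => (\1_W z : R)%:E) by exact: measurable_indicE.
apply: (@le_trans _ _ (\int[leb]_r \int[V]_x (\1_W (r, x) : R)%:E)%E); last first.
  rewrite (@fubini_tonelli _ _ _ _ _ leb V (fun z => (\1_W z : R)%:E))//.
  apply: ge0_le_integral_any => x _; first by apply: integral_ge0 => r _; exact: indic_ge0.
  have [Sx|nSx] := pselect (S x); last first.
    rewrite integral0_eq ?lee_fin; first pos.
    move=> r _; rewrite indicE memNset// => -[/=]; rewrite /I/= in_itv/= => /andP[Ir rs] /andP[fr rf].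
    apply: nSx; rewrite /S/shell/=; apply/andP; split; last exact: lt_le_trans rs.
    have : h * q x <= h * Qm by rewrite ler_pM2l.
    by lra.
  apply: (@le_trans _ _ (\int[leb]_r (\1_([set r : R | (f x < r <= f x + h * q x)%R]) r : R)%:E)%E).
    apply: ge0_le_integral_any => r _ //; rewrite lee_fin !indicE; case: (boolP ((r, x) \in W)) => [/set_mem[_ rx]|_]; last by [].
    by rewrite mem_set.
  rewrite -measure_indic// (_ : [set r | _] = `]f x, f x + h * q x]%classic)//.
  apply: (@le_trans _ _ (f x + h * q x - f x)%:E).
    by apply: le_of_eq; apply: leb_itv_oc; rewrite lerDl mulr_ge0// ltW.
  by rewrite indicE mem_set// mulr1 addrAC subrr add0r.
apply: (@le_trans _ _ (\int[leb]_r ((h * K)%:E * (\1_I r : R)%:E))%E).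
  rewrite ge0_integralZl//; last 2 first.
  - meas.
  - by rewrite lee_fin !mulr_ge0 ?exprn_ge0 ?invr_ge0//; try pos; exact/ltW/ball_volume_gt0.
  rewrite -measure_indic; last meas.
  apply: (@le_trans _ _ ((h * K)%:E * (s1 - (s0 + h * Qm))%:E)%E); last first.
    apply: le_of_eq; congr (_ * _)%E; apply: esym; apply: leb_itv_oc; lra.
  by rewrite -EFinM lee_fin; apply: le_of_eq; ring.
apply: ge0_le_integral_any => r _.
  by rewrite lee_fin !mulr_ge0 ?exprn_ge0 ?invr_ge0//; try pos; exact/ltW/ball_volume_gt0.
have [Ir|nIr] := pselect (I r); last first.
  by rewrite indicE memNset// mule0; apply: integral_ge0 => x _; pos.
rewrite indicE mem_set// mule1.
have := Ir; rewrite /I/= in_itv/= => /andP[Ir1 Ir2].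
have r0 : 0 < r by apply: le_lt_trans Ir1; rewrite addr_ge0// mulr_ge0// ltW.
apply: le_trans (level_gain sp r0 Ir2 h0 a10 Va1 HC) _.
set X := [set x | _].
have mX : measurable X.
  rewrite (_ : X = [set x | f x < r] `&` [set x | r <= f x + h * q x]); last first.
    by apply/seteqP; split => z; [move=> /andP[]|move=> [? ?]; apply/andP].
  meas.
rewrite (measure_indic V mX); apply: ge0_le_integral_any => x _ //.
by rewrite lee_fin !indicE; case: (boolP (x \in X)) => [/set_mem Xx|//]; rewrite mem_set.
Qed.

End shell.

#[global] Hint Resolve measurable_shell : meas.

(** * Summation over the levels *)

Section riemann.
Context {R : realType}.
Variables (n : nat) (p : R).
Hypotheses (p1 : 1 <= p) (pn : p < n.+1%:R).

(* The p-capacity of the unit ball is om * kap, kap = n.+1 * exponent ^ (p - 1); at p = 1 the junk value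
   exponent = 0 still gives kap = n.+1, since 0 `^ 0 = 1. *)
Definition exponent : R := (n.+1%:R - p) / (p - 1).
Definition kap : R := n.+1%:R * exponent `^ (p - 1).
Local Notation beta := exponent.

Lemma kap_gt0 : 0 < kap.
Proof.
rewrite mulr_gt0//; have [->|pn1] := eqVneq p 1; first by rewrite subrr powRr0.
by rewrite powR_gt0// divr_gt0// subr_gt0// lt_neqAle eq_sym pn1.
Qed.

Variables (M : nat) (a : R) (av T : nat -> R).
Hypotheses (M0 : (0 < M)%N) (avM : av M = a) (av0 : forall i, (i <= M)%N -> 0 < av i)
  (avS : forall i, (i < M)%N -> av i.+1 <= av i)
  (HT : forall i (s : R), (i < M)%N -> 0 < s -> p / M%:R * (n.+1%:R * s `^ (p - 1) * av i.+1 ^+ n) <=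
     T i + (p - 1) * s `^ p * (av i ^+ n.+1 - av i.+1 ^+ n.+1)).

Let a0 : 0 < a. Proof. by rewrite -avM; exact: av0. Qed.
Let M0' : 0 < M%:R :> R. Proof. by rewrite ltr0n. Qed.
Let p0 : 0 < p. Proof. exact: lt_le_trans p1. Qed.

Lemma av_ge i : (i <= M)%N -> a <= av i.
Proof.
move=> iM; have : forall k, (k <= M)%N -> av M <= av (M - k).
  elim=> [|k IH] kM; first by rewrite subn0.
  apply: le_trans (IH (ltnW kM)) _; rewrite -(subSS k) subSn//; apply: avS.
  by rewrite ltn_subrL/= M0.
by move=> /(_ (M - i)%N (leq_subr _ _)); rewrite avM subKn.
Qed.

Lemma riemann_bound1 : p = 1 -> n.+1%:R * a ^+ n <= \sum_(0 <= i < M) T i.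
Proof.
move=> pE; apply: le_trans (_ : \sum_(0 <= i < M) (M%:R^-1 * (n.+1%:R * a ^+ n)) <= _).
  by rewrite big_const_nat subn0 iter_addr_0 -[leRHS]mulr_natl mulrA mulfV ?mul1r// gt_eqF.
rewrite !big_mkord; apply: ler_sum => i _.
have := HT (ltn_ord i) ltr01; rewrite !powR1 pE subrr !mul0r addr0 mul1r mulr1; apply: le_trans.
rewrite ler_pM2l ?invr_gt0// ler_pM2l// lerXn2r ?av_ge//; first pos.
exact/ltW/av0.
Qed.

(** At the slope chosen below, s^(p-1) (av i)^n is a constant K. The tangent inequalities for the
    exponential, for t^(n+1) and for t^(-beta) then leave only differences of ln av and of
    av^(-beta), which telescope. *)
Lemma riemann_step i : 1 < p -> (i < M)%N ->
  kap * a `^ (n.+1%:R - p) * (p / M%:R * (1 + n%:R * (ln (av i.+1) - ln (av i)))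
    - (p - 1) * (a `^ beta * (av i.+1 `^ (- beta) - av i `^ (- beta)))) <= T i.
Proof.
move=> p1' iM; have ai := av0 (ltnW iM); have ai1 := av0 iM.
have pm : 0 < p - 1 by pos.
have b0 : 0 < beta by rewrite divr_gt0// subr_gt0.
(* The absolute slope at radius [av i] of the extremal profile (t / a)^(-beta), for which the flux
   s^(p-1) t^n does not depend on t. *)
pose s := beta * a `^ beta * av i `^ (- beta - 1).
have s0 : 0 < s by apply: mulr_gt0; [apply: mulr_gt0 => //|]; pos.
pose K := beta `^ (p - 1) * a `^ (n.+1%:R - p).
have K0 : 0 < K by rewrite mulr_gt0// powR_gt0.
have sK : s `^ (p - 1) * av i ^+ n = K.
  rewrite /s (powRM _ (mulr_ge0 (ltW b0) (powR_ge0 _ _)) (powR_ge0 _ _)) (powRM _ (ltW b0) (powR_ge0 _ _)).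
  rewrite -!powRrM.
  have -> : beta * (p - 1) = n.+1%:R - p by rewrite /exponent divfK// gt_eqF.
  have -> : (- beta - 1) * (p - 1) = - n%:R.
    by rewrite /exponent; field; rewrite gt_eqF.
  by rewrite (powR_invn _ (ltW ai)) -mulrA mulVf ?mulr1// expf_neq0// gt_eqF.
have H := HT iM s0.
have H1 : K * (1 + n%:R * (ln (av i.+1) - ln (av i))) <= s `^ (p - 1) * av i.+1 ^+ n.
  have r0 : 0 < av i.+1 / av i by pos.
  have -> : s `^ (p - 1) * av i.+1 ^+ n = K * (av i.+1 / av i) `^ n%:R.
    rewrite -sK (powR_mulrn _ (ltW r0)) expr_div_n -!mulrA; congr (_ * _).
    by rewrite mulrCA mulfV ?mulr1// expf_neq0// gt_eqF.
  apply: ler_wpM2l; first pos.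
  by have := powR_ge_ln n%:R r0; rewrite ln_div.
have H2 : av i ^+ n.+1 - av i.+1 ^+ n.+1 <= n.+1%:R * av i ^+ n * (av i - av i.+1).
  have N1 : 1 <= n.+1%:R :> R by rewrite ler1n.
  have := powR_tangent N1 ai (ltW ai1); rewrite !(powR_mulrn _ (ltW ai)) (powR_mulrn _ (ltW ai1)) -{2}natr1 addrK (powR_mulrn _ (ltW ai)).
  lra.
have H3 : s * (av i - av i.+1) <= a `^ beta * (av i.+1 `^ (- beta) - av i `^ (- beta)).
  have := powRN_tangent (ltW b0) ai ai1 => H3.
  have -> : s * (av i - av i.+1) = a `^ beta * (- (beta * av i `^ (- beta - 1) * (av i.+1 - av i))).
    by rewrite /s; ring.
  apply: ler_wpM2l; first pos.
  move: H3; lra.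
have H4 : (p - 1) * s `^ p * (av i ^+ n.+1 - av i.+1 ^+ n.+1) <=
    (p - 1) * (n.+1%:R * K * (a `^ beta * (av i.+1 `^ (- beta) - av i `^ (- beta)))).
  rewrite -mulrA; apply: ler_wpM2l; first pos.
  apply: le_trans (ler_wpM2l (powR_ge0 _ _) H2) _.
  rewrite -(mulr_powRB1 (ltW s0) p0).
  have -> : s * s `^ (p - 1) * (n.+1%:R * av i ^+ n * (av i - av i.+1)) =
    n.+1%:R * (s `^ (p - 1) * av i ^+ n) * (s * (av i - av i.+1)) by ring.
  by rewrite sK; apply: ler_wpM2l => //; rewrite mulr_ge0// ltW.
have H5 : p / M%:R * (n.+1%:R * (K * (1 + n%:R * (ln (av i.+1) - ln (av i))))) <=
   p / M%:R * (n.+1%:R * s `^ (p - 1) * av i.+1 ^+ n).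
  rewrite -[n.+1%:R * _ * av i.+1 ^+ n]mulrA; apply: ler_wpM2l; first pos.
  exact: ler_wpM2l.
have -> : kap * a `^ (n.+1%:R - p) = n.+1%:R * K by rewrite /kap /K mulrA.
have := le_trans H5 (le_trans H (lerD (lexx (T i)) H4)).
set X := 1 + _; set Y := a `^ beta * _; rewrite -lerBlDr; apply: le_trans.
by apply: le_of_eq; ring.
Qed.

(** The main terms sum to p - (p - 1) = 1 times kap a^(n+1-p). What remains is a nonnegative term
    and the error p n ln(av 0 / a) / M, which tends to 0 if [av 0] and a stay fixed while M
    grows. *)
Lemma riemann_bound : kap * a `^ (n.+1%:R - p) * (1 - (p * n%:R * (ln (av 0%N) - ln a)) / M%:R) <=
  \sum_(0 <= i < M) T i.
Proof.
have L0 : 0 <= ln (av 0%N) - ln a.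
  by rewrite subr_ge0 ler_ln ?posrE ?av0//; exact: av_ge.
have [pE|pn1] := eqVneq p 1.
  apply: le_trans (riemann_bound1 pE); rewrite /kap pE subrr powRr0 mulr1.
  have -> : n.+1%:R - 1 = n%:R :> R by rewrite -natr1 addrK.
  rewrite (powR_mulrn _ (ltW a0)); apply: ler_piMr; first pos.
  by rewrite gerBl divr_ge0// mulr_ge0.
have p1' : 1 < p by rewrite lt_neqAle eq_sym pn1.
pose c := kap * a `^ (n.+1%:R - p).
have c0 : 0 <= c by rewrite mulr_ge0 ?powR_ge0// ltW// kap_gt0.
apply: (@le_trans _ _ (\sum_(0 <= i < M) c * (p / M%:R * (1 + n%:R * (ln (av i.+1) - ln (av i)))
    - (p - 1) * (a `^ beta * (av i.+1 `^ (- beta) - av i `^ (- beta)))))); last first.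
  by rewrite !big_mkord; apply: ler_sum => i _; exact: riemann_step.
rewrite -mulr_sumr; apply: ler_wpM2l => //.
rewrite sumrB -!mulr_sumr big_split/= -mulr_sumr.
rewrite (telescope_sumr (fun i => ln (av i)))// (telescope_sumr (fun i => av i `^ (- beta)))//.
rewrite big_const_nat subn0 iter_addr_0 avM.
have -> : a `^ beta * (a `^ (- beta) - av 0%N `^ (- beta)) = 1 - a `^ beta * av 0%N `^ (- beta).
  by rewrite mulrBr powRN mulfV// gt_eqF// powR_gt0.
set X := _ * av 0%N `^ _; have X0 : 0 <= (p - 1) * X by rewrite mulr_ge0 ?subr_ge0// mulr_ge0// powR_ge0.
have -> : p / M%:R * (1 *+ M + n%:R * (ln a - ln (av 0%N))) = p - (p * n%:R * (ln (av 0%N) - ln a)) / M%:R.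
  by field; rewrite gt_eqF.
move: X0; set Q := _ / M%:R; lra.
Qed.

End riemann.

Lemma le_of_inv_nat {R : realType} (X Y c : R) : (forall M : nat, (0 < M)%N -> X <= Y + c / M%:R) -> X <= Y.
Proof.
move=> H; apply/ler_addgt0Pr => e e0; have [M HM] : exists M : nat, `|c| / e < M.+1%:R.
  by exists (Num.trunc (`|c| / e)); exact: truncnS_gt.
apply: le_trans (H M.+1 isT) _; rewrite lerD2l ler_pdivrMr//.
apply: le_trans (ler_norm _) _; rewrite mulrC -ler_pdivrMr//; pos.
Qed.

Section total.
Context {R : realType} {n : nat}.
Local Notation V := (@lebesgue_rV R n.+1).
Local Notation B := (@eball R n.+1).
Variables (p cp cm : R).
Hypotheses (p1 : 1 <= p) (pn : p < n.+1%:R) (cp0 : 0 <= cp) (cm0 : 0 <= cm).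
Local Notation F := (apow p cp cm).
Local Notation om := (@ball_volume R n).
Implicit Types (x y u w : 'rV[R]_n.+1) (s a h r D : R).

Lemma directional_energyZ (Phi : set 'rV[R]_n.+1) D s w : measurable Phi -> Phi `<=` B D -> 0 <= s ->
  directional_energy p cp cm Phi (s *: w) = s `^ p * directional_energy p cp cm Phi w.
Proof.
move=> mP PD s0; rewrite /directional_energy -RintegralZl//; last exact: (integrable_apow_dotp p1 cp0 cm0 w mP PD).
by apply: eq_Rintegral => u _; rewrite dotpZr apowM// mulrA.
Qed.

Lemma ball_energyE s r : @ball_energy R n F s r = directional_energy p cp cm (B r) (s *: delta_mx 0 ord0).
Proof. by apply: eq_Rintegral => u _; rewrite dotpZr. Qed.

Lemma ball_energyZ s r : 0 <= s -> @ball_energy R n F s r = s `^ p * @ball_energy R n F 1 r.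
Proof.
move=> s0; rewrite !ball_energyE (directional_energyZ _ (@measurable_eball R n.+1 r) (@subset_refl _ _) s0).
by rewrite scale1r.
Qed.

Variable f : 'rV[R]_n.+1 -> R.
Hypothesis sf : smooth_compact_support f.
Variables (Phi : set 'rV[R]_n.+1) (rho : R).
Hypotheses (mPhi : measurable Phi) (cPhi : isconvex Phi) (rho0 : 0 < rho)
  (bPhi : exists D, Phi `<=` B D) (VPhi : V Phi = V (B rho)).

Local Notation Z := (fun x => directional_energy p cp cm Phi (grad f x)).
Local Notation I := (@ball_energy R n F 1 rho).

Let mg : mfun (grad f). Proof. by apply: measurable_grad; case: sf. Qed.
Let mf : mfun f.
Proof. by apply: continuous_measurable_rV; apply: smooth_continuous; case: sf. Qed.
Let p0 : 0 < p. Proof. exact: lt_le_trans p1. Qed.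
Let mZ : mfun Z. Proof. meas. Qed.
Let Z0 x : 0 <= Z x. Proof. exact: directional_energy_ge0. Qed.

Lemma integrable_Z : integrableV Z.
Proof.
have [D0 [M [C [[D00 M0 C0 fD gD] [_ gM _ _]]]]] := smooth_compact_bounds sf.
have [N N0 HN] := Z_bounded p1 cp0 cm0 sf mPhi bPhi.
apply: (@integrable_bounded_support R n.+1 _ D0 N) => //.
- move=> x /negP; rewrite -leNgt => /gD/eqP; rewrite enorm_eq0 => /eqP ->.
  have [D PD] := bPhi.
  by rewrite -(scale0r 0) (directional_energyZ _ mPhi PD)// powR0 ?mul0r// gt_eqF.
- by move=> x; rewrite ger0_norm.
Qed.

Let integrable_Z_shell s0 s1 : 0 <= s0 ->
  integrableV (fun x => Z x * \1_(shell f s0 s1) x).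
Proof.
move=> s00; have [N N0 HN] := Z_bounded p1 cp0 cm0 sf mPhi bPhi.
by apply: integrable_shell => // x; rewrite ger0_norm.
Qed.

Lemma sum_shells (M k : nat) : (0 < M)%N ->
  \sum_(0 <= i < k) \int[V]_x (Z x * \1_(shell f (i%:R / M%:R) (i.+1%:R / M%:R)) x) <= \int[V]_x Z x.
Proof.
move=> M0; have M0' : 0 < M%:R :> R by rewrite ltr0n.
have nn (i : nat) : 0 <= i%:R / M%:R :> R by [].
apply: (@le_trans _ _ (\int[V]_x (Z x * \1_(shell f 0 (k%:R / M%:R)) x))); last first.
  apply: le_Rintegral => //; [exact: integrable_Z_shell|exact: integrable_Z|].
  by move=> x _; rewrite indicE; case: (_ \in _); rewrite ?mulr1// mulr0.
elim: k => [|k IH].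
  by rewrite big_nil; apply: Rintegral_ge0 => x _; rewrite mulr_ge0//.
rewrite big_nat_recr//=; apply: le_trans (lerD IH (lexx _)) _.
rewrite -RintegralD//; [|exact: integrable_Z_shell|exact: integrable_Z_shell].
apply: le_Rintegral => //; last 1 first.
- move=> x _; rewrite -mulrDr; apply: ler_wpM2l => //.
  have kk : k%:R / M%:R <= k.+1%:R / M%:R :> R by rewrite ler_pM2r ?invr_gt0// ler_nat.
  rewrite !indicE; case: (boolP (x \in shell f 0 (k%:R / M%:R))) => [/set_mem/andP[H1 H2]|_].
    rewrite memNset; last by move=> /andP[H3 _]; move: (lt_trans H2 H3); rewrite ltxx.
    by rewrite mem_set ?addr0//; apply/andP; split => //; exact: lt_le_trans kk.
  case: (boolP (x \in _)) => [/set_mem/andP[H1 H2]|_]; last by rewrite addr0.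
  by rewrite mem_set ?add0r//; apply/andP; split => //; exact: le_lt_trans (nn k) H1.
- have := integrableD measurableT (@integrable_Z_shell 0 (k%:R / M%:R) (lexx _)) (@integrable_Z_shell (k%:R / M%:R) (k.+1%:R / M%:R) (nn k)).
  by [].
- exact: integrable_Z_shell.
Qed.

Lemma shell_volume (s0 s1 a0 a1 : R) : s0 < s1 -> 0 <= s0 -> 0 < a0 -> 0 < a1 ->
  (V [set x | (s0 < f x)%R] <= V (B a0))%E -> V [set x | s1 <= f x] = V (B a1) ->
  fine (V (shell f s0 s1)) <= om * (a0 ^+ n.+1 - a1 ^+ n.+1).
Proof.
move=> s01 s00 a00 a10 H0 H1.
have mS : measurable (shell f s0 s1) by meas.
have m1 : measurable [set x | s1 <= f x] by meas.
have [D D0 HD] := shell_bounded sf.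
have VE : V (shell f s0 s1) = (fine (V (shell f s0 s1)))%:E by apply: lebesgue_rV_fin (HD _ _ s00).
have E : V (shell f s0 s1 `|` [set x | s1 <= f x]) = (V (shell f s0 s1) + V [set x | (s1 <= f x)%R])%E.
  apply: measureU => //; apply/seteqP; split => // x [/andP[_ H]] /=.
  by rewrite leNgt H.
have : (V (shell f s0 s1 `|` [set x | (s1 <= f x)%R]) <= V (B a0))%E.
  apply: le_trans H0; apply: le_lebesgue_rV.
  - meas.
  - meas.
  - by move=> x [/andP[]//|/=]; exact: lt_le_trans.
rewrite E VE H1 !lebesgue_eballE// -EFinD lee_fin -lerBrDr => H; apply: le_trans H _.
by rewrite -mulrBl mulrC.
Qed.

Lemma total_energy_ge a : 0 < a -> V [set x | 1 <= f x] = V (B a) ->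
  I * om * (kap n p * a `^ (n.+1%:R - p)) <= \int[V]_x Z x.
Proof.
move=> a0 Va; have I0 : 0 <= I by apply: Rintegral_ge0 => u _; rewrite mulr_ge0 ?apow_ge0// indicE.
have TZ0 : 0 <= \int[V]_x Z x by apply: Rintegral_ge0.
have om0 := @ball_volume_gt0 R n.
have [->|In0] := eqVneq I 0; first by rewrite !mul0r.
have {In0} I0 : 0 < I by rewrite lt_neqAle eq_sym In0.
have Io : 0 < I * om by pos.
rewrite mulrC -ler_pdivlMr//; set X := kap _ _ * _.
have [D D0 HD] := superlevel_bounded sf.
pose c := X * (p * n%:R * (ln D - ln a)).
apply: (@le_of_inv_nat _ _ _ c) => M M0; have M0' : 0 < M%:R :> R by rewrite ltr0n.
have nn (i : nat) : 0 <= i%:R / M%:R :> R by pos.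
have mle r : measurable [set x | r <= f x] by meas.
have rad (i : nat) : exists b : R, 0 < b /\ ((0 < i <= M)%N -> V [set x | i%:R / M%:R <= f x] = V (B b)).
  have [/andP[i0 iM]|iM] := boolP (0 < i <= M)%N; last by exists 1; rewrite ltr01.
  have i0' : 0 < i%:R / M%:R :> R by rewrite divr_gt0// ltr0n.
  have [] := @radius_exists R n [set x | i%:R / M%:R <= f x] D (mle _).
  - by move=> x ix; apply: (HD (i%:R / M%:R / 2)); [lra|rewrite /=; apply: lt_le_trans ix; lra].
  - apply: (@lt_le_trans _ _ (V [set x | 1 <= f x])); first by rewrite Va lebesgue_eball_gt0.
    by apply: le_lebesgue_rV => // x; apply: le_trans; rewrite ler_pdivrMr// mul1r ler_nat.
  by move=> b b0 Vb; exists b.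
have [b bP] := choice rad.
(* The level 0 gets the radius D of a ball containing the set 0 < f: the set 0 <= f contains the
   complement of the support and has infinite volume. *)
pose av i := if i is 0%N then D else b i.
have Vav i : (0 < i <= M)%N -> V [set x | i%:R / M%:R <= f x] = V (B (av i)).
  by case: i => // i; exact: (bP i.+1).2.
have av0 i : 0 < av i by case: i => // i; exact: (bP i.+1).1.
have avM : av M = a.
  have VM : V (B (av M)) = V (B a).
    by rewrite -(Vav M) ?M0 ?leqnn// divff ?gt_eqF.
  by apply/le_anti/andP; split; apply: (@le_radius R n) => //; rewrite VM.
have sub i : (i < M)%N -> (V [set x | (i%:R / M%:R < f x)%R] <= V (B (av i)))%E.
  case: i => [|i] iM.
    apply: le_lebesgue_rV; [meas|meas|].
    by move=> x; rewrite mul0r => H; exact: (HD 0).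
  rewrite -(Vav i.+1 (ltnW iM)); apply: le_lebesgue_rV; [meas|exact: mle|].
  by move=> x /ltW.
have lt_step i : i%:R / M%:R < i.+1%:R / M%:R :> R by rewrite ltr_pM2r ?invr_gt0// ltr_nat.
have avS i : (i < M)%N -> av i.+1 <= av i.
  move=> iM; apply: le_radius; [exact: av0|exact: av0|]; apply: le_trans (sub i iM).
  rewrite -(Vav i.+1 iM); apply: le_lebesgue_rV; [exact: mle|meas|].
  by move=> x; exact: lt_le_trans.
pose T i := (\int[V]_x (Z x * \1_(shell f (i%:R / M%:R) (i.+1%:R / M%:R)) x)) / (I * om).
have HT i s : (i < M)%N -> 0 < s -> p / M%:R * (n.+1%:R * s `^ (p - 1) * av i.+1 ^+ n) <=
     T i + (p - 1) * s `^ p * (av i ^+ n.+1 - av i.+1 ^+ n.+1).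
  move=> iM s0; have [D' D'0 HD'] := shell_bounded sf.
  have mS : measurable (shell f (i%:R / M%:R) (i.+1%:R / M%:R)) by meas.
  have := shell_estimate p1 cp0 cm0 sf mPhi cPhi rho0 bPhi VPhi s0 (nn i) (lt_step i) (av0 i.+1) (Vav i.+1 iM).
  have SV := shell_volume (lt_step i) (nn i) (av0 i) (av0 i.+1) (sub i iM) (Vav i.+1 iM).
  have E0 : 0 <= (p - 1) * @ball_energy R n F s rho.
    by rewrite (ball_energyZ _ (ltW s0)) mulr_ge0 ?subr_ge0// mulr_ge0 ?powR_ge0// ltW.
  have -> : \int[V]_x ((Z x + (p - 1) * @ball_energy R n F s rho) * \1_(shell f (i%:R / M%:R) (i.+1%:R / M%:R)) x) =
      T i * (I * om) + (p - 1) * @ball_energy R n F s rho * fine (V (shell f (i%:R / M%:R) (i.+1%:R / M%:R))).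
    rewrite /T divfK ?gt_eqF// -(Rintegral_cst_indic E0 mS (HD' _ _ (nn i))) -RintegralD//.
    - by apply: eq_Rintegral => x _; rewrite mulrDl.
    - exact: integrable_Z_shell.
    - exact: integrable_cst_indic mS (HD' _ _ (nn i)).
  move/le_trans => /(_ _ (lerD (lexx _) (ler_wpM2l E0 SV))).
  rewrite (ball_energyZ _ (ltW s0)).
  have -> : s `^ p * I / s = s `^ (p - 1) * I.
    by rewrite -(mulr_powRB1 (ltW s0) p0); field; rewrite gt_eqF.
  have -> : p * (i.+1%:R / M%:R - i%:R / M%:R) * (n.+1%:R * om * (s `^ (p - 1) * I) * av i.+1 ^+ n) =
     (p / M%:R * (n.+1%:R * s `^ (p - 1) * av i.+1 ^+ n)) * (I * om).
    by rewrite -[i.+1%:R]natr1; field; rewrite gt_eqF.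
  have -> : T i * (I * om) + (p - 1) * (s `^ p * I) * (om * (av i ^+ n.+1 - av i.+1 ^+ n.+1)) =
    (T i + (p - 1) * s `^ p * (av i ^+ n.+1 - av i.+1 ^+ n.+1)) * (I * om) by ring.
  by rewrite ler_pM2r.
have := riemann_bound p1 pn M0 avM (fun i _ => av0 i) avS HT.
rewrite -/X /T -mulr_suml => H.
have := le_trans H (ler_wpM2r (ltW (_ : 0 < (I * om)^-1)) (sum_shells M M0)).
rewrite invr_gt0 => /(_ Io); rewrite /c; set Y := _ / (I * om).
set Q := p * n%:R * _ => HQ; rewrite -lerBlDr; apply: le_trans HQ.
by apply: le_of_eq; ring.
Qed.

Lemma integral_Z_energy : \int[V]_x Z x = \int[V]_u (energy p cp cm f u * \1_Phi u).
Proof.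
pose h (z : 'rV[R]_n.+1 * 'rV[R]_n.+1) := (F (dotp z.2 (grad f z.1)) * \1_Phi z.2)%:E.
have mh : mfun h.
  apply/measurable_EFinP; apply: measurable_funM.
    apply: measurableT_comp; first exact: measurable_apow.
    meas.
  meas.
have h0 z : (0 <= h z)%E by rewrite lee_fin mulr_ge0 ?apow_ge0//.
have [D PD] := bPhi.
rewrite /Rintegral; congr fine.
transitivity (\int[V]_x \int[V]_u h (x, u))%E.
  apply: eq_integral => x _; rewrite /directional_energy /Rintegral fineK//.
  exact: integrable_fin_num (integrable_apow_dotp p1 cp0 cm0 (grad f x) mPhi PD).
rewrite (@fubini_tonelli _ _ _ _ _ V V h mh h0); apply: eq_integral => u _.
rewrite /h EFinM /energy /Rintegral fineK; last exact: integrable_fin_num (energy_integrable p1 cp0 cm0 sf u).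
rewrite muleC -ge0_integralZl//; first by apply: eq_integral => x _; rewrite muleC EFinM.
- by apply/measurable_EFinP; exact: measurable_energy_integrand.
- by move=> x _; rewrite lee_fin apow_ge0.
Qed.

End total.

(** * Averages over the sphere *)

Section rotations.
Context {R : realType} {n : nat}.
Implicit Types (u v w x : 'rV[R]_n.+1) (Q : 'M[R]_n.+1).

Definition rotation Q := Q *m Q^T = 1%:M /\ \det Q = 1.

Lemma det_orth Q : Q *m Q^T = 1%:M -> \det Q = 1 \/ \det Q = -1.
Proof.
move=> /(congr1 determinant); rewrite det_mulmx det_tr det1 => /eqP.
by rewrite sqrf_eq1 => /orP[]/eqP; [left|right].
Qed.

Lemma rotation_mul Q Q' : rotation Q -> rotation Q' -> rotation (Q *m Q').
Proof.
move=> [oQ dQ] [oQ' dQ']; split; last by rewrite det_mulmx dQ dQ' mulr1.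
by rewrite trmx_mul mulmxA -[Q *m Q' *m _]mulmxA oQ' mulmx1.
Qed.

Lemma rotation_tr Q : rotation Q -> rotation Q^T.
Proof. by move=> [oQ dQ]; split; [exact: orth_tr|rewrite det_tr]. Qed.

Lemma rotation_from_e0 v : (0 < n)%N -> enorm v = 1 ->
  exists2 Q, rotation Q & (delta_mx 0 ord0 : 'rV[R]_n.+1) *m Q = v.
Proof.
move=> n0 v1; pose e : 'rV[R]_n.+1 := delta_mx 0 ord0.
have ev : enorm e = enorm v by rewrite enorm_delta v1.
pose Q := householder (e - v).
have oQ : Q *m Q^T = 1%:M by exact: householder_orth.
have eQ : e *m Q = v by exact: householder_swap.
have [dQ|dQ] := det_orth oQ; first by exists Q.
pose D : 'M[R]_n.+1 := diag_mx (\row_j (if j == ord_max then -1 else 1)).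
have DT : D^T = D by rewrite /D tr_diag_mx.
have dD : \det D = -1.
  rewrite det_diag (bigD1 ord_max)//= mxE eqxx big1 ?mulr1// => j jm.
  by rewrite mxE (negbTE jm).
have oD : D *m D^T = 1%:M.
  rewrite DT; apply/matrixP => i j; rewrite mul_diag_mx !mxE.
  have [->|ij] := eqVneq i j; last by rewrite mulr0.
  by rewrite mulr1n; case: ifP; rewrite ?mulrNN mulr1.
have eD : e *m D = e.
  apply/rowP => j; rewrite mul_mx_diag !mxE eqxx.
  case: eqVneq => [->|_]; last by rewrite mul0r.
  case: ifP => [/eqP/(congr1 val)/= H|_]; last by rewrite mulr1.
  by move: n0; rewrite -H.
exists (D *m Q); last by rewrite mulmxA eD.
split; last by rewrite det_mulmx dD dQ mulrNN mulr1.
by rewrite trmx_mul mulmxA -[D *m Q *m _]mulmxA oQ mulmx1.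
Qed.

Lemma rotation_transitive u v : (0 < n)%N -> enorm u = 1 -> enorm v = 1 ->
  exists2 Q, rotation Q & u *m Q = v.
Proof.
move=> n0 u1 v1; have [P rP eP] := rotation_from_e0 n0 u1.
have [Q rQ eQ] := rotation_from_e0 n0 v1.
exists (P^T *m Q); first by apply: rotation_mul => //; exact: rotation_tr.
by rewrite -eP mulmxA -[_ *m P *m P^T]mulmxA rP.1 mulmx1.
Qed.

End rotations.

Section sphere_measure.
Context {R : realType} {n : nat}.
Variable sigma : probability 'rV[R]_n.+1 R.
Hypotheses (n0 : (0 < n)%N) (hsigma : rotation_invariant_on_sphere sigma).
Local Notation V := (@lebesgue_rV R n.+1).
Local Notation S := (unit_sphere R n.+1).
Implicit Types (u v w x : 'rV[R]_n.+1) (Q : 'M[R]_n.+1) (A : set 'rV[R]_n.+1).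

Lemma measurable_sphere : measurable S.
Proof.
have -> : S = [set x | enorm x <= 1] `&` [set x | 1 <= enorm x].
  apply/seteqP; split => x; rewrite /unit_sphere/=; first by move=> ->.
  by move=> [? ?]; apply/le_anti/andP.
meas.
Qed.

Lemma sigma_rotation Q A : rotation Q -> measurable A -> sigma [set x | A (x *m Q)] = sigma A.
Proof.
move=> rQ mA; have [oQ dQ] := rotation_tr rQ.
rewrite -(hsigma.2 _ oQ dQ A mA); congr (sigma _); apply/seteqP; split => x /=.
  by move=> AxQ; exists (x *m Q) => //; rewrite -mulmxA rQ.1 mulmx1.
by move=> [y Ay <-]; rewrite -mulmxA (orthC rQ.1) mulmx1.
Qed.

Lemma ge0_integral_rotation Q (g : 'rV[R]_n.+1 -> \bar R) : rotation Q ->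
  mfun g -> (forall x, 0 <= g x)%E ->
  (\int[sigma]_x g ((x : 'rV[R]_n.+1) *m Q)%R = \int[sigma]_x g x)%E.
Proof.
move=> rQ mg g0.
have mQ : mfun (fun x : 'rV[R]_n.+1 => x *m Q) by meas.
have := @ge0_integral_pushforward _ _ _ _ R _ mQ sigma setT g measurableT mg (fun x _ => g0 x).
rewrite preimage_setT => <-; apply: eq_measure_integral => A mA _.
exact: sigma_rotation.
Qed.

Lemma sphere_orth Q x : rotation Q -> (\1_S (x *m Q) : R)%:E = (\1_S x : R)%:E.
Proof. by move=> rQ; apply: indic_iff; rewrite /unit_sphere/= (orth_enorm x rQ.1). Qed.

Lemma sphere_integral_unit (G : R -> \bar R) u v : mfun G -> (forall t, 0 <= G t)%E ->
  enorm u = 1 -> enorm v = 1 ->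
  (\int[sigma]_(x in S) G (dotp x u) = \int[sigma]_(x in S) G (dotp x v))%E.
Proof.
move=> mG G0 u1 v1; have [Q rQ uQ] := rotation_transitive n0 u1 v1.
rewrite (integral_in_indic sigma S (fun x => G (dotp x u))) (integral_in_indic sigma S (fun x => G (dotp x v))).
pose g x := (G (dotp x v) * (\1_S x : R)%:E)%E.
rewrite -(@ge0_integral_rotation Q g rQ).
- by apply: eq_integral => x _; rewrite /g (sphere_orth x rQ) -uQ (orth_dotp _ _ rQ.1).
- apply: emeasurable_funM; last by apply: measurable_indicE; exact: measurable_sphere.
  meas.
- by move=> x; rewrite mule_ge0// lee_fin.
Qed.

(** The nonzero x whose direction is within e of u, written without dividing by the norm; the strict
    inequality excludes x = 0. *)
Definition cone (e : R) u : set 'rV[R]_n.+1 := [set x | enorm (x - enorm x *: u) < e * enorm x].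

Lemma measurable_cone e u : measurable (cone e u).
Proof.
apply: measurable_lt_set; last by apply: measurable_funM => //; meas.
apply: measurable_enorm; apply: measurable_add_rV => //; apply: measurable_opp_rV.
meas.
Qed.

Lemma measurable_cone2 e : measurable [set z : 'rV[R]_n.+1 * 'rV[R]_n.+1 | cone e z.2 z.1].
Proof.
apply: measurable_lt_set; last by apply: measurable_funM => //; meas.
apply: measurable_enorm; apply: measurable_add_rV; first meas.
apply: measurable_opp_rV; apply: measurable_scale_rV; last meas.
meas.
Qed.

Lemma cone_scale e u x (c : R) : 0 < c -> cone e u (c *: x) <-> cone e u x.
Proof.
move=> c0; rewrite /cone/= enormZ gtr0_norm// -scalerA -scalerBr enormZ gtr0_norm// mulrCA.
by rewrite ltr_pM2l.
Qed.

Lemma cone_neq0 e u x : cone e u x -> x != 0.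
Proof. by apply: contraPneq => ->; rewrite /cone/= enorm0 scale0r subrr enorm0 mulr0 ltxx. Qed.

Lemma cone_orth e u x Q : Q *m Q^T = 1%:M -> cone e (u *m Q) (x *m Q) <-> cone e u x.
Proof. by move=> oQ; rewrite /cone/= !(orth_enorm _ oQ) scalemxAl -mulmxBl (orth_enorm _ oQ). Qed.

Local Notation B := (eball n.+1 1).

Lemma cone_volume_unit e u v : enorm u = 1 -> enorm v = 1 ->
  V (cone e u `&` B) = V (cone e v `&` B).
Proof.
move=> u1 v1; have [Q [oQ _] uQ] := rotation_transitive n0 u1 v1.
have mC : measurable (cone e v `&` B) by apply: measurableI; [exact: measurable_cone|meas].
rewrite -(lebesgue_rV_orth oQ mC); congr (V _); apply/seteqP; split => x; rewrite -uQ.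
  by move=> [xu xB]; split; [exact/cone_orth|rewrite /eball/= orth_enorm].
by move=> [/cone_orth - /(_ oQ) xu]; rewrite /eball/= orth_enorm.
Qed.

Lemma cone_sigma_unit e (x y : 'rV[R]_n.+1) : x != 0 -> y != 0 ->
  sigma [set u | S u /\ cone e u x] = sigma [set u | S u /\ cone e u y].
Proof.
have aux (z : 'rV[R]_n.+1) : z != 0 -> forall u, cone e u z <-> cone e u ((enorm z)^-1 *: z).
  by move=> z0 u; rewrite cone_scale// invr_gt0 enorm_gt0.
have unit (z : 'rV[R]_n.+1) : z != 0 -> enorm ((enorm z)^-1 *: z) = 1.
  move=> z0; rewrite enormZ ger0_norm ?invr_ge0 ?enorm_ge0// mulVf// enorm_eq0//.
move=> x0 y0; have [Q rQ xQ] := rotation_transitive n0 (unit _ x0) (unit _ y0).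
have mA : measurable [set u | S u /\ cone e u y].
  apply: measurableI; first exact: measurable_sphere.
  apply: (measurable_preim (f := fun u : 'rV[R]_n.+1 => (y, u)) _ (measurable_cone2 e)).
  meas.
rewrite -(sigma_rotation rQ mA); congr (sigma _); apply/seteqP; split => u; rewrite /unit_sphere/= (orth_enorm _ rQ.1).
  by move=> [u1 /(aux _ x0) ux]; split => //; apply/(aux _ y0); rewrite -xQ; apply/cone_orth => //; case: rQ.
move=> [u1 /(aux _ y0)]; rewrite -xQ => /cone_orth H; split => //; apply/(aux _ x0); apply: H; case: rQ.
by [].
Qed.

End sphere_measure.

#[global] Hint Resolve measurable_sphere measurable_cone : meas.

Lemma one_powR {R : realType} (a : R) : 1 `^ a = 1.
Proof. by rewrite powR1. Qed.

Section volume_lemmas.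
Context {R : realType} {n : nat}.
Local Notation V := (@lebesgue_rV R n.+1).
Local Notation B := (@eball R n.+1).
Local Notation om := (@ball_volume R n).
Implicit Types (x y u : 'rV[R]_n.+1) (A : set 'rV[R]_n.+1).

Lemma lebesgue_point0 : V [set 0] = 0%E.
Proof.
have m0 : measurable [set (0 : 'rV[R]_n.+1)].
  rewrite (_ : [set _] = [set x | enorm x <= 0]).
    meas.
  apply/seteqP; split => x /=; first by move=> ->; rewrite enorm0.
  by move=> H; apply/eqP; rewrite -enorm_eq0 eq_le H enorm_ge0.
have sub r : 0 < r -> [set (0 : 'rV[R]_n.+1)] `<=` B r by move=> r0 x ->; rewrite /eball/= enorm0.
have VE := lebesgue_rV_fin m0 (sub 1 ltr01).
apply/eqP; rewrite eq_le measure_ge0 andbT VE.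
apply: le_of_linear_error => // h h0 h1; rewrite add0r.
have := le_lebesgue_rV m0 (@measurable_eball R n.+1 h) (sub h h0).
rewrite VE lebesgue_eballE// lee_fin => /le_trans; apply.
apply: ler_wpM2r; first exact/ltW/ball_volume_gt0.
by rewrite exprS ler_piMr ?exprn_ile1// ltW.
Qed.

Lemma lebesgue_ball_gt0 A y (r : R) : measurable A -> 0 < r -> (forall x, enorm (x - y) < r -> A x) ->
  (0 < V A)%E.
Proof.
move=> mA r0 H; apply: lt_le_trans (_ : (V (B r) <= V A)%E); first exact: lebesgue_eball_gt0.
rewrite -(lebesgue_rV_addr (- y) (@measurable_eball R n.+1 r)); apply: le_lebesgue_rV => //.
meas.
Qed.

Lemma lebesgue_dilate A (r : R) : 0 < r -> measurable A ->
  V [set x | A (r^-1 *: x)] = ((r ^+ n.+1)%:E * V A)%E.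
Proof.
by move=> r0 mA; rewrite lebesgue_rV_scale ?invr_neq0 ?gt_eqF// ger0_norm ?invr_ge0 1?ltW// invrK.
Qed.

(** Equals a / (a + 1). It multiplies both sides of the comparison in [sphere_energy_ge] and cancels
    there. *)
Definition theta (a : R) : \bar R := (\int[@lebesgue_measure R]_(t in `]0%R, 1%R[) (1 - t `^ a)%:E)%E.

Lemma theta_gt0 (a : R) : 0 < a -> exists2 c : R, 0 < c & theta a = c%:E.
Proof.
move=> a0; have mI : measurable (`]0, 1[%classic : set R) by exact: measurable_itv.
have m1 : mfun (fun t : R => (1 - t `^ a)%:E) by meas.
have leb0 (b : R) : 0 < b -> @lebesgue_measure R `]0, b[ = b%:E.
  by move=> b0; rewrite lebesgue_measure_itv/= lte_fin b0 -EFinB subr0.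
have ge0' (t : R) : t \in `]0, 1[ -> 0 <= 1 - t `^ a.
  rewrite in_itv/= => /andP[t0 t1]; rewrite subr_ge0 -[leRHS](one_powR a).
  by apply: le_powRl; pos.
have I0 : (0 <= theta a)%E by apply: integral_ge0 => t It; rewrite lee_fin ge0'.
have le1 : (theta a <= 1)%E.
  apply: (@le_trans _ _ (\int[lebesgue_measure]_(t in `]0%R, 1%R[) 1%:E)%E).
    apply: ge0_le_integral => //.
    - exact: measurable_funTS m1.
    - by move=> t _; rewrite lee_fin gerBl powR_ge0.
  by rewrite integral_cst// mul1e; apply: le_of_eq; exact: (leb0 _ ltr01).
have gt0 : (0 < theta a)%E.
  pose d : R := 1 - 2^-1 `^ a.
  have d0 : 0 < d.
    rewrite subr_gt0 -[ltRHS](one_powR a); apply: gt0_ltr_powR => //; rewrite ?nnegrE//.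
    by rewrite invf_lt1// ltr1n.
  apply: (@lt_le_trans _ _ (\int[lebesgue_measure]_(t in `]0%R, 2^-1%R[) d%:E)%E).
    have h0 : 0 < 2^-1 :> R by [].
    rewrite integral_cst//; apply: (@lt_le_trans _ _ (d%:E * (2^-1)%:E)%E).
      pos.
    by apply: le_of_eq; congr (_ * _)%E; apply: esym; exact: (leb0 _ h0).
  apply: (@le_trans _ _ (\int[lebesgue_measure]_(t in `]0%R, 2^-1%R[) (1 - t `^ a)%:E)%E).
    apply: ge0_le_integral => //.
    - by move=> t _; rewrite ltW.
    - exact: measurable_funTS m1.
    - move=> t /=; rewrite in_itv/= => /andP[t0 t2]; rewrite lee_fin lerD2l lerN2.
      by apply: le_powRl; pos.
  apply: ge0_subset_integral => //.
  - exact: measurable_funTS m1.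
  - move=> t /=; rewrite !in_itv/= => /andP[-> t2]; apply: lt_trans t2 _.
    by rewrite invf_lt1// ltr1n.
exists (fine (theta a)); first by rewrite fine_gt0// gt0/= (le_lt_trans le1)// ltry.
by rewrite fineK// ge0_fin_numE// (le_lt_trans le1)// ltry.
Qed.

Let leb_itv_oc (a b : R) : a <= b -> @lebesgue_measure R `]a, b] = (b - a)%:E.
Proof.
rewrite le_eqVlt => /predU1P[->|ab]; rewrite lebesgue_measure_itv/= lte_fin ?ltxx ?subrr//.
by rewrite ab -EFinB.
Qed.

(* The layer-cake formula: N has the same distribution as t^(1/a) under any such normalization, whence the same theta. *)
Lemma layer_cake_power A (N : 'rV[R]_n.+1 -> R) (a : R) : 0 < a -> measurable A -> mfun N ->
  (forall x, 0 <= N x) -> (V [set x | A x /\ (N x < 1)%R] < +oo)%E ->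
  (forall t : R, 0 < t -> t < 1 -> V [set x | A x /\ N x < t] = ((t `^ a)%:E * V [set x | A x /\ (N x < 1)%R])%E) ->
  (\int[V]_x (N x * \1_([set x | A x /\ (N x < 1)%R]) x)%:E = theta a * V [set x | A x /\ (N x < 1)%R])%E.
Proof.
move=> a0 mA mN N0 Vfin HV; pose A1 := [set x | A x /\ N x < 1].
have mAt (t : R) : measurable [set x | A x /\ N x < t] by meas.
have mA1 : measurable A1 by exact: mAt.
pose W : set (R * 'rV[R]_n.+1) := [set z | `]0, 1[%classic z.1 /\ (A1 z.2 /\ z.1 <= N z.2)].
have mW : measurable W.
  apply: measurableI; first exact: (measurable_preim measurable_fst (measurable_itv _)).
  apply: measurableI; first exact: (measurable_preim measurable_snd mA1).
  exact: (measurable_le_set measurable_fst (measurableT_comp mN measurable_snd)).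
pose w z : \bar R := (\1_W z : R)%:E.
have mw : mfun w by exact: measurable_indicE.
have w0 z : (0 <= w z)%E by pos.
transitivity (\int[V]_x \int[lebesgue_measure]_t w (t, x))%E.
  apply: eq_integral => x _.
  have [Ax|nAx] := pselect (A1 x); last first.
    rewrite indicE memNset// mulr0 integral0_eq// => t _; rewrite /w indicE memNset// => -[_ []].
    by [].
  rewrite indicE mem_set// mulr1; transitivity (@lebesgue_measure R `]0, N x]).
    by rewrite leb_itv_oc// subr0.
  rewrite measure_indic//.
  apply: eq_integral => t _; apply: indic_iff; rewrite /W/= !in_itv/=.
  split; last by move=> [/andP[t0 _] [_ tN]]; rewrite t0.
  by move=> /andP[t0 tN]; split; [rewrite t0/= (le_lt_trans tN)//; case: Ax|split].
rewrite -(@fubini_tonelli _ _ _ _ _ lebesgue_measure V w mw w0).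
have VE : V A1 = (fine (V A1))%:E by rewrite fineK// ge0_fin_numE.
transitivity (\int[lebesgue_measure]_t ((1 - t `^ a)%:E * (\1_(`]0%R, 1%R[%classic) t : R)%:E * V A1))%E.
  apply: eq_integral => t _; rewrite [in RHS]indicE.
  case: (boolP (t \in `]0, 1[%classic)) => [/set_mem It|It]; last first.
    rewrite mule0 mul0e integral0_eq// => x _; rewrite /w indicE memNset// => -[/= H _].
    by move: It; rewrite mem_set.
  have := It; rewrite /= in_itv/= => /andP[t0 t1]; rewrite mule1.
  have sub : [set x | A x /\ N x < t] `<=` A1 by move=> x [Ax Nt]; split => //; exact: lt_trans t1.
  transitivity (V (A1 `\` [set x | A x /\ N x < t])).
    rewrite (measure_indic V (measurableD mA1 (mAt t))); apply: eq_integral => x _; apply: indic_iff; rewrite /W/=.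
    split; first by move=> [_ [[Ax N1] tN]]; split => // -[_]; rewrite ltNge tN.
    move=> [[Ax N1] nN]; split => //; split => //; rewrite leNgt; apply/negP => Nt; apply: nN; split => //.
  rewrite lebesgue_rVD//; first by rewrite (setIidr sub) HV// -/A1 VE -!EFinM -EFinB; congr EFin; ring.
transitivity (V A1 * \int[lebesgue_measure]_t ((1 - t `^ a)%:E * (\1_(`]0%R, 1%R[%classic) t : R)%:E))%E.
  rewrite -ge0_integralZl//.
  - by apply: eq_integral => t _; rewrite muleC.
  - apply: emeasurable_funM; last by apply: measurable_indicE; exact: measurable_itv.
    meas.
  - move=> t _; rewrite indicE; case: (boolP (t \in _)) => [/set_mem/=|_]; last by rewrite mule0.
    rewrite in_itv/= => /andP[t0 t1]; rewrite mule1 lee_fin subr_ge0 -[leRHS](one_powR a).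
    by apply: le_powRl; pos.
by rewrite muleC; congr (_ * _)%E; rewrite -integral_in_indic.
Qed.

End volume_lemmas.

(** * Averages over thin cones, Jensen's inequality and polar volume *)

Section cone_average.
Context {R : realType} {n : nat}.
Variable sigma : probability 'rV[R]_n.+1 R.
Hypotheses (n0 : (0 < n)%N) (hsigma : rotation_invariant_on_sphere sigma).
Local Notation V := (@lebesgue_rV R n.+1).
Local Notation S := (unit_sphere R n.+1).
Local Notation B := (eball n.+1 1).
Local Notation om := (@ball_volume R n).
Local Notation e0 := (delta_mx 0 ord0 : 'rV[R]_n.+1).
Implicit Types (u v w x : 'rV[R]_n.+1).

Let e01 : enorm e0 = 1. Proof. exact: enorm_delta. Qed.
Let e00 : e0 != 0. Proof. by rewrite -enorm_gt0 e01. Qed.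

Lemma cone_volume_gt0 (e : R) : 0 < e -> (0 < V (cone e e0 `&` B))%E.
Proof.
move=> ep; pose d := Num.min (4^-1) (e / 16).
have d0 : 0 < d by rewrite /d lt_min; apply/andP; split; lra.
have d4 : d <= 4^-1 by rewrite /d ge_min lexx.
have de : d <= e / 16 by rewrite /d ge_min lexx orbT.
apply: (@lebesgue_ball_gt0 R n _ (2^-1 *: e0) d) => //.
  meas.
move=> x xd; have en : enorm (2^-1 *: e0) = 2^-1 by rewrite enormZ e01 mulr1 ger0_norm//.
have := enorm_dist x (2^-1 *: e0); rewrite en => H1.
have H2 : `|enorm x - 2^-1| < d by exact: le_lt_trans xd.
move: (H2); rewrite ltr_norml => /andP[H3 H4].
split; last by rewrite /eball/=; lra.
rewrite /cone/=; have -> : x - enorm x *: e0 = (x - 2^-1 *: e0) + (2^-1 - enorm x) *: e0.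
  by rewrite scalerBl addrA subrK.
apply: le_lt_trans (enorm_triangle _ _) _; rewrite enormZ e01 distrC.
have : e * 4^-1 <= e * enorm x by rewrite ler_pM2l//; lra.
lra.
Qed.

Let K (e : R) u x : \bar R := (\1_([set z : 'rV[R]_n.+1 * 'rV[R]_n.+1 | S z.2 /\ cone e z.2 z.1]) (x, u) : R)%:E.

Let mK e : measurable [set z : 'rV[R]_n.+1 * 'rV[R]_n.+1 | S z.2 /\ cone e z.2 z.1].
Proof.
apply: measurableI; last exact: measurable_cone2.
exact: (measurable_preim measurable_snd measurable_sphere).
Qed.

Let cone_swap (e : R) (g : 'rV[R]_n.+1 -> \bar R) : mfun g -> (forall x, 0 <= g x)%E ->
  (\int[sigma]_(u in S) \int[V]_x (g x * (\1_(cone e u) x : R)%:E) =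
   \int[V]_x (g x * sigma [set u | S u /\ cone e u x]))%E.
Proof.
move=> mg g0; pose h z := (g z.1 * K e z.2 z.1)%E.
have mh : mfun h.
  apply: emeasurable_funM; first meas.
  by apply: (measurable_indicE (mK e)).
have h0 z : (0 <= h z)%E by rewrite /h mule_ge0 ?indic_ge0.
transitivity (\int[V]_x \int[sigma]_u h (x, u))%E; last first.
  apply: eq_integral => x _; rewrite /h /= ge0_integralZl//.
  - congr (_ * _)%E; rewrite measure_indic; last first.
      apply: (measurable_preim (f := fun u : 'rV[R]_n.+1 => (x, u)) _ (mK e)).
      meas.
    by [].
  - apply: (measurableT_comp (measurable_indicE (mK e))).
    by [].
  - by move=> u _; pos.
rewrite (@fubini_tonelli _ _ _ _ _ V sigma h mh h0).
rewrite (integral_in_indic sigma S); apply: eq_integral => u _.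
rewrite [X in (_ * X%:E)%E]indicE; case: (boolP (u \in S)) => [/set_mem Su|Su].
  rewrite mule1; apply: eq_integral => x _; congr (_ * _)%E; apply: indic_iff.
  by split => [Cx|[]].
rewrite mule0 integral0_eq// => x _; rewrite /h /K indicE memNset ?mule0//= => -[Su' _].
by rewrite mem_set in Su.
Qed.

Let sigma_cone e x : (sigma [set u | S u /\ cone e u x] <= sigma [set u | S u /\ cone e u e0])%E.
Proof.
have [->|x0] := eqVneq x 0; last by rewrite (cone_sigma_unit n0 hsigma e x0 e00).
rewrite (_ : [set u | _] = set0) ?measure0//; apply/seteqP; split => // u [_ /cone_neq0].
by rewrite eqxx.
Qed.

Let measurable_sigma_cone (e : R) x : measurable [set u | S u /\ cone e u x].
Proof.
apply: (measurable_preim (f := fun u : 'rV[R]_n.+1 => (x, u)) _ (mK e)).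
meas.
Qed.

Let measurable_sigma_cone_fun (e : R) : mfun (fun x => sigma [set u | S u /\ cone e u x]).
Proof.
rewrite (_ : (fun x => _) = (fun x => \int[sigma]_u K e u x)%E); last first.
  apply/funext => x; rewrite measure_indic; last meas.
  by [].
apply: (@measurable_fun_fubini_tonelli_F _ _ _ _ _ sigma (fun z => K e z.2 z.1)).
  exact: (measurable_indicE (mK e)).
by move=> z; pos.
Qed.

(** Average the volume of the cone in the unit ball over its axis u: it is constant in u, and each x
    != 0 lies in the cones of a set of directions of constant measure. *)
Let cone_volume_sigma (e : R) : 0 < e -> V (cone e e0 `&` B) = (sigma [set u | S u /\ cone e u e0] * om%:E)%E.
Proof.
move=> ep; have mB := @measurable_eball R n.+1 1.
have mS := @measurable_sphere R n.
have := @cone_swap e (fun x => (\1_B x : R)%:E) (measurable_indicE mB) (@indic_ge0 R _ _).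
have -> : (\int[sigma]_(u in S) \int[V]_x ((\1_B x : R)%:E * (\1_(cone e u) x : R)%:E) = V (cone e e0 `&` B))%E.
  transitivity (\int[sigma]_(u in S) cst (V (cone e e0 `&` B)) u)%E.
    apply: eq_integral => u /set_mem Su; rewrite (cone_volume_unit n0 e e01 (Su : enorm u = 1)).
    rewrite (measure_indic V); last by apply: measurableI => //; exact: measurable_cone.
    by apply: eq_integral => x _; rewrite -EFinM indicI/= mulrC.
  rewrite integral_cst// -[RHS]mule1; congr (_ * _)%E; exact: hsigma.1.
move=> ->; transitivity (\int[V]_x (sigma [set u | S u /\ cone e u e0] * (\1_(B `\ 0) x : R)%:E))%E.
  apply: eq_integral => x _; rewrite muleC !indicE.
  have [->|x0] := eqVneq x 0.
    rewrite [0 \in B `\ 0]memNset; last by move=> [_]; apply.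
    rewrite mule0 (_ : [set u | _] = set0) ?measure0 ?mul0e//; apply/seteqP; split => // u [_ /cone_neq0].
    by rewrite eqxx.
  rewrite (cone_sigma_unit n0 hsigma e x0 e00); congr (_ * (_ %:R)%:E)%E; congr nat_of_bool.
  apply/idP/idP => /set_mem; last by move=> [xB _]; exact: mem_set.
  by move=> xB; apply: mem_set; split => //; exact/eqP.
have m0 : measurable [set (0 : 'rV[R]_n.+1)].
  rewrite (_ : [set _] = [set x | enorm x <= 0]).
    meas.
  apply/seteqP; split => x /=; first by move=> ->; rewrite enorm0.
  by move=> H; apply/eqP; rewrite -enorm_eq0 eq_le H enorm_ge0.
have mB0 : measurable (B `\ (0 : 'rV[R]_n.+1)) by meas.
rewrite ge0_integralZl//; last meas.
congr (_ * _)%E; transitivity (V (B `\ (0 : 'rV[R]_n.+1))); first by apply: esym; exact: measure_indic.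
rewrite lebesgue_rVD//; last exact: lebesgue_eball_lty.
have -> : V (B `&` [set 0]) = 0%E.
  apply/eqP; rewrite -measure_le0; apply: (@le_trans _ _ (V [set 0])); last by rewrite lebesgue_point0.
  by apply: le_lebesgue_rV => //; meas.
by rewrite sube0 lebesgue_eballE// expr1n mul1r.
Qed.

(** Takes the place of polar coordinates. Integrate the hypothesis over u and exchange the
    integrals: each x is counted with the measure of the directions whose cone contains it, the same
    number for all x != 0, and this number cancels against the volume of one cone. *)
Lemma cone_average (e : R) (A : 'rV[R]_n.+1 -> R) (g : 'rV[R]_n.+1 -> \bar R) : 0 < e ->
  mfun A -> (forall u, 0 <= A u) -> mfun g -> (forall x, 0 <= g x)%E ->
  (forall u, enorm u = 1 -> ((A u)%:E * V (cone e u `&` B) <= \int[V]_x (g x * (\1_(cone e u) x : R)%:E))%E) ->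
  (om%:E * \int[sigma]_(u in S) (A u)%:E <= \int[V]_x g x)%E.
Proof.
move=> ep mA A0 mg g0 H; have om0 := @ball_volume_gt0 R n.
have mS := @measurable_sphere R n.
pose kp := sigma [set u | S u /\ cone e u e0].
have VK : V (cone e e0 `&` B) = (kp * om%:E)%E by exact: cone_volume_sigma.
have kfin : kp \is a fin_num.
  have k1 : (kp <= 1)%E by apply: probability_le1; meas.
  by rewrite ge0_fin_numE; [exact: le_lt_trans k1 (ltry _)|exact: measure_ge0].
have k0 : (0 < fine kp)%R.
  have := cone_volume_gt0 ep; rewrite VK -(fineK kfin) -EFinM => H1.
  by rewrite -(pmulr_lgt0 _ om0).
have J : (\int[sigma]_(u in S) ((A u)%:E * V (cone e e0 `&` B)) <= kp * \int[V]_x g x)%E.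
  apply: (@le_trans _ _ (\int[sigma]_(u in S) \int[V]_x (g x * (\1_(cone e u) x : R)%:E))%E).
    have mh : mfun (fun z : 'rV[R]_n.+1 * 'rV[R]_n.+1 => g z.1 * (\1_([set z | cone e z.2 z.1]) z : R)%:E)%E.
      apply: emeasurable_funM; first meas.
      exact: (measurable_indicE (measurable_cone2 e)).
    apply: ge0_le_integral_any => u Su; first by rewrite mule_ge0// lee_fin.
    by rewrite (cone_volume_unit n0 e e01 (Su : enorm u = 1)); exact: H.
  rewrite cone_swap//; have <- : (\int[V]_x ((fine kp)%:E * g x) = kp * \int[V]_x g x)%E.
    by rewrite ge0_integralZl ?fineK//; exact: measure_ge0.
  apply: ge0_le_integral_any => x _; first by rewrite mule_ge0.
  by rewrite muleC fineK// lee_wpmul2r.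
have : ((\int[sigma]_(u in S) (A u)%:E) * (kp * om%:E) <= kp * \int[V]_x g x)%E.
  apply: le_trans J; rewrite -VK ge0_integralZr//.
  - by apply: measurable_funTS; meas.
  - by move=> u _; rewrite lee_fin.
by rewrite muleCA -(fineK kfin) lee_pmul2l// muleC.
Qed.

End cone_average.

Section sphere_mean.
Context {R : realType} {n : nat}.
Variable sigma : probability 'rV[R]_n.+1 R.
Hypotheses (n0 : (0 < n)%N) (hsigma : rotation_invariant_on_sphere sigma).
Local Notation V := (@lebesgue_rV R n.+1).
Local Notation S := (unit_sphere R n.+1).
Local Notation B := (eball n.+1).
Local Notation om := (@ball_volume R n).
Local Notation e0 := (delta_mx 0 ord0 : 'rV[R]_n.+1).
Local Notation N := (n.+1%:R : R).
Implicit Types (u v w x : 'rV[R]_n.+1).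

Let mS : measurable S. Proof. meas. Qed.

Lemma sphere_integral_cst (c : R) : (\int[sigma]_(u in S) c%:E)%E = c%:E.
Proof. by rewrite integral_cst// -[RHS]mule1; congr (_ * _)%E; exact: hsigma.1. Qed.

Lemma sphere_integrable (g : 'rV[R]_n.+1 -> R) (M : R) : mfun g ->
  (forall u, S u -> `|g u| <= M) -> sigma.-integrable S (EFin \o g).
Proof.
move=> mg gM; apply: measurable_bounded_integrable => //.
- exact: le_lt_trans (probability_le1 sigma mS) (ltry _).
- exact: measurable_funTS.
- exists M; split; first exact: num_real.
  by move=> x Mx y Sy; apply: le_trans (gM y Sy) (ltW Mx).
Qed.

(** Integrate the tangent of t^(-b) at the mean of Z; the bounds c and C make the integrals finite
    and the mean positive. *)
Lemma jensen_neg (Z : 'rV[R]_n.+1 -> R) (b c C : R) : mfun Z -> 0 < b -> 0 < c ->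
  (forall u, S u -> c <= Z u <= C) ->
  0 < \int[sigma]_(u in S) (Z u `^ (- b)) /\
  (\int[sigma]_(u in S) (Z u `^ (- b))) `^ (- b^-1) <= \int[sigma]_(u in S) Z u.
Proof.
move=> mZ b0 c0 cZC.
have Zp u : S u -> 0 < Z u by move=> /cZC/andP[h1 _]; exact: lt_le_trans h1.
have iZ : sigma.-integrable S (EFin \o Z).
  apply: (@sphere_integrable _ C) => // u Su; rewrite gtr0_norm ?Zp//.
  by have /andP[] := cZC _ Su.
have iZb : sigma.-integrable S (EFin \o (fun u => Z u `^ (- b))).
  apply: (@sphere_integrable _ (c `^ (- b))).
    meas.
  move=> u Su; rewrite ger0_norm ?powR_ge0//; apply: le_powRN => //; first pos.
  by have /andP[] := cZC _ Su.
have icst (k : R) : sigma.-integrable S (EFin \o cst k) by apply: (@sphere_integrable _ `|k|).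
have Icst (k : R) : \int[sigma]_(u in S) k = k by rewrite /Rintegral sphere_integral_cst.
pose m := \int[sigma]_(u in S) Z u.
have mc : c <= m.
  rewrite -(Icst c); apply: le_Rintegral => //; first exact: icst.
  by move=> u /cZC/andP[].
have m0 : 0 < m by exact: lt_le_trans mc.
have H : m `^ (- b) <= \int[sigma]_(u in S) (Z u `^ (- b)).
  pose t u := m `^ (- b) - b * m `^ (- b - 1) * (Z u - m).
  have it1 : sigma.-integrable S (EFin \o (fun u => - (b * m `^ (- b - 1)) * Z u)).
    have := integrableZl mS (- (b * m `^ (- b - 1))) iZ.
    by [].
  have it : \int[sigma]_(u in S) t u = m `^ (- b).
    transitivity (\int[sigma]_(u in S) (- (b * m `^ (- b - 1)) * Z u + (m `^ (- b) + b * m `^ (- b - 1) * m))).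
      by apply: eq_Rintegral => u _; rewrite /t; ring.
    rewrite (RintegralD mS it1 (icst _)) (RintegralZl _ mS iZ) -/m.
    by rewrite (Icst (m `^ (- b) + b * m `^ (- b - 1) * m)) mulNr addrCA addNr addr0.
  rewrite -it; apply: le_Rintegral => //.
    have := integrableD mS it1 (icst (m `^ (- b) + b * m `^ (- b - 1) * m)).
    by apply: eq_integrable => // u _; rewrite /= -EFinD /t; congr EFin; ring.
  by move=> u Su; apply: powRN_tangent => //; [pos|exact: Zp].
split; first by apply: lt_le_trans H; rewrite powR_gt0.
rewrite -/m -[leRHS](powRK (ltW m0) (_ : - b != 0)); last by rewrite oppr_eq0 gt_eqF.
rewrite invrN; apply: le_powRN => //; first pos.
pos.
Qed.

Section polar.
Variables (Z : 'rV[R]_n.+1 -> R) (p c L : R).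
Hypotheses (p0 : 0 < p) (mZ : mfun Z) (c0 : 0 < c) (L0 : 0 <= L)
  (Zc : forall u, S u -> c <= Z u)
  (ZZ : forall (s : R) u, 0 <= s -> Z (s *: u) = s `^ p * Z u)
  (ZL : forall u w, S u -> S w -> `|Z u - Z w| <= L * enorm (u - w)).

Lemma homogeneous_ge0 u : 0 <= Z u.
Proof.
have [->|u0] := eqVneq u 0; first by have := @ZZ 0 0 (lexx _); rewrite scale0r => ->; rewrite powR0 ?mul0r ?gt_eqF.
have eu : 0 < enorm u by rewrite enorm_gt0.
have -> : u = enorm u *: ((enorm u)^-1 *: u) by rewrite scalerA mulfV ?scale1r// gt_eqF.
rewrite ZZ ?mulr_ge0 ?powR_ge0 ?ltW//; apply: lt_le_trans c0 (Zc _).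
by rewrite /unit_sphere/= enormZ gtr0_norm ?invr_gt0// mulVf// gt_eqF.
Qed.

Lemma Z_on_cone (e : R) u x : S u -> cone e u x -> Z x <= enorm x `^ p * (Z u + L * e).
Proof.
move=> Su Cx; have x0 : 0 < enorm x by rewrite enorm_gt0; exact: cone_neq0 Cx.
pose w := (enorm x)^-1 *: x.
have Sw : S w by rewrite /unit_sphere/= /w enormZ gtr0_norm ?invr_gt0// mulVf// gt_eqF.
have xw : x = enorm x *: w by rewrite /w scalerA mulfV ?scale1r// gt_eqF.
rewrite {1}xw ZZ; last pos.
apply: ler_wpM2l; first pos.
have wu : enorm (w - u) < e.
  have -> : w - u = (enorm x)^-1 *: (x - enorm x *: u).
    by rewrite scalerBr scalerA mulVf ?scale1r// gt_eqF.
  by rewrite enormZ gtr0_norm ?invr_gt0// mulrC ltr_pdivrMr.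
have := ZL Sw Su; rewrite ler_norml => /andP[_]; have := ler_wpM2l L0 (ltW wu); lra.
Qed.

Lemma sphere_power_integrable : exists2 J : R, 0 < J &
  (\int[sigma]_(u in S) (Z u `^ (- (N / p)))%:E)%E = J%:E.
Proof.
have Np : 0 < N / p by pos.
have ZC u : S u -> c <= Z u <= Z e0 + L * 2.
  move=> Su; rewrite Zc//=; have := ZL Su (enorm_delta ord0 : S e0); rewrite ler_norml => /andP[_].
  have : L * enorm (u - e0) <= L * 2.
    apply: ler_wpM2l => //; apply: le_trans (enorm_triangle _ _) _.
    by rewrite enormN enorm_delta (Su : enorm u = 1).
  lra.
have [J0 _] := jensen_neg mZ Np c0 ZC.
have iZb : sigma.-integrable S (EFin \o (fun u => Z u `^ (- (N / p)))).
  apply: (@sphere_integrable _ (c `^ (- (N / p)))).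
    meas.
  move=> u Su; rewrite ger0_norm ?powR_ge0//; apply: le_powRN => //; first pos.
  exact: Zc.
by exists (\int[sigma]_(u in S) (Z u `^ (- (N / p)))) => //; rewrite /Rintegral fineK//; exact: integrable_fin_num iZb.
Qed.

(** On the cone of opening e around u, Z exceeds |x|^p Z(u) by at most the factor q = 1 + L e / c.
    So the part of that cone in the ball of radius (q Z(u))^(-1/p) lies in {Z < 1}, and its volume
    is proportional to (q Z(u))^(-N/p). [cone_average] sums over u, and e tends to 0. *)
Lemma polar_volume : (V [set x | (Z x < 1)%R] < +oo)%E ->
  (om%:E * \int[sigma]_(u in S) (Z u `^ (- (N / p)))%:E <= V [set x | (Z x < 1)%R])%E.
Proof.
move=> Vfin; have [J J0 JE] := sphere_power_integrable.
have mP : measurable [set x | Z x < 1] by meas.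
have om0 := @ball_volume_gt0 R n.
have [v VE] : exists v : R, V [set x | Z x < 1] = v%:E by eexists; rewrite -[LHS]fineK// ge0_fin_numE.
have v0 : 0 <= v by rewrite -lee_fin -VE.
have main (e : R) : 0 < e -> om * (1 + L * e / c) `^ (- (N / p)) * J <= v.
  move=> ep; pose q := 1 + L * e / c.
  have q0 : 0 < q by rewrite ltr_pwDl// divr_ge0 ?mulr_ge0// ltW.
  pose A u := (q * Z u) `^ (- (N / p)).
  have mA : mfun A.
    by apply: (measurableT_comp (measurable_powR _)); meas.
  have := @cone_average R n sigma n0 hsigma e A (fun x => (\1_([set x | Z x < 1]) x : R)%:E) ep mA
    (fun u => powR_ge0 _ _) (measurable_indicE mP) (@indic_ge0 R _ _).
  have -> : (\int[sigma]_(u in S) (A u)%:E = (q `^ (- (N / p)) * J)%:E)%E.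
    transitivity (\int[sigma]_(u in S) ((q `^ (- (N / p)))%:E * (Z u `^ (- (N / p)))%:E))%E.
      by apply: eq_integral => u _; rewrite /A powRM// ?homogeneous_ge0// ltW.
    rewrite ge0_integralZl//.
    - by rewrite JE -EFinM.
    - by apply: measurable_funTS; apply/measurable_EFinP; meas.
    - by move=> u _; rewrite lee_fin powR_ge0.
    - pos.
  have -> : (\int[V]_x (\1_([set x | Z x < 1]) x : R)%:E = v%:E)%E.
    by rewrite -VE; apply: esym; exact: measure_indic.
  rewrite -EFinM mulrA; apply => u Su.
  have Zu : 0 < q * Z u by rewrite mulr_gt0// (lt_le_trans c0)// Zc.
  pose r := (q * Z u) `^ (- p^-1).
  have r0 : 0 < r by rewrite powR_gt0.
  have mC : measurable (cone e u `&` B 1) by meas.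
  have -> : (A u)%:E = (r ^+ n.+1)%:E.
    rewrite -powR_mulrn ?powR_ge0// /r -powRrM /A; congr (_ `^ _)%:E; rewrite mulNr mulrC//.
  rewrite -lebesgue_dilate//.
  have mPC : measurable ([set x | Z x < 1] `&` cone e u) by meas.
  apply: (@le_trans _ _ (V ([set x | (Z x < 1)%R] `&` cone e u))); last first.
    rewrite (measure_indic V mPC); apply: ge0_le_integral_any => x _ //.
    by rewrite indicI EFinM.
  apply: le_lebesgue_rV => //; first meas.
  move=> x [Cx]; rewrite /eball/= enormZ gtr0_norm ?invr_gt0// mulrC ltr_pdivrMr// mul1r => xr.
  have ri0 : 0 < r^-1 by pos.
  have {}Cx : cone e u x := (cone_scale e u x ri0).1 Cx.
  split => //=; apply: le_lt_trans (Z_on_cone Su Cx) _.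
  have qZ : Z u + L * e <= q * Z u.
    rewrite /q mulrDl mul1r lerD2l mulrAC -mulrA; apply: ler_peMr; first pos.
    by rewrite ler_pdivlMr// mul1r Zc.
  apply: le_lt_trans (ler_wpM2l (powR_ge0 _ _) qZ) _.
  rewrite -ltr_pdivlMr// mul1r -powR_inv1 ?(ltW Zu)//.
  have -> : (q * Z u) `^ (-1) = r `^ p by rewrite /r -powRrM mulNr mulVf// gt_eqF.
  by apply: gt0_ltr_powR => //; rewrite nnegrE ?enorm_ge0// ltW.
have pN : 0 < p / N by pos.
(* After raising to the power p / N the loss is the factor q itself, which is linear in e. *)
have H : (om * J) `^ (p / N) <= v `^ (p / N).
  apply: (@le_of_linear_error R _ _ (L / c * v `^ (p / N)) 1) => // e ep _.
  have q0 : 0 < 1 + L * e / c by pos.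
  have H0 : 0 <= om * (1 + L * e / c) `^ (- (N / p)) * J by pos.
  have := le_powRl (ltW pN) H0 (main e ep).
  rewrite mulrAC (powRM _ (mulr_ge0 (ltW om0) (ltW J0)) (powR_ge0 _ _)) -powRrM.
  have -> : - (N / p) * (p / N) = -1 by field; rewrite gt_eqF//= gt_eqF.
  rewrite (powR_inv1 (ltW q0)) ler_pdivrMr// => H; apply: le_trans H _.
  by apply: le_of_eq; ring.
rewrite JE VE -EFinM.
have Nz : p / N != 0 by pos.
rewrite -(powRK (ltW (mulr_gt0 om0 J0)) Nz) -(powRK v0 Nz).
by apply: le_powRl => //; rewrite ?powR_ge0// invr_ge0 ltW.
Qed.
End polar.
End sphere_mean.

Lemma convex_combination_lt1 {R : realDomainType} (t x y : R) : 0 <= t <= 1 -> x < 1 -> y < 1 ->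
  t * x + (1 - t) * y < 1.
Proof.
move=> /andP[t0 t1] x1 y1; have m1 : Num.max x y < 1 by rewrite gt_max x1 y1.
apply: le_lt_trans m1; have t1' : 0 <= 1 - t by rewrite subr_ge0.
have H1 : t * x <= t * Num.max x y by apply: ler_wpM2l; rewrite // le_max lexx.
have H2 : (1 - t) * y <= (1 - t) * Num.max x y by apply: ler_wpM2l; rewrite // le_max lexx orbT.
by apply: le_trans (lerD H1 H2) _; rewrite -mulrDl subrKC mul1r.
Qed.

Lemma powR_invK {R : realType} (p t : R) : 0 < p -> 0 < t -> (t `^ p^-1)^-1 `^ p = t^-1.
Proof.
move=> p0 t0; have r0 : 0 <= t `^ p^-1 by pos.
by rewrite -powR_inv1// powRAC powRVK ?gt_eqF ?(ltW t0)// powR_inv1 ?(ltW t0).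
Qed.

(** * The affine energy of one function *)

Section affine.
Context {R : realType} {n : nat}.
Variable sigma : probability 'rV[R]_n.+1 R.
Hypotheses (n0 : (0 < n)%N) (hsigma : rotation_invariant_on_sphere sigma).
Variables (p cp cm : R).
Hypotheses (p1 : 1 <= p) (pn : p < n.+1%:R) (cp0 : 0 <= cp) (cm0 : 0 <= cm) (cpm : 0 < cp + cm).
Local Notation F := (apow p cp cm).
Local Notation V := (@lebesgue_rV R n.+1).
Local Notation S := (unit_sphere R n.+1).
Local Notation B := (eball n.+1).
Local Notation om := (@ball_volume R n).
Local Notation e0 := (delta_mx 0 ord0 : 'rV[R]_n.+1).
Local Notation N := (n.+1%:R : R).
Implicit Types (u v w x : 'rV[R]_n.+1).

Let mS : measurable S. Proof. meas. Qed.
Let p0 : 0 < p. Proof. exact: lt_le_trans p1. Qed.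
Let mF : mfun F. Proof. meas. Qed.
Let F0 t : 0 <= F t. Proof. exact: apow_ge0. Qed.

Definition direction_mean : R := \int[sigma]_(u in S) F (dotp u e0).

Lemma direction_integrable v : sigma.-integrable S (EFin \o (fun u => F (dotp u v))).
Proof.
have [M M0 HM] := apow_bounded p1 cp0 cm0 (enorm v).
apply: sphere_integrable; first exact: measurable_apow_dotp.
move=> u Su; apply: HM; apply: le_trans (abs_dotp_le _ _) _.
by rewrite (Su : enorm u = 1) mul1r.
Qed.

Lemma direction_mean_ge0 : 0 <= direction_mean.
Proof. by apply: Rintegral_ge0. Qed.

Lemma direction_meanE v : (\int[sigma]_(u in S) (F (dotp u v))%:E)%E = (enorm v `^ p * direction_mean)%:E.
Proof.
have E w : enorm w = 1 -> (\int[sigma]_(u in S) (F (dotp u w))%:E)%E = direction_mean%:E.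
  move=> w1; rewrite (@sphere_integral_unit R n sigma n0 hsigma (EFin \o F) w e0)//.
  - by rewrite /direction_mean /Rintegral fineK//; exact: integrable_fin_num (direction_integrable e0).
  - meas.
  - exact: enorm_delta.
have [->|v0] := eqVneq v 0.
  rewrite enorm0 powR0 ?gt_eqF// mul0r integral0_eq// => u _; by rewrite dotp0r apow0.
have ev : 0 < enorm v by rewrite enorm_gt0.
have -> : v = enorm v *: ((enorm v)^-1 *: v) by rewrite scalerA mulfV ?scale1r// gt_eqF.
set w := _^-1 *: v; have w1 : enorm w = 1 by rewrite enormZ gtr0_norm ?invr_gt0// mulVf// gt_eqF.
transitivity (\int[sigma]_(u in S) ((enorm v `^ p)%:E * (F (dotp u w))%:E))%E.
  by apply: eq_integral => u _; rewrite dotpZr apowM// ltW.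
rewrite ge0_integralZl//.
- by rewrite (E w w1) -EFinM enormZ w1 mulr1 (gtr0_norm ev).
- by apply: measurable_funTS; apply/measurable_EFinP; exact: measurable_apow_dotp.
- by move=> u _; rewrite lee_fin.
- pos.
Qed.

(** [cone_average] with F(u.e0): F(x.e0) is |x|^p times its value at the direction of x, which is
    within e of u, and the factor c is the mean of |x|^p over the part of a cone in the unit
    ball. *)
Lemma direction_mean_le_ball (c : R) : theta (N / p) = c%:E -> 0 < c ->
  c * om * direction_mean <= @ball_energy R n F 1 1.
Proof.
move=> cE c0; have om0 := @ball_volume_gt0 R n.
have [L L0 HL] := apow_lipschitz p1 cp0 cm0 1.
have mB := @measurable_eball R n.+1 1.
apply: (@le_of_linear_error R _ _ (L * om) 1) => // e ep _.
pose g x := (F (dotp x e0) + L * e * enorm x `^ p) * \1_(B 1) x.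
have mp : mfun (fun x : 'rV[R]_n.+1 => enorm x `^ p).
  by apply: (measurableT_comp (measurable_powR p)); exact: measurable_enorm.
have mg : mfun g.
  apply: measurable_funM; last exact: measurable_indic.
  apply: measurable_funD; first exact: measurable_apow_dotp.
  by apply: measurable_funM.
have g0 x : 0 <= g x by rewrite mulr_ge0 ?indicE// addr_ge0// !mulr_ge0 ?powR_ge0// ltW.
pose A u := c * F (dotp u e0).
have := @cone_average R n sigma n0 hsigma e A (EFin \o g) ep.
have mA : mfun A by apply: measurable_funM => //; exact: measurable_apow_dotp.
have A0 u : 0 <= A u by rewrite mulr_ge0// ltW.
have mg' : mfun (EFin \o g) by exact/measurable_EFinP.
move=> /(_ mA A0 mg' (fun x => _)) H.
have {H} : (om%:E * \int[sigma]_(u in S) (A u)%:E <= \int[V]_x (g x)%:E)%E.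
  apply: H => [x|u u1]; first by rewrite /= lee_fin.
  have mC := measurable_cone e u.
  have BE : [set x | cone e u x /\ enorm x `^ p < 1] = cone e u `&` B 1.
    apply/seteqP; split => x [Cx] H; split => //.
      by rewrite /eball/= ltNge; apply/negP => x1; move: H; rewrite ltNge -(one_powR p) le_powRl// ltW.
    by rewrite -(one_powR p); apply: gt0_ltr_powR => //; rewrite nnegrE ?enorm_ge0.
  have VC : (V (cone e u `&` B 1) < +oo)%E.
    by apply: le_lt_trans (lebesgue_eball_lty n.+1 1); apply: le_lebesgue_rV => //; exact: measurableI.
  have LC : (\int[V]_x (enorm x `^ p * \1_(cone e u `&` B 1) x)%:E = c%:E * V (cone e u `&` B 1))%E.
    rewrite -cE -BE; apply: layer_cake_power => //.
    - by rewrite divr_gt0.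
    - by move=> x; exact: powR_ge0.
    - by rewrite BE.
    move=> t t0 t1; pose r := t `^ p^-1; have r0 : 0 < r by rewrite powR_gt0.
    rewrite BE; have mCB : measurable (cone e u `&` B 1) by meas.
    have -> : t `^ (N / p) = r ^+ n.+1 by rewrite -powR_mulrn ?powR_ge0// /r -powRrM mulrC.
    rewrite -lebesgue_dilate//; congr (V _); apply/seteqP; split => x.
      move=> [Cx xt]; split; first by apply/cone_scale => //; rewrite invr_gt0.
      rewrite /eball/= enormZ gtr0_norm ?invr_gt0// mulrC ltr_pdivrMr// mul1r.
      rewrite ltNge; apply/negP => rx; move: xt; rewrite ltNge.
      by rewrite -(powRVK (ltW t0) (lt0r_neq0 p0)) le_powRl// ltW.
    move=> [Cx]; rewrite /eball/= enormZ gtr0_norm ?invr_gt0// mulrC ltr_pdivrMr// mul1r => xr.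
    have ri0 : 0 < r^-1 by pos.
    split; first exact: (cone_scale e u x ri0).1 Cx.
    rewrite -(powRVK (ltW t0) (lt0r_neq0 p0)); apply: gt0_ltr_powR => //; rewrite nnegrE ?enorm_ge0//.
    pos.
  rewrite /A EFinM [(c%:E * _)%E]muleC -muleA -LC -ge0_integralZl//; last 3 first.
  - meas.
  - by move=> x _; rewrite lee_fin mulr_ge0 ?powR_ge0// indicE.
  - by rewrite lee_fin.
  apply: ge0_le_integral_any => x _.
    by rewrite -EFinM lee_fin !mulr_ge0 ?powR_ge0// indicE.
  rewrite -!EFinM lee_fin indicI /g /= !indicE.
  case: (boolP (x \in cone e u)) => [/set_mem Cx|_]; last by rewrite mul0r !mulr0.
  case: (boolP (x \in B 1)) => _; last by rewrite !(mulr0, mul0r).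
  rewrite !mulr1; have x0 : 0 < enorm x by rewrite enorm_gt0; exact: cone_neq0 Cx.
  pose w := (enorm x)^-1 *: x.
  have Sw : enorm w = 1 by rewrite /w enormZ gtr0_norm ?invr_gt0// mulVf// gt_eqF.
  have -> : dotp x e0 = enorm x * dotp w e0.
    by rewrite /w dotpZl mulrA mulfV ?mul1r// gt_eqF.
  rewrite apowM ?(ltW x0)// [L * e * _]mulrC -mulrDr mulrC; apply: ler_wpM2l; first pos.
  have wu : enorm (u - w) <= e.
    have -> : u - w = - ((enorm x)^-1 *: (x - enorm x *: u)).
      by rewrite scalerBr scalerA mulVf ?scale1r ?gt_eqF// opprB.
    by rewrite enormN enormZ gtr0_norm ?invr_gt0// mulrC ler_pdivrMr// ltW.
  have d1 z : enorm z = 1 -> `|dotp z e0| <= 1.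
    by move=> z1; apply: le_trans (abs_dotp_le _ _) _; rewrite z1 enorm_delta.
  have := HL _ _ (d1 _ u1) (d1 _ Sw); rewrite ler_norml => /andP[_].
  have : L * `|dotp u e0 - dotp w e0| <= L * e.
    apply: ler_wpM2l => //; rewrite -dotpBl; apply: le_trans (abs_dotp_le _ _) _.
    by rewrite enorm_delta mulr1.
  lra.
have -> : (\int[sigma]_(u in S) (A u)%:E = (c * direction_mean)%:E)%E.
  transitivity (\int[sigma]_(u in S) (c%:E * (F (dotp u e0))%:E))%E; first by apply: eq_integral => u _.
  rewrite ge0_integralZl//.
  - by rewrite direction_meanE enorm_delta one_powR mul1r.
  - by apply: measurable_funTS; apply/measurable_EFinP; meas.
  - by move=> u _; rewrite lee_fin.
  - pos.
have iF := integrable_apow_dotp p1 cp0 cm0 e0 mB (@subset_refl _ _).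
have Le0 : 0 <= L * e by pos.
have iL := integrable_cst_indic (L * e) mB (@subset_refl _ _).
have gle x : g x <= F (dotp x e0) * \1_(B 1) x + L * e * \1_(B 1) x.
  rewrite /g indicE; case: (boolP (x \in B 1)) => [/set_mem xB|_]; last by rewrite !mulr0.
  rewrite !mulr1 lerD2l; apply: ler_piMr => //.
  by rewrite -(one_powR p); apply: le_powRl; rewrite ?enorm_ge0// ltW.
have : (\int[V]_x (g x)%:E <= (@ball_energy R n F 1 1 + L * e * om)%:E)%E.
  apply: (@le_trans _ _ (\int[V]_x (F (dotp x e0) * \1_(B 1) x + L * e * \1_(B 1) x)%:E)%E).
    by apply: ge0_le_integral_any => x _; rewrite lee_fin.
  have iFL : integrableV (fun x => F (dotp x e0) * \1_(B 1) x + L * e * \1_(B 1) x).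
    have := integrableD measurableT iF iL.
    by [].
  rewrite -[leLHS]fineK; last exact: integrable_fin_num iFL.
  rewrite -/(Rintegral _ _ _) RintegralD// (Rintegral_cst_indic Le0 mB (@subset_refl _ _)).
  apply: lerD; last exact: lexx.
  by apply: le_of_eq; apply: eq_Rintegral => x _; rewrite mul1r; exact: erefl.
move=> H1 /le_trans /(_ H1); rewrite -EFinM.
have -> : om * (c * direction_mean) = c * om * direction_mean by ring.
by have -> : e * (L * om) = L * e * om by ring.
Qed.

Variable f : 'rV[R]_n.+1 -> R.
Hypotheses (sf : smooth_compact_support f) (fpos : exists x, 0 < f x).
Local Notation Z := (energy p cp cm f).

Let mZ : mfun Z.
Proof. by apply: continuous_measurable_rV; exact: energy_continuous. Qed.

Let mg : mfun (grad f). Proof. by apply: measurable_grad; case: sf. Qed.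

Lemma energy_sphere_bounds : exists c C L : R, [/\ 0 < c, 0 <= L, forall u, S u -> c <= Z u <= C &
  forall u w, S u -> S w -> `|Z u - Z w| <= L * enorm (u - w)].
Proof.
have [L L0 HL] := energy_lipschitz p1 cp0 cm0 sf 1.
have cS : compact S.
  apply: (@subclosed_compact _ _ [set x | enorm x <= 1]); last 2 first.
  - exact: closed_eball_compact.
  - by move=> x; rewrite /unit_sphere/= => ->.
  rewrite (_ : S = (@enorm R n.+1) @^-1` [set 1]).
    by apply: preimage_closed; [move=> x _; exact: enorm_continuous|exact: closed_eq].
  by [].
have S0 : S !=set0 by exists e0; exact: enorm_delta.
have [w /set_mem Sw wP] := EVT_min_rV S0 cS (continuous_subspaceT (energy_continuous p1 cp0 cm0 sf)).
have [w' _ wP'] := EVT_max_rV S0 cS (continuous_subspaceT (energy_continuous p1 cp0 cm0 sf)).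
exists (Z w), (Z w'), L; split => //.
- by apply: energy_gt0 => //; rewrite -enorm_gt0 (Sw : enorm w = 1).
- by move=> u Su; apply/andP; split; [apply: wP|apply: wP']; rewrite inE.
- by move=> u v Su Sv; apply: HL; rewrite ?(Su : enorm u = 1) ?(Sv : enorm v = 1).
Qed.

Definition sphere_energy : R := (\int[sigma]_(u in S) (Z u `^ (- (N / p)))) `^ (- (p / N)).

Lemma grad_power_integrable :
  integrableV (fun x => enorm (grad f x) `^ p).
Proof.
have [D [M [C [[D0 M0 _ _ gD] [_ gM _ _]]]]] := smooth_compact_bounds sf.
apply: (@integrable_bounded_support R n.+1 _ D (M `^ p)).
- meas.
- by move=> x /negP; rewrite -leNgt => /gD ->; rewrite powR0// gt_eqF.
- by move=> x; rewrite ger0_norm ?powR_ge0// le_powRl ?enorm_ge0// ltW.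
Qed.

Lemma sphere_integral_energy : \int[sigma]_(u in S) Z u = direction_mean * \int[V]_x (enorm (grad f x) `^ p).
Proof.
pose h (z : 'rV[R]_n.+1 * 'rV[R]_n.+1) := (F (dotp z.1 (grad f z.2)) * \1_S z.1)%:E.
have mh : mfun h.
  apply/measurable_EFinP; apply: measurable_funM.
    meas.
  meas.
have h0 z : (0 <= h z)%E by pos.
have E : (\int[sigma]_(u in S) (Z u)%:E = \int[V]_x (direction_mean%:E * (enorm (grad f x) `^ p)%:E))%E.
  rewrite integral_in_indic; transitivity (\int[sigma]_u \int[V]_x h (u, x))%E.
    apply: eq_integral => u _; rewrite /h.
    have -> : (Z u)%:E = (\int[V]_x (F (dotp u (grad f x)))%:E)%E.
      by rewrite /energy /Rintegral fineK//; exact: integrable_fin_num (energy_integrable p1 cp0 cm0 sf u).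
    rewrite -ge0_integralZr//; last 2 first.
    - meas.
    - by move=> x _; rewrite lee_fin.
  rewrite (@fubini_tonelli _ _ _ _ _ sigma V h mh h0); apply: eq_integral => x _.
  rewrite /h -EFinM mulrC -direction_meanE (integral_in_indic sigma S (fun u => (F (dotp u (grad f x)))%:E)).
  by [].
rewrite /Rintegral E ge0_integralZl//; last 3 first.
- meas.
- by move=> x _; rewrite lee_fin powR_ge0.
- by rewrite lee_fin direction_mean_ge0.
rewrite fineM//; exact: integrable_fin_num grad_power_integrable.
Qed.

Lemma sphere_energy_le : sphere_energy <= direction_mean * \int[V]_x (enorm (grad f x) `^ p).
Proof.
have [c [C [L [c0 L0 cZC _]]]] := energy_sphere_bounds.
have Np : 0 < N / p by pos.
have [_] := jensen_neg hsigma mZ Np c0 cZC.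
by rewrite sphere_integral_energy invf_div.
Qed.

(** Let Phi = {Z < 1} have the volume of a ball of radius rho. [layer_cake_power] gives the integral
    of Z over Phi as theta V(Phi), and [total_energy_ge] bounds it below by kap om a^(N-p) times the
    energy of that ball, which scales as rho^(N+p). Hence direction_mean kap om a^(N-p) <= rho^(-p),
    and [polar_volume] bounds rho^(-p) by the sphere energy. *)
Lemma sphere_energy_ge a : 0 < a -> V [set x | 1 <= f x] = V (B a) ->
  direction_mean * (kap n p * om) * a `^ (N - p) <= sphere_energy.
Proof.
move=> a0 Va; have [c [C [L [c0 L0 cZC ZL]]]] := energy_sphere_bounds.
have om0 := @ball_volume_gt0 R n.
have Zc u : S u -> c <= Z u by move=> /cZC/andP[].
have ZZ (s : R) u : 0 <= s -> Z (s *: u) = s `^ p * Z u by exact: energyZ.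
pose Phi := [set x | Z x < 1].
have mPhi : measurable Phi by exact: measurable_lt_set.
have unitZ x : x != 0 -> exists2 w, S w & x = enorm x *: w.
  move=> x0; have ex : 0 < enorm x by rewrite enorm_gt0.
  exists ((enorm x)^-1 *: x); last by rewrite scalerA mulfV ?scale1r// gt_eqF.
  by rewrite /unit_sphere/= enormZ gtr0_norm ?invr_gt0// mulVf// gt_eqF.
have PD : Phi `<=` B (c `^ (- p^-1) + 1).
  move=> x Zx; rewrite /eball/=; have [->|x0] := eqVneq x 0.
    by rewrite enorm0 ltr_wpDl// powR_ge0.
  have [w Sw xw] := unitZ x x0; have ex : 0 < enorm x by rewrite enorm_gt0.
  rewrite ltr_pwDr// ltW// -(powRK (ltW ex) (lt0r_neq0 p0)) -[X in _ < _ `^ X]mulN1r powRrM.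
  apply: gt0_ltr_powR; rewrite ?invr_gt0// ?nnegrE ?powR_ge0// powR_inv1 ?(ltW c0)//.
  rewrite -div1r ltr_pdivlMr//; apply: le_lt_trans Zx.
  by rewrite [in leRHS]xw ZZ ?(ltW ex)// ler_wpM2l ?powR_ge0// Zc.
have cPhi : isconvex Phi.
  move=> x y t t01 Zx Zy; rewrite /Phi/=; apply: le_lt_trans (energy_convex p1 cp0 cm0 sf x y t01) _.
  exact: (@convex_combination_lt1 R t (Z x) (Z y) t01 Zx Zy).
have VPhi0 : (0 < V Phi)%E.
  have [d d0 dP] : exists2 d : R, 0 < d & forall x, enorm x < d -> Phi x.
    have C0 : 0 < C by have /cZC/andP[h1 h2] := enorm_delta ord0 : S e0; exact: lt_le_trans (lt_le_trans c0 h1) h2.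
    exists (C `^ (- p^-1)) => [|x xd]; first by rewrite powR_gt0.
    rewrite /Phi/=; have [->|x0] := eqVneq x 0.
      by have := ZZ 0 0 (lexx _); rewrite scale0r => ->; rewrite powR0 ?mul0r ?gt_eqF.
    have [w Sw xw] := unitZ x x0; have ex : 0 < enorm x by rewrite enorm_gt0.
    rewrite xw ZZ ?(ltW ex)//; apply: (@le_lt_trans _ _ (enorm x `^ p * C)).
      by apply: ler_wpM2l; [exact: powR_ge0|have /andP[] := cZC _ Sw].
    rewrite -ltr_pdivlMr// div1r -powR_inv1 ?(ltW C0)//.
    have -> : C `^ (-1) = (C `^ (- p^-1)) `^ p by rewrite -powRrM mulNr mulVf// gt_eqF.
    by apply: gt0_ltr_powR => //; rewrite nnegrE ?powR_ge0// ltW.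
  by apply: (@lebesgue_ball_gt0 R n Phi 0 d) => // x; rewrite subr0; exact: dP.
have [rho rho0 VPhi] := radius_exists mPhi PD VPhi0.
have bPhi : exists D, Phi `<=` B D by eexists; exact: PD.
have := total_energy_ge p1 pn cp0 cm0 sf mPhi cPhi rho0 bPhi VPhi a0 Va.
rewrite (integral_Z_energy p1 cp0 cm0 sf mPhi bPhi).
have Np : 0 < N / p by pos.
have [ct ct0 ctE] := theta_gt0 Np.
have VE : V Phi = (rho ^+ n.+1 * om)%:E by rewrite VPhi lebesgue_eballE.
have Vfin : (V Phi < +oo)%E by rewrite VE ltry.
have -> : \int[V]_u (Z u * \1_Phi u) = ct * (rho ^+ n.+1 * om).
  have PE : [set x | setT x /\ Z x < 1] = Phi by apply/seteqP; split => x // [].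
  have := @layer_cake_power R n setT Z (N / p) Np measurableT mZ (energy_ge0 _ cp0 cm0 _).
  rewrite PE => /(_ Vfin) H; rewrite /Rintegral H ?ctE ?VE -?EFinM//.
  move=> t t0 t1; pose r := t `^ p^-1; have r0 : 0 < r by rewrite powR_gt0.
  have -> : t `^ (N / p) = r ^+ n.+1 by rewrite -powR_mulrn ?powR_ge0// /r -powRrM mulrC.
  rewrite -VE -lebesgue_dilate//; congr (V _); apply/seteqP; split => x /=.
    move=> [_ Zt]; by rewrite /Phi/= ZZ ?invr_ge0 ?(ltW r0)// powR_invK// mulrC ltr_pdivrMr// mul1r.
  by rewrite /Phi/= ZZ ?invr_ge0 ?(ltW r0)// powR_invK// mulrC ltr_pdivrMr// mul1r.
have IE : @ball_energy R n F 1 rho = rho ^+ n.+1 * (rho `^ p * @ball_energy R n F 1 1).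
  have mB1 := @measurable_eball R n.+1 1.
  have iF := integrable_apow_dotp p1 cp0 cm0 e0 mB1 (@subset_refl _ _).
  rewrite /ball_energy -RintegralZl//; last first.
    by have := iF; apply: eq_integrable => // x _; rewrite /= mul1r.
  have rn : rho^-1 != 0 by pos.
  pose g x := (rho `^ p * (F (dotp x e0) * \1_(B 1) x))%:E.
  have mg' : mfun g.
    by apply/measurable_EFinP; meas.
  have g0 x : (0 <= g x)%E by pos.
  have := ge0_integral_rV_scale rn mg' g0.
  rewrite ger0_norm ?invr_ge0 ?(ltW rho0)// invrK => H.
  rewrite /Rintegral; have -> : (\int[V]_x (F (1 * dotp x e0) * \1_(B rho) x)%:E = \int[V]_x g (rho^-1 *: x))%E.
    apply: eq_integral => x _; rewrite /g dotpZl mul1r apowM ?invr_ge0 ?(ltW rho0)//.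
    rewrite -powR_inv1 ?(ltW rho0)// -powRrM mulN1r powRN mulrA mulrA mulfV ?mul1r; last pos.
    rewrite !EFinM; congr (_ * _)%E; apply: indic_iff; rewrite /eball/= powR_inv1 ?(ltW rho0)//.
    by rewrite enormZ gtr0_norm ?invr_gt0// mulrC ltr_pdivrMr// mul1r.
  rewrite H; have gi : (\int[V]_x g x)%E \is a fin_num.
    have := integrableZl measurableT (rho `^ p) iF => /integrable_fin_num; apply; meas.
  have -> : (\int[V]_x (rho `^ p * (F (1 * dotp x e0) * \1_(B 1) x))%:E = \int[V]_x g x)%E.
    by apply: eq_integral => x _; rewrite mul1r; exact: erefl.
  by rewrite (fineM _ gi); exact: erefl.
have [J J0 JE] := sphere_power_integrable hsigma p0 mZ c0 L0 Zc ZL.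
have := polar_volume n0 hsigma p0 mZ c0 L0 Zc ZZ ZL Vfin.
rewrite JE -/Phi VE -EFinM lee_fin mulrC ler_pM2r// => Jr.
have I1 := direction_mean_le_ball ctE ct0.
have rp : 0 < rho `^ p by pos.
have rn : 0 < rho ^+ n.+1 by pos.
have X0 : 0 <= kap n p * a `^ (N - p) by rewrite mulr_ge0 ?powR_ge0// ltW// kap_gt0.
rewrite IE => H1.
have H2 : rho ^+ n.+1 * (rho `^ p * (ct * om * direction_mean)) * om * (kap n p * a `^ (N - p)) <= ct * (rho ^+ n.+1 * om).
  apply: le_trans H1; apply: ler_wpM2r => //; apply: ler_wpM2r; first pos.
  by rewrite !ler_pM2l.
have H3 : direction_mean * (kap n p * om) * a `^ (N - p) <= (rho `^ p)^-1.
  rewrite -div1r ler_pdivlMr//.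
  have q0 : 0 < ct * (rho ^+ n.+1 * om) by pos.
  rewrite -(ler_pM2l q0) mulr1; apply: le_trans H2.
  by apply: le_of_eq; ring.
apply: le_trans H3 _; rewrite /sphere_energy /Rintegral JE.
have -> : (rho `^ p)^-1 = (rho ^+ n.+1) `^ (- (p / N)).
  rewrite -powR_mulrn ?(ltW rho0)// -powRrM -powRN; congr (_ `^ _).
  by rewrite mulrN mulrCA mulfV ?mulr1//.
by apply: le_powRN => //; rewrite divr_ge0// ltW.
Qed.

End affine.

(** * Hausdorff measure of flat sets *)

Section hausdorff_lipschitz.
Context {R : realType}.
Implicit Types (d m n : nat) (r L : R).

Lemma diam_setP n (A : set 'rV[R]_n) r : (diam A <= r%:E)%E <->
  forall x y, A x -> A y -> enorm (x - y) <= r.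
Proof.
split=> [Ar x y Ax Ay|h].
  rewrite -lee_fin; apply: le_trans Ar.
  by apply: ereal_sup_ubound; exists x => //; exists y.
by apply: ge_ereal_sup => _ [x Ax [y Ay <-]]; rewrite lee_fin; exact: h.
Qed.

Lemma diam_fin n (A : set 'rV[R]_n) r : A !=set0 -> (diam A <= r%:E)%E ->
  exists2 D : R, 0 <= D & diam A = D%:E.
Proof.
move=> A0 Ar; have h := diam_ge0 A0.
have f : diam A \is a fin_num by rewrite ge0_fin_numE// (le_lt_trans Ar)// ltry.
by exists (fine (diam A)); rewrite ?fine_ge0// fineK.
Qed.

Lemma unit_ball_lebesgue d : exists2 w : R, 0 <= w & lebesgue_rV d (unit_ball R d) = w%:E.
Proof.
have m : measurable (unit_ball R d).
  apply: measurable_le_set; last meas.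
  meas.
exists (fine (lebesgue_rV d (unit_ball R d))); first exact: fine_ge0.
apply: (@lebesgue_rV_fin _ _ _ 2) => // x x1.
by apply: (le_lt_trans x1); lra.
Qed.

Lemma hausdorff_weightE d : exists2 w : R, 0 <= w &
  forall n (A : set 'rV[R]_n) (D : R), A !=set0 -> diam A = D%:E ->
  hausdorff_weight d A = (w * (2^-1 * D) ^+ d)%:E.
Proof.
have [w w0 wE] := unit_ball_lebesgue d; exists w => // n A D A0 DE.
rewrite /hausdorff_weight DE wE; case: ifPn => [/eqP A00|_].
  by move: A0; rewrite A00 => -[].
by rewrite -EFinM -EFin_expe -EFinM.
Qed.

Lemma hausdorff_weight_le d m n (A : set 'rV[R]_m) (B : set 'rV[R]_n) L r : 0 < L ->
  (diam A <= r%:E)%E -> (B !=set0 -> A !=set0) ->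
  (forall D : R, diam A = D%:E -> (diam B <= (L * D)%:E)%E) ->
  (hausdorff_weight d B <= (L ^+ d)%:E * hausdorff_weight d A)%E.
Proof.
move=> L0 Ar BA h; have [->|/set0P B0] := eqVneq B set0.
  by rewrite hausdorff_weight0 mule_ge0 ?hausdorff_weight_ge0// lee_fin exprn_ge0// ltW.
have [w w0 wE] := hausdorff_weightE d.
have [D D0 DE] := diam_fin (BA B0) Ar.
have [D' D'0 DE'] := diam_fin B0 (h D DE).
rewrite (wE _ _ _ B0 DE') (wE _ _ _ (BA B0) DE) -EFinM lee_fin mulrCA ler_wpM2l//.
rewrite -exprMn lerXn2r ?nnegrE ?mulr_ge0//; first pos.
move: (h D DE); rewrite DE' lee_fin; lra.
Qed.

Lemma le_diam n (A B : set 'rV[R]_n) : A `<=` B -> (diam A <= diam B)%E.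
Proof.
move=> AB; apply: ge_ereal_sup => _ [x Ax [y Ay <-]].
by apply: ereal_sup_ubound; exists x; [exact: AB|exists y => //; exact: AB].
Qed.

Lemma le_hausdorff_weight d n (A B : set 'rV[R]_n) r : (diam B <= r%:E)%E -> A `<=` B ->
  (hausdorff_weight d A <= hausdorff_weight d B)%E.
Proof.
move=> Br AB; have := @hausdorff_weight_le d n n B A 1 r ltr01 Br.
rewrite expr1n mul1e; apply.
  by move=> [x /AB]; exists x.
by move=> D BD; rewrite mul1r -BD; exact: le_diam.
Qed.

Lemma hausdorff_delta_le d n (X : set 'rV[R]_n) r : 0 < r ->
  (hausdorff_delta d r X <= hausdorff d X)%E.
Proof. by move=> r0; apply: ereal_sup_ubound; exists r. Qed.

Lemma hausdorff_lipschitz d m n (X : set 'rV[R]_m) (f : 'rV[R]_m -> 'rV[R]_n) L : 0 < L ->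
  (forall x y, X x -> X y -> enorm (f x - f y) <= L * enorm (x - y)) ->
  (hausdorff d (f @` X) <= (L ^+ d)%:E * hausdorff d X)%E.
Proof.
move=> L0 fL; have Ld0 : 0 < L ^+ d by rewrite exprn_gt0.
apply: ge_ereal_sup => _ [r r0 <-].
have rL : 0 < r / L by pos.
apply: (le_trans _ (lee_wpmul2l _ (hausdorff_delta_le d X rL))); last pos.
rewrite -lee_pdivrMl//; apply: le_ereal_inf_tmp => _ [E [dE XE] <-].
rewrite lee_pdivrMl// -nneseriesZl; last by move=> i _; exact: hausdorff_weight_ge0.
pose E' k : set 'rV[R]_n := f @` (X `&` E k).
have dE' k D : (diam (E k) <= D%:E)%E -> (diam (E' k) <= (L * D)%:E)%E.
  move=> /diam_setP kD; apply/diam_setP => _ _ [x [Xx Ex] <-] [y [Xy Ey] <-].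
  by apply: (le_trans (fL _ _ Xx Xy)); rewrite ler_pM2l//; exact: kD.
apply: (@le_trans _ _ (\sum_(k <oo) hausdorff_weight d (E' k))%E).
  apply: ereal_inf_lbound; exists E' => //; split=> [k|_ [x Xx <-]].
    by apply: (le_trans (dE' k _ (dE k))); rewrite mulrCA divff ?mulr1// gt_eqF.
  by have [k _ Ex] := XE _ Xx; exists k => //; exists x.
apply: lee_nneseries => [k _ _|k _]; first exact: hausdorff_weight_ge0.
apply: (@hausdorff_weight_le _ _ _ _ _ L (r / L)) => //.
- by move=> [_ [x [_ Ex] _]]; exists x.
- by move=> D kD; apply: dE'; rewrite kD.
Qed.

End hausdorff_lipschitz.

(** * Borel sets are Caratheodory measurable for Hausdorff measure *)

Section hausdorff_metric.
Context {R : realType} {n : nat} (d : nat).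
Implicit Types (X Y : set 'rV[R]_n).

(** A set of diameter at most s < r cannot meet both X and Y, so every covering of the union splits
    into one of X and one of Y. *)
Lemma hausdorff_delta_separated X Y (r s : R) : 0 < r -> s < r ->
  (forall x y, X x -> Y y -> r <= enorm (x - y)) ->
  (hausdorff_delta d s X + hausdorff_delta d s Y <= hausdorff_delta d s (X `|` Y))%E.
Proof.
move=> r0 sr sep; apply: le_ereal_inf_tmp => _ [E [dE XE] <-].
apply: (@le_trans _ _ (\sum_(k <oo) hausdorff_weight d (E k `&` X) +
    \sum_(k <oo) hausdorff_weight d (E k `&` Y))%E).
  by apply: leeD; apply: ereal_inf_lbound; (eexists; [split|reflexivity]) => [k|x Zx];
    try (by apply: le_trans (dE k); apply: le_diam; exact: subIsetl);
    (have [k _ Ek] := XE x ltac:(by [left|right])); exists k.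
rewrite -nneseriesD; try by move=> *; exact: hausdorff_weight_ge0.
apply: lee_nneseries => [k _ _|k _].
  by rewrite adde_ge0 ?hausdorff_weight_ge0.
have [->|/set0P[x [Ex Xx]]] := eqVneq (E k `&` X) set0.
  rewrite hausdorff_weight0 add0e; apply: (le_hausdorff_weight _ (dE k)); exact: subIsetl.
rewrite (_ : E k `&` Y = set0); last first.
  apply/seteqP; split=> // y [Ey Yy]; have /diam_setP/(_ x y Ex Ey) := dE k.
  by have := sep _ _ Xx Yy; lra.
rewrite hausdorff_weight0 adde0; apply: (le_hausdorff_weight _ (dE k)); exact: subIsetl.
Qed.

Lemma hausdorff_deltaS X (r s : R) : r <= s ->
  (hausdorff_delta d s X <= hausdorff_delta d r X)%E.
Proof.
move=> rs; apply: le_ereal_inf_tmp => _ [E [dE XE] <-].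
apply: ereal_inf_lbound; exists E => //; split => // k.
by apply: (le_trans (dE k)); rewrite lee_fin.
Qed.

Lemma hausdorff_separated X Y (r : R) : 0 < r ->
  (forall x y, X x -> Y y -> r <= enorm (x - y)) ->
  (hausdorff d X + hausdorff d Y <= hausdorff d (X `|` Y))%E.
Proof.
move=> r0 sep.
have key s t : 0 < s -> 0 < t ->
    (hausdorff_delta d s X + hausdorff_delta d t Y <= hausdorff d (X `|` Y))%E.
  move=> s0 t0; pose q := Num.min (Num.min s t) (r / 2).
  have q0 : 0 < q by rewrite !lt_min s0 t0 divr_gt0.
  have qr : q < r by rewrite gt_min; apply/orP; right; lra.
  apply: (le_trans _ (hausdorff_delta_le d (X `|` Y) q0)).
  apply: (le_trans _ (hausdorff_delta_separated r0 qr sep)).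
  by apply: leeD; apply: hausdorff_deltaS; rewrite !ge_min lexx ?orbT.
have [->|fin] := eqVneq (hausdorff d (X `|` Y)) +oo%E; first exact: leey.
have fY : hausdorff d Y \is a fin_num.
  rewrite ge0_fin_numE; last exact: (outer_measure_ge0 (hausdorff_outer d)).
  apply: le_lt_trans (_ : hausdorff d (X `|` Y) < _)%E; last by rewrite ltey.
  by apply: (le_outer_measure (hausdorff_outer d)) => x Yx; right.
rewrite -leeBrDr//; apply: ge_ereal_sup => _ [s s0 <-].
have fX : hausdorff_delta d s X \is a fin_num.
  rewrite ge0_fin_numE; last exact: hausdorff_delta_ge0.
  apply: le_lt_trans (_ : hausdorff d (X `|` Y) < _)%E; last by rewrite ltey.
  apply: (le_trans (hausdorff_delta_le d X s0)).
  by apply: (le_outer_measure (hausdorff_outer d)) => x Yx; left.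
rewrite leeBrDr// addeC -leeBrDr//; apply: ge_ereal_sup => _ [t t0 <-].
by rewrite leeBrDr// addeC; exact: key.
Qed.

(** Caratheodory's argument for metric outer measures. The slice [T k] of X stays at distance at
    least 1/(k+1) from the complement of the half-space. The layers [Q k] between successive slices
    have summable measure, so the part of X in the half-space but outside [T k] has measure tending
    to 0. *)
Lemma caratheodory_halfspace (i : 'I_n) (c : R) :
  caratheodory_measurable (hausdorff_outer d) [set x : 'rV[R]_n | x 0 i < c].
Proof.
apply: le_caratheodory_measurable => X.
pose H : {outer_measure set 'rV[R]_n -> \bar R} := hausdorff_outer d.
have [->|Xfin] := eqVneq (hausdorff_outer d X) +oo%E; first exact: leey.
have XF : (H X < +oo)%E by rewrite ltey.
pose A0 : set 'rV[R]_n := [set x | x 0 i < c]; rewrite -/A0.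
pose t k : R := c - k.+1%:R^-1.
pose T k := X `&` [set x : 'rV[R]_n | x 0 i < t k].
pose Q k := T k.+1 `\` T k.
have tS k : t k < t k.+1.
  by rewrite /t ltrD2l ltrN2 ltf_pV2 ?posrE// ltr_nat.
have tc k : t k < c by rewrite /t ltrBlDr ltrDl.
have sep (A B : set 'rV[R]_n) (a b : R) : a < b -> (forall x, A x -> x 0 i < a) -> (forall x, B x -> b <= x 0 i) ->
    (H A + H B <= H (A `|` B))%E.
  move=> ab Aa Bb; apply: (@hausdorff_separated _ _ (b - a)); first pos.
  move=> x y /Aa xa /Bb yb; apply: le_trans (coord_le_enorm (x - y) i).
  rewrite !mxE distrC; apply: le_trans (ler_norm _); lra.
have sub (A B : set 'rV[R]_n) : A `<=` B -> (H A <= H B)%E by exact: (le_outer_measure H).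
have QT k : (H (T k) + H (Q k.+1) <= H (T k.+2))%E.
  apply: (@le_trans _ _ (H (T k `|` Q k.+1))).
    apply: (sep _ _ _ _ (tS k)) => x; first by move=> [].
    by move=> [[Xx _]] nT; rewrite leNgt; apply/negP => h; apply: nT.
  apply: sub => x [[Xx xt]|[]//]; split => //=.
  by apply: lt_trans xt _; exact: lt_trans (tS k.+1).
(* [Q j.+1] is separated from [T j], with one layer in between; layers of the same parity therefore
   add up inside one slice, and the two parities give the two terms on the right. *)
have sumQ N : (\sum_(0 <= j < N) H (Q j.+1) <= H (T N) + H (T N.+1))%E.
  elim: N => [|N IH]; first by rewrite big_geq// adde_ge0//.
  rewrite big_nat_recr//= [leRHS]addeC; apply: (le_trans (leeD2r _ IH)).
  by rewrite addeAC; apply: leeD2r; exact: QT.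
have TX k : (H (T k) <= H X)%E by apply: sub; exact: subIsetl.
have Qfin : (\sum_(0 <= j <oo) H (Q j.+1) < +oo)%E.
  apply: (@le_lt_trans _ _ (H X + H X)%E); last by rewrite lte_add_pinfty.
  apply: lime_le; first by apply: is_cvg_nneseries => *; exact: outer_measure_ge0.
  by apply: nearW => N; apply: (le_trans (sumQ N)); apply: leeD.
have tail : (\sum_(N <= j <oo) H (Q j.+1) @[N --> \oo] --> 0)%E.
  by apply: (nneseries_tail_cvg (f := fun j => H (Q j.+1)) (P := xpredT)) => // *; pos.
apply/lee_addgt0Pr => e e0.
have /fine_cvgP[_ /cvgrPdist_lt/(_ e e0)] := tail.
have /fine_cvgP[tfin _] := tail; move=> te.
have [N] : exists N : nat, (\sum_(N <= j <oo) H (Q j.+1) < e%:E)%E.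
  have [N _ hN] : \forall N \near \oo, (\sum_(N <= j <oo) H (Q j.+1) < e%:E)%E.
    near=> N.
    have f : (\sum_(N <= j <oo) H (Q j.+1))%E \is a fin_num by near: N.
    rewrite -(fineK f); apply: le_lt_trans (ler_norm _) _.
    rewrite -[X in `|X|]subr0 distrC; near: N; exact: te.
  by exists N; apply: hN; rewrite /=.
move=> Ne.
have cover : X `&` [set x : 'rV[R]_n | x 0 i < c] `<=` T N.+1 `|` \bigcup_(j in ~` `I_N) Q j.+1.
  move=> x [Xx xc].
  have [xt|xt] := ltP (x 0 i) (t N.+1); first by left.
  right.
  have mono a b : (a <= b)%N -> t a <= t b.
    move=> ab; rewrite /t lerD2l lerN2 lef_pV2 ?posrE// ler_nat//.
  have ex : exists k, x 0 i < t k.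
    have [k kc] : exists k : nat, (c - x 0 i)^-1 < k.+1%:R.
      exists (Num.bound (c - x 0 i)^-1).
      apply: (@lt_le_trans _ _ (Num.bound (c - x 0 i)^-1)%:R); last by rewrite ler_nat.
      by apply: archi_boundP; rewrite invr_ge0 subr_ge0 ltW.
    exists k; rewrite /t ltrBrDr addrC -ltrBrDr invf_plt ?posrE// subr_gt0//.
  case: (ex_minnP ex) => -[|k] xk kmin.
    by have := mono _ _ (leq0n N.+1); rewrite leNgt (le_lt_trans xt xk).
  have kN : (N < k)%N.
    rewrite ltnNge; apply/negP => kN.
    have := mono _ _ (kN : (k.+1 <= N.+1)%N); have := xk; lra.
  case: k xk kmin kN => // k xk kmin kN.
  exists k; first by move=> /=; apply/negP; rewrite -leqNgt.
  by split; [split|move=> [_ /kmin]; rewrite ltnn].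
have step : (H (X `&` A0) <= H (T N.+1) + e%:E)%E.
  apply: (le_trans (sub _ _ cover)).
  apply: (le_trans (outer_measureU2 H _ _)).
  apply: leeD => //; apply: le_trans (ltW Ne).
  exact: (outer_measure_sigma_subadditive_tail H N (fun j => Q j.+1)).
apply: (le_trans (leeD2r _ step)); rewrite addeAC; apply: leeD2r.
apply: (@le_trans _ _ (H (T N.+1 `|` (X `&` ~` A0)))).
  apply: (sep _ _ _ _ (tc N.+1)) => x; first by move=> [].
  by move=> [_ /negP]; rewrite -leNgt.
by apply: sub => x [[]|[]].
Unshelve. all: end_near. Qed.

Lemma caratheodory_borel (A : set 'rV[R]_n) : measurable A ->
  caratheodory_measurable (hausdorff_outer d) A.
Proof.
have sC : sigma_algebra setT (caratheodory_measurable (@hausdorff_outer R n d)).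
  split; first exact: caratheodory_measurable_set0.
    by move=> B CB; rewrite setTD; exact: caratheodory_measurable_setC.
  by move=> F CF; exact: caratheodory_measurable_bigcup.
apply: smallest_sub => //.
rewrite -bigcup_seq => _ [i _ [Y mY <-]]; rewrite setTI.
suff: @measurable _ (measurableTypeR R) `<=` [set Z : set R | caratheodory_measurable (@hausdorff_outer R n d) (@rV_coord R n i @^-1` Z)].
  by apply.
rewrite (RGenInftyO.measurableE R); apply: smallest_sub.
  split=> /=.
  - by rewrite preimage_set0; exact: caratheodory_measurable_set0.
  - by move=> B CB; rewrite setTD; exact: caratheodory_measurable_setC.
  - by move=> F CF; rewrite preimage_bigcup; exact: caratheodory_measurable_bigcup.
move=> _ [c ->] /=.
rewrite (_ : _ @^-1` _ = [set x : 'rV[R]_n | x 0 i < c]); first exact: caratheodory_halfspace.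
by [].
Qed.

End hausdorff_metric.

Section finite_cover.
Context {R : realType} {n : nat} (d : nat).

Lemma hausdorff_delta_finite_cover (T : finType) (E : T -> set 'rV[R]_n) (X : set 'rV[R]_n)
    (r c : R) : 0 <= c -> (forall x, X x -> exists a, E a x) -> (forall a, (diam (E a) <= r%:E)%E) ->
  (forall a, (hausdorff_weight d (E a) <= c%:E)%E) ->
  (hausdorff_delta d r X <= (#|T|%:R * c)%:E)%E.
Proof.
move=> c0 XE Er Ec.
pose F k := if insub k is Some i then E (enum_val (i : 'I_#|T|)) else set0.
have Fc k : (hausdorff_weight d (F k) <= c%:E)%E.
  by rewrite /F; case: insub => //; rewrite hausdorff_weight0.
apply: (@le_trans _ _ (\sum_(k <oo) hausdorff_weight d (F k))%E).
  apply: ereal_inf_lbound; exists F => //; split=> [k|x /XE[a Ea]].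
    rewrite /F; case: insub => //; apply/diam_setP => x y; by case.
  exists (enum_rank a) => //; rewrite /F insubT/=//.
  move=> h; rewrite (_ : Sub _ _ = enum_rank a) ?enum_rankK//; exact: val_inj.
rewrite (nneseries_split 0 #|T|); last by move=> *; exact: hausdorff_weight_ge0.
rewrite [X in (_ + X)%E](_ : _ = 0)%E ?adde0; last first.
  apply: eseries0 => k; rewrite add0n => kT _; rewrite /F insubF ?hausdorff_weight0//.
  by apply/negbTE; rewrite -leqNgt.
rewrite add0n; apply: (@le_trans _ _ (\sum_(0 <= k < #|T|) c%:E)%E).
  by apply: lee_sum => k _; exact: Fc.
by rewrite sumEFin sumr_const_nat subn0 mulr_natl.
Qed.

Lemma hausdorff_weight_bound : exists2 w : R, 0 <= w & forall (A : set 'rV[R]_n) (h : R),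
  0 <= h -> (diam A <= h%:E)%E -> (hausdorff_weight d A <= (w * (2^-1 * h) ^+ d)%:E)%E.
Proof.
have [w w0 wE] := @hausdorff_weightE R d; exists w => // A h h0 Ah.
have hh : 0 <= 2^-1 * h by pos.
have [->|/set0P A0] := eqVneq A set0.
  by rewrite hausdorff_weight0 lee_fin mulr_ge0// exprn_ge0.
have [D D0 DE] := diam_fin A0 Ah; rewrite (wE _ _ _ A0 DE) lee_fin ler_wpM2l//.
rewrite lerXn2r ?nnegrE// ?mulr_ge0// ler_wpM2l//.
by move: Ah; rewrite DE.
Qed.

(** Hausdorff measure on the Borel sigma-algebra of the row vectors instead of the Caratheodory one:
    there it can be compared with Lebesgue measure by invariance. *)
Definition hausdorff_borel (X : set 'rV[R]_n) : \bar R := hausdorff d X.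

Let hausdorff_borel0 : hausdorff_borel set0 = 0%E.
Proof. by []. Qed.

Let hausdorff_borel_ge0 X : (0 <= hausdorff_borel X)%E.
Proof. exact: (outer_measure_ge0 (hausdorff_outer d)). Qed.

Let hausdorff_borel_additive : semi_sigma_additive hausdorff_borel.
Proof.
move=> F mF tF mUF.
apply: (caratheodory_measure_sigma_additive (mu := hausdorff_outer d)) => //.
- by move=> i; apply: caratheodory_borel; exact: mF.
- by apply: caratheodory_borel.
Qed.

HB.instance Definition _ := isMeasure.Build _ _ _ hausdorff_borel
  hausdorff_borel0 hausdorff_borel_ge0 hausdorff_borel_additive.

End finite_cover.

Lemma hausdorff_isometry {R : realType} d m n (X : set 'rV[R]_m) (f : 'rV[R]_m -> 'rV[R]_n) :
  (forall x y, X x -> X y -> enorm (f x - f y) = enorm (x - y)) ->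
  hausdorff d (f @` X) = hausdorff d X.
Proof.
move=> fE; apply/eqP; rewrite eq_le; apply/andP; split.
  rewrite -[leRHS]mul1e -(expr1n R d); apply: hausdorff_lipschitz => // x y Xx Xy.
  by rewrite mul1r fE.
pose g y := xget 0 [set x | X x /\ f x = y].
have gP x : X x -> g (f x) = x.
  move=> Xx; have [Xg gE] : X (g (f x)) /\ f (g (f x)) = f x.
    by apply: (@xgetPex _ 0 [set z | X z /\ f z = f x]); exists x.
  by apply/eqP; rewrite -subr_eq0 -enorm_eq0 -fE// gE subrr enorm0.
have gfX : X = g @` (f @` X).
  apply/seteqP; split=> [x Xx|_ [_ [x Xx <-] <-]]; last by rewrite gP.
  by exists (f x); [exists x|exact: gP].
rewrite [X in (hausdorff d X <= _)%E]gfX -[leRHS]mul1e -(expr1n R d).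
apply: hausdorff_lipschitz => // _ _ [x Xx <-] [y Xy <-].
by rewrite mul1r !gP// fE.
Qed.

(** * Hausdorff and Lebesgue measure in full dimension *)

Section hausdorff_lebesgue.
Context {R : realType} {d : nat}.
Local Notation V := (lebesgue_rV d).

Lemma hausdorff_cube_lty (r : R) : 0 < r -> (hausdorff d (@cube R d r) < +oo)%E.
Proof.
move=> r0; have [w w0 wE] := @hausdorff_weight_bound R d d.
apply: (@le_lt_trans _ _ (w * (d%:R * r) ^+ d)%:E); last exact: ltry.
apply: ge_ereal_sup => _ [s s0 <-].
(* A grid of (M + 1)^d cubes of side h; this M makes their diameter, at most d h, no larger than s.
   The total weight w (d r)^d does not depend on s. *)
pose M := Num.bound (d%:R * (2 * r) / s).
pose h : R := 2 * r / M.+1%:R.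
have h0 : 0 < h by rewrite ?mulr_gt0.
have hs : d%:R * h <= s.
  rewrite /h mulrA ler_pdivrMr// -ler_pdivrMl// mulrC.
  apply: ltW; apply: (@lt_le_trans _ _ M%:R); last by rewrite ler_nat.
  by apply: archi_boundP; rewrite divr_ge0 ?mulr_ge0// ltW.
pose E (a : {ffun 'I_d -> 'I_M.+1}) : set 'rV[R]_d :=
  [set x | forall i, (a i)%:R * h <= x 0 i + r <= (a i)%:R * h + h].
have dE a : (diam (E a) <= (d%:R * h)%:E)%E.
  apply/diam_setP => x y Ex Ey; apply: enorm_le_coord; first pos.
  by move=> i; rewrite !mxE ler_norml; have := Ex i; have := Ey i; lra.
have wa a : (hausdorff_weight d (E a) <= (w * (2^-1 * (d%:R * h)) ^+ d)%:E)%E.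
  by apply: wE => //; rewrite mulr_ge0// ltW.
apply: le_trans (hausdorff_delta_finite_cover _ _ _ wa) _.
- pos.
- move=> x xr; exists [ffun i => inord (Num.trunc ((x 0 i + r) / h))] => i.
  rewrite ffunE; have := xr i; rewrite ltr_norml => /andP[xr1 xr2].
  have t0 : 0 <= (x 0 i + r) / h by rewrite divr_ge0 ?(ltW h0)//; move: xr1; clear; lra.
  set y := (x 0 i + r) / h in t0 *.
  have tM : (Num.trunc y < M.+1)%N.
    rewrite truncn_lt_nat// /y ltr_pdivrMr// mulrC divfK//; move: xr2; clear; lra.
  rewrite inordK//; have /andP[t1 t2] := truncn_itv t0.
  rewrite -ler_pdivlMr// -/y t1/= -[X in _ <= _ + X]mul1r -mulrDl -ler_pdivrMr// natr1; pos.
- by move=> a; apply: le_trans (dE a) _; rewrite lee_fin.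
rewrite lee_fin card_ffun !card_ord natrX mulrCA ler_wpM2l// -exprMn lerXn2r ?nnegrE//.
- pos.
- pos.
have -> : M.+1%:R * (2^-1 * (d%:R * h)) = d%:R * r by rewrite /h; field.
by [].
Qed.

Lemma hausdorff_eball_lty (r : R) : (hausdorff d (@eball R d r) < +oo)%E.
Proof.
apply: (@le_lt_trans _ _ (hausdorff d (@cube R d (Num.max r 1)))).
  apply: (le_outer_measure (hausdorff_outer d)) => x xr i.
  by apply: le_lt_trans (coord_le_enorm x i) _; rewrite lt_max xr.
by apply: hausdorff_cube_lty; rewrite lt_max ltr01 orbT.
Qed.

Lemma hausdorff_translate (v : 'rV[R]_d) (A : set 'rV[R]_d) :
  hausdorff d [set x | A (x + v)] = hausdorff d A.
Proof.
rewrite -(@hausdorff_isometry R d d d A (fun x => x - v)) => [|x y _ _].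
  congr (hausdorff d _); apply/seteqP; split=> [x Ax|_ [x Ax <-]] /=.
    by exists (x + v) => //; rewrite addrK.
  by rewrite subrK.
by congr enorm; rewrite opprB addrA subrK.
Qed.

Lemma measurable_closed_eball (x : 'rV[R]_d) (r : R) : measurable [set y | enorm (y - x) <= r].
Proof.
apply: measurable_le_set; last meas.
apply: measurable_enorm; apply: measurable_add_rV; meas.
Qed.

Lemma lebesgue_closed_eball (x : 'rV[R]_d) (r : R) : 0 < r ->
  V [set y | enorm (y - x) <= r] = ((r ^+ d)%:E * V (unit_ball R d))%E.
Proof.
move=> r0; have -> : [set y : 'rV[R]_d | enorm (y - x) <= r] =
    [set y | [set z : 'rV[R]_d | unit_ball R d (r^-1 *: z)] (y + - x)].
  apply/seteqP; split=> y; rewrite /unit_ball /= enormZ gtr0_norm ?invr_gt0// mulrC ler_pdivrMr ?mul1r//.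
have mB : measurable (unit_ball R d).
  rewrite (_ : unit_ball R d = [set y | enorm (y - 0) <= 1]); first exact: measurable_closed_eball.
  by apply/seteqP; split=> y /=; rewrite subr0.
rewrite lebesgue_rV_addr; last meas.
rewrite lebesgue_rV_scale ?invr_eq0 ?gt_eqF//.
by rewrite gtr0_norm ?invr_gt0// invrK.
Qed.

Lemma lebesgue_point (x : 'rV[R]_d) : (0 < d)%N -> V [set x] = 0%E.
Proof.
case: d x => // d' x _; rewrite (_ : [set x] = [set y | [set 0] (y + - x)]).
  rewrite lebesgue_rV_addr; first exact: lebesgue_point0.
  rewrite (_ : [set 0] = [set y : 'rV[R]_d'.+1 | enorm (y - 0) <= 0]).
    apply: measurable_le_set; last meas.
    apply: measurable_enorm; apply: measurable_add_rV; meas.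
  apply/seteqP; split=> y /=; first by move=> ->; rewrite subr0 enorm0.
  by rewrite subr0 => y0; apply/eqP; rewrite -enorm_eq0 eq_le y0 enorm_ge0.
apply/seteqP; split=> y /=; first by move=> ->; rewrite subrr.
by move/eqP; rewrite subr_eq0 => /eqP.
Qed.

(** A covering set of diameter D lies in a closed ball of radius D around one of its points, whose
    volume is 2^d times the weight of the set. This makes the Hausdorff measure of a ball
    positive. *)
Lemma lebesgue_le_hausdorff (A : set 'rV[R]_d) : (0 < d)%N -> measurable A ->
  (V A <= (2 ^+ d)%:E * hausdorff d A)%E.
Proof.
move=> d0 mA; have e0 : 0 < 2 ^+ d :> R by rewrite exprn_gt0.
apply: (le_trans _ (lee_wpmul2l _ (hausdorff_delta_le d A ltr01))); last pos.
rewrite -lee_pdivrMl//; apply: le_ereal_inf_tmp => _ [E [dE XE] <-].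
rewrite lee_pdivrMl// -nneseriesZl; last by move=> i _; exact: hausdorff_weight_ge0.
pose F k := if pselect (exists x, E k x) is left h
  then [set y | enorm (y - projT1 (cid h)) <= fine (diam (E k))] else set0.
have mF k : measurable (F k).
  by rewrite /F; case: pselect => // h; exact: measurable_closed_eball.
have EF k : E k `<=` F k.
  move=> x Ex; rewrite /F; case: pselect => [h|]; last by case; exists x.
  rewrite /=; case: cid => y Ey.
  have [D D0 DE] : exists2 D : R, 0 <= D & diam (E k) = D%:E by apply: (diam_fin _ (dE k)); exists x.
  by rewrite DE; apply: (iffLR (diam_setP (E k) D)) => //; rewrite DE.
apply: (@le_trans _ _ (\sum_(k <oo) V (F k))%E).
  by apply: measure_sigma_subadditive => //; apply: subset_trans XE _; apply: subset_bigcup => k _; exact: EF.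
apply: lee_nneseries => [k _ _|k _]//.
rewrite /F; case: pselect => [h|nh]; last by rewrite measure0 mule_ge0//// hausdorff_weight_ge0.
case: cid => x Ex.
have [D D0 DE] : exists2 D : R, 0 <= D & diam (E k) = D%:E by apply: (diam_fin _ (dE k)); exists x.
rewrite /hausdorff_weight DE ifF; last by apply/eqP => h0; move: Ex; rewrite h0.
have [w w0 wE] := @unit_ball_lebesgue R d; rewrite wE.
rewrite -!EFinM -EFin_expe -!EFinM.
have [D00|Dn0] := eqVneq D 0.
  rewrite D00 (_ : [set y | _] = [set x]); last first.
    apply/seteqP; split=> y /=; last by move=> ->; rewrite subrr enorm0.
    by move=> yx; apply/eqP; rewrite -subr_eq0 -enorm_eq0 eq_le yx enorm_ge0.
  rewrite lebesgue_point// lee_fin mulr_ge0// mulr_ge0//.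
have D1 : 0 < D by rewrite lt_neqAle eq_sym Dn0.
rewrite lebesgue_closed_eball// wE -EFinM lee_fin exprMn mulrCA [_ * w]mulrC ler_wpM2l//.
by rewrite mulrA -exprMn divff// expr1n mul1r.
Qed.

(** Both measures are translation invariant, and a ball has finite positive measure for both. *)
Lemma hausdorff_lebesgue : (0 < d)%N -> exists2 c : R, 0 < c &
  forall A : set 'rV[R]_d, measurable A -> hausdorff d A = (c%:E * V A)%E.
Proof.
move=> d0; have V1 : (0 < V (@eball R d 1))%E by exact: lebesgue_eball_gt0.
have V1E : V (@eball R d 1) = (fine (V (@eball R d 1)))%:E.
  by rewrite fineK// ge0_fin_numE// lebesgue_eball_lty.
have H1E : hausdorff d (@eball R d 1) = (fine (hausdorff d (@eball R d 1)))%:E.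
  rewrite fineK// ge0_fin_numE; first exact: hausdorff_eball_lty.
  exact: (outer_measure_ge0 (hausdorff_outer d)).
set v := fine _ in V1E; set h := fine _ in H1E.
have v0 : 0 < v by move: V1; rewrite V1E.
have h0 : 0 < h.
  have := lebesgue_le_hausdorff d0 (@measurable_eball R d 1); rewrite V1E H1E -EFinM => vh.
  by have := lt_le_trans v0 vh; rewrite pmulr_rgt0//.
exists (h / v) => [|A mA]; first pos.
have E : (V (@eball R d 1) * hausdorff d A = V A * hausdorff d (@eball R d 1))%E.
  apply: (@invariant_measure_eball R d (@hausdorff_borel R d d) A) => //.
    by apply: sigma_finite_rV => r; exact: hausdorff_eball_lty.
  by move=> w B mB; exact: hausdorff_translate.
rewrite mulrC EFinM -muleA [(h%:E * _)%E]muleC -H1E -E V1E.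
by rewrite muleA -EFinM mulVf ?gt_eqF// mul1e.
Qed.

End hausdorff_lebesgue.

#[global] Hint Resolve measurable_closed_eball : meas.

Section power_integral.
Context {R : realType} (n : nat).

(** Equals 1 / (n + 1), the ratio of the volume of a cone to the product of its height and its
    base. *)
Definition power_integral : \bar R :=
  (\int[@lebesgue_measure R]_t (t ^+ n * \1_(`]0%R, 1%R]%classic) t)%:E)%E.

Lemma measurable_power_indic : mfun (fun t : R => (t ^+ n * \1_(`]0%R, 1%R]%classic) t : R)).
Proof.
apply: measurable_funM; first meas.
by [].
Qed.

Lemma power_indic_ge0 (t : R) : 0 <= (t ^+ n * \1_(`]0%R, 1%R]%classic) t : R).
Proof.
rewrite indicE; case: (boolP (t \in _)) => [|_]; last by rewrite mulr0.
by rewrite inE/= in_itv/= mulr1 => /andP[t0 _]; rewrite exprn_ge0// ltW.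
Qed.

Lemma power_integral_gt0 : exists2 c : R, 0 < c & power_integral = c%:E.
Proof.
have h1 : 2^-1 < 1 :> R by rewrite invf_lt1// ltr1n.
have h0 : 0 < 2^-1 :> R by [].
have leb_oc (a b : R) : a < b -> (\int[lebesgue_measure]_t (\1_(`]a, b]%classic) t : R)%:E = (b - a)%:E)%E.
  move=> ab; have lE : @lebesgue_measure R `]a, b] = (b - a)%:E.
    by rewrite lebesgue_measure_itv/= lte_fin ab -EFinB.
  rewrite -(measure_indic lebesgue_measure); last exact: measurable_itv.
  by [].
have mp := measurable_power_indic.
have le1 : (power_integral <= 1)%E.
  have := leb_oc _ _ ltr01; rewrite subr0 => <-.
  apply: ge0_le_integral_any => t _; first by rewrite lee_fin power_indic_ge0.
  rewrite lee_fin indicE; case: (boolP (t \in _)) => [|_]; last by rewrite mulr0.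
  by rewrite inE/= in_itv/= mulr1 => /andP[t0 t1]; rewrite exprn_ile1// ltW.
have ge : ((2^-1 ^+ n * 2^-1)%:E <= power_integral)%E.
  have -> : (2^-1 ^+ n * 2^-1 : R)%:E =
      (\int[lebesgue_measure]_t ((2^-1 ^+ n)%:E * (\1_(`](2^-1)%R, 1%R]%classic) t : R)%:E))%E.
    rewrite ge0_integralZl//; last exact/measurable_EFinP.
    rewrite leb_oc// EFinM; congr (_ * _%:E)%E; lra.
  apply: ge0_le_integral_any => t _ //.
  rewrite -EFinM lee_fin; have := power_indic_ge0 t; rewrite !indicE.
  case: (boolP (t \in `](2^-1)%R, 1%R]%classic)) => [|_]; last by rewrite !mulr0.
  rewrite inE/= in_itv/= => /andP[t0 t1] _; rewrite mem_set/=; last by rewrite in_itv/= t1 (lt_trans h0).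
  by rewrite !mulr1 lerXn2r// ?nnegrE ltW// (lt_trans h0).
have fin : power_integral \is a fin_num.
  rewrite ge0_fin_numE; first by rewrite (le_lt_trans le1)// ltry.
  by apply: le_trans ge; rewrite lee_fin mulr_ge0//// ltW.
exists (fine power_integral); last by rewrite fineK.
apply: (@lt_le_trans _ _ (2^-1 ^+ n * 2^-1)); first by [].
by rewrite -lee_fin fineK.
Qed.

End power_integral.

(** * Flat sections of cones *)

Section flat_cones.
Context {R : realType} {n : nat}.
Local Notation V := (@lebesgue_rV R n.+1).
Local Notation Vn := (@lebesgue_rV R n).
Implicit Types (x y v : 'rV[R]_n.+1) (C : set 'rV[R]_n.+1).

Definition is_cone C := forall s x, 0 < s -> C x -> C (s *: x).

(** The slice at height t is the slice at height h scaled by t / h, so its volume is (t / h)^n times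
    as large. *)
Lemma cone_volume_e0 C (h : R) : is_cone C -> measurable C -> 0 < h ->
  V [set x | C x /\ 0 < x 0 ord0 <= h] =
  (h%:E * power_integral n * Vn [set z | C (rV_cons (h, z))])%E.
Proof.
move=> cC mC h0; set K := [set x | _]; set Y := [set z | _].
have mh : measurable [set x : 'rV[R]_n.+1 | 0 < x 0 ord0 <= h] by meas.
have mK : measurable K by exact: measurableI.
have mY : measurable Y.
  rewrite /Y -[X in measurable X]setTI.
  meas.
pose g (s : R) : \bar R := (Vn Y * (s ^+ n * \1_(`]0%R, 1%R]%classic) s)%:E)%E.
have inner (t : R) : (\int[Vn]_z (\1_K (rV_cons (t, z)) : R)%:E)%E = g (h^-1 * t).
  have [/andP[t0 th]|nt] := boolP (0 < t <= h).
    have tE : \1_(`]0%R, 1%R]%classic) (h^-1 * t) = 1 :> R.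
      by rewrite indicE mem_set//= in_itv/= mulr_gt0 ?invr_gt0//= mulrC ler_pdivrMr// mul1r.
    have ht : h / t != 0 by pos.
    rewrite /g tE mulr1 muleC.
    have := lebesgue_rV_scale ht mY; rewrite gtr0_norm ?divr_gt0// invf_div [t / h]mulrC => <-.
    rewrite [RHS]measure_indic; last meas.
    apply: eq_integral => z _; apply: indic_iff; rewrite /K /Y /= rV_cons0/=.
    have zE : rV_cons (h, (h / t) *: z) = (h / t) *: rV_cons (t, z).
      by rewrite rV_consZ divfK ?gt_eqF.
    split=> [[Cz _]|Cz]; first by rewrite zE; apply: cC => //; pos.
    split; last by rewrite t0.
    have -> : rV_cons (t, z) = (h / t)^-1 *: rV_cons (h, (h / t) *: z).
      by rewrite zE scalerA mulVf// scale1r.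
    by apply: cC => //; rewrite invr_gt0 divr_gt0.
  have -> : g (h^-1 * t) = 0%E.
    rewrite /g indicE memNset ?mulr0 ?mule0//= in_itv/= => /andP[].
    rewrite pmulr_rgt0 ?invr_gt0// mulrC ler_pdivrMr// mul1r => t0 th.
    by move: nt; rewrite t0 th.
  apply: integral0_eq => z _; rewrite indicE memNset//= => -[_].
  by rewrite rV_cons0/= => th; move: nt; rewrite th.
have g0 s : (0 <= g s)%E by rewrite mule_ge0// lee_fin power_indic_ge0.
have mp := @measurable_power_indic R n.
have mg : mfun g.
  by rewrite /g; meas.
rewrite (measure_indic V mK) (integral_rVS (f := fun x => (\1_K x : R)%:E)); last 2 first.
- meas.
- by [].
under eq_integral => t _ do rewrite inner.
rewrite ge0_integral_mulr ?invr_eq0 ?gt_eqF//.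
rewrite gtr0_norm ?invr_gt0// invrK -muleA; congr (_ * _)%E.
rewrite /g ge0_integralZl//; last 2 first.
- meas.
- by move=> s _; rewrite lee_fin power_indic_ge0.
by rewrite muleC.
Qed.

(* The cone over a flat set of area a at height 1 / enorm v has volume a / (n.+1 * enorm v), so that k is n.+1;
   this value is not needed. *)
Definition cone_area_ratio (k : R) := forall C v, is_cone C -> measurable C -> v != 0 ->
  hausdorff n [set y | C y /\ dotp v y = 1] =
  ((k * enorm v)%:E * V [set x | C x /\ (0 < dotp v x <= 1)%R])%E.

(** A reflection turns v onto the first axis. The section is then an isometric copy of a set in R^n,
    where Hausdorff and Lebesgue measure are proportional, and [cone_volume_e0] gives the volume of
    the cone below it. *)
Lemma flat_cone_area : (0 < n)%N -> exists2 k : R, 0 < k & cone_area_ratio k.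
Proof.
move=> n0; have [c c0 cE] := @hausdorff_lebesgue R n n0.
have [b b0 bE] := @power_integral_gt0 R n.
exists (c / b) => [|C v cC mC v0]; first pos.
have a0 : 0 < enorm v by rewrite enorm_gt0.
set a := enorm v in a0 *; pose e0 : 'rV[R]_n.+1 := delta_mx 0 ord0.
have [Q oQ vQ] : exists2 Q : 'M[R]_n.+1, Q *m Q^T = 1%:M & v *m Q = a *: e0.
  exists (householder (v - a *: e0)); first exact: householder_orth.
  by apply: householder_swap; rewrite enormZ enorm_delta mulr1 gtr0_norm.
have vE x : dotp v (x *m Q^T) = a * x 0 ord0.
  by rewrite -orth_dotpl// vQ dotpZl dotpC dotp_delta.
pose C' : set 'rV[R]_n.+1 := [set x | C (x *m Q^T)].
have mC' : measurable C' by exact: measurable_rV_mul.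
have cC' : is_cone C' by move=> s x s0 Cx; rewrite /C'/= -scalemxAl; exact: cC.
pose h := a^-1; have h0 : 0 < h by rewrite invr_gt0.
have mK : measurable [set x : 'rV[R]_n.+1 | C x /\ 0 < dotp v x <= 1] by meas.
have -> : V [set x : 'rV[R]_n.+1 | C x /\ 0 < dotp v x <= 1] = V [set x | C' x /\ 0 < x 0 ord0 <= h].
  rewrite -(lebesgue_rV_orth (orth_tr oQ) mK); congr (V _).
  apply/seteqP; split=> x /=; rewrite vE pmulr_rgt0// /h -[a^-1]mul1r ler_pdivlMr// [_ * a]mulrC//.
set Y := [set z : 'rV[R]_n | C' (rV_cons (h, z))].
have mY : measurable Y.
  rewrite /Y -[X in measurable X]setTI.
  meas.
rewrite (cone_volume_e0 cC' mC' h0) bE -/Y muleA -!EFinM.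
have -> : c / b * a * (h * b) = c.
  by rewrite /h; field; rewrite !gt_eqF.
rewrite -cE// -(@hausdorff_isometry R n n n.+1 Y (fun z => rV_cons (h, z) *m Q^T)).
  congr (hausdorff n _); apply/seteqP; split=> [y [Cy vy]|_ [z Yz <-]].
    exists (rV_uncons (y *m Q)).2.
      rewrite /Y /C' /=.
        rewrite -[h]mul1r -vy -[y in dotp v y](mulmx1 y) -oQ mulmxA vE mulrAC divff ?mul1r ?gt_eqF//.
      by rewrite -rV_cons_eta -mulmxA oQ mulmx1.
      rewrite -[h]mul1r -vy -[y in dotp v y](mulmx1 y) -oQ mulmxA vE mulrAC divff ?mul1r ?gt_eqF//.
    by rewrite -rV_cons_eta -mulmxA oQ mulmx1.
  by split=> //; rewrite vE rV_cons0 /h divff// gt_eqF.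
move=> x y _ _; rewrite -mulmxBl (orth_enorm _ (orth_tr oQ)) rV_consN rV_consD subrr.
by rewrite /enorm dotp_cons mul0r add0r.
Qed.

End flat_cones.

Lemma convex_body_isconvex {R : realType} n (K : set 'rV[R]_n) : convex_body K -> isconvex K.
Proof.
move=> [_ cK _] x y a /andP[a0 a1] Kx Ky; apply: set_mem.
exact: (cK x y (Itv01 a0 a1) (mem_set Kx) (mem_set Ky)).
Qed.

Lemma convex_body_bounds {R : realType} n (K : set 'rV[R]_n) : convex_body K -> K° 0 ->
  exists r D : R, [/\ 0 < r, 0 < D, forall x, enorm x <= r -> K x & forall x, K x -> enorm x <= D].
Proof.
move=> [kK _ _] K0; have /nbhs_enormP[d d0 dK] := K0.
have Kn0 : K !=set0 by exists 0; apply: dK; rewrite subrr enorm0.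
have [c _ cP] := EVT_max_rV Kn0 kK (continuous_subspaceT enorm_continuous).
exists (d / 2), (enorm c + 1); split.
- pos.
- pos.
- by move=> x xd; apply: dK; rewrite subr0; lra.
- by move=> x /mem_set/cP; lra.
Qed.

(** * The gauge of a convex body and its surface area *)

Section gauge.
Context {R : realType} {n : nat}.
Variables (K : set 'rV[R]_n) (r D : R).
Hypotheses (cK : isconvex K) (kK : compact K) (r0 : 0 < r) (D0 : 0 < D)
  (rK : forall x, enorm x <= r -> K x) (KD : forall x, K x -> enorm x <= D).
Implicit Types (x y z v w : 'rV[R]_n) (s t e : R).

Definition polar : set 'rV[R]_n := [set v | forall y, K y -> dotp v y <= 1].

(** Defined as the support function of the polar body: the supremum is attained, and its maximizers
    are the subgradients, so the gauge never has to be differentiated. That K is its unit ball is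
    [gauge_le1]. *)
Definition gauge x : R := sup [set dotp v x | v in polar].

Definition subgrad x : set 'rV[R]_n := [set v | polar v /\ dotp v x = gauge x].

Lemma dotp_continuous x : continuous (fun v => dotp v x).
Proof.
apply/continuous_enormP => v e e0; exists (e / (enorm x + 1)).
  pos.
have x1 : 0 < enorm x + 1 by pos.
move=> w; rewrite ltr_pdivlMr// => wv; rewrite -dotpBl; apply: le_lt_trans (abs_dotp_le _ _) _.
apply: le_lt_trans wv; rewrite ler_wpM2l ?enorm_ge0//; lra.
Qed.

Lemma ball_in_direction v : v != 0 -> K ((r / enorm v) *: v).
Proof.
rewrite -enorm_gt0 => v0; apply: rK.
by rewrite enormZ gtr0_norm ?divr_gt0// divfK ?gt_eqF.
Qed.

Lemma polar_bounded v : polar v -> enorm v <= r^-1.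
Proof.
move=> Pv; have [->|v0] := eqVneq v 0; first by rewrite enorm0 invr_ge0 ltW.
have v1 : 0 < enorm v by rewrite enorm_gt0.
have := Pv _ (ball_in_direction v0).
rewrite dotpZr -enorm_sqr mulrA divfK ?gt_eqF// mulrC -ler_pdivlMr// div1r//.
Qed.

Lemma polar0 : polar 0.
Proof. by move=> y _; rewrite dotp0l. Qed.

Lemma compact_polar : compact polar.
Proof.
apply: (@subclosed_compact _ _ [set v | enorm v <= r^-1]).
- rewrite (_ : polar = \bigcap_(y in K) [set v | dotp v y <= 1]).
    apply: closed_bigI => y Ky; apply: (@preimage_closed _ _ (fun v => dotp v y) [set t | t <= 1]).
      by move=> v _; exact: dotp_continuous.
    by [].
  by [].
- exact: closed_eball_compact.
- by move=> v; exact: polar_bounded.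
Qed.

Lemma gauge_attained x : exists2 v, polar v & forall w, polar w -> dotp w x <= dotp v x.
Proof.
have P0 : polar !=set0 by exists 0; exact: polar0.
have [v vP h] := EVT_max_rV P0 compact_polar (continuous_subspaceT (@dotp_continuous x)).
by exists v; [exact: set_mem|move=> w /mem_set; exact: h].
Qed.

Lemma le_gauge v x : polar v -> dotp v x <= gauge x.
Proof.
move=> Pv; have [w Pw h] := gauge_attained x; apply: ub_le_sup; last by exists v.
by exists (dotp w x) => _ [u Pu <-]; exact: h.
Qed.

Lemma subgrad_exists x : exists v, subgrad x v.
Proof.
have [v Pv h] := gauge_attained x; exists v; split=> //; apply/eqP.
rewrite eq_le le_gauge//=; apply: ge_sup; first by exists (dotp v x); exists v.
by move=> _ [u Pu <-]; exact: h.
Qed.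

Lemma subgrad_le x v y : subgrad x v -> gauge x + dotp v (y - x) <= gauge y.
Proof. by move=> [Pv <-]; rewrite dotpBr addrC subrK; exact: le_gauge. Qed.

Lemma gauge_ge0 x : 0 <= gauge x.
Proof. by rewrite -(dotp0l x); apply: le_gauge; exact: polar0. Qed.

Lemma gaugeZ s x : 0 <= s -> gauge (s *: x) = s * gauge x.
Proof.
move=> s0; have [v [Pv vx]] := subgrad_exists x; have [w [Pw wx]] := subgrad_exists (s *: x).
apply/eqP; rewrite eq_le -{1}wx -{2}vx -dotpZr le_gauge// dotpZr ler_wpM2l//.
exact: le_gauge.
Qed.

Lemma gauge0 : gauge 0 = 0.
Proof. by rewrite -(scale0r 0) gaugeZ// mul0r. Qed.

Lemma subgradZ s x v : 0 < s -> subgrad (s *: x) v <-> subgrad x v.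
Proof.
move=> s0; rewrite /subgrad /= gaugeZ ?(ltW s0)// dotpZr.
have s1 : s != 0 by pos.
split=> -[Pv E]; split=> //; first exact: (mulfI s1).
by rewrite E.
Qed.

Lemma gauge_lipschitz_subgrad x y w : subgrad x w -> gauge x - gauge y <= enorm w * enorm (x - y).
Proof.
move=> Gw; have := subgrad_le y Gw; have := dotp_le (- w) (y - x).
rewrite dotpNl enormN (enormB y x); lra.
Qed.

Lemma gauge_lipschitz x y : `|gauge x - gauge y| <= r^-1 * enorm (x - y).
Proof.
have h a b : gauge a - gauge b <= r^-1 * enorm (a - b).
  have [w Gw] := subgrad_exists a; apply: le_trans (gauge_lipschitz_subgrad b Gw) _.
  by rewrite ler_wpM2r ?enorm_ge0//; apply: polar_bounded; case: Gw.
by rewrite ler_norml h lerNl opprB enormB h.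
Qed.

Lemma gauge_continuous : continuous gauge.
Proof.
apply/continuous_enormP => x e e0; exists (e * r); first pos.
move=> y yx; apply: le_lt_trans (gauge_lipschitz y x) _.
by rewrite mulrC ltr_pdivrMr.
Qed.

Lemma measurable_gauge : mfun gauge.
Proof. by apply: continuous_measurable_rV; exact: gauge_continuous. Qed.

Lemma gauge_ge x : enorm x / D <= gauge x.
Proof.
have [->|x0] := eqVneq x 0; first by rewrite enorm0 mul0r gauge_ge0.
have x1 : 0 < enorm x by rewrite enorm_gt0.
have Pv : polar ((D * enorm x)^-1 *: x).
  move=> y /KD yD; rewrite dotpZl mulrC ler_pdivrMr ?mulr_gt0// mul1r.
  by apply: le_trans (dotp_le _ _) _; rewrite mulrC ler_wpM2r// ltW.
apply: le_trans (le_gauge x Pv); rewrite dotpZl -enorm_sqr; apply: le_of_eq.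
by field; rewrite !gt_eqF.
Qed.

Lemma gauge_le x : gauge x <= r^-1 * enorm x.
Proof.
have := gauge_lipschitz x 0; rewrite gauge0 !subr0; exact: le_trans (ler_norm _).
Qed.

Lemma gauge_gt0 x : x != 0 -> 0 < gauge x.
Proof. by rewrite -enorm_gt0 => x0; apply: lt_le_trans (gauge_ge x); rewrite divr_gt0. Qed.

(** Separate x from K through the nearest point z of K: w = x - z satisfies w.(y - z) <= 0 for y in
    K, so w / (w.z) lies in the polar, and its value at x exceeds 1. *)
Lemma gauge_separation x : ~ K x -> 1 < gauge x.
Proof.
move=> nKx.
have K0 : K 0 by apply: rK; rewrite enorm0 ltW.
have cd : continuous (fun z => enorm (z - x)).
  apply/continuous_enormP => z e e0; exists e => // y yz.
  apply: le_lt_trans (enorm_dist _ _) _; by rewrite opprB addrA subrK.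
have [z zK zmin] := EVT_min_rV (ex_intro _ _ K0) kK (continuous_subspaceT cd).
have Kz := set_mem zK; pose w : 'rV[R]_n := x - z.
have wy y : K y -> dotp w (y - z) <= 0.
  move=> Ky; apply: (@le_of_linear_error R _ _ (dotp (y - z) (y - z) / 2) 1) => // h h0 h1.
  have Kh : K (h *: y + (1 - h) *: z) by apply: cK => //; rewrite (ltW h0).
  have := zmin _ (mem_set Kh).
  have -> : h *: y + (1 - h) *: z - x = h *: (y - z) - w.
    by rewrite /w scalerBl scalerBr scale1r opprB -!addrA; congr (_ + _); rewrite addrCA.
  have -> : z - x = - w by rewrite opprB.
  rewrite enormN -(ler_pXn2r (n := 2)) ?nnegrE ?enorm_ge0// !enorm_sqr.
  have hh : 0 <= dotp (y - z) (y - z) by exact: dotp_ge0.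
  move: hh; set u : 'rV[R]_n := y - z => hh.
  have -> : dotp (h *: u - w) (h *: u - w) = h * (h * dotp u u) - h * (2 * dotp w u) + dotp w w.
    have E (a b : 'rV[R]_n) : dotp (h *: a - b) (h *: a - b) = h * (h * dotp a a) - h * (2 * dotp b a) + dotp b b.
      by rewrite dotpBl !dotpBr !dotpZl !dotpZr [dotp a b]dotpC; ring.
    by [].
  move=> H; have {H} : h * (2 * dotp w u) <= h * (h * dotp u u) by lra.
  rewrite ler_pM2l//; lra.
have w0 : w != 0.
  by apply/eqP => /eqP; rewrite subr_eq0 => /eqP xz; apply: nKx; rewrite xz.
have w1 : 0 < enorm w by rewrite enorm_gt0.
have wz : 0 < dotp w z.
  have := wy _ (ball_in_direction w0).
  rewrite dotpBr dotpZr -enorm_sqr mulrA divfK ?gt_eqF// subr_le0; apply: lt_le_trans.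
  pos.
have Pv : polar ((dotp w z)^-1 *: w).
  move=> y /wy; rewrite dotpBr subr_le0 dotpZl mulrC ler_pdivrMr// mul1r//.
apply: lt_le_trans (le_gauge x Pv).
rewrite dotpZl mulrC ltr_pdivlMr// mul1r -subr_gt0 -dotpBr -/w -enorm_sqr.
pos.
Qed.

Lemma gauge_le1 x : K x <-> gauge x <= 1.
Proof.
split=> [Kx|]; first by have [v [Pv <-]] := subgrad_exists x; exact: Pv.
by move=> Nx; apply: contrapT => /gauge_separation; rewrite ltNge Nx.
Qed.

Lemma boundaryP x : boundary K x <-> gauge x = 1.
Proof.
have clK : closure K = K.
  apply/esym/closure_id; apply: compact_closed => //; exact: norm_hausdorff.
rewrite /boundary clK; split=> [[/gauge_le1 Nx nKx]|N1].
  apply/eqP; rewrite eq_le Nx leNgt; apply/negP => N1; apply: nKx.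
  rewrite /interior; apply/nbhs_enormP; exists ((1 - gauge x) * r).
    pos.
  move=> y yx; apply/gauge_le1; have := gauge_lipschitz y x; rewrite ler_norml => /andP[_].
  have : r^-1 * enorm (y - x) < 1 - gauge x by rewrite mulrC ltr_pdivrMr.
  lra.
split; first by apply/gauge_le1; rewrite N1.
rewrite /interior => /nbhs_enormP[d d0 dK].
have x0 : 0 < enorm x.
  by rewrite enorm_gt0; apply/eqP => x0; move: N1; rewrite x0 gauge0 => /eqP; rewrite eq_sym oner_eq0.
pose a := d / (2 * enorm x); have a0 : 0 < a by rewrite divr_gt0 ?mulr_gt0.
have : K ((1 + a) *: x).
  apply: dK; rewrite scalerDl scale1r addrC addKr enormZ gtr0_norm// /a invfM mulrA divfK ?gt_eqF//.
  lra.
move=> /gauge_le1; rewrite gaugeZ ?N1; lra.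
Qed.

(** The subgradient attached to a normal nu is nu / (x.nu), of norm 1 / (x.nu); this turns the
    surface integrand |x.nu|^(1-p) into |v|^(p-1). *)
Lemma outer_normal_subgrad x nu : gauge x = 1 -> outer_unit_normal K x nu ->
  exists v, [/\ subgrad x v, `|dotp x nu| * enorm v = 1 & 0 < enorm v].
Proof.
move=> N1 [nu1 nuK].
have t0 : 0 < dotp x nu.
  have nu0 : nu != 0 by rewrite -enorm_gt0 nu1.
  have := nuK _ (ball_in_direction nu0); rewrite nu1 divr1.
  by rewrite dotpBl dotpZl -enorm_sqr nu1 expr1n mulr1 subr_le0; exact: lt_le_trans.
exists ((dotp x nu)^-1 *: nu); split.
- have Pv : polar ((dotp x nu)^-1 *: nu).
    move=> y /nuK; rewrite dotpBl subr_le0 dotpZl mulrC ler_pdivrMr// mul1r [dotp nu y]dotpC//.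
  by split=> //; rewrite dotpZl [dotp nu x]dotpC mulVf ?gt_eqF.
- by rewrite enormZ nu1 mulr1 gtr0_norm// gtr0_norm ?invr_gt0// divff ?gt_eqF.
- by rewrite enormZ nu1 mulr1 gtr0_norm invr_gt0.
Qed.

Lemma subgrad_gt0 x v : x != 0 -> subgrad x v -> 0 < enorm v.
Proof.
move=> x0 [Pv vx]; rewrite enorm_gt0; apply/eqP => v0.
by have := gauge_gt0 x0; rewrite -vx v0 dotp0l ltxx.
Qed.

Lemma gauge1_neq0 x : gauge x = 1 -> x != 0.
Proof. by move=> N1; apply/eqP => x0; move: N1; rewrite x0 gauge0 => /eqP; rewrite eq_sym oner_eq0. Qed.

Lemma normal_vectorP x : gauge x = 1 -> outer_unit_normal K x (normal_vector K x).
Proof.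
move=> N1; have [v Gv] := subgrad_exists x; have v0 := subgrad_gt0 (gauge1_neq0 N1) Gv.
apply: (@xgetPex _ 0 (outer_unit_normal K x)); exists ((enorm v)^-1 *: v).
split; first by rewrite enormZ gtr0_norm ?invr_gt0// mulVf ?gt_eqF.
move=> y Ky; rewrite dotpZr dotpBl [dotp y v]dotpC [dotp x v]dotpC.
case: Gv => Pv ->; rewrite N1 pmulr_rle0 ?invr_gt0// subr_le0; exact: Pv.
Qed.

Lemma surface_integrandE (p : R) x : gauge x = 1 ->
  exists2 v, subgrad x v & `|dotp x (normal_vector K x)| `^ (1 - p) = enorm v `^ (p - 1).
Proof.
move=> N1; have [v [Gv vE v0]] := outer_normal_subgrad N1 (normal_vectorP N1); exists v => //.
have -> : `|dotp x (normal_vector K x)| = (enorm v)^-1.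
  by rewrite -[LHS]mulr1 -(divff (lt0r_neq0 v0)) mulrA vE mul1r.
by rewrite -powR_inv1 ?enorm_ge0// -powRrM; congr (_ `^ _); lra.
Qed.

(** The points of the polar at distance at least e from all subgradients at x form a compact set, on
    which the pairing with x stays strictly below the gauge of x; by continuity none of them is a
    maximizer for y near x. *)
Lemma subgrad_usc x e : 0 < e -> exists2 d : R, 0 < d &
  forall y w, enorm (y - x) < d -> subgrad y w -> exists2 v, subgrad x v & enorm (w - v) < e.
Proof.
move=> e0; pose U := [set w | polar w /\ forall v, subgrad x v -> e <= enorm (w - v)].
have [U0|/set0P U0] := eqVneq U set0.
  exists 1 => // y w _ [Pw _]; apply: contrapT => h.
  suff : U w by rewrite U0.
  by split=> // v Gv; rewrite leNgt; apply/negP => ?; apply: h; exists v.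
have kU : compact U.
  apply: (@subclosed_compact _ _ polar) => [||w []//]; last exact: compact_polar.
  rewrite (_ : U = polar `&` \bigcap_(v in subgrad x) [set w | e <= enorm (w - v)]); last first.
    by [].
  apply: closedI; first by apply: compact_closed; [exact: norm_hausdorff|exact: compact_polar].
  apply: closed_bigI => v _.
  rewrite (_ : [set w | _] = ~` [set w | enorm (w - v) < e]).
    by apply: open_closedC; exact: eball_open.
  by apply/seteqP; split=> w; [move=> ?; apply/negP; rewrite -leNgt|move/negP; rewrite -leNgt].
have [w0 w0U w0max] := EVT_max_rV U0 kU (continuous_subspaceT (@dotp_continuous x)).
have [Pw0 w0e] := set_mem w0U.
have m0 : 0 < gauge x - dotp w0 x.
  rewrite subr_gt0 lt_neqAle le_gauge// andbT; apply/eqP => E.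
  by have := w0e w0 (conj Pw0 E); rewrite subrr enorm0 leNgt e0.
exists ((gauge x - dotp w0 x) * r / 2); first pos.
move=> y w yx Gw; have [Pw wy] := Gw; apply: contrapT => h.
have Uw : U w.
  by split=> // v Gv; rewrite leNgt; apply/negP => ?; apply: h; exists v.
have h1 := w0max _ (mem_set Uw).
have h2 := gauge_lipschitz x y.
have h3 : dotp w y - dotp w x <= r^-1 * enorm (x - y).
  rewrite -dotpBr enormB; apply: le_trans (dotp_le _ _) _.
  by rewrite ler_wpM2r ?enorm_ge0//; exact: polar_bounded.
have h4 : r^-1 * enorm (x - y) < (gauge x - dotp w0 x) / 2.
  rewrite mulrC ltr_pdivrMr// enormB; lra.
move: h2; rewrite ler_norml => /andP[_ h2]; move: wy => wy; lra.
Qed.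

Definition slope x : R := sup [set enorm v | v in subgrad x].

Lemma le_slope x v : subgrad x v -> enorm v <= slope x.
Proof.
move=> Gv; apply: ub_le_sup; last by exists v.
by exists r^-1 => _ [w [Pw _] <-]; exact: polar_bounded.
Qed.

Lemma slope_le x (t : R) : (forall v, subgrad x v -> enorm v <= t) -> slope x <= t.
Proof.
move=> h; apply: ge_sup; last by move=> _ [v /h ? <-].
by have [v Gv] := subgrad_exists x; exists (enorm v); exists v.
Qed.

Lemma slope_ge0 x : 0 <= slope x.
Proof. by have [v Gv] := subgrad_exists x; apply: le_trans (le_slope Gv); pos. Qed.

Lemma slope_bounded x : slope x <= r^-1.
Proof. by apply: slope_le => v [Pv _]; exact: polar_bounded. Qed.

Lemma slopeZ s x : 0 < s -> slope (s *: x) = slope x.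
Proof.
move=> s0; rewrite /slope; congr (sup _); apply/seteqP.
by split=> _ [v Gv <-]; exists v => //; move: Gv; rewrite subgradZ.
Qed.

Lemma slope_usc x e : 0 < e -> exists2 d : R, 0 < d &
  forall y, enorm (y - x) < d -> slope y <= slope x + e.
Proof.
move=> e0; have [d d0 h] := subgrad_usc x e0; exists d => // y yx.
apply: slope_le => w /(h y w yx)[v Gv wv].
have := enorm_triangle2 w v 0; rewrite !subr0; have := le_slope Gv; lra.
Qed.

Lemma measurable_slope : mfun slope.
Proof.
apply: (measurability _ (RGenInftyO.measurableE R)) => //.
move=> _ [_ [t ->] <-]; rewrite setTI; apply: open_measurable_rV.
rewrite openE => x /=; rewrite in_itv/= => xt.
have e0 : 0 < (t - slope x) / 2 by pos.
have [d d0 h] := slope_usc x e0; apply/nbhs_enormP; exists d => // y /h.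
rewrite /= in_itv/=; lra.
Qed.

(** [slope] is upper semicontinuous, so near x all subgradients have norm at most slope x + e, and
    the norms of subgradients bound the increments of the gauge. *)
Lemma gauge_local_lipschitz x e : 0 < e -> exists2 d : R, 0 < d &
  forall y z, enorm (y - x) < d -> enorm (z - x) < d ->
  `|gauge y - gauge z| <= (slope x + e) * enorm (y - z).
Proof.
move=> e0; have [d d0 h] := slope_usc x e0; exists d => // y z yx zx.
have H a b : enorm (a - x) < d -> gauge a - gauge b <= (slope x + e) * enorm (a - b).
  move=> ax; have [w Gw] := subgrad_exists a; apply: le_trans (gauge_lipschitz_subgrad b Gw) _.
  rewrite ler_wpM2r ?enorm_ge0//; apply: le_trans (le_slope Gw) _; exact: h.
by rewrite ler_norml H// lerNl opprB enormB H.
Qed.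

End gauge.

#[global] Hint Resolve measurable_gauge measurable_slope : meas.

Section null_sets.
Context {R : realType} {n : nat}.
Local Notation V := (@lebesgue_rV R n.+1).

Lemma lebesgue_rV_direction (A : set 'rV[R]_n.+1) (e : 'rV[R]_n.+1) : measurable A -> enorm e = 1 ->
  (forall x (s : R), A x -> A (x + s *: e) -> s = 0) -> V A = 0%E.
Proof.
move=> mA e1 As; pose Q := householder (delta_mx 0 ord0 - e).
have oQ : Q *m Q^T = 1%:M by exact: householder_orth.
have eQ : (delta_mx 0 ord0 : 'rV[R]_n.+1) *m Q = e by apply: householder_swap; rewrite enorm_delta e1.
rewrite -(lebesgue_rV_orth oQ mA) lebesgue_rV_fiber; last meas.
apply: integral0_eq => x _.
set F := fiber _ x.
have [->|/set0P[t Ft]] := eqVneq F set0; first exact: measure0.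
rewrite (_ : F = [set t]); first exact: lebesgue_measure_set1.
apply/seteqP; split=> s; last by move=> ->.
move=> Fs; have := As (rV_cons (t, x) *m Q) (s - t) Ft.
rewrite -eQ scalemxAl -mulmxDl.
have dE : delta_mx 0 ord0 = rV_cons (1, 0) :> 'rV[R]_n.+1.
  apply/rowP => i; rewrite [LHS]mxE; case: (unliftP ord0 i) => [j ->|->].
    by rewrite rV_consS mxE.
  by rewrite rV_cons0.
have -> : rV_cons (t, x) + (s - t) *: delta_mx 0 ord0 = rV_cons (s, x) :> 'rV[R]_n.+1.
  by rewrite dE rV_consZ rV_consD mulr1 addrC subrK scaler0 addr0.
by move=> /(_ Fs) /eqP; rewrite subr_eq0 => /eqP.
Qed.

Lemma lebesgue_rV_countable (T : countType) (F : T -> set 'rV[R]_n.+1) :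
  (forall c, measurable (F c)) -> (forall c, V (F c) = 0%E) ->
  measurable (\bigcup_c F c) /\ V (\bigcup_c F c) = 0%E.
Proof.
move=> mF F0; pose G k := if unpickle k is Some c then F c else set0.
have FG : \bigcup_c F c = \bigcup_k G k.
  apply/seteqP; split=> x [c _ Fc].
    by exists (pickle c) => //; rewrite /G pickleK.
  by move: Fc; rewrite /G; case: unpickle => // c' Fc'; exists c'.
have mG k : measurable (G k) by rewrite /G; case: unpickle.
rewrite FG; split; first exact: bigcupT_measurable.
apply/eqP; rewrite eq_le measure_ge0 andbT.
have mU : measurable (\bigcup_k G k) by exact: bigcupT_measurable.
apply: le_trans (measure_sigma_subadditive V mG mU _) _ => //.
rewrite eseries0// => k _ _; rewrite /G; case: unpickle => [c|]; [exact: F0|exact: measure0].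
Qed.

End null_sets.

(** * Uniqueness of subgradients almost everywhere; cones of small oscillation *)

Section almost_everywhere.
Context {R : realType} {n : nat}.
Variables (K : set 'rV[R]_n.+1) (r D : R).
Hypotheses (cK : isconvex K) (kK : compact K) (r0 : 0 < r) (D0 : 0 < D)
  (rK : forall x, enorm x <= r -> K x) (KD : forall x, K x -> enorm x <= D).
Local Notation V := (@lebesgue_rV R n.+1).
Local Notation N := (gauge K).
Implicit Types (x y z v w : 'rV[R]_n.+1) (s t e : R).

(* Where the gauge has two subgradients it has a corner along some coordinate
   axis, with rational data; along that axis such corners cannot repeat. *)
Definition corner (c : R) (m : nat) (i : 'I_n.+1) : set 'rV[R]_n.+1 :=
  [set x | forall s, N x + c * s + m.+1%:R^-1 * `|s| <= N (x + s *: delta_mx 0 i)].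

Lemma corner_closed c m i : closed (corner c m i).
Proof.
rewrite (_ : corner c m i = \bigcap_(s in setT) [set x | (fun x => N (x + s *: delta_mx 0 i) - N x) x \in
    [set t : R | c * s + m.+1%:R^-1 * `|s| <= t]]); last first.
  apply/seteqP; split=> x h s; last by have := h s I; rewrite /= inE/= lerBrDl addrA.
  by move=> _; rewrite /= inE/= lerBrDl addrA; exact: h.
apply: closed_bigI => s _.
rewrite (_ : [set x | _] = (fun x => N (x + s *: delta_mx 0 i) - N x) @^-1` [set t : R | c * s + m.+1%:R^-1 * `|s| <= t]).
  apply: preimage_closed; last exact: closed_ge.
  move=> x _; apply: locally_lipschitz_continuous => rho; exists (2 * r^-1).
    pos.
  move=> y z _ _; have := gauge_lipschitz r0 rK y z.
  have := gauge_lipschitz r0 rK (y + s *: delta_mx 0 i) (z + s *: delta_mx 0 i).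
  have -> : y + s *: delta_mx 0 i - (z + s *: delta_mx 0 i) = y - z by rewrite opprD addrACA subrr addr0.
  rewrite !ler_norml => /andP[h1 h2] /andP[h3 h4]; lra.
by apply/seteqP; split=> x /=; rewrite inE.
Qed.

(** If x and x + s e_i were corners with the same data, the inequality at x with step s and the one
    at x + s e_i with step - s would add up to 2 |s| / (m + 1) <= 0. *)
Lemma corner_null c m i : V (corner c m i) = 0%E.
Proof.
apply: (@lebesgue_rV_direction _ _ _ (delta_mx 0 i)).
- by apply: closed_measurable_rV; exact: corner_closed.
- exact: enorm_delta.
move=> x s cx cxs; apply/eqP; apply: contrapT => /negP s0.
have := cx s; have := cxs (- s); rewrite scaleNr addrK normrN.
have : 0 < m.+1%:R^-1 * `|s| by rewrite mulr_gt0 ?normr_gt0.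
by move: (N _) (N _) (m.+1%:R^-1 * _) => a b d; rewrite mulrN; lra.
Qed.

Lemma subgrad_corner x v w i : subgrad K x v -> subgrad K x w -> v 0 i < w 0 i ->
  exists (q : rat) (m : nat), corner (ratr q) m i x.
Proof.
move=> Gv Gw vw; have [q] := rat_in_itvoo vw; rewrite in_itv/= => /andP[q1 q2].
pose a : R := Num.min (ratr q - v 0 i) (w 0 i - ratr q).
have a0 : 0 < a by rewrite lt_min !subr_gt0 q1.
have av : a <= ratr q - v 0 i by rewrite /a ge_min lexx.
have aw : a <= w 0 i - ratr q by rewrite /a ge_min lexx orbT.
exists q, (Num.bound a^-1) => s.
have ma : (Num.bound a^-1).+1%:R^-1 <= a.
  rewrite -[leRHS]invrK lef_pV2 ?posrE ?invr_gt0//; apply: ltW.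
  apply: (@lt_le_trans _ _ (Num.bound a^-1)%:R); last by rewrite ler_nat.
  by apply: archi_boundP; rewrite invr_ge0 ltW.
have hv := subgrad_le r0 rK (x + s *: delta_mx 0 i) Gv; have hw := subgrad_le r0 rK (x + s *: delta_mx 0 i) Gw.
move: hv hw; rewrite addrAC subrr add0r !dotpZr !dotp_delta => hv hw.
have lin (g b m t y : R) : b <= y - g -> m <= b -> 0 <= t -> N x + g * t + m * t <= N x + t * y.
  move=> h1 h2 t0; have := ler_wpM2l t0 h1; have := ler_wpM2l t0 h2; lra.
have [s0|s0] := leP 0 s.
  by rewrite ger0_norm//; apply: le_trans hw; exact: lin aw ma s0.
rewrite ltr0_norm//; apply: le_trans hv; have s1 : 0 <= - s by lra.
have av' : a <= - v 0 i - - ratr q by rewrite opprK addrC.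
by have := lin _ _ _ _ _ av' ma s1; rewrite !mulrNN.
Qed.

Lemma subgrad_unique_ae : exists Z : set 'rV[R]_n.+1, [/\ measurable Z, V Z = 0%E &
  forall x v w, ~ Z x -> subgrad K x v -> subgrad K x w -> v = w].
Proof.
pose F (c : rat * nat * 'I_n.+1) := corner (ratr c.1.1) c.1.2 c.2.
have [mU U0] : measurable (\bigcup_c F c) /\ V (\bigcup_c F c) = 0%E.
  apply: lebesgue_rV_countable => c; last exact: corner_null.
  by apply: closed_measurable_rV; exact: corner_closed.
exists (\bigcup_c F c); split=> // x v w nZ Gv Gw; apply/rowP => i.
have [h|h|//] := ltgtP (v 0 i) (w 0 i); case: nZ.
  by have [q [m cx]] := subgrad_corner Gv Gw h; exists (q, m, i).
by have [q [m cx]] := subgrad_corner Gw Gv h; exists (q, m, i).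
Qed.

Lemma subgrad_norm_ge x v : x != 0 -> subgrad K x v -> D^-1 <= enorm v.
Proof.
rewrite -enorm_gt0 => x0 [Pv vx]; have := gauge_ge r0 D0 rK KD x; rewrite -vx => h.
have := le_trans h (dotp_le v x); rewrite mulrC ler_pM2r//.
Qed.

Lemma rational_near x e : 0 < e -> exists q : 'rV[rat]_n.+1, enorm (x - map_mx ratr q) < e.
Proof.
move=> e0; pose d := e / (2 * n.+1%:R); have d0 : 0 < d by rewrite divr_gt0//.
have ex i : exists q : rat, `|x 0 i - ratr q| <= d.
  have [q] : exists q : rat, ratr q \in `](x 0 i - d), (x 0 i + d)[ by apply: rat_in_itvoo; lra.
  by rewrite in_itv/= => /andP[q1 q2]; exists q; rewrite ler_norml; lra.
have [f fP] := choice ex; exists (\row_i f i).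
apply: (@le_lt_trans _ _ (n.+1%:R * d)).
  by apply: enorm_le_coord => [|i]; [pos|rewrite !mxE].
have -> : n.+1%:R * d = e / 2 by rewrite /d; field; rewrite addrC.
lra.
Qed.

(** The cones with rational axis and opening 1 / (m + 1) are enumerated. One on which the
    subgradients stay within e of some v is kept; any other is replaced by the empty set with a
    fixed v. Upper semicontinuity puts each nonzero x with a unique subgradient into a kept cone,
    and removing the earlier cones makes the family disjoint while its members remain cones. *)
Lemma good_cones e : 0 < e -> exists (C : nat -> set 'rV[R]_n.+1) (v : nat -> 'rV[R]_n.+1),
  [/\ forall k, is_cone (C k), forall k, measurable (C k), trivIset setT C & forall k x, C k x -> x != 0] /\
  [/\ forall k, polar K (v k), forall k, D^-1 <= enorm (v k),
    forall k x w, C k x -> subgrad K x w -> enorm (w - v k) <= e &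
    forall x v0, x != 0 -> (forall w, subgrad K x w -> w = v0) -> exists k, C k x].
Proof.
move=> e0.
pose Dq (c : 'rV[rat]_n.+1 * nat) : set 'rV[R]_n.+1 := cone c.2.+1%:R^-1 (map_mx ratr c.1).
pose good c v := [/\ polar K v, D^-1 <= enorm v & forall x w, Dq c x -> subgrad K x w -> enorm (w - v) <= e].
pose ok (k : nat) (Ev : set 'rV[R]_n.+1 * 'rV[R]_n.+1) :=
  [/\ forall s x, 0 < s -> (Ev.1 (s *: x) <-> Ev.1 x), measurable Ev.1, forall x, Ev.1 x -> x != 0 &
      polar K Ev.2] /\ [/\ D^-1 <= enorm Ev.2, forall x w, Ev.1 x -> subgrad K x w -> enorm (w - Ev.2) <= e &
      forall c, unpickle k = Some c -> (exists v, good c v) -> Ev.1 = Dq c].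
have e00 : (delta_mx 0 ord0 : 'rV[R]_n.+1) != 0 by rewrite -enorm_gt0 enorm_delta.
have [vd Gvd] := subgrad_exists r0 rK (delta_mx 0 ord0 : 'rV[R]_n.+1).
have ex k : exists Ev, ok k Ev.
  have [[c [kc [v [Pv vD vP]]]]|h] := pselect (exists c, unpickle k = Some c /\ exists v, good c v).
    exists (Dq c, v); split; split=> //=.
    - by move=> s x s0; exact: cone_scale.
    - exact: measurable_cone.
    - by move=> x; exact: cone_neq0.
    - by move=> c'; rewrite kc => -[<-].
  exists (set0, vd); split; split=> //=; first by case: Gvd.
    exact: subgrad_norm_ge Gvd.
  by move=> c kc gc; case: h; exists c.
have [f fP] := choice ex.
exists (seqDU (fun k => (f k).1)), (fun k => (f k).2); split; split.
- move=> k s x s0; rewrite /seqDU => -[kx nx]; split.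
    by have [[h _ _ _] _] := fP k; rewrite h.
  move=> h; apply: nx; move: h; rewrite -!(bigcup_mkord _ (fun j => (f j).1)) => -[j jk Ej]; exists j => //.
  by have [[h _ _ _] _] := fP j; move: Ej; rewrite h.
- by apply: seqDU_measurable => k; case: (fP k) => -[].
- by [].
- by move=> k x kx; have [[_ _ h _] _] := fP k; apply: h; exact: (subset_seqDU kx).
- by move=> k; case: (fP k) => -[].
- by move=> k; case: (fP k) => _ [].
- by move=> k x w kx; have [_ [_ h _]] := fP k; apply: h; exact: (subset_seqDU kx).
move=> x v0 x0 xv; suff : (\bigcup_k seqDU (fun k => (f k).1) k) x by move=> [k _ ?]; exists k.
rewrite -seqDU_bigcup_eq.
have x1 : 0 < enorm x by rewrite enorm_gt0.
pose u : 'rV[R]_n.+1 := (enorm x)^-1 *: x.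
have [d d0 dP] := subgrad_usc r0 rK u e0.
pose m := Num.bound (2 / d).
(* Every direction of the cone is within 1 / (m + 1) of the rational axis q, and so is u; hence it
   is within d of u. *)
have md : 2 * m.+1%:R^-1 < d.
  rewrite ltr_pdivrMr// mulrC -ltr_pdivrMr//; apply: (@lt_le_trans _ _ m%:R); last by rewrite ler_nat.
  by apply: archi_boundP; rewrite divr_ge0// ltW.
have m0 : 0 < m.+1%:R^-1 :> R by [].
have [q uq] := rational_near u m0.
have cone_near y : Dq (q, m) y -> enorm ((enorm y)^-1 *: y - map_mx ratr q) < m.+1%:R^-1.
  move=> yq; have y1 : 0 < enorm y by rewrite enorm_gt0; exact: cone_neq0 yq.
  rewrite -(ltr_pM2l y1) -[X in X * enorm (_ - _)]gtr0_norm// -enormZ scalerBr scalerA divff ?gt_eqF//.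
  by rewrite scale1r [ltRHS]mulrC.
have g : good (q, m) v0.
  have xv0 : subgrad K x v0.
    by have [w Gw] := subgrad_exists r0 rK x; rewrite -(xv w Gw).
  split; first by case: xv0.
    exact: subgrad_norm_ge xv0.
  move=> y w yq Gw; have y1 : 0 < enorm y by rewrite enorm_gt0; exact: cone_neq0 yq.
  have Gw' : subgrad K ((enorm y)^-1 *: y) w.
    by apply/(subgradZ r0 rK) => //; rewrite invr_gt0.
  have yu : enorm ((enorm y)^-1 *: y - u) < d.
    have := enorm_triangle2 ((enorm y)^-1 *: y) (map_mx ratr q) u.
    move=> h; apply: le_lt_trans h _; apply: lt_trans md; rewrite [2 * _]mulr_natl mulr2n.
    by apply: ltrD; [exact: cone_near|rewrite enormB].
  have [v' Gv' wv'] := dP _ _ yu Gw'.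
  have -> : v0 = v'.
    apply/esym/xv; move: Gv'; rewrite /u (subgradZ r0 rK)// invr_gt0//.
  pos.
exists (pickle (q, m)) => //.
have [_ [_ _ h]] := fP (pickle (q, m)).
rewrite (h (q, m)) ?pickleK//; last by exists v0.
rewrite /Dq /cone /=.
have -> : x - enorm x *: map_mx ratr q = enorm x *: (u - map_mx ratr q).
  by rewrite scalerBr scalerA divff ?gt_eqF// scale1r.
by rewrite enormZ gtr0_norm// mulrC ltr_pM2r.
Qed.

End almost_everywhere.

Lemma bernoulli_ineq {R : realDomainType} (t : R) m : 0 <= t -> t <= 1 -> 1 - m%:R * t <= (1 - t) ^+ m.
Proof.
move=> t0 t1; elim: m => [|m IH]; first by rewrite mul0r subr0.
rewrite exprS; have q0 : 0 <= 1 - t by lra.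
apply: le_trans (ler_wpM2l q0 IH); rewrite -natr1.
have : 0 <= m%:R * (t * t) by pos.
move: (m%:R : R) => a; nra.
Qed.

(** * Area of the unit sphere *)

Section unit_ball.
Context {R : realType} {n : nat}.
Local Notation V := (@lebesgue_rV R n.+1).
Local Notation om := (@ball_volume R n).
Implicit Types (x y z v w : 'rV[R]_n.+1) (C : set 'rV[R]_n.+1).

Lemma unit_ball_in x : enorm x <= 1 -> unit_ball R n.+1 x.
Proof. by []. Qed.

Lemma unit_ball_sub x : unit_ball R n.+1 x -> enorm x <= 1.
Proof. by []. Qed.

Lemma lebesgue_unit_ball : V (unit_ball R n.+1) = om%:E.
Proof.
have [w w0 wE] := @unit_ball_lebesgue R n.+1; rewrite wE; congr (_%:E).
have mE : measurable (@eball R n.+1 1) by meas.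
have mU : measurable (unit_ball R n.+1).
  rewrite (_ : unit_ball R n.+1 = [set y | enorm (y - 0) <= 1]); first meas.
  by apply/seteqP; split=> y /=; rewrite subr0.
have omE : V (@eball R n.+1 1) = om%:E by rewrite lebesgue_eballE// expr1n mul1r.
apply/eqP; rewrite eq_le; apply/andP; split; last first.
  rewrite -lee_fin -wE -omE; apply: le_lebesgue_rV => // x; exact: ltW.
apply: (@le_of_linear_error R _ _ (n.+1%:R * w) 2^-1) => // h h0 h1.
have h2 : 0 < 1 - h by lra.
have : ((1 - h) ^+ n.+1 * w <= om).
  rewrite -lee_fin EFinM -wE -(lebesgue_closed_eball 0)// -omE; apply: le_lebesgue_rV => //.
    meas.
  by move=> x /=; rewrite subr0 /eball => xh; apply: le_lt_trans xh _; lra.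
have := @bernoulli_ineq R h n.+1; move=> /(_ (ltW h0)); have h3 : h <= 1 by lra.
move=> /(_ h3) /(ler_wpM2r w0); lra.
Qed.

Lemma gauge_unit_ball x : gauge (unit_ball R n.+1) x = enorm x.
Proof.
apply/eqP; rewrite eq_le; apply/andP; split.
  by have := gauge_le ltr01 unit_ball_in x; rewrite invr1 mul1r.
by have := gauge_ge ltr01 ltr01 unit_ball_in unit_ball_sub x; rewrite divr1.
Qed.

Lemma subgrad_unit_ball x v : x != 0 -> subgrad (unit_ball R n.+1) x v -> v = (enorm x)^-1 *: x.
Proof.
rewrite -enorm_gt0 => x0 [Pv]; rewrite gauge_unit_ball => vx.
have v1 : enorm v <= 1 by have := polar_bounded ltr01 unit_ball_in Pv; rewrite invr1.
apply/eqP; rewrite -subr_eq0 -enorm_eq0 -sqrf_eq0 enorm_sqr.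
rewrite eq_le dotp_ge0 dotpBl !dotpBr !dotpZl !dotpZr [dotp x v]dotpC vx -!enorm_sqr.
have := enorm_ge0 v; have -> : (enorm x)^-1 * ((enorm x)^-1 * enorm x ^+ 2) = 1.
  by field; rewrite gt_eqF.
rewrite mulVf//; nra.
Qed.

Lemma radial_contraction x y : 1 <= enorm x -> 1 <= enorm y ->
  enorm ((enorm x)^-1 *: x - (enorm y)^-1 *: y) <= enorm (x - y).
Proof.
move=> x1 y1; have x0 : 0 < enorm x by apply: lt_le_trans x1.
have y0 : 0 < enorm y by apply: lt_le_trans y1.
rewrite -(ler_pXn2r (n := 2)) ?nnegrE ?enorm_ge0// !enorm_sqr.
rewrite !dotpBl !dotpBr !dotpZl !dotpZr [dotp y x]dotpC -!enorm_sqr.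
have xy := dotp_le x y; move: (dotp x y) (enorm x) (enorm y) xy x1 y1 x0 y0 => c a b ca a1 b1 a0 b0.
have ab : 1 <= a * b by rewrite -[1]mulr1 ler_pM.
have -> : a^-1 * (a^-1 * a ^+ 2) - a^-1 * (b^-1 * c) - (b^-1 * (a^-1 * c) - b^-1 * (b^-1 * b ^+ 2)) =
    2 - 2 * c / (a * b) by field; rewrite !gt_eqF.
have E : (a * b - c) * (1 - (a * b)^-1) = a * b - c - 1 + c / (a * b).
  by field; rewrite !gt_eqF.
have := sqr_ge0 (a - b); nra.
Qed.

Variable k : R.
Hypotheses (k0 : 0 < k) (kP : @cone_area_ratio R n k).

(** As |v| <= 1, the part of the hyperplane v.y = 1 inside the cone lies outside the open unit ball,
    so radial projection contracts it onto a set covering the patch of the sphere; its area is k |v|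
    times the volume of the cone below it. *)
Lemma sphere_patch C v (e : R) : 0 < e -> e < 1 -> is_cone C -> measurable C -> (forall x, C x -> x != 0) ->
  polar (unit_ball R n.+1) v -> v != 0 ->
  (forall x w, C x -> subgrad (unit_ball R n.+1) x w -> enorm (w - v) <= e) ->
  (hausdorff n (unit_sphere R n.+1 `&` C) <=
   k%:E * V (C `&` [set x | (enorm (x - 0) <= (1 - e)^-1)%R]))%E.
Proof.
move=> e0 e1 cC mC C0 Pv v0 Cv.
have v1 : enorm v <= 1 by have := polar_bounded ltr01 unit_ball_in Pv; rewrite invr1.
have vx x : C x -> enorm x * (1 - e) <= dotp v x.
  move=> Cx; have [w Gw] := subgrad_exists ltr01 unit_ball_in x.
  have := Cv x w Cx Gw; have := dotp_le (w - v) x; rewrite dotpBl.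
  case: Gw => _ ->; rewrite gauge_unit_ball => h1 h2.
  have := ler_wpM2r (enorm_ge0 x) h2; lra.
pose F := [set y | C y /\ dotp v y = 1].
have F1 y : F y -> 1 <= enorm y.
  move=> [_ vy]; rewrite -vy; apply: le_trans (dotp_le _ _) _.
  by rewrite ler_piMl ?enorm_ge0.
have SF : unit_sphere R n.+1 `&` C `<=` (fun y => (enorm y)^-1 *: y) @` F.
  move=> x [x1 Cx]; have d0 : 0 < dotp v x.
    by apply: lt_le_trans (vx x Cx); rewrite x1 mul1r subr_gt0.
  exists ((dotp v x)^-1 *: x).
    by split; [apply: cC => //; rewrite invr_gt0|rewrite dotpZr mulVf// gt_eqF].
  rewrite enormZ gtr0_norm ?invr_gt0// x1 mulr1 invrK scalerA divff ?scale1r// gt_eqF//.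
apply: (@le_trans _ _ (hausdorff n ((fun y => (enorm y)^-1 *: y) @` F))).
  exact: (le_outer_measure (hausdorff_outer n)).
apply: (@le_trans _ _ (hausdorff n F)).
  rewrite -[leRHS]mul1e -(expr1n R n); apply: hausdorff_lipschitz => // x y Fx Fy.
  by rewrite mul1r; apply: radial_contraction; exact: F1.
rewrite kP//; apply: lee_pmul.
- pos.
- by [].
- by rewrite lee_fin ler_piMr// ltW.
apply: le_lebesgue_rV.
- rewrite (_ : [set x | _] = C `&` ([set x : 'rV[R]_n.+1 | 0 < dotp v x] `&` [set x | dotp v x <= 1])).
    meas.
  by apply/seteqP; split=> x /= => [[? /andP[]]|[? [-> ->]]].
- meas.
- move=> x [Cx /andP[_ vx1]]; split=> //=; rewrite subr0 -[leRHS]mul1r ler_pdivlMr ?subr_gt0//.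
  exact: le_trans (vx x Cx) vx1.
Qed.

(** The patches over disjoint cones add up, the cones below the flat pieces all lie in the ball of
    radius 1 / (1 - e), and e tends to 0. *)
Lemma sphere_area_le : (hausdorff n (unit_sphere R n.+1) <= (k * om)%:E)%E.
Proof.
have main (e : R) : 0 < e -> e < 1 -> (hausdorff n (unit_sphere R n.+1) <= (k * ((1 - e)^-1 ^+ n.+1 * om))%:E)%E.
  move=> e0 e1; have q0 : 0 < (1 - e)^-1 by rewrite invr_gt0 subr_gt0.
  have [C [v [[cC mC tC C0] [Pv vD Cv CE]]]] := good_cones ltr01 ltr01 unit_ball_in unit_ball_sub e0.
  have v0 j : v j != 0 by rewrite -enorm_gt0; apply: lt_le_trans (vD j); rewrite invr1.
  have cl : measurable [set x : 'rV[R]_n.+1 | enorm (x - 0) <= (1 - e)^-1] by meas.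
  apply: (@le_trans _ _ (\sum_(j <oo) hausdorff n (unit_sphere R n.+1 `&` C j))%E).
    apply: le_trans (outer_measure_sigma_subadditive (hausdorff_outer n) _).
    apply: (le_outer_measure (hausdorff_outer n)) => x x1.
    have x0 : x != 0 by rewrite -enorm_gt0 x1.
    have [j Cx] := CE x _ x0 (fun w => @subgrad_unit_ball x w x0).
    by exists j.
  apply: (@le_trans _ _ (\sum_(j <oo) k%:E * V (C j `&` [set x | (enorm (x - 0) <= (1 - e)^-1)%R]))%E).
    apply: lee_nneseries => [j _ _|j _]; first exact: (outer_measure_ge0 (hausdorff_outer n)).
    exact: (sphere_patch e0 e1 (cC j) (mC j) (C0 j) (Pv j) (v0 j) (Cv j)).
  rewrite nneseriesZl; last by move=> j _; exact: measure_ge0.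
  rewrite EFinM; apply: lee_wpmul2l; first pos.
  have mF j : measurable (C j `&` [set x : 'rV[R]_n.+1 | (enorm (x - 0) <= (1 - e)^-1)%R]) by meas.
  have -> : (\sum_(j <oo) V (C j `&` [set x | (enorm (x - 0) <= (1 - e)^-1)%R]) =
      V (\bigcup_j (C j `&` [set x | (enorm (x - 0) <= (1 - e)^-1)%R])))%E.
    apply/esym; rewrite measure_bigcup//.
      by apply: eq_eseriesl => j; rewrite in_setT.
    by move=> i j _ _ [x [[Ci _] [Cj _]]]; apply: (tC i j) => //; exists x.
  have := lebesgue_closed_eball (0 : 'rV[R]_n.+1) q0; rewrite lebesgue_unit_ball -EFinM => <-.
  apply: le_lebesgue_rV => //; first exact: bigcupT_measurable.
  by move=> x [j _ []].
have hE : hausdorff n (unit_sphere R n.+1) = (fine (hausdorff n (unit_sphere R n.+1)))%:E.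
  rewrite fineK// ge0_fin_numE; last exact: (outer_measure_ge0 (hausdorff_outer n)).
  have h1 : 2^-1 < 1 :> R by rewrite invf_lt1// ltr1n.
  by apply: (le_lt_trans (main 2^-1 _ h1)); rewrite ?ltry//.
rewrite hE; set h := fine _ in hE *.
have h0 : 0 <= h by rewrite -lee_fin -hE; exact: (outer_measure_ge0 (hausdorff_outer n)).
apply: (@le_of_linear_error R _ _ (n.+1%:R * h) 2^-1) => // e e0 e1.
have e2 : e < 1 by lra.
have := main e e0 e2; rewrite hE lee_fin exprVn mulrCA ler_pdivlMl ?exprn_gt0 ?subr_gt0//.
have := ler_wpM2r h0 (@bernoulli_ineq R e n.+1 (ltW e0) (ltW e2)); lra.
Qed.

End unit_ball.

Lemma integral_cst_indic d (T : measurableType d) (R : realType) (mu : {measure set T -> \bar R})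
    (D B : set T) (c : R) : measurable D -> measurable B -> B `<=` D -> 0 <= c ->
  (\int[mu]_(x in D) (c * \1_B x)%:E = c%:E * mu B)%E.
Proof.
move=> mD mB BD c0; under eq_integral => x _ do rewrite EFinM.
rewrite ge0_integralZl//; last first.
  by apply/measurable_EFinP; meas.
by rewrite integral_indic// setIidl.
Qed.

(** * Lower bound for the surface area of a body *)

Section surface.
Context {R : realType} {n : nat}.
Variables (K : set 'rV[R]_n.+1) (r D p k : R).
Hypotheses (cK : isconvex K) (kK : compact K) (r0 : 0 < r) (D0 : 0 < D)
  (rK : forall x, enorm x <= r -> K x) (KD : forall x, K x -> enorm x <= D)
  (p1 : 1 <= p) (pn : p < n.+1%:R).
Hypotheses (k0 : 0 < k) (kP : @cone_area_ratio R n k).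
Local Notation V := (@lebesgue_rV R n.+1).
Local Notation N := (gauge K).
Implicit Types (x y z v w : 'rV[R]_n.+1) (C : set 'rV[R]_n.+1) (s t e : R).

Lemma measurable_body : measurable K.
Proof. by apply: closed_measurable_rV; apply: compact_closed => //; exact: norm_hausdorff. Qed.

Lemma measurable_boundary : measurable (boundary K).
Proof.
rewrite (_ : boundary K = [set x | N x <= 1] `&` [set x | 1 <= N x]).
  by apply: measurableI; apply: measurable_le_set; try meas; exact: (measurable_gauge r0 rK).
apply/seteqP; split=> x; first by move/(boundaryP cK kK r0 rK) => /= ->.
by move=> [/= h1 h2]; apply/(boundaryP cK kK r0 rK)/eqP; rewrite eq_le h1.
Qed.

(** Since v is within t / D of every subgradient on the cone, v.x is at least 1 - t on the boundary
    patch and varies there by at most (t / D) |x - y|. Hence x -> x / (v.x) has Lipschitz constant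
    (1 - t)^(-2) on the patch. Its image contains the section v.y = 1, and the cone below this
    section contains the part of K in [C]. *)
Lemma patch_lower C v t : 0 < t -> t < 1 -> is_cone C -> measurable C -> (forall x, C x -> x != 0) ->
  polar K v -> v != 0 -> (forall x w, C x -> subgrad K x w -> enorm (w - v) <= t / D) ->
  (((k * enorm v) * (1 - t) ^+ (2 * n))%:E * V (K `&` C) <= hausdorff n (boundary K `&` C))%E.
Proof.
move=> t0 t1 cC mC C0 Pv v0 Cv; have q0 : 0 < 1 - t by rewrite subr_gt0.
have bP := boundaryP cK kK r0 rK.
have vx x : C x -> N x - t * (enorm x / D) <= dotp v x.
  move=> Cx; have [w Gw] := subgrad_exists r0 rK x.
  have := Cv x w Cx Gw; have := dotp_le (w - v) x; rewrite dotpBl.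
  case: Gw => _ -> h1 h2; have := ler_wpM2r (enorm_ge0 x) h2.
  lra.
have vx1 x : C x -> (1 - t) * N x <= dotp v x.
  move=> Cx; apply: le_trans (vx x Cx); have := gauge_ge r0 D0 rK KD x => h.
  have := ler_wpM2l (ltW t0) h; lra.
have vx0 x : C x -> 0 < dotp v x.
  move=> Cx; apply: lt_le_trans (vx1 x Cx); rewrite mulr_gt0//.
  by apply: (gauge_gt0 r0 D0 rK KD); exact: C0.
pose F := [set y | C y /\ dotp v y = 1].
pose f x : 'rV[R]_n.+1 := (dotp v x)^-1 *: x.
have FS : F `<=` f @` (boundary K `&` C).
  move=> y [Cy vy]; have Ny : 0 < N y by apply: (gauge_gt0 r0 D0 rK KD); exact: C0.
  exists ((N y)^-1 *: y).
    split; last by apply: cC => //; rewrite invr_gt0.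
    by apply/bP; rewrite (gaugeZ r0 rK) ?invr_ge0 ?(ltW Ny)// mulVf ?gt_eqF.
  by rewrite /f dotpZr vy mulr1 invrK scalerA divff ?scale1r// gt_eqF.
have fL x y : (boundary K `&` C) x -> (boundary K `&` C) y ->
    enorm (f x - f y) <= ((1 - t) ^+ 2)^-1 * enorm (x - y).
  move=> [/bP Nx Cx] [/bP Ny Cy].
  (* The estimate is used for (x, y) and for (y, x); the alternative on the distance lets one proof
     serve both. *)
  have dif a b : C a -> N a = 1 -> N b = 1 -> dotp v (b - a) <= t / D * enorm (x - y) \/ enorm (b - a) != enorm (x - y).
    move=> Ca Na Nb; have [w Gw] := subgrad_exists r0 rK a.
    have := subgrad_le r0 rK b Gw; rewrite Na Nb => h1.
    have h2 := dotp_le (v - w) (b - a); have h3 := Cv a w Ca Gw.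
    have h4 := ler_wpM2r (enorm_ge0 (b - a)) h3.
    have [ab|] := eqVneq (enorm (b - a)) (enorm (x - y)); last by right.
    left; move: h2 h4; rewrite dotpBl (enormB v w) -ab; move: h1; lra.
  have d1 : dotp v (y - x) <= t / D * enorm (x - y).
    by have [//|] := dif x y Cx Nx Ny; rewrite enormB eqxx.
  have d2 : dotp v (x - y) <= t / D * enorm (x - y).
    by have [//|] := dif y x Cy Ny Nx; rewrite eqxx.
  have gx := vx1 x Cx; have gy := vx1 y Cy; rewrite Nx Ny !mulr1 in gx gy.
  have gx0 := vx0 x Cx; have gy0 := vx0 y Cy.
  have -> : f x - f y = (dotp v x)^-1 *: (x - y) + (dotp v (y - x) / (dotp v x * dotp v y)) *: y.
    apply/rowP => i; rewrite /f !mxE dotpBr; field; rewrite !gt_eqF//.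
  apply: le_trans (enorm_triangle _ _) _; rewrite !enormZ.
  have yD : enorm y <= D by apply: KD; apply/(gauge_le1 cK kK r0 rK); rewrite Ny.
  have A1 : `|(dotp v x)^-1| <= (1 - t)^-1.
    by rewrite gtr0_norm ?invr_gt0// lef_pV2.
  have A2 : `|dotp v (y - x) / (dotp v x * dotp v y)| * enorm y <= t * enorm (x - y) * ((1 - t) ^+ 2)^-1.
    rewrite normrM [`|(_ * _)^-1|]gtr0_norm ?invr_gt0 ?mulr_gt0// mulrAC.
    apply: ler_pM; rewrite ?mulr_ge0 ?enorm_ge0 ?invr_ge0//.
    - pos.
    - have h : `|dotp v (y - x)| <= t / D * enorm (x - y).
        by rewrite ler_norml d1 andbT lerNl -dotpNr opprB.
      apply: (@le_trans _ _ (t / D * enorm (x - y) * D)); first by apply: ler_pM; rewrite ?enorm_ge0.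
      by rewrite mulrAC divfK// gt_eqF.
    - by rewrite lef_pV2 ?posrE ?mulr_gt0// ler_pM// ltW.
  have A3 := ler_wpM2r (enorm_ge0 (x - y)) A1.
  apply: le_trans (lerD A3 A2) _.
  have -> : (1 - t)^-1 = (1 - t) * ((1 - t) ^+ 2)^-1 by field; rewrite gt_eqF.
  apply: le_of_eq; ring.
have L0 : 0 < ((1 - t) ^+ 2)^-1 by pos.
have HF : (hausdorff n F <= (((1 - t) ^+ 2)^-1 ^+ n)%:E * hausdorff n (boundary K `&` C))%E.
  apply: le_trans (hausdorff_lipschitz n L0 fL).
  exact: (le_outer_measure (hausdorff_outer n)).
have KV : (V (K `&` C) <= V [set x | C x /\ (0 < dotp v x <= 1)%R])%E.
  apply: le_lebesgue_rV.
  - by apply: measurableI => //; exact: measurable_body.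
  - rewrite (_ : [set x | _] = C `&` ([set x : 'rV[R]_n.+1 | 0 < dotp v x] `&` [set x | dotp v x <= 1])).
      meas.
    by apply/seteqP; split=> x /= => [[? /andP[]]|[? [-> ->]]].
  - by move=> x [Kx Cx]; split=> //; rewrite vx0//=; exact: Pv.
have c0 : 0 < (1 - t) ^+ (2 * n) by pos.
rewrite mulrC EFinM -muleA -lee_pdivlMl//.
move: HF; rewrite kP// exprVn -exprM => HF; apply: le_trans HF.
by apply: lee_wpmul2l => //; rewrite lee_fin mulr_ge0 ?enorm_ge0// ltW.
Qed.

Lemma powR_anti (q a b : R) : 0 < q -> q <= 1 -> a <= b -> q `^ b <= q `^ a.
Proof.
move=> q0 q1 ab; rewrite /powR (gt_eqF q0) ler_expR; apply: ler_wnM2r => //.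
exact: ln_le0.
Qed.

(** Comparing the exponents of q, the claim is 4n + 1 - p >= 2n + p - 1, that is p <= n + 1; this is
    where 4n + 1 comes from. *)
Lemma density_compare (q a : R) : 0 < q -> q <= 1 -> 0 < a ->
  q ^+ (4 * n + 1) * (a / q) `^ p <= a * q ^+ (2 * n) * (a * q) `^ (p - 1).
Proof.
move=> q0 q1 a0; have q0' := ltW q0; have a0' := ltW a0; have p0 : 0 < p := lt_le_trans ltr01 p1.
have qi : 0 <= q^-1 by pos.
rewrite (powRM _ a0' qi) (powRM _ a0' q0') -powR_inv1// -powRrM.
rewrite mulrCA -(mulr_powRB1 a0' p0) -!powR_mulrn// -!mulrA; apply: ler_wpM2l => //.
rewrite [leRHS]mulrCA; apply: ler_wpM2l; first pos.
rewrite -!powRD; try by rewrite (gt_eqF q0) implybT.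
apply: powR_anti => //; rewrite natrD; move: pn; rewrite -natr1; lra.
Qed.

Lemma measurable_slope_power : mfun (fun x => (slope K x `^ p)%:E).
Proof.
apply/measurable_EFinP; apply: (measurableT_comp (measurable_powR p)).
exact: (measurable_slope r0 rK).
Qed.

Local Notation H := (@hausdorff_measure R n.+1 n).

Lemma integral_cst_indic_H (A : set 'rV[R]_n.+1) (c : R) : 0 <= c -> measurable A ->
  (\int[H]_(x in boundary K) (c * \1_(boundary K `&` A) x)%:E)%E = (c%:E * hausdorff n (boundary K `&` A))%E.
Proof.
move=> c0 mA; have mb := measurable_boundary.
have cb : measurable (boundary K : set (caratheodory_type (@hausdorff_outer R n.+1 n))) by exact: (@caratheodory_borel R n.+1 n).
have cA : measurable ((boundary K `&` A) : set (caratheodory_type (@hausdorff_outer R n.+1 n))).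
  by apply: (@caratheodory_borel R n.+1 n); meas.
exact: integral_cst_indic.
Qed.

(** On the j-th cone the boundary integrand is at least [a j] and the power of the slope at most
    [b j]; both are given by [v j] up to a factor 1 - t. The cones cover K up to a null set but may
    miss a part of the boundary, which is compatible with an upper bound on K and a lower bound on
    the boundary. *)
Lemma surface_lower t (g : 'rV[R]_n.+1 -> R) : 0 < t -> t < 1 ->
  (forall x, N x = 1 -> exists2 v, subgrad K x v & g x = enorm v `^ (p - 1)) ->
  (((1 - t) ^+ (4 * n + 1) * k)%:E * \int[V]_(x in K) (slope K x `^ p)%:E <=
   \int[H]_(x in boundary K) (g x)%:E)%E.
Proof.
move=> t0 t1 gP; have q0 : 0 < 1 - t by rewrite subr_gt0.
have bP := boundaryP cK kK r0 rK.
have tD : 0 < t / D by pos.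
have [C [v [[cC mC tC C0] [Pv vD Cv CE]]]] := good_cones r0 D0 rK KD tD.
have va j : 0 < enorm (v j) by apply: lt_le_trans (vD j); rewrite invr_gt0.
have v0 j : v j != 0 by rewrite -enorm_gt0.
have tv j : t / D <= t * enorm (v j) by rewrite ler_wpM2l ?vD// ltW.
have p0 : 0 <= p - 1 by pos.
have mK := measurable_body; have mb := measurable_boundary.
pose a j := (enorm (v j) * (1 - t)) `^ (p - 1).
pose b j := (enorm (v j) / (1 - t)) `^ p.
have a0 j : 0 <= a j by exact: powR_ge0.
have b0 j : 0 <= b j by exact: powR_ge0.
have lower : (\sum_(j <oo) (a j)%:E * hausdorff n (boundary K `&` C j) <= \int[H]_(x in boundary K) (g x)%:E)%E.
  have -> : (\sum_(j <oo) (a j)%:E * hausdorff n (boundary K `&` C j) =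
      \int[H]_(x in boundary K) \sum_(j <oo) (a j * \1_(boundary K `&` C j) x)%:E)%E.
    rewrite integral_nneseries.
    - by apply: eq_eseriesr => j _; rewrite integral_cst_indic_H.
    - exact: (@caratheodory_borel R n.+1 n).
    - move=> j; apply/measurable_EFinP; apply: measurable_funM; first meas.
      by apply: measurable_indic; apply: (@caratheodory_borel R n.+1 n); meas.
    - by move=> j x _; rewrite lee_fin mulr_ge0.
  apply: ge0_le_integral_any => x Bx.
    by apply: nneseries_ge0 => j _ _; rewrite lee_fin mulr_ge0.
  have [w Gw gE] := gP x (proj1 (bP x) Bx).
  have g0 : 0 <= g x by rewrite gE powR_ge0.
  apply: lime_le; first by apply: is_cvg_nneseries => j _ _; rewrite lee_fin mulr_ge0.
  apply: nearW => M; rewrite sumEFin lee_fin.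
  have [[j jM Cj]|nC] := pselect (exists2 j, (j < M)%N & C j x); last first.
    rewrite big_nat big1// => j /andP[_ jM]; rewrite indicE memNset ?mulr0// => -[_ Cj].
    by apply: nC; exists j.
  rewrite big_mkord (bigD1 (Ordinal jM))//= big1 ?addr0; last first.
    move=> i ij; rewrite indicE memNset ?mulr0// => -[_ Ci].
    move/negP: ij; apply; apply/eqP/val_inj => /=; apply: (tC i j) => //; by exists x.
  rewrite indicE mem_set//= mulr1 gE /a; apply: le_powRl => //.
    pos.
  have := Cv j x w Cj Gw; have := enorm_triangle2 (v j) w 0; rewrite !subr0 (enormB (v j)).
  have := tv j; lra.
have upper : (\int[V]_(x in K) (slope K x `^ p)%:E <= \sum_(j <oo) (b j)%:E * V (K `&` C j))%E.
  have [Z [mZ Z0 ZP]] := subgrad_unique_ae r0 rK.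
  have -> : (\sum_(j <oo) (b j)%:E * V (K `&` C j) = \int[V]_(x in K) \sum_(j <oo) (b j * \1_(K `&` C j) x)%:E)%E.
    rewrite integral_nneseries//.
    - apply: eq_eseriesr => j _; apply/esym; apply: integral_cst_indic => //.
      meas.
    - by move=> j; apply/measurable_EFinP; apply: measurable_funM; meas.
    - by move=> j x _; rewrite lee_fin mulr_ge0.
  apply: ae_ge0_le_integral => //.
  - by move=> x _; rewrite lee_fin powR_ge0.
  - exact: measurable_funTS measurable_slope_power.
  - by move=> x _; apply: nneseries_ge0 => j _ _; rewrite lee_fin mulr_ge0.
  - apply: ge0_emeasurable_sum => [j x _|j _]; first by rewrite lee_fin mulr_ge0.
    apply/measurable_EFinP; apply: measurable_funM; meas.
  have m0 : measurable [set (0 : 'rV[R]_n.+1)].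
    rewrite (_ : [set _] = [set x | enorm (x - 0) <= 0]); first meas.
    apply/seteqP; split=> x /=; first by move=> ->; rewrite subr0 enorm0.
    by rewrite subr0 => x0; apply/eqP; rewrite -enorm_eq0 eq_le x0 enorm_ge0.
  exists (Z `|` [set 0]); split; first meas.
    have z := @lebesgue_point0 R n.
    apply/eqP; rewrite eq_le measure_ge0 andbT; apply: le_trans (measureU2 _ _ _) _ => //.
    apply: (@le_trans _ _ (0 + 0)%E); last by rewrite adde0.
    by apply: leeD; apply: le_of_eq => //.
  move=> x h; apply: contrapT => /not_orP[nZ nx0]; apply: h => Kx.
  have x0 : x != 0 by apply/eqP.
  have [w0 Gw0] := subgrad_exists r0 rK x.
  have [j Cj] := CE x w0 x0 (fun w Gw => ZP x w w0 nZ Gw Gw0).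
  apply: le_trans (nneseries_lim_ge j.+1 _); last by move=> i _ _; rewrite lee_fin mulr_ge0.
  rewrite sumEFin big_nat_recr//=.
  apply: (@le_trans _ _ (b j * \1_(K `&` C j) x)); last first.
    by rewrite lerDr; apply: sumr_ge0 => i _; rewrite mulr_ge0.
  rewrite indicE mem_set//= mulr1; apply: le_powRl; [by lra|exact: (slope_ge0 r0 rK)|].
  apply: (slope_le r0 rK) => w Gw; have := Cv j x w Cj Gw; have := enorm_triangle2 w (v j) 0.
  rewrite !subr0 => h1 h2; rewrite ler_pdivlMr//.
  have := tv j; have := enorm_ge0 w; have := va j; move: h1 h2; nra.
apply: le_trans lower; apply: le_trans (lee_wpmul2l _ upper) _.
  pos.
rewrite -nneseriesZl; last by move=> j _; rewrite mule_ge0 ?lee_fin.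
apply: lee_nneseries => j; first by move=> _ _; rewrite ?mule_ge0 ?lee_fin// mulr_ge0 ?(ltW k0)// exprn_ge0// ltW.
move=> _; apply: le_trans (lee_wpmul2l _ (patch_lower t0 t1 (cC j) (mC j) (C0 j) (Pv j) (v0 j) (Cv j))).
  rewrite !muleA -!EFinM; apply: lee_wpmul2r => //; rewrite lee_fin.
  have q1 : 1 - t <= 1 by lra.
  have := ler_wpM2l (ltW k0) (density_compare q0 q1 (va j)).
  rewrite -/(a j) -/(b j); move: (a j) (b j) (_ ^+ _) (_ ^+ _) (enorm _) => a' b' c' d' e' h.
  by move: h; lra.
by rewrite lee_fin.
Qed.

End surface.

#[global] Hint Resolve measurable_body : meas.

Section surface_area.
Context {R : realType} {n : nat}.
Variables (p k : R).
Hypotheses (p1 : 1 <= p) (pn : p < n.+1%:R).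
Hypotheses (k0 : 0 < k) (kP : @cone_area_ratio R n k).
Local Notation V := (@lebesgue_rV R n.+1).
Local Notation om := (@ball_volume R n).
Local Notation H := (@hausdorff_measure R n.+1 n).
Implicit Types (x y z v w : 'rV[R]_n.+1) (C : set 'rV[R]_n.+1) (s t e : R).

Definition slope_energy (K : set 'rV[R]_n.+1) : R := \int[V]_(x in K) (slope K x `^ p).

Section body.
Variables (K : set 'rV[R]_n.+1) (r D : R).
Hypotheses (cK : isconvex K) (kK : compact K) (r0 : 0 < r) (D0 : 0 < D)
  (rK : forall x, enorm x <= r -> K x) (KD : forall x, K x -> enorm x <= D).
Local Notation N := (gauge K).

(** The boundary is covered by the image of the unit sphere under x -> x / N(x), which is Lipschitz
    there because N is Lipschitz and bounded below on the sphere. *)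
Lemma boundary_area_lty : (hausdorff n (boundary K) < +oo)%E.
Proof.
have L0 : 0 < D + r^-1 * D ^+ 2 by pos.
have Nge x : enorm x = 1 -> (N x)^-1 <= D.
  move=> x1; have := gauge_ge r0 D0 rK KD x; rewrite x1 div1r => h.
  rewrite -[leRHS]invrK lef_pV2 ?posrE ?invr_gt0//; apply: lt_le_trans h; pos.
have N0 x : enorm x = 1 -> 0 < N x.
  by move=> x1; apply: (gauge_gt0 r0 D0 rK KD); rewrite -enorm_gt0 x1.
apply: (@le_lt_trans _ _ ((D + r^-1 * D ^+ 2) ^+ n * (k * om))%:E); last exact: ltry.
rewrite EFinM; apply: (@le_trans _ _ (((D + r^-1 * D ^+ 2) ^+ n)%:E * hausdorff n (unit_sphere R n.+1))%E); last first.
  apply: lee_wpmul2l; first pos.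
  exact: sphere_area_le.
pose f x : 'rV[R]_n.+1 := (N x)^-1 *: x.
apply: (@le_trans _ _ (hausdorff n (f @` unit_sphere R n.+1))).
  apply: (le_outer_measure (hausdorff_outer n)) => x /(boundaryP cK kK r0 rK) Nx.
  have x0 : 0 < enorm x by rewrite enorm_gt0; exact: (gauge1_neq0 r0 rK).
  exists ((enorm x)^-1 *: x); first by rewrite /unit_sphere /= enormZ gtr0_norm ?invr_gt0// mulVf ?gt_eqF.
  rewrite /f (gaugeZ r0 rK) ?invr_ge0 ?(ltW x0)// Nx mulr1 invrK scalerA divff ?scale1r// gt_eqF//.
apply: hausdorff_lipschitz => // x y x1 y1.
have -> : f x - f y = (N x)^-1 *: (x - y) + (((N x)^-1 * (N y)^-1) * (N y - N x)) *: y.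
  by apply/rowP => i; rewrite /f !mxE; field; rewrite !gt_eqF ?N0.
apply: le_trans (enorm_triangle _ _) _; rewrite !enormZ y1 mulr1 mulrDl.
have i0 z : enorm z = 1 -> 0 <= (N z)^-1 by move=> z1; rewrite invr_ge0 ltW// N0.
apply: lerD; first by rewrite ger0_norm ?i0// ler_wpM2r ?enorm_ge0 ?Nge.
have -> : r^-1 * D ^+ 2 * enorm (x - y) = D ^+ 2 * (r^-1 * enorm (x - y)) by ring.
rewrite normrM ger0_norm ?mulr_ge0 ?i0//; apply: ler_pM => //.
- pos.
- by rewrite expr2; apply: ler_pM; rewrite ?i0 ?Nge.
- by rewrite (enormB x); exact: (gauge_lipschitz r0 rK).
Qed.

Lemma slope_energyE : (\int[V]_(x in K) (slope K x `^ p)%:E)%E = (slope_energy K)%:E.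
Proof.
have mK := measurable_body kK.
rewrite /slope_energy /Rintegral fineK// ge0_fin_numE; last first.
  pos.
have p0 : 0 <= p by apply: le_trans p1.
apply: (@le_lt_trans _ _ (\int[V]_(x in K) (r^-1 `^ p)%:E)%E).
  apply: ge0_le_integral_any => x _; rewrite lee_fin ?powR_ge0//.
  apply: le_powRl => //; [exact: (slope_ge0 r0 rK)|exact: (slope_bounded r0 rK)].
have KB : K `<=` eball n.+1 (D + 1) by move=> x /KD; rewrite /eball /= => ?; lra.
rewrite integral_cst//; apply: lte_mul_pinfty => //; first pos.
apply: (@le_lt_trans _ _ (V K)); first exact: lexx.
by rewrite (lebesgue_rV_fin mK KB) ltry.
Qed.

Lemma slope_energy_ge0 : 0 <= slope_energy K.
Proof.
by rewrite -lee_fin -slope_energyE; apply: integral_ge0 => x _; rewrite lee_fin powR_ge0.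
Qed.

Lemma surface_area_ge : k * slope_energy K <= surface_area p K.
Proof.
pose g x := `|dotp x (normal_vector K x)| `^ (1 - p).
have bP := boundaryP cK kK r0 rK.
have gP x : N x = 1 -> exists2 v, subgrad K x v & g x = enorm v `^ (p - 1).
  exact: (surface_integrandE r0 D0 rK KD).
have mb := measurable_boundary cK kK r0 rK.
have cb : measurable (boundary K : set (caratheodory_type (@hausdorff_outer R n.+1 n))) by exact: (@caratheodory_borel R n.+1 n).
(* A real integral is 0 when the extended one is infinite, so finiteness is part of the bound. *)
have fin : (\int[H]_(x in boundary K) (g x)%:E < +oo)%E.
  apply: (@le_lt_trans _ _ (\int[H]_(x in boundary K) (r^-1 `^ (p - 1))%:E)%E).
    apply: ge0_le_integral_any => x Bx; rewrite lee_fin ?powR_ge0//.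
    have [v Gv ->] := gP x (proj1 (bP x) Bx).
    apply: le_powRl; [pos|pos|].
    by case: Gv => Pv _; exact: (polar_bounded r0 rK).
  rewrite integral_cst//; apply: lte_mul_pinfty => //; first pos.
  exact: boundary_area_lty.
have gE : (\int[H]_(x in boundary K) (g x)%:E)%E = (surface_area p K)%:E.
  rewrite /surface_area /Rintegral fineK// ge0_fin_numE//.
  pos.
have W0 := slope_energy_ge0; have kW : 0 <= k * slope_energy K by pos.
apply: (@le_of_linear_error R _ _ ((4 * n + 1)%:R * (k * slope_energy K)) 2^-1) => // t t0 t1.
have t2 : t < 1 by lra.
have := surface_lower cK kK r0 D0 rK KD p1 pn k0 kP t0 t2 gP.
rewrite slope_energyE -EFinM gE lee_fin.
have := ler_wpM2r kW (@bernoulli_ineq R t (4 * n + 1) (ltW t0) (ltW t2)); lra.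
Qed.

End body.

Lemma unit_ball_convex : isconvex (unit_ball R n.+1).
Proof.
move=> x y a /andP[a0 a1] x1 y1; rewrite /unit_ball.
apply: le_trans (enorm_triangle _ _) _; rewrite !enormZ !ger0_norm ?subr_ge0//.
have h1 := ler_wpM2l a0 x1; have b0 : 0 <= 1 - a by lra.
have h2 := ler_wpM2l b0 y1; lra.
Qed.

Lemma unit_ball_compact : compact (unit_ball R n.+1).
Proof. exact: closed_eball_compact. Qed.

Lemma boundary_unit_ball : boundary (unit_ball R n.+1) = unit_sphere R n.+1.
Proof.
apply/seteqP; split=> x.
  by move/(boundaryP unit_ball_convex unit_ball_compact ltr01 unit_ball_in); rewrite gauge_unit_ball.
by move=> x1; apply/(boundaryP unit_ball_convex unit_ball_compact ltr01 unit_ball_in); rewrite gauge_unit_ball.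
Qed.

(** Positivity comes from the general lower bound, the slope being at least 1 on the ball; the upper
    bound is the area of the sphere, on which the integrand is 1. *)
Lemma surface_area_unit_ball : 0 < surface_area p (unit_ball R n.+1) <= k * om.
Proof.
have om0 := @ball_volume_gt0 R n.
have mU := measurable_body unit_ball_compact.
have WE := slope_energyE unit_ball_compact ltr01 unit_ball_in unit_ball_sub.
have W1 : om <= slope_energy (unit_ball R n.+1).
  rewrite -lee_fin -WE -lebesgue_unit_ball -[leLHS]mul1e.
  have <- : (\int[V]_(x in unit_ball R n.+1) 1%:E = 1%:E * V (unit_ball R n.+1))%E by exact: integral_cst.
  apply: ge0_le_integral_any => x _; rewrite ?lee_fin// -[leLHS](one_powR p).
  apply: le_powRl => //; first exact: le_trans p1.
  have [->|x0] := eqVneq x 0.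
    rewrite -(@enorm_delta R n.+1 ord0); apply: (le_slope ltr01 unit_ball_in); split.
      by move=> y y1; rewrite dotpC; apply: le_trans (dotp_le _ _) _; rewrite enorm_delta mulr1.
    by rewrite dotp0r gauge_unit_ball enorm0.
  have [v Gv] := subgrad_exists ltr01 unit_ball_in x.
  apply: le_trans (le_slope ltr01 unit_ball_in Gv).
  by rewrite (subgrad_unit_ball x0 Gv) enormZ gtr0_norm ?invr_gt0 ?enorm_gt0// mulVf ?enorm_eq0.
apply/andP; split.
  apply: lt_le_trans (surface_area_ge unit_ball_convex unit_ball_compact ltr01 ltr01 unit_ball_in unit_ball_sub).
  by rewrite mulr_gt0//; apply: lt_le_trans W1.
rewrite -lee_fin; apply: le_trans (sphere_area_le k0 kP).
have mb := measurable_boundary unit_ball_convex unit_ball_compact ltr01 unit_ball_in.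
have bb := boundary_unit_ball.
have cb : measurable (unit_sphere R n.+1 : set (caratheodory_type (@hausdorff_outer R n.+1 n))).
  by apply: (@caratheodory_borel R n.+1 n); rewrite -bb.
have E : (\int[H]_(x in unit_sphere R n.+1) (`|dotp x (normal_vector (unit_ball R n.+1) x)| `^ (1 - p))%:E)%E
    = hausdorff n (unit_sphere R n.+1).
  transitivity (\int[H]_(x in unit_sphere R n.+1) 1%:E)%E; last first.
    by rewrite integral_cst// mul1e.
  apply: eq_integral => x /set_mem x1; congr (_%:E).
  have g1 : gauge (unit_ball R n.+1) x = 1 by rewrite gauge_unit_ball.
  have x0 : x != 0 by rewrite -enorm_gt0 x1.
  have [v Gv ->] := surface_integrandE ltr01 ltr01 unit_ball_in unit_ball_sub p g1.
  rewrite (subgrad_unit_ball x0 Gv) enormZ gtr0_norm ?invr_gt0 ?enorm_gt0// mulVf ?enorm_eq0//.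
  exact: one_powR.
rewrite /surface_area /Rintegral bb E fineK// ge0_fin_numE; last exact: (outer_measure_ge0 (hausdorff_outer n)).
by apply: le_lt_trans (sphere_area_le k0 kP) _; exact: ltry.
Qed.

End surface_area.

(** * Mollified radial profiles *)

Section derivatives.
Context {R : realType}.

Lemma is_derive_of_quadratic (W : normedModType R) (f : W -> R) (a v : W) (d C : R) :
  (forall h : R, `|h| <= 1 -> `|f (a + h *: v) - f a - h * d| <= C * h ^+ 2) -> is_derive a v f d.
Proof.
move=> fC.
have lim : (fun h : R => h^-1 *: ((f \o shift a) (h *: v) - f a)) @ 0^' --> d.
  apply/cvgrPdist_le => e e0; near=> h.
  have h0 : h != 0 by near: h; exact: nbhs_dnbhs_neq.
  have h1 : `|h| <= 1.
    by near: h; apply: nbhs_dnbhs; apply/nbhs_normP; exists 1 => //= y /=; rewrite sub0r normrN => /ltW.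
  have hC : (`|C| + 1) * `|h| <= e.
    near: h; apply: nbhs_dnbhs; apply/nbhs_normP; exists (e / (`|C| + 1)) => /=.
      pos.
    move=> y /=; rewrite sub0r normrN => ye; rewrite mulrC -ler_pdivlMr; first pos.
    by [].
  have habs : 0 < `|h| by rewrite normr_gt0.
  have -> : d - h^-1 *: ((f \o shift a) (h *: v) - f a) = - (h^-1 * (f (a + h *: v) - f a - h * d)).
    by rewrite /GRing.scale/= [h *: v + a]addrC; field.
  rewrite normrN normrM normfV ler_pdivrMl// [leRHS]mulrC; apply: le_trans (fC h h1) _.
  rewrite -[h ^+ 2]real_normK ?num_real// expr2 mulrA; apply: ler_wpM2r => //.
  by apply: le_trans hC; rewrite mulrDl ler_wpDr// ler_wpM2r// ler_norm.
split; first by apply: cvgP lim.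
by apply: cvg_lim lim.
Unshelve. all: end_near. Qed.

Lemma is_derive_of_line n (f : 'rV[R]_n -> R) (x e : 'rV[R]_n) (d : R) :
  is_derive (0 : R) 1 (fun t : R => f (x + t *: e)) d -> is_derive x e f d.
Proof.
have E : (fun h : R => h^-1 *: (((fun s : R => f (x + s *: e)) \o shift 0) (h *: (1 : R)) - f (x + 0 *: e)))
    = (fun h : R => h^-1 *: ((f \o shift x) (h *: e) - f x)).
  apply/funext => h /=; congr (_ *: (f _ - f _)); last by rewrite scale0r addr0.
  by rewrite scaler1 addr0 addrC.
by move=> [h1 h2]; split; move: h1 h2; rewrite /derivable /derive E.
Qed.

End derivatives.

Section bump.
Context {R : realType}.
Implicit Types (P : {poly R}) (t : R).

(** The functions P(1/t) exp(-1/t) are stable under differentiation, P becoming X^2 (P - P'), and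
    they are O(t^2) at 0; one lemma thus gives all derivatives of the bump. *)
Definition flat_exp P t : R := if 0 < t then P.[t^-1] * expR (- t^-1) else 0.

Lemma flat_exp_bound P : exists2 C : R, 0 <= C & forall t, t <= 1 -> `|flat_exp P t| <= C * t ^+ 2.
Proof.
pose A := \sum_(i < size P) `|P`_i|; pose m := (size P).+2.
have A0 : 0 <= A by apply: sumr_ge0.
have C0 : 0 <= A * m%:R ^+ m by pos.
exists (A * m%:R ^+ m) => // t t1; rewrite /flat_exp; case: ltP => [t0|t0]; last first.
  by rewrite normr0 mulr_ge0// sqr_ge0.
set u := t^-1; have u1 : 1 <= u by rewrite invf_ge1.
have u0 : 0 < u by rewrite invr_gt0.
have Pu : `|P.[u]| <= A * u ^+ size P.
  rewrite horner_coef mulr_suml; apply: le_trans (ler_norm_sum _ _ _) _; apply: ler_sum => i _.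
  rewrite normrM [`|u ^+ i|]ger0_norm ?exprn_ge0 ?(ltW u0)//; apply: ler_wpM2l => //.
  by apply: ler_weXn2l; [exact: u1|exact/ltnW/ltn_ord].
(* m exceeds [size P] by 2, which leaves the factor t^2 once the powers of 1/t in P are
   cancelled. *)
have eu : (u / m%:R) ^+ m <= expR u.
  have -> : expR u = expR (u / m%:R) ^+ m by rewrite -expRM_natl mulrC divfK ?gt_eqF.
  rewrite lerXn2r ?nnegrE ?divr_ge0 ?(ltW u0)//.
  by apply: le_trans (expR_ge1Dx _); rewrite lerDr.
have eu' : expR (- u) <= (m%:R * t) ^+ m.
  rewrite expRN -[leRHS]invrK lef_pV2 ?posrE ?expR_gt0 ?invr_gt0 ?exprn_gt0 ?mulr_gt0//.
  by rewrite -exprVn invfM mulrC.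
rewrite normrM [`|expR _|]ger0_norm//.
apply: le_trans (ler_pM (normr_ge0 _) (expR_ge0 _) Pu eu') _.
have ut : u ^+ size P * t ^+ size P = 1 by rewrite -exprMn mulVf ?gt_eqF// expr1n.
have tm : t ^+ m = t ^+ 2 * t ^+ size P by rewrite -exprD.
rewrite exprMn tm (_ : A * u ^+ size P * _ = A * m%:R ^+ m * t ^+ 2 * (u ^+ size P * t ^+ size P)).
  by rewrite ut mulr1.
by move: (m%:R ^+ m) (u ^+ size P) (t ^+ size P) => b c d; ring.
Qed.

Lemma is_derive_flat_exp P t : is_derive t 1 (flat_exp P) (flat_exp ('X^2 * (P - P^`())) t).
Proof.
have [t0|t0|->] := ltgtP t 0; last first.
- rewrite {2}/flat_exp ltxx.
  have [C C0 CP] := flat_exp_bound P; apply: is_derive_of_quadratic => h h1.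
  rewrite add0r scaler1 mulr0 subr0 {2}/flat_exp ltxx subr0; apply: CP.
  exact: le_trans (ler_norm _) h1.
- rewrite {2}/flat_exp t0.
  have t1 : t != 0 by pos.
  apply: (@near_eq_is_derive _ _ _ (fun s : R => P.[s^-1] * expR (- s^-1))).
    near=> s; rewrite /flat_exp ifT//; near: s; exact: lt_nbhsr.
  have dV : is_derive t 1 (fun s : R => s^-1) (- t ^- 2 *: 1) by exact: is_deriveV.
  have d1 := is_derive1_comp (is_derive_poly P t^-1) dV.
  have dN : is_derive t 1 (fun s : R => - s^-1) (- (- t ^- 2 *: 1)) by exact: is_deriveN.
  have d2 := @is_derive1_comp R expR (fun s : R => - s^-1) t _ _ (is_derive_expR (- t^-1)) dN.
  have d3 := is_deriveM d1 d2.
  apply: is_derive_eq d3 _.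
  by rewrite /GRing.scale /= hornerM hornerXn hornerD hornerN; field.
- rewrite {2}/flat_exp ltNge (ltW t0)/=.
  have dc : is_derive t 1 (fun=> 0 : R) (0 : R) by exact: is_derive_cst.
  apply: near_eq_is_derive dc.
  near=> s; rewrite /flat_exp ltNge ifF//; apply/negbTE; rewrite negbK.
  by apply: ltW; near: s; exact: lt_nbhsl.
Unshelve. all: end_near. Qed.

Lemma flat_exp_ge0 t : 0 <= flat_exp 1 t.
Proof. by rewrite /flat_exp; case: ltP => // _; rewrite hornerC. Qed.

Lemma flat_exp_gt0 t : 0 < t -> 0 < flat_exp 1 t.
Proof. by rewrite /flat_exp => ->; rewrite hornerC mul1r expR_gt0. Qed.

Variables (n : nat) (a : R).
Implicit Types (x e : 'rV[R]_n) (f g : 'rV[R]_n -> R).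

(* A class of functions containing the bump exp(-1/(a - |x|^2)) and closed
   under partial derivatives. *)
Inductive bump_class : ('rV[R]_n -> R) -> Prop :=
| bump_cst c : bump_class (fun=> c)
| bump_coord i : bump_class (fun x => x 0 i)
| bump_flat P : bump_class (fun x => flat_exp P (a - dotp x x))
| bump_add f g : bump_class f -> bump_class g -> bump_class (fun x => f x + g x)
| bump_mul f g : bump_class f -> bump_class g -> bump_class (fun x => f x * g x).

Lemma dotp_sqr_line x e (h : R) :
  dotp (x + h *: e) (x + h *: e) = dotp x x + h * (2 * dotp x e) + h ^+ 2 * dotp e e.
Proof. by rewrite !dotpDl !dotpDr !dotpZl !dotpZr [dotp e x]dotpC; ring. Qed.

Lemma bump_class_derive f : bump_class f -> exists2 df : 'I_n -> 'rV[R]_n -> R,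
  (forall i, bump_class (df i)) & forall i x, is_derive x (delta_mx 0 i) f (df i x).
Proof.
elim=> [c|j|P|f1 f2 _ [d1 b1 D1] _ [d2 b2 D2]|f1 f2 B1 [d1 b1 D1] B2 [d2 b2 D2]].
- by exists (fun _ _ => 0) => i; [exact: bump_cst|move=> x; exact: is_derive_cst].
- exists (fun i _ => (i == j)%:R) => i; first exact: bump_cst.
  move=> x; apply: (@is_derive_of_quadratic _ _ _ _ _ _ 0) => h _.
  by rewrite !mxE eqxx/= (eq_sym j) [x 0 j + _]addrC addrK subrr normr0 mul0r.
- exists (fun i x => flat_exp ('X^2 * (P - P^`())) (a - dotp x x) * (-2 * x 0 i)) => i.
    apply: bump_mul; first exact: bump_flat.
    by apply: (bump_mul (bump_cst (-2))); exact: bump_coord.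
  move=> x; apply: is_derive_of_line.
  have dq : is_derive (0 : R) 1 (fun h : R => a - dotp (x + h *: delta_mx 0 i) (x + h *: delta_mx 0 i)) (-2 * x 0 i).
    apply: (@is_derive_of_quadratic _ _ _ _ _ _ 1) => h _.
    have ee : dotp (delta_mx 0 i : 'rV[R]_n) (delta_mx 0 i) = 1 by rewrite -enorm_sqr enorm_delta expr1n.
    rewrite !dotp_sqr_line ee dotp_delta scaler1.
    rewrite (_ : _ - _ - _ = - h ^+ 2); last by ring.
    by rewrite normrN ger0_norm ?sqr_ge0// mul1r.
  have q0 : a - dotp (x + 0 *: delta_mx 0 i) (x + 0 *: delta_mx 0 i) = a - dotp x x by rewrite scale0r addr0.
  have dg := is_derive_flat_exp P (a - dotp x x).
  rewrite -{1}q0 in dg.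
  exact: (@is_derive1_comp R (flat_exp P) (fun h => a - dotp (x + h *: delta_mx 0 i) (x + h *: delta_mx 0 i)) 0 _ _ dg dq).
- exists (fun i x => d1 i x + d2 i x) => i; first exact: bump_add.
  by move=> x; exact: is_deriveD (D1 i x) (D2 i x).
- exists (fun i x => f1 x * d2 i x + f2 x * d1 i x) => i; first by apply: bump_add; exact: bump_mul.
  by move=> x; exact: is_deriveM (D1 i x) (D2 i x).
Qed.

Lemma bump_class_continuous f : bump_class f -> continuous f.
Proof.
elim=> [c|j|P|f1 f2 _ c1 _ c2|f1 f2 _ c1 _ c2] x.
- exact: cst_continuous.
- exact: coord_continuous.
- have cq : {for x, continuous (fun x => a - dotp x x)}.
    have cd : continuous (fun x : 'rV[R]_n => dotp x x).
      apply: locally_lipschitz_continuous => r; exists (2 * `|r|); first pos.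
      move=> y z yr zr; have -> : dotp y y - dotp z z = dotp (y - z) y + dotp z (y - z).
        by rewrite dotpBl dotpBr [dotp z y]dotpC; ring.
      apply: le_trans (ler_normD _ _) _.
      have h1 := abs_dotp_le (y - z) y; have h2 := abs_dotp_le z (y - z).
      have rr := ler_norm r; have e0 := enorm_ge0 (y - z).
      have h3 := ler_wpM2l e0 (le_trans yr rr); have h4 := ler_wpM2l e0 (le_trans zr rr).
      by move: h1 h2 h3 h4; lra.
    by apply: (@cvgB _ _ _ (nbhs x) _ (fun=> a) (fun x : 'rV[R]_n => dotp x x)); [exact: cvg_cst|exact: cd].
  apply: (@continuous_comp _ _ _ (fun x => a - dotp x x) (flat_exp P)) => //.
  apply: differentiable_continuous; apply/derivable1_diffP.
  by have [] := is_derive_flat_exp P (a - dotp x x).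
- exact: (continuousD (c1 x) (c2 x)).
- exact: (continuousM (c1 x) (c2 x)).
Qed.

Lemma bump_class_smooth f : bump_class f -> smooth f.
Proof.
move=> bf s; suff bs : bump_class (foldr partial f s).
  split; first exact: bump_class_continuous.
  by move=> i x; have [df _ /(_ i x)[]] := bump_class_derive bs.
elim: s => //= i s bs; have [df bd dP] := bump_class_derive bs.
rewrite (_ : partial i _ = df i) //; apply/funext => x; rewrite /partial.
by have [_ ->] := dP i x.
Qed.

Lemma bump_exists : 0 < a -> exists rho : 'rV[R]_n -> R, [/\ forall c, smooth_compact_support (fun x => c * rho x),
  forall x, 0 <= rho x, 0 < rho 0 & forall x, rho x != 0 -> enorm x ^+ 2 <= a].
Proof.
move=> a0; exists (fun x => flat_exp 1 (a - dotp x x)); split.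
- move=> c; split; first by apply: bump_class_smooth; apply: (bump_mul (bump_cst c)); exact: bump_flat.
  apply: (@subclosed_compact _ _ [set x : 'rV[R]_n | enorm x <= Num.sqrt a]).
  + exact: closed_closure.
  + exact: closed_eball_compact.
  + have cl : closed [set x : 'rV[R]_n | enorm x <= Num.sqrt a].
      by apply: compact_closed; [exact: norm_hausdorff|exact: closed_eball_compact].
    rewrite [X in _ `<=` X](closure_id _).1//; apply: closure_subset => x /=.
    rewrite /flat_exp; case: ltP => [|_]; last by rewrite mulr0 eqxx.
    rewrite subr_gt0 => xa _; rewrite -(ler_pXn2r (n := 2)) ?nnegrE ?enorm_ge0//.
    by rewrite enorm_sqr sqr_sqrtr ltW.
- by move=> x; exact: flat_exp_ge0.
- by apply: flat_exp_gt0; rewrite dotp0l subr0.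
- move=> x; rewrite /flat_exp; case: ltP => [|_]; last by rewrite eqxx.
  by rewrite subr_gt0 enorm_sqr => /ltW.
Qed.

End bump.

Section compact_support.
Context {R : realType} {n : nat}.
Implicit Types (f : 'rV[R]_n -> R).

Lemma smooth_vanishes_compact f (D : R) : smooth f -> vanishes_outside D f -> smooth_compact_support f.
Proof.
move=> sf fD; split=> //.
apply: (@subclosed_compact _ _ [set x : 'rV[R]_n | enorm x <= D]); first exact: closed_closure.
  exact: closed_eball_compact.
have cl : closed [set x : 'rV[R]_n | enorm x <= D].
  by apply: compact_closed; [exact: norm_hausdorff|exact: closed_eball_compact].
rewrite [X in _ `<=` X](closure_id _).1//; apply: closure_subset => x /= fx.
by rewrite leNgt; apply/negP => /ltW /fD fx0; move: fx; rewrite fx0 eqxx.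
Qed.

Lemma smooth_compact_partial f i : smooth_compact_support f -> smooth_compact_support (partial i f).
Proof.
move=> sf; have [D D0 fD] := smooth_compact_vanishes sf.
apply: (@smooth_vanishes_compact _ (D + 1)); first by apply: smooth_partial; case: sf.
by apply: (@partial_vanishes _ _ D) => //; lra.
Qed.

End compact_support.

(** * Convolution with a smooth kernel *)

Section mollification.
Context {R : realType} {n : nat}.
Local Notation V := (@lebesgue_rV R n.+1).
Implicit Types (x y z v w e : 'rV[R]_n.+1) (g : 'rV[R]_n.+1 -> R).
Variables (f0 : 'rV[R]_n.+1 -> R) (D : R).
Hypotheses (cf0 : continuous f0) (f0_ge0 : forall x, 0 <= f0 x) (f0_le1 : forall x, f0 x <= 1)
  (f0D : vanishes_outside D f0).

Lemma pair_integrable g (M : R) : mfun g -> (forall y, `|g y| <= M) ->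
  integrableV (fun y => f0 y * g y).
Proof.
move=> mg gM; apply: (@integrable_bounded_support _ _ _ D M).
- by apply: measurable_funM => //; exact: continuous_measurable_rV.
- by move=> x /negP; rewrite /eball -leNgt => /f0D ->; rewrite mul0r.
- move=> x; rewrite normrM (ger0_norm (f0_ge0 x)) -[leRHS]mul1r.
  by apply: ler_pM => //; exact: gM.
Qed.

Lemma f0_integrable : integrableV f0.
Proof.
have := @pair_integrable (fun=> 1) 1 (measurable_cst _) (fun _ => _).
rewrite normr1 => /(_ (fun _ => lexx _)); apply: eq_integrable => // x _ /=.
by rewrite mulr1.
Qed.

Lemma pair_bound g (c : R) : mfun g -> (forall y, `|g y| <= c) ->
  `|\int[V]_y (f0 y * g y)| <= c * \int[V]_y f0 y.
Proof.
move=> mg gc; apply: le_trans (le_normr_Rintegral _ (pair_integrable mg gc)) _ => //.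
rewrite -RintegralZl//; last exact: f0_integrable.
apply: le_Rintegral => //.
- have := @pair_integrable (fun y => `|g y|) c (measurableT_comp (@normr_measurable R setT) mg).
  have gc' y : `| `|g y| | <= c by rewrite normr_id.
  move=> /(_ gc'); apply: eq_integrable => // x _ /=.
  by rewrite normrM (ger0_norm (f0_ge0 x)).
- have := integrableZl measurableT c f0_integrable.
  by [].
- by move=> x _; rewrite normrM (ger0_norm (f0_ge0 x)) mulrC; apply: ler_wpM2r => //.
Qed.

Definition mollify rho x : R := \int[V]_y (f0 y * rho (x - y)).

Lemma measurable_shift (rho : 'rV[R]_n.+1 -> R) x : mfun rho ->
  mfun (fun y : 'rV[R]_n.+1 => rho (x - y)).
Proof.
move=> mr; apply: (measurableT_comp mr); apply: measurable_add_rV; first meas.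
by apply: measurable_opp_rV; meas.
Qed.

Lemma smooth_measurable (rho : 'rV[R]_n.+1 -> R) : smooth rho -> mfun rho.
Proof. by move=> /smooth_continuous; exact: continuous_measurable_rV. Qed.

Lemma conv_integrable rho x : smooth_compact_support rho ->
  integrableV (fun y => f0 y * rho (x - y)).
Proof.
move=> sr; have [_ [M [_ [_ [rM _ _ _]]]]] := smooth_compact_bounds sr.
apply: pair_integrable => //.
by apply: measurable_shift; apply: smooth_measurable; case: sr.
Qed.

(** The second-order Taylor bound on [rho] is uniform in the point, so it passes through the
    integral and gives the derivative with a quadratic remainder. *)
Lemma conv_derive rho i x : smooth_compact_support rho ->
  is_derive x (delta_mx 0 i) (mollify rho) (mollify (partial i rho) x).
Proof.
move=> sr; have [_ [M [C [[_ _ C0 _ _] [rM gM rC _]]]]] := smooth_compact_bounds sr.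
have sp := smooth_compact_partial i sr.
apply: (@is_derive_of_quadratic _ _ _ _ _ _ (C * \int[V]_y f0 y)) => h _.
have mr : mfun rho by apply: smooth_measurable; case: sr.
have mp : mfun (partial i rho) by apply: smooth_measurable; case: sp.
have E : mollify rho (x + h *: delta_mx 0 i) - mollify rho x - h * mollify (partial i rho) x =
    \int[V]_y (f0 y * (rho (x + h *: delta_mx 0 i - y) - rho (x - y) - h * partial i rho (x - y))).
  have i1 := conv_integrable (x + h *: delta_mx 0 i) sr; have i2 := conv_integrable x sr.
  have i3 := conv_integrable x sp.
  have i3' : integrableV (fun y => h * (f0 y * partial i rho (x - y))).
    have := integrableZl measurableT h i3.
    by [].
  have i12 : integrableV (fun y => f0 y * rho (x + h *: delta_mx 0 i - y) - f0 y * rho (x - y)).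
    have := integrableB measurableT i1 i2.
    by [].
  rewrite /mollify -RintegralZl// -RintegralB// -RintegralB//.
  by apply: eq_Rintegral => y _; ring.
rewrite E; apply: le_trans (pair_bound (c := C * h ^+ 2) _ _) _; last by rewrite mulrAC.
- apply: measurable_funB; last by apply: measurable_funM; [meas|exact: measurable_shift].
  by apply: measurable_funB; exact: measurable_shift.
- move=> y; have := rC (x - y) (h *: delta_mx 0 i).
  rewrite enormZ enorm_delta mulr1 real_normK ?num_real// dotpZr dotp_delta mxE.
  by rewrite (addrAC x).
Qed.

Lemma conv_continuous rho : smooth_compact_support rho -> continuous (mollify rho).
Proof.
move=> sr; have [_ [M [C [[_ M0 C0 _ _] [rM gM rC _]]]]] := smooth_compact_bounds sr.
have mr : mfun rho by apply: smooth_measurable; case: sr.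
have I0 : 0 <= \int[V]_y f0 y by apply: Rintegral_ge0.
apply: locally_lipschitz_continuous => r; exists ((M + C * (2 * `|r|)) * \int[V]_y f0 y).
  pos.
move=> x y xr yr.
have -> : mollify rho x - mollify rho y = \int[V]_z (f0 z * (rho (x - z) - rho (y - z))).
  rewrite /mollify -RintegralB//; try exact: conv_integrable.
  by apply: eq_Rintegral => z _; ring.
rewrite [leRHS]mulrAC; apply: pair_bound; first by apply: measurable_funB; exact: measurable_shift.
move=> z; have := rC (y - z) (x - y).
have -> : y - z + (x - y) = x - z by apply/rowP => i; rewrite !mxE; ring.
have h1 := abs_dotp_le (grad rho (y - z)) (x - y).
have h2 := ler_wpM2r (enorm_ge0 (x - y)) (gM (y - z)).
have h3 : enorm (x - y) <= 2 * `|r|.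
  have := enorm_triangle2 x 0 y; rewrite subr0 sub0r enormN; have := ler_norm r; lra.
have h4 := ler_wpM2l C0 (ler_wpM2l (enorm_ge0 (x - y)) h3).
have := ler_normD (rho (x - z) - rho (y - z) - dotp (grad rho (y - z)) (x - y)) (dotp (grad rho (y - z)) (x - y)).
rewrite subrK; move: h1 h2 h4; lra.
Qed.

Lemma conv_partials rho (s : seq 'I_n.+1) : smooth_compact_support rho ->
  foldr (@partial R n.+1) (mollify rho) s = mollify (foldr (@partial R n.+1) rho s) /\
  smooth_compact_support (foldr (@partial R n.+1) rho s).
Proof.
move=> sr; elim: s => //= i s [-> ss]; split; last exact: smooth_compact_partial.
by apply/funext => x; rewrite {1}/partial; have [_ ->] := conv_derive i x ss.
Qed.

Lemma conv_smooth rho : smooth_compact_support rho -> smooth (mollify rho).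
Proof.
move=> sr s; have [-> ss] := conv_partials s sr; split; first exact: conv_continuous.
by move=> i x; have [] := conv_derive i x ss.
Qed.

Variables (rho : 'rV[R]_n.+1 -> R) (delta : R).
Hypotheses (d0 : 0 < delta) (sr : smooth_compact_support rho) (r0 : forall x, 0 <= rho x)
  (rs : forall x, rho x != 0 -> enorm x <= delta) (r1 : \int[V]_y rho (- y) = 1).

Lemma conv_vanishes : vanishes_outside (D + delta) (mollify rho).
Proof.
move=> x xD; rewrite /mollify (_ : (fun y => _) = fun=> 0); first by rewrite /Rintegral integral0.
apply/funext => y; have [->|ry] := eqVneq (rho (x - y)) 0; first by rewrite mulr0.
rewrite f0D//; have := rs ry; have := enorm_triangle2 x y 0; rewrite !subr0; lra.
Qed.

Lemma conv_smooth_compact : smooth_compact_support (mollify rho).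
Proof. by apply: (smooth_vanishes_compact (conv_smooth sr) conv_vanishes). Qed.

Lemma ge0_Rintegral_translate g v : (forall x, 0 <= g x) -> mfun g ->
  \int[V]_x g (x + v) = \int[V]_x g x.
Proof.
move=> g0 mg; rewrite /Rintegral; congr fine.
apply: (@ge0_integral_rV_addr R n.+1 v (fun x => (g x)%:E)); first meas.
by [].
Qed.

Lemma kernel_mass x : \int[V]_y rho (x - y) = 1.
Proof.
have mr : mfun rho by apply: smooth_measurable; case: sr.
rewrite -r1 -(@ge0_Rintegral_translate (fun y => rho (x - y)) x).
- by apply: eq_Rintegral => y _; rewrite opprD addrCA subrr addr0.
- by [].
- exact: measurable_shift.
Qed.

Lemma kernel_integrable x : integrableV (fun y => rho (x - y)).
Proof.
have [_ [M [_ [_ [rM _ _ _]]]]] := smooth_compact_bounds sr.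
apply: (@integrable_bounded_support _ _ _ (enorm x + delta + 1) M) => //.
  by apply: measurable_shift; apply: smooth_measurable; case: sr.
move=> y /negP; rewrite /eball => yx; apply/eqP; apply: contraT => /rs.
have := enorm_triangle2 y x 0; rewrite !subr0 (enormB y x); lra.
Qed.

Lemma conv_plateau x : (forall y, enorm (y - x) <= delta -> f0 y = 1) -> mollify rho x = 1.
Proof.
move=> f1; rewrite -(kernel_mass x); apply: eq_Rintegral => y _.
have [->|ry] := eqVneq (rho (x - y)) 0; first by rewrite mulr0.
by rewrite f1 ?mul1r// enormB; exact: rs.
Qed.

(** Move x by a short vector along the gradient. Translating the variable of integration puts the
    increment on [f0], evaluated within delta of x plus a step of length at most delta; hence the
    radius 2 delta. *)
Lemma conv_grad_le x (M : R) : 0 <= M ->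
  (forall y z, enorm (y - x) <= 2 * delta -> enorm (z - x) <= 2 * delta -> `|f0 y - f0 z| <= M * enorm (y - z)) ->
  enorm (grad (mollify rho) x) <= M.
Proof.
move=> M0 fM; have [_ [_ [C [[_ _ C0 _ _] [_ _ cC _]]]]] := smooth_compact_bounds conv_smooth_compact.
have mr : mfun rho by apply: smooth_measurable; case: sr.
set g := grad (mollify rho) x in cC *.
have [->|g0] := eqVneq g 0; first by rewrite enorm0.
have g1 : 0 < enorm g by rewrite enorm_gt0.
apply: (@le_of_linear_error R _ _ C delta) => // t t0 td.
pose w : 'rV[R]_n.+1 := (t / enorm g) *: g.
have wt : enorm w = t by rewrite enormZ gtr0_norm ?divr_gt0// divfK// gt_eqF.
have gw : dotp g w = enorm g * t.
  by rewrite dotpZr -enorm_sqr mulrA divfK ?gt_eqF// mulrC.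
have main : mollify rho (x + w) - mollify rho x <= M * t.
  have i1 := @kernel_integrable x.
  have i2 : integrableV (fun y => M * t * rho (x - y)).
    have := integrableZl measurableT (M * t) i1.
    by [].
  have i3 := conv_integrable x sr.
  have -> : M * t = \int[V]_y (M * t * rho (x - y)) by rewrite RintegralZl// kernel_mass mulr1.
  rewrite lerBlDr -RintegralD//.
  have -> : mollify rho (x + w) = \int[V]_y (f0 (y + w) * rho (x - y)).
    rewrite /mollify -(@ge0_Rintegral_translate (fun y => f0 y * rho (x + w - y)) w).
    - by apply: eq_Rintegral => y _; rewrite [y + w]addrC opprD addrA addrK.
    - by move=> y; rewrite mulr_ge0.
    - apply: measurable_funM; first exact: continuous_measurable_rV.
      exact: measurable_shift.
  apply: le_Rintegral => //.
  - have [_ [Mr [_ [_ [rM _ _ _]]]]] := smooth_compact_bounds sr.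
    apply: (@integrable_bounded_support _ _ _ (D + t) Mr).
    + apply: measurable_funM; last exact: measurable_shift.
      apply: (measurableT_comp (continuous_measurable_rV cf0)).
      meas.
    + move=> y /negP; rewrite /eball => yD; rewrite f0D ?mul0r//.
      have := enorm_triangle2 y (y + w) 0; rewrite !subr0 opprD addrA subrr sub0r enormN wt; lra.
    + move=> y; rewrite normrM (ger0_norm (f0_ge0 _)) -[leRHS]mul1r.
      by apply: ler_pM => //; exact: rM.
  - have := integrableD measurableT i2 i3.
    by [].
  - move=> y _; have [->|ry] := eqVneq (rho (x - y)) 0; first by rewrite !mulr0.
    rewrite -mulrDl; apply: ler_wpM2r; first exact: r0.
    rewrite -lerBlDr; apply: le_trans (ler_norm _) _.
    have yx : enorm (y - x) <= delta by rewrite enormB; exact: rs.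
    have := fM (y + w) y; rewrite [y + w - y]addrC addKr wt; apply.
      have := enorm_triangle (y - x) w; rewrite addrAC wt; lra.
    lra.
have := cC x w; rewrite gw wt ler_norml => /andP[h _].
rewrite -(ler_pM2r t0); move: h; rewrite mulrDl; lra.
Qed.

End mollification.

Lemma kernel_exists {R : realType} n (delta : R) : 0 < delta -> exists rho : 'rV[R]_n.+1 -> R,
  [/\ smooth_compact_support rho, forall x, 0 <= rho x, forall x, rho x != 0 -> enorm x <= delta &
    \int[lebesgue_rV n.+1]_y rho (- y) = 1].
Proof.
move=> d0; have [rho [sr r0 rp rs]] := @bump_exists R n.+1 _ (exprn_gt0 2 d0).
have sr1 : smooth_compact_support rho.
  by have := sr 1; rewrite (_ : (fun x => 1 * rho x) = rho)//; apply/funext => x; rewrite mul1r.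
have rd x : rho x != 0 -> enorm x <= delta.
  by move=> /rs; rewrite ler_pXn2r// ?nnegrE ?enorm_ge0// ltW.
have cr : continuous rho by apply: smooth_continuous; case: sr1.
have cr' : continuous (fun y : 'rV[R]_n.+1 => rho (- y)).
  apply/continuous_enormP => x e e0; have /continuous_enormP/(_ (- x) e e0)[d dd h] := cr.
  by exists d => // y yx; apply: h; rewrite -opprD enormN.
have ir : integrableV (fun y => rho (- y)).
  have [_ [M [_ [_ [rM _ _ _]]]]] := smooth_compact_bounds sr1.
  apply: (@integrable_bounded_support _ _ _ (delta + 1) M) => //; first exact: continuous_measurable_rV.
  move=> y /negP; rewrite /eball => yd; apply/eqP; apply: contraT => /rd.
  rewrite enormN; lra.
have I0 : 0 < \int[lebesgue_rV n.+1]_y rho (- y).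
  apply: (@integral_continuous_gt0 R n.+1 _ 0 cr' _ ir); last by rewrite oppr0.
  by [].
set I := Rintegral _ _ _ in I0.
exists (fun x => I^-1 * rho x); split => //.
- by move=> x; rewrite mulr_ge0// invr_ge0 ltW.
- by move=> x; rewrite mulf_eq0 negb_or => /andP[_ /rd].
- by rewrite RintegralZl// -/I mulVf// gt_eqF.
Qed.

Lemma powR_lipschitz {R : realType} (p M : R) : 1 <= p -> exists2 L : R, 0 <= L &
  forall a b, 0 <= a <= M -> 0 <= b <= M -> `|a `^ p - b `^ p| <= L * `|a - b|.
Proof.
move=> p1; have [L L0 h] := apow_lipschitz p1 ler01 (lexx (0 : R)) M.
exists L => // a b /andP[a0 aM] /andP[b0 bM].
have := h a b; rewrite !apow_pos// !mul1r; apply; by rewrite ger0_norm.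
Qed.

(** * Piecewise linear profiles *)

Section profile.
Context {R : realType}.
Variables (rr d : nat -> R).
Hypotheses (rr0 : forall j, 0 < rr j) (rrS : forall j, rr j < rr j.+1) (d0 : forall j, 0 <= d j).
Implicit Types (s t : R) (j J : nat).

Definition ramp j t : R := Num.max 0 (Num.min 1 ((rr j.+1 - t) / (rr j.+1 - rr j))).

Let w0 j : 0 < rr j.+1 - rr j. Proof. by rewrite subr_gt0. Qed.

Lemma ramp_ge0 j t : 0 <= ramp j t. Proof. by rewrite /ramp le_max lexx. Qed.

Lemma ramp_le1 j t : ramp j t <= 1. Proof. by rewrite /ramp ge_max ler01 ge_min lexx. Qed.

Lemma ramp1 j t : t <= rr j -> ramp j t = 1.
Proof.
move=> tj; have h : 1 <= (rr j.+1 - t) / (rr j.+1 - rr j) by rewrite ler_pdivlMr// mul1r lerB.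
by rewrite /ramp; move/min_idPl : h => ->; apply/max_idPr.
Qed.

Lemma ramp0 j t : rr j.+1 <= t -> ramp j t = 0.
Proof.
move=> tj; apply/max_idPl; rewrite ge_min; apply/orP; right.
by rewrite pmulr_lle0 ?invr_gt0// subr_le0.
Qed.

Lemma ramp_lipschitz j s t : `|ramp j s - ramp j t| <= `|s - t| / (rr j.+1 - rr j).
Proof.
have clip (a b : R) : Num.max 0 (Num.min 1 a) - Num.max 0 (Num.min 1 b) <= `|a - b|.
  have ab : a <= b + `|a - b| by have := ler_norm (a - b); lra.
  rewrite lerBlDr ge_max; apply/andP; split; first by rewrite addr_ge0// le_max lexx.
  rewrite [`|_| + _]addrC; have [b1|b1] := leP 1 b.
    by rewrite max_r// ge_min ler_wpDr.
  have [b00|b00] := leP 0 b; first by rewrite ge_min ab orbT.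
  by rewrite ge_min; apply/orP; right; lra.
have E a b : (rr j.+1 - a) / (rr j.+1 - rr j) - (rr j.+1 - b) / (rr j.+1 - rr j) = (b - a) / (rr j.+1 - rr j).
  by rewrite -mulrBl; congr (_ / _); lra.
have h := clip ((rr j.+1 - s) / (rr j.+1 - rr j)) ((rr j.+1 - t) / (rr j.+1 - rr j)).
have h' := clip ((rr j.+1 - t) / (rr j.+1 - rr j)) ((rr j.+1 - s) / (rr j.+1 - rr j)).
rewrite E normrM [`|_^-1|]gtr0_norm ?invr_gt0// in h; rewrite E normrM [`|_^-1|]gtr0_norm ?invr_gt0// in h'.
rewrite distrC in h; rewrite ler_norml h andbT lerNl opprB; exact: h'.
Qed.

Definition profile J t : R := \sum_(j < J) d j * ramp j t.
(** Open intervals make at most one term of [profile_slope] nonzero; with t the gauge of x, the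
    value 0 at the radii themselves concerns a null set of points. *)
Definition ramp_slope j t : R := d j / (rr j.+1 - rr j) * (rr j < t < rr j.+1)%R%:R.
Definition profile_slope J t : R := \sum_(j < J) ramp_slope j t.
Definition profile_bound J : R := \sum_(j < J) d j / (rr j.+1 - rr j).

Lemma rr_mono i j : (i <= j)%N -> rr i <= rr j.
Proof.
elim: j => [|j IH]; first by rewrite leqn0 => /eqP ->.
by rewrite leq_eqVlt => /predU1P[->//|/IH ij]; exact: le_trans ij (ltW (rrS j)).
Qed.

Lemma ramp_slope_ge0 j t : 0 <= ramp_slope j t.
Proof. by rewrite /ramp_slope !mulr_ge0//; pos. Qed.

Lemma profile_slope_ge0 J t : 0 <= profile_slope J t.
Proof. by apply: sumr_ge0 => j _; exact: ramp_slope_ge0. Qed.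

Lemma profile_bound_ge0 J : 0 <= profile_bound J.
Proof. by apply: sumr_ge0 => j _; rewrite divr_ge0// ltW. Qed.

Lemma profile_slope_le J t : profile_slope J t <= profile_bound J.
Proof.
apply: ler_sum => j _; rewrite /ramp_slope ler_piMr ?divr_ge0 ?(ltW (w0 _))//.
by case: (_ < _ < _); rewrite ?ler0n.
Qed.

Lemma profile_ge0 J t : 0 <= profile J t.
Proof. by apply: sumr_ge0 => j _; rewrite mulr_ge0// ramp_ge0. Qed.

Lemma profile_plateau J t : \sum_(j < J) d j = 1 -> t <= rr 0 -> profile J t = 1.
Proof.
move=> d1 t0; rewrite -d1; apply: eq_bigr => j _; rewrite ramp1 ?mulr1//.
exact: le_trans t0 (rr_mono _).
Qed.

Lemma profile_le1 J t : \sum_(j < J) d j = 1 -> profile J t <= 1.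
Proof. by move=> <-; apply: ler_sum => j _; rewrite ler_piMr// ramp_le1. Qed.

Lemma profile_eq0 J t : rr J <= t -> profile J t = 0.
Proof.
move=> tJ; apply: big1 => j _; rewrite ramp0 ?mulr0//; apply: le_trans tJ; apply: rr_mono; exact: ltn_ord.
Qed.

Lemma profile_slope_eq0 J t : rr J <= t -> profile_slope J t = 0.
Proof.
move=> tJ; apply: big1 => j _; rewrite /ramp_slope; case: andP => [[_ tj]|]; last by rewrite mulr0.
by have := le_trans (rr_mono (ltn_ord j)) tJ; rewrite leNgt tj.
Qed.

Lemma profile_lipschitz J s t : `|profile J s - profile J t| <= profile_bound J * `|s - t|.
Proof.
rewrite /profile -sumrB mulr_suml; apply: le_trans (ler_norm_sum _ _ _) _; apply: ler_sum => j _.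
rewrite -mulrBr normrM ger0_norm// -mulrA; apply: ler_wpM2l => //.
by rewrite mulrC; exact: ramp_lipschitz.
Qed.

Lemma profile_local J t : (forall j, t != rr j) -> exists2 e : R, 0 < e & forall s s', `|s - t| < e -> `|s' - t| < e ->
  `|profile J s - profile J s'| <= profile_slope J t * `|s - s'|.
Proof.
move=> tr; elim: J => [|J [e e0 IH]].
  by exists 1 => // s s' _ _; rewrite /profile /profile_slope !big_ord0 subrr normr0.
suff [e' e'0 h] : exists2 e' : R, 0 < e' & forall s s', `|s - t| < e' -> `|s' - t| < e' ->
    `|d J * ramp J s - d J * ramp J s'| <= ramp_slope J t * `|s - s'|.
  exists (Num.min e e') => [|s s']; first by rewrite lt_min e0.
  rewrite !lt_min => /andP[s1 s2] /andP[s1' s2']; rewrite /profile /profile_slope !big_ord_recr/=.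
  rewrite opprD addrACA; apply: le_trans (ler_normD _ _) _; rewrite mulrDl.
  by apply: lerD; [exact: IH|exact: h].
have near_lt (a b : R) : b < a -> 0 < a - b by rewrite subr_gt0.
have rs : 0 <= ramp_slope J t by exact: ramp_slope_ge0.
have [tJ|tJ|E] := ltgtP t (rr J); last by move: (tr J); rewrite E eqxx.
  exists (rr J - t) => [|s s']; first exact: near_lt.
  rewrite !ltr_norml => /andP[_ h1] /andP[_ h2].
  have s1 : s <= rr J by lra.
  have s2 : s' <= rr J by lra.
  by rewrite !ramp1// subrr normr0 mulr_ge0.
have [tJ'|tJ'|E] := ltgtP t (rr J.+1); last by move: (tr J.+1); rewrite E eqxx.
  exists 1 => // s s' _ _; rewrite /ramp_slope tJ tJ' mulr1 -mulrBr normrM ger0_norm// -mulrA.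
  by apply: ler_wpM2l => //; rewrite mulrC; exact: ramp_lipschitz.
exists (t - rr J.+1) => [|s s']; first exact: near_lt.
rewrite !ltr_norml => /andP[h1 _] /andP[h2 _].
have s1 : rr J.+1 <= s by lra.
have s2 : rr J.+1 <= s' by lra.
by rewrite !ramp0// subrr normr0 mulr_ge0.
Qed.

Lemma profile_slope_power J t (p g : R) : 1 <= p -> 0 <= g ->
  (profile_slope J t * g) `^ p <= \sum_(j < J) (ramp_slope j t `^ p * g `^ p).
Proof.
move=> p1 g0; have p0 : p != 0 by lra.
rewrite -mulr_suml powRM ?profile_slope_ge0//; apply: ler_wpM2r; first pos.
have [[j jt]|nj] := pselect (exists j : 'I_J, rr j < t < rr j.+1); last first.
  rewrite /profile_slope big1 ?powR0//; first by apply: sumr_ge0 => j _; pos.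
  by move=> j _; rewrite /ramp_slope; case: (boolP (_ < _ < _)) => h; rewrite ?mulr0//; case: nj; exists j.
rewrite /profile_slope (bigD1 j)//= big1 ?addr0; last first.
  move=> i ij; rewrite /ramp_slope; case: (boolP (_ < _ < _)) => h; rewrite ?mulr0//.
  move: jt h => /andP[j1 j2] /andP[i1 i2]; have [ij'|ij'|ij'] := ltngtP i j.
  - by have := rr_mono ij'; rewrite leNgt (lt_trans j1 i2).
  - by have := rr_mono ij'; rewrite leNgt (lt_trans i1 j2).
  - by move/negP: ij; case; apply/eqP/val_inj.
by rewrite (bigD1 j)//= lerDl; apply: sumr_ge0 => i _; pos.
Qed.

End profile.

Section level_sets.
Context {R : realType} {n : nat}.
Variables (K : set 'rV[R]_n.+1) (r D p : R).
Hypotheses (cK : isconvex K) (kK : compact K) (r0 : 0 < r) (D0 : 0 < D)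
  (rK : forall x, enorm x <= r -> K x) (KD : forall x, K x -> enorm x <= D) (p1 : 1 <= p).
Local Notation V := (@lebesgue_rV R n.+1).
Local Notation N := (gauge K).
Implicit Types (x y z v w : 'rV[R]_n.+1) (s t a b : R).

Let mN := measurable_gauge r0 rK.

(** The level set {N = 1} and the shrunk body (1 - h) K are disjoint subsets of K, so the former has
    volume at most (1 - (1 - h)^(n+1)) V(K), which tends to 0; the other levels are its dilates. *)
Lemma level_set_null t : 0 < t -> V [set x | N x = t] = 0%E.
Proof.
move=> t0; have mE s : measurable [set x | N x = s].
  rewrite (_ : [set x | _] = [set x | N x <= s] `&` [set x | s <= N x]).
    meas.
  by apply/seteqP; split=> x /= => [->//|[h1 h2]]; apply/eqP; rewrite eq_le h1.
have -> : [set x | N x = t] = [set x | [set x | N x = 1] (t^-1 *: x)].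
  apply/seteqP; split=> x /=; rewrite (gaugeZ r0 rK) ?invr_ge0 ?(ltW t0)// => h.
    by rewrite h mulVf// gt_eqF.
  by rewrite -[N x]mul1r -(divff (lt0r_neq0 t0)) -mulrA h mulr1.
rewrite lebesgue_dilate//.
suff -> : V [set x | N x = 1] = 0%E by rewrite mule0.
have KB : K `<=` eball n.+1 (D + 1) by move=> x /KD; rewrite /eball /= => ?; lra.
have mK := measurable_body kK; have VK := lebesgue_rV_fin mK KB.
have EK : [set x | N x = 1] `<=` K by move=> x h; apply/(gauge_le1 cK kK r0 rK); rewrite h.
have VE := lebesgue_rV_fin (mE 1) (subset_trans EK KB).
rewrite VE; congr (_%:E); apply/eqP; rewrite eq_le fine_ge0// andbT.
set a := fine (V K) in VK; set b := fine _ in VE *.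
apply: (@le_of_linear_error R _ _ (n.+1%:R * a) 2^-1) => // h h0 h1; rewrite add0r.
have h2 : 0 < 1 - h by lra.
pose K' := [set x | K ((1 - h)^-1 *: x)].
have mK' : measurable K' by meas.
have VK' : V K' = ((1 - h) ^+ n.+1 * a)%:E by rewrite lebesgue_dilate// VK.
have K'N x : K' x -> N x <= 1 - h.
  move/(gauge_le1 cK kK r0 rK); rewrite (gaugeZ r0 rK) ?invr_ge0 ?(ltW h2)// ler_pdivrMl// mulr1//.
pose E1 : set 'rV[R]_n.+1 := [set x | N x = 1];
have : (V (E1 `|` K') <= V K)%E.
  apply: le_lebesgue_rV => //; first by apply: measurableU => //; exact: mE.
  by move=> x [/EK//|/K'N h3]; apply/(gauge_le1 cK kK r0 rK); lra.
have -> : V (E1 `|` K') = (b + (1 - h) ^+ n.+1 * a)%:E.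
  rewrite EFinD -VE -VK'; apply: measureU => //; first exact: mE.
  by apply/seteqP; split=> // x [/= Nx /K'N]; rewrite Nx; lra.
have a0 : 0 <= a by apply: fine_ge0; exact: measure_ge0.
have hh : h <= 1 by lra.
rewrite VK lee_fin; have := ler_wpM2r a0 (@bernoulli_ineq R h n.+1 (ltW h0) hh); lra.
Qed.

Local Notation g := (fun x => slope K x `^ p).

Let mg : mfun g.
Proof. exact: (measurableT_comp (measurable_powR p) (measurable_slope r0 rK)). Qed.

Let mB t : measurable [set x | N x < t].
Proof. meas. Qed.

Let g0 (A : set 'rV[R]_n.+1) x : (0 <= (g x * \1_A x)%:E)%E.
Proof. pos. Qed.

Let mgA (A : set 'rV[R]_n.+1) : measurable A -> mfun (fun x => (g x * \1_A x)%:E).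
Proof. by move=> mA; apply/measurable_EFinP; meas. Qed.

(** [slope] is homogeneous of degree 0, so the integral of its power over {N < t} is t^(n+1) times
    the one over {N < 1}; the shell is estimated by a difference of two such integrals. *)
Lemma shell_slope_energy a b : 0 < a -> a < b ->
  (\int[V]_x (slope K x `^ p * \1_([set x | (a < N x < b)%R]) x)%:E <=
   ((b ^+ n.+1 - a ^+ n.+1) * slope_energy p K)%:E)%E.
Proof.
move=> a0 ab; have b0 := lt_trans a0 ab.
pose I t := (\int[V]_x (slope K x `^ p * \1_([set x | (N x < t)%R]) x)%:E)%E.
have I0 t : (0 <= I t)%E by pos.
have IZ t : 0 < t -> I t = ((t ^+ n.+1)%:E * I 1%R)%E.
  move=> t0; rewrite /I.
  have := @ge0_integral_rV_scale R n.+1 t^-1 _ (invr_neq0 (lt0r_neq0 t0)) (mgA (mB 1)) (g0 _).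
  rewrite gtr0_norm ?invr_gt0// invrK => <-; apply: eq_integral => x _; congr (_%:E).
  rewrite (slopeZ r0 rK) ?invr_gt0//; congr (_ * _).
  have := @indic_iff R _ _ [set x | N x < t] [set x | N x < 1] x (t^-1 *: x).
  move=> H; apply: EFin_inj; apply: H; rewrite /= (gaugeZ r0 rK) ?invr_ge0 ?(ltW t0)//.
  by rewrite ltr_pdivrMl// mulr1.
have I1 : (I 1%R <= (slope_energy p K)%:E)%E.
  rewrite -(slope_energyE p1 kK r0 rK KD) integral_in_indic; apply: ge0_le_integral_any => x _ //.
  rewrite -EFinM; apply: ler_wpM2l; first pos.
  rewrite !indicE; have [/set_mem/= h|] := boolP (x \in [set x0 | N x0 < 1]) => //.
  by rewrite mem_set//; apply/(gauge_le1 cK kK r0 rK); pos.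
have I1f : I 1%R = (fine (I 1%R))%:E by rewrite fineK// ge0_fin_numE// (le_lt_trans I1)// ltry.
have mS : measurable [set x | (a < N x < b)%R] by meas.
set X := (\int[V]_x _)%E; have X0 : (0 <= X)%E by apply: integral_ge0 => x _; exact: g0.
have : (I a + X <= I b)%E.
  have E := ge0_integralD V measurableT (fun x _ => g0 _ x) (mgA (mB a)) (fun x _ => g0 _ x) (mgA mS).
  rewrite /I /X -E.
  apply: ge0_le_integral_any => x _; rewrite -?EFinD ?lee_fin.
    pos.
  rewrite -mulrDr; apply: ler_wpM2l; first pos.
  rewrite !indicE; have [xa|xa] := boolP (x \in [set x | N x < a]).
    move/set_mem : xa => xa; rewrite memNset ?addr0 => [|/= /andP[]]; last by rewrite ltNge (ltW xa).
    by rewrite mem_set//= (lt_trans xa).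
  rewrite add0r; have [/set_mem/= /andP[_ xb]|//] := boolP (x \in [set x | a < N x < b]).
  by rewrite mem_set.
have If := IZ _ a0; have Ib := IZ _ b0; rewrite I1f -EFinM in If; rewrite I1f -EFinM in Ib.
rewrite If Ib; have [Xf|] := boolP (X \is a fin_num); last first.
  by rewrite ge0_fin_numE// -leNgt leye_eq => /eqP ->.
rewrite -(fineK Xf) -EFinD !lee_fin => h.
have h1 : fine (I 1) <= slope_energy p K by rewrite -lee_fin -I1f.
have ba : 0 <= b ^+ n.+1 - a ^+ n.+1 by rewrite subr_ge0 lerXn2r ?nnegrE ?ltW.
have := ler_wpM2l ba h1; lra.
Qed.

End level_sets.

Lemma fine_lee {R : realType} (a b : \bar R) : (0 <= a)%E -> (a <= b)%E -> ((fine a)%:E <= b)%E.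
Proof. by case: a => [a||] //= _; apply: le_trans; exact: leey. Qed.

(** * Capacity of a body from a profile of its gauge *)

Section capacity_upper.
Context {R : realType} {n : nat}.
Variables (K : set 'rV[R]_n.+1) (r D p : R).
Hypotheses (cK : isconvex K) (kK : compact K) (r0 : 0 < r) (D0 : 0 < D)
  (rK : forall x, enorm x <= r -> K x) (KD : forall x, K x -> enorm x <= D) (p1 : 1 <= p).
Variables (rr d : nat -> R) (J : nat).
Hypotheses (rr0 : 1 < rr 0) (rrS : forall j, rr j < rr j.+1) (d0 : forall j, 0 <= d j)
  (d1 : \sum_(j < J) d j = 1).
Local Notation V := (@lebesgue_rV R n.+1).
Local Notation N := (gauge K).
Implicit Types (x y z v w : 'rV[R]_n.+1) (e : R).

Let f0 x := profile rr d J (N x).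
Let S x := profile_slope rr d J (N x).
Let L := profile_bound rr d J * r^-1.
(** Mollifying at a scale at most c keeps the value 1 on K: a step of length (rr 0 - 1) r raises the
    gauge by at most rr 0 - 1. *)
Let c : R := Num.min 1 ((rr 0 - 1) * r).
Let delta (k : nat) : R := c / k.+1%:R.

Let rr_gt0 j : 0 < rr j.
Proof. by apply: lt_le_trans (rr_mono rrS (leq0n j)); apply: lt_trans rr0. Qed.

Let c0 : 0 < c. Proof. by rewrite lt_min ltr01 mulr_gt0// subr_gt0. Qed.
Let delta_gt0 k : 0 < delta k. Proof. by rewrite divr_gt0. Qed.
Let delta_le k : delta k <= c.
Proof. by rewrite ler_pdivrMr// ler_peMr ?(ltW c0)// ler1n. Qed.
Let delta_le1 k : delta k <= 1.
Proof. by apply: le_trans (delta_le k) _; rewrite ge_min lexx. Qed.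

Let f0_lip x y : `|f0 x - f0 y| <= L * enorm (x - y).
Proof.
apply: le_trans (profile_lipschitz rrS d0 J _ _) _; rewrite /L -mulrA.
by apply: ler_wpM2l; [exact: profile_bound_ge0|exact: (gauge_lipschitz r0 rK)].
Qed.

Let L0 : 0 <= L. Proof. by rewrite mulr_ge0 ?invr_ge0 ?(ltW r0)// profile_bound_ge0. Qed.

Let cf0 : continuous f0.
Proof. by apply: locally_lipschitz_continuous => t; exists L => // x y _ _; exact: f0_lip. Qed.

Let f0_ge0 x : 0 <= f0 x. Proof. exact: profile_ge0. Qed.
Let f0_le1 x : f0 x <= 1. Proof. exact: profile_le1. Qed.

Let gauge_far x : D * rr J <= enorm x -> rr J <= N x.
Proof. by move=> xD; apply: le_trans (gauge_ge r0 D0 rK KD x); rewrite ler_pdivlMr// mulrC. Qed.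

Let f0D : vanishes_outside (D * rr J) f0.
Proof. by move=> x xD; rewrite /f0 profile_eq0// gauge_far. Qed.

Let kernels : {rho : nat -> 'rV[R]_n.+1 -> R | forall k, [/\ smooth_compact_support (rho k), forall x, 0 <= rho k x,
  forall x, rho k x != 0 -> enorm x <= delta k & \int[V]_y rho k (- y) = 1]}.
Proof. by apply/cid; have [f fP] := choice (fun k => @kernel_exists R n _ (delta_gt0 k)); exists f. Qed.

Let rho := sval kernels.
Let F k := mollify f0 (rho k).

Let F_smooth k : smooth_compact_support (F k).
Proof.
have [sr rh0 rs r1] := svalP kernels k.
exact: (conv_smooth_compact cf0 f0_ge0 f0_le1 f0D sr rs).
Qed.

Let F_admissible k : admissible K (F k).
Proof.
have [sr rh0 rs r1] := svalP kernels k.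
split; first exact: F_smooth.
move=> x Kx; rewrite /F (conv_plateau sr rh0 rs r1)// => y yx.
apply: profile_plateau => //.
have := proj1 (gauge_le1 cK kK r0 rK x) Kx; have := gauge_lipschitz r0 rK y x.
rewrite ler_norml => /andP[_].
have : r^-1 * enorm (y - x) <= rr 0 - 1.
  rewrite ler_pdivrMl//; apply: le_trans yx _; apply: le_trans (delta_le k) _.
  by rewrite /c mulrC ge_min lexx orbT.
lra.
Qed.

Let F_grad k x M : 0 <= M -> (forall y z, enorm (y - x) <= 2 * delta k -> enorm (z - x) <= 2 * delta k ->
  `|f0 y - f0 z| <= M * enorm (y - z)) -> enorm (grad (F k) x) <= M.
Proof.
have [sr rh0 rs r1] := svalP kernels k.
exact: (conv_grad_le cf0 f0_ge0 f0_le1 f0D (delta_gt0 k) sr rh0 rs r1).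
Qed.

Let gradL k x : enorm (grad (F k) x) <= L.
Proof. by apply: F_grad => // y z _ _; exact: f0_lip. Qed.

Let grad0 k x : D * rr J + 2 <= enorm x -> enorm (grad (F k) x) = 0.
Proof.
move=> xD; apply/eqP; rewrite eq_le enorm_ge0 andbT; apply: F_grad => // y z yx zx.
have far u : enorm (u - x) <= 2 * delta k -> f0 u = 0.
  move=> ux; apply: f0D; have := enorm_triangle2 x u 0; rewrite !subr0 (enormB x u).
  have := delta_le1 k; lra.
by rewrite !far// subrr normr0 mul0r.
Qed.

Let S_ge0 x : 0 <= S x. Proof. exact: profile_slope_ge0. Qed.

Let SL x : S x * slope K x <= L.
Proof.
by apply: ler_pM => //; [exact: (slope_ge0 r0 rK)|exact: profile_slope_le|exact: (slope_bounded r0 rK)].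
Qed.

(** Away from the radii, f0 is Lipschitz near x with constant S x (slope + e), and the supports of
    the kernels shrink into that neighbourhood. *)
Let grad_limit x e : (forall j, N x != rr j) -> 0 < e ->
  \forall k \near \oo, enorm (grad (F k) x) <= S x * (slope K x + e).
Proof.
move=> Nx e0; have [a a0 fa] := profile_local rrS d0 J Nx.
have [b b0 gb] := gauge_local_lipschitz r0 rK x e0.
have ab : 0 < Num.min (a * r) b / 2 by rewrite divr_gt0// lt_min b0 mulr_gt0.
have sm : delta k @[k --> \oo] --> 0.
  have := @cvgMr _ _ _ _ _ c _ cvg_harmonic; rewrite mulr0; exact.
near=> k.
have dk : delta k < Num.min (a * r) b / 2.
  near: k; have /cvgrPdist_lt/(_ _ ab) := sm; apply: filterS => k.
  by rewrite sub0r normrN gtr0_norm.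
have ma : Num.min (a * r) b <= a * r by rewrite ge_min lexx.
have mb : Num.min (a * r) b <= b by rewrite ge_min lexx orbT.
have da : 2 * delta k < a * r by lra.
have db : 2 * delta k < b by lra.
have s0 : 0 <= slope K x + e by rewrite addr_ge0 ?(ltW e0)//; exact: (slope_ge0 r0 rK).
apply: F_grad; first pos.
move=> y z yx zx.
have near u : enorm (u - x) <= 2 * delta k -> `|N u - N x| < a.
  move=> ux; apply: le_lt_trans (gauge_lipschitz r0 rK u x) _.
  by rewrite ltr_pdivrMl// mulrC; exact: le_lt_trans ux da.
apply: le_trans (fa _ _ (near _ yx) (near _ zx)) _.
rewrite -/(S x) -mulrA; apply: ler_wpM2l; first pos.
by apply: gb; [exact: le_lt_trans yx db|exact: le_lt_trans zx db].
Unshelve. all: end_near. Qed.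

Let measurable_S : mfun S.
Proof.
rewrite /S /profile_slope; apply: (@measurable_sum _ _ _ _ _ _ (fun (j : 'I_J) x => ramp_slope rr d j (N x))) => j.
rewrite (_ : (fun x => _) = fun x => d j / (rr j.+1 - rr j) *
    \1_([set x | rr j < N x] `&` [set x | N x < rr j.+1]) x).
  apply: measurable_funM; first meas.
  apply: measurable_indic; apply: measurableI; apply: measurable_lt_set; try meas;
    exact: (measurable_gauge r0 rK).
apply/funext => x; rewrite /ramp_slope; congr (_ * _%:R); congr nat_of_bool.
by apply/idP/idP => [/andP[h1 h2]|/set_mem[/= -> ->]//]; rewrite mem_set.
Qed.

Let h x := S x * slope K x.
(** The maximum with the expected limit h makes G k >= h, so an upper estimate of the gradients
    suffices for convergence, and the energy of G k still bounds the one of F k. *)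
Let G k x := Num.max (enorm (grad (F k) x)) (h x).

Let h_ge0 x : 0 <= h x. Proof. by rewrite mulr_ge0//; exact: (slope_ge0 r0 rK). Qed.

Let G_le k x : 0 <= G k x <= L.
Proof. by rewrite /G le_max h_ge0 orbT/= ge_max gradL SL. Qed.

Let measurable_h : mfun h.
Proof. by rewrite /h; apply: measurable_funM; [meas|exact: (measurable_slope r0 rK)]. Qed.

Let measurable_G k : mfun (G k).
Proof.
apply: measurable_maxr => //; apply: measurable_enorm; apply: measurable_grad.
by case: (F_smooth k).
Qed.

Let G_limit x : (forall j, N x != rr j) -> (G k x `^ p)%:E @[k --> \oo] --> (h x `^ p)%:E.
Proof.
move=> Nx; apply: cvg_EFin; first by apply: nearW.
have [Lp Lp0 lip] := powR_lipschitz L p1.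
apply/cvgrPdist_le => e e0.
pose e1 := e / ((Lp + 1) * (S x + 1)).
have e10 : 0 < e1 by rewrite divr_gt0// mulr_gt0// ltr_wpDl.
near=> k; have gk : enorm (grad (F k) x) <= S x * (slope K x + e1).
  by near: k; exact: grad_limit.
have hG : h x <= G k x by rewrite /G le_max lexx orbT.
have hL : 0 <= h x <= L by rewrite h_ge0 SL.
apply: le_trans (lip _ _ hL (G_le k x)) _.
rewrite distrC ger0_norm ?subr_ge0//.
have GS : G k x - h x <= S x * e1.
  rewrite lerBlDr ge_max lerDr mulr_ge0 ?(ltW e10)// andbT; apply: le_trans gk _.
  by rewrite /h mulrDr addrC.
apply: le_trans (ler_wpM2l Lp0 GS) _.
have S1 : 0 < S x + 1 by rewrite ltr_wpDl.
have Lp1 : 0 < Lp + 1 by rewrite ltr_wpDl.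
have -> : Lp * (S x * e1) = e * ((Lp / (Lp + 1)) * (S x / (S x + 1))).
  by rewrite /e1; field; rewrite !gt_eqF.
rewrite ler_piMr ?(ltW e0)//; apply: mulr_ile1; rewrite ?divr_ge0// ?(ltW Lp1)// ?(ltW S1)//.
  by rewrite ler_pdivrMr// mul1r lerDl.
by rewrite ler_pdivrMr// mul1r lerDl.
Unshelve. all: end_near. Qed.

(** Dominated convergence: off the null set where N takes one of the radii, G k tends to h, and all
    G k are bounded by L and vanish outside one ball. *)
Let energy_limit : ((variational_capacity p K)%:E <= \int[V]_x (h x `^ p)%:E)%E.
Proof.
have p0 : 0 <= p by apply: le_trans p1.
have mG k : mfun (fun x => (G k x `^ p)%:E) by meas.
have lower k : ((variational_capacity p K)%:E <= \int[V]_x (G k x `^ p)%:E)%E.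
  have gE : (0 <= \int[V]_x (enorm (grad (F k) x) `^ p)%:E)%E by pos.
  have gG : (\int[V]_x (enorm (grad (F k) x) `^ p)%:E <= \int[V]_x (G k x `^ p)%:E)%E.
    apply: ge0_le_integral_any => x _; rewrite lee_fin ?powR_ge0//.
    by apply: le_powRl => //; [pos|rewrite /G le_max lexx].
  apply: (@le_trans _ _ (\int[V]_x (enorm (grad (F k) x) `^ p))%:E).
    rewrite lee_fin; apply: ge_inf; last by exists (F k).
    by exists 0 => _ [f _ <-]; apply: Rintegral_ge0 => x _; pos.
  exact: (fine_lee gE gG).
pose Z := \bigcup_(j in @setT nat) [set x | N x = rr j].
have mlev j : measurable [set x | N x = rr j].
  rewrite (_ : [set x | _] = [set x | N x <= rr j] `&` [set x | rr j <= N x]).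
    by apply: measurableI; apply: measurable_le_set; try meas; exact: (measurable_gauge r0 rK).
  by apply/seteqP; split=> x /= => [->//|[h1 h2]]; apply/eqP; rewrite eq_le h1.
have [mZ Z0] : measurable Z /\ V Z = 0%E.
  apply: lebesgue_rV_countable => // j.
  exact: (level_set_null cK kK r0 rK KD (rr_gt0 j)).
pose g x : \bar R := (L `^ p * \1_(@eball R n.+1 (D * rr J + 2)) x)%:E.
have mf : mfun (fun x => (h x `^ p)%:E) by meas.
have cv : \forall x \ae V, setT x -> (G k x `^ p)%:E @[k --> \oo] --> (h x `^ p)%:E.
  exists Z; split=> // x nx; apply: contrapT => nZ; apply: nx => _.
  by apply: G_limit => j; apply/eqP => E; apply: nZ; exists j.
have dom : \forall x \ae V, forall k, setT x -> (`|(G k x `^ p)%:E| <= g x)%E.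
  apply: aeW => x k _; rewrite lee_fin ger0_norm ?powR_ge0// indicE.
  have [xB|xB] := boolP (x \in _); first by rewrite mulr1; have /andP[h1 h2] := G_le k x; exact: le_powRl.
  have xD : D * rr J + 2 <= enorm x by rewrite leNgt; apply/negP => H; move/negP: xB; apply; rewrite mem_set.
  have S0 : S x = 0 by apply: profile_slope_eq0 => //; apply: gauge_far; apply: le_trans xD; lra.
  by rewrite mulr0 /G grad0// /h S0 mul0r maxxx powR0// gt_eqF//; apply: lt_le_trans p1.
have ig := @integrable_cst_indic R n.+1 (L `^ p) _ _ (@measurable_eball R n.+1 (D * rr J + 2)) (@subset_refl _ _).
have [_ _ lim] := dominated_convergence measurableT mG mf cv ig dom.
rewrite -(cvg_lim _ lim)//; apply: lime_ge; first by apply: cvgP lim.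
by apply: nearW => k; exact: lower.
Qed.

Lemma capacity_le_profile : variational_capacity p K <=
  \sum_(j < J) (d j / (rr j.+1 - rr j)) `^ p * (rr j.+1 ^+ n.+1 - rr j ^+ n.+1) * slope_energy p K.
Proof.
rewrite -lee_fin; apply: le_trans energy_limit _.
pose q (j : 'I_J) x : \bar R := (((d j / (rr j.+1 - rr j)) `^ p)%:E *
  (slope K x `^ p * \1_([set x | (rr j < N x < rr j.+1)%R]) x)%:E)%E.
have mq0 (j : 'I_J) : mfun (fun x => (slope K x `^ p * \1_([set x | rr j < N x < rr j.+1]) x)%:E).
  apply/measurable_EFinP; apply: measurable_funM.
    exact: (measurableT_comp (measurable_powR p) (measurable_slope r0 rK)).
  apply: measurable_indic.
  rewrite (_ : [set x | _] = [set x | rr j < N x] `&` [set x | N x < rr j.+1]).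
    by apply: measurableI; apply: measurable_lt_set; try meas; exact: (measurable_gauge r0 rK).
  by apply/seteqP; split=> x /= => [/andP[]|[-> ->]].
have q00 (j : 'I_J) x : (0 <= (slope K x `^ p * \1_([set x | (rr j < N x < rr j.+1)%R]) x)%:E)%E by pos.
have q0 j x : (0 <= q j x)%E by pos.
have mq j : mfun (q j) by apply: measurable_funeM; exact: mq0.
apply: (@le_trans _ _ (\int[V]_x (\sum_(j < J) q j x))%E).
  apply: ge0_le_integral_any => x _; first pos.
  rewrite sumEFin; apply: le_trans (profile_slope_power rrS d0 J (N x) p1 (slope_ge0 r0 rK x)) _.
  apply: ler_sum => j _; rewrite /ramp_slope indicE.
  have [jx|jx] := boolP (_ < _ < _).
    by rewrite mulr1 mem_set// mulr1.
  rewrite mulr0 powR0 ?mul0r; last by rewrite gt_eqF//; apply: lt_le_trans p1.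
  pos.
rewrite ge0_integral_sum//.
rewrite -sumEFin; apply: lee_sum => j _.
rewrite ge0_integralZl//; last pos.
rewrite -mulrA EFinM; apply: lee_wpmul2l; first pos.
exact: (shell_slope_energy cK kK r0 rK KD p1 (rr_gt0 j) (rrS j)).
Qed.

Lemma admissible_exists : admissible K !=set0.
Proof. by exists (F 0); exact: F_admissible. Qed.

End capacity_upper.

(** * Comparison of the capacities *)

Section geometric_profile.
Context {R : realType}.
Variables (n : nat) (p q : R).
Hypotheses (p1 : 1 <= p) (pn : p < n.+1%:R) (q1 : 1 < q).
Local Notation beta := (exponent n p).
Local Notation m := n.+1.

Let q0 : 0 < q. Proof. exact: lt_trans q1. Qed.

Let rr (j : nat) : R := q ^+ j.+1.

Let geometric_quotient : (q ^+ m - 1) / (q - 1) <= m%:R * q ^+ m.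
Proof.
rewrite subrX1 mulrAC mulfV ?mul1r ?subr_eq0 ?gt_eqF//.
rewrite mulr_natl -[X in _ <= _ *+ X]card_ord -sumr_const; apply: ler_sum => i _.
by apply: ler_weXn2l; [pos|exact/ltnW/ltn_ord].
Qed.

Let cost (d : nat -> R) J : R :=
  \sum_(j < J) (d j / (rr j.+1 - rr j)) `^ p * (rr j.+1 ^+ m - rr j ^+ m).

Let rrB j : rr j.+1 - rr j = q ^+ j.+1 * (q - 1).
Proof. by rewrite /rr exprS; ring. Qed.

Let rrXB j : rr j.+1 ^+ m - rr j ^+ m = q `^ (j.+1%:R * m%:R) * (q ^+ m - 1).
Proof. by rewrite /rr (exprS q j.+1) exprMn -exprM -natrM powR_mulrn ?(ltW q0)//; ring. Qed.

Let q3 : q ^+ (3 * m) = q ^+ m * q ^+ m * q ^+ m.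
Proof. by rewrite mulnC exprM -expr2 -exprSr. Qed.

Let powRDl (x a c : R) : 0 < x -> x `^ (a + c) = x `^ a * x `^ c.
Proof. by move=> x0; rewrite powRD// (gt_eqF x0) implybT. Qed.

Let qm1 : 0 <= q ^+ m - 1.
Proof. by rewrite subr_ge0 exprn_ege1// ltW. Qed.

(** For p = 1, where kap = n + 1, a single ramp from q to q^2 is already nearly optimal. *)
Let cost_linear : p = 1 -> cost (fun=> 1) 1 <= kap n p * q ^+ (3 * m).
Proof.
move=> pE; rewrite /cost big_ord1 rrB rrXB /kap pE subrr powRr0 mulr1 powRr1; last first.
  pos.
rewrite mul1r invfM mul1r powR_mulrn ?(ltW q0)//.
have -> : q^-1 / (q - 1) * (q ^+ m * (q ^+ m - 1)) = (q ^+ m * q^-1) * ((q ^+ m - 1) / (q - 1)) by ring.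
apply: (@le_trans _ _ (q ^+ m * (m%:R * q ^+ m))).
  apply: ler_pM => //.
  - pos.
  - pos.
  by rewrite ler_piMr ?exprn_ge0 ?(ltW q0)// invf_le1// ltW.
rewrite mulrCA -exprD; apply: ler_wpM2l => //.
by apply: ler_weXn2l; [pos|lia].
Qed.

Section superlinear.
Hypothesis p1' : 1 < p.
Variable J : nat.
Let b : R := q `^ (- beta).
Let w : R := \sum_(i < J) b ^+ i.
Let T : R := w * (q - 1).
Hypothesis bJ : b ^+ J <= 1 - q^-1.

Let p10 : 0 < p - 1. Proof. pos. Qed.
Let p0 : 0 < p. Proof. exact: lt_trans p1'. Qed.
Let beta0 : 0 < beta. Proof. by rewrite divr_gt0// subr_gt0. Qed.
Let b0 : 0 < b. Proof. by rewrite powR_gt0. Qed.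

(** T is nearly at least 1 / beta for q close to 1: w (1 - b) = 1 - b^J >= 1 / q, while 1 - b <=
    beta (q - 1). *)
Let T_ge : q^-1 / beta <= T.
Proof.
have b1 : 1 - b <= beta * (q - 1).
  have h := powR_ge_ln (- beta) q0.
  have h2 : beta * ln q <= beta * (q - 1) by rewrite ler_pM2l// ln_le_sub1.
  by rewrite /b; move: (q `^ (- beta)) (ln q) h h2 => a l; nra.
have wb : w * (1 - b) = 1 - b ^+ J.
  by rewrite -[RHS]opprB subrX1 -/w; ring.
have w0 : 0 <= w by apply: sumr_ge0 => i _; rewrite exprn_ge0// ltW.
rewrite ler_pdivrMr// /T -mulrA (mulrC (q - 1)).
apply: (@le_trans _ _ (w * (1 - b))); last exact: ler_wpM2l.
by rewrite wb; move: bJ; move: (b ^+ J) (q^-1) => x y; lra.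
Qed.

Let T0 : 0 < T. Proof. by apply: lt_le_trans T_ge; rewrite divr_gt0// invr_gt0. Qed.
Let w0 : 0 < w. Proof. by move: T0; rewrite /T pmulr_lgt0// subr_gt0. Qed.

(** The exponents of q that are linear in j combine, through beta (p - 1) = n + 1 - p, to - beta j,
    so the costs form a geometric series with the ratio b of the increments. *)
Let cost_term j : ((b ^+ j / w) / (rr j.+1 - rr j)) `^ p * (rr j.+1 ^+ m - rr j ^+ m) =
  b ^+ j * (T `^ (- p) * q `^ (m%:R - p) * (q ^+ m - 1)).
Proof.
have bE : b ^+ j = q `^ (- beta * j%:R).
  by rewrite powRrM powR_mulrn// powR_ge0.
have -> : b ^+ j / w / (rr j.+1 - rr j) = q `^ (- beta * j%:R - j.+1%:R) * T^-1.
  rewrite rrB bE powRDl// (powRN _ j.+1%:R) powR_mulrn ?(ltW q0)// /T !invfM.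
  by ring.
rewrite powRM ?powR_ge0 ?invr_ge0 ?(ltW T0)// -powRrM rrXB bE.
have -> : T^-1 `^ p = T `^ (- p) by rewrite -powR_inv1 ?(ltW T0)// -powRrM mulN1r.
have -> : q `^ ((- beta * j%:R - j.+1%:R) * p) * T `^ (- p) * (q `^ (j.+1%:R * m%:R) * (q ^+ m - 1)) =
  (q `^ ((- beta * j%:R - j.+1%:R) * p) * q `^ (j.+1%:R * m%:R)) * (T `^ (- p) * (q ^+ m - 1)) by ring.
rewrite -powRDl//.
have -> : (- beta * j%:R - j.+1%:R) * p + j.+1%:R * m%:R = - beta * j%:R + (m%:R - p).
  have bE2 : beta * (p - 1) = m%:R - p by rewrite /exponent mulfVK// gt_eqF.
  have -> : m%:R = beta * (p - 1) + p by rewrite bE2; ring.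
  by rewrite -(natr1 j); ring.
by rewrite powRDl//; ring.
Qed.

Let cost_superlinear :
  \sum_(j < J) b ^+ j / w = 1 /\ cost (fun j => b ^+ j / w) J <= kap n p * q ^+ (3 * m).
Proof.
split; first by rewrite -mulr_suml mulfV// gt_eqF.
rewrite /cost (eq_bigr (fun j : 'I_J => b ^+ j * (T `^ (- p) * q `^ (m%:R - p) * (q ^+ m - 1)))) => [|j _]//.
rewrite -mulr_suml -/w.
have -> : w * (T `^ (- p) * q `^ (m%:R - p) * (q ^+ m - 1)) =
    T `^ (1 - p) * (q `^ (m%:R - p) * ((q ^+ m - 1) / (q - 1))).
  have qq : q - 1 != 0 by pos.
  rewrite (@powRDl T 1)// (powRr1 (ltW T0)).
  by rewrite {2}/T; field.
have TT : T `^ (1 - p) <= beta `^ (p - 1) * q ^+ m.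
  rewrite -(opprB p) powRN -[beta `^ _]invrK -[q ^+ m]invrK -invfM lef_pV2 ?posrE ?powR_gt0//; last first.
    pos.
  apply: (@le_trans _ _ ((q^-1 / beta) `^ (p - 1))); last first.
    by apply: ge0_ler_powR; rewrite ?nnegrE ?(ltW p10) ?(ltW T0)// divr_ge0 ?invr_ge0 ?ltW.
  rewrite (@powRM _ q^-1 beta^-1) ?invr_ge0 ?(ltW q0) ?(ltW beta0)// mulrC.
  have -> : beta^-1 `^ (p - 1) = (beta `^ (p - 1))^-1.
    by rewrite -powR_inv1 ?(ltW beta0)// -powRrM mulN1r powRN.
  apply: ler_wpM2r; first pos.
  have -> : q^-1 `^ (p - 1) = (q `^ (p - 1))^-1.
    by rewrite -powR_inv1 ?(ltW q0)// -powRrM mulN1r powRN.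
  rewrite lef_pV2 ?posrE ?powR_gt0 ?exprn_gt0// -powR_mulrn ?(ltW q0)//.
  by rewrite ler_powR ?(ltW q1)//; apply: le_trans (ltW pn); rewrite gerBl.
have qq : q `^ (m%:R - p) <= q ^+ m.
  by rewrite -powR_mulrn ?(ltW q0)// ler_powR ?(ltW q1)// gerBl ltW.
rewrite /kap.
apply: (@le_trans _ _ ((beta `^ (p - 1) * q ^+ m) * (q ^+ m * (m%:R * q ^+ m)))).
  apply: ler_pM => //; first pos.
    pos.
  by apply: ler_pM => //; pos.
rewrite q3.
by move: (q ^+ m) (beta `^ _) => x y; apply: le_of_eq; ring.
Qed.

Lemma geometric_superlinear : exists d : nat -> R, [/\ forall j, 0 <= d j, \sum_(j < J) d j = 1 &
  cost d J <= kap n p * q ^+ (3 * m)].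
Proof.
exists (fun j => b ^+ j / w); have [h1 h2] := cost_superlinear.
by split => // j; rewrite divr_ge0 ?(ltW w0)// exprn_ge0// ltW.
Qed.

End superlinear.

(* Geometric radii and geometric increments discretize the optimal profile [N x `^ (- exponent)]. *)
Lemma geometric_profile : exists rr d : nat -> R, exists J, [/\ 1 < rr 0%N, forall j, rr j < rr j.+1,
  forall j, 0 <= d j, \sum_(j < J) d j = 1 &
  \sum_(j < J) (d j / (rr j.+1 - rr j)) `^ p * (rr j.+1 ^+ m - rr j ^+ m) <= kap n p * q ^+ (3 * m)].
Proof.
have rrS j : rr j < rr j.+1 by rewrite -subr_gt0 rrB mulr_gt0 ?exprn_gt0// subr_gt0.
move: p1; rewrite le_eqVlt => /orP[/eqP pE|p1'].
  exists rr, (fun=> 1), 1%N; split => //; first by rewrite big_ord1.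
  exact: cost_linear.
have bt : 0 <= q `^ (- exponent n p) < 1.
  rewrite powR_ge0/= powRN invf_lt1 ?powR_gt0//.
  have e0 : 0 < exponent n p by rewrite divr_gt0// subr_gt0.
  by apply: lt_le_trans (powR_ge_ln (exponent n p) q0); rewrite ltrDl mulr_gt0// ln_gt0.
have : ((q `^ (- exponent n p)) ^+ k)%R @[k --> \oo] --> (0 : R).
  by apply: cvg_expr; rewrite ger0_norm; case/andP: bt.
have qV : 0 < 1 - q^-1 by rewrite subr_gt0 invf_lt1.
(* J makes the neglected tail b^J of the geometric series at most 1 - 1/q. *)
move/cvgrPdist_le => /(_ _ qV)[J _ /(_ J (leqnn J))]; rewrite sub0r normrN => hJ.
have [d [d0 d1 dc]] := geometric_superlinear p1' (le_trans (ler_norm _) hJ).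
by exists rr, d, J; split.
Qed.

End geometric_profile.

Section capacity_upper_bound.
Context {R : realType} {n : nat}.
Variables (K : set 'rV[R]_n.+1) (r D p : R).
Hypotheses (cK : isconvex K) (kK : compact K) (r0 : 0 < r) (D0 : 0 < D)
  (rK : forall x, enorm x <= r -> K x) (KD : forall x, K x -> enorm x <= D)
  (p1 : 1 <= p) (pn : p < n.+1%:R).

Lemma admissible_nonempty : admissible K !=set0.
Proof.
have [rr [d [J [h1 h2 h3 h4 _]]]] := geometric_profile p1 pn (ltac:(lra) : (1 < 2 :> R)).
exact: (admissible_exists cK kK r0 D0 rK KD h1 h2 h3 h4).
Qed.

Lemma variational_capacity_ge0 : 0 <= variational_capacity p K.
Proof.
apply: lb_le_inf; first by have [f af] := admissible_nonempty; exists (\int[lebesgue_rV n.+1]_x (enorm (grad f x) `^ p)); exists f.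
by move=> _ [f _ <-]; apply: Rintegral_ge0 => x _; pos.
Qed.

Lemma variational_capacity_le : variational_capacity p K <= kap n p * slope_energy p K.
Proof.
set C := variational_capacity p K; set W := slope_energy p K.
have W0 : 0 <= W by exact: (slope_energy_ge0 p1 kK r0 rK KD).
apply: (@le_of_linear_error R _ _ ((3 * n.+1)%:R * C) 2^-1) => [|t t0 t12]//.
have t1 : t < 1 by lra.
have s1 : 0 < 1 - t by pos.
(* With q = 1 / (1 - t), Bernoulli's inequality absorbs the factor q^(3(n+1)) with an error linear
   in t. *)
have q1 : 1 < (1 - t)^-1 by rewrite invf_gt1//; lra.
have [rr [d [J [h1 h2 h3 h4 h5]]]] := geometric_profile p1 pn q1.
rewrite exprVn in h5.
have h := capacity_le_profile cK kK r0 D0 rK KD p1 h1 h2 h3 h4.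
have {h}h : C <= kap n p / (1 - t) ^+ (3 * n.+1) * W.
  apply: le_trans h _; rewrite -mulr_suml; exact: ler_wpM2r.
have s0 : 0 < (1 - t) ^+ (3 * n.+1) by pos.
have {}h : C * (1 - t) ^+ (3 * n.+1) <= kap n p * W.
  by rewrite -ler_pdivlMr// mulrAC.
have := bernoulli_ineq (3 * n.+1) (ltW t0) (ltW t1).
have := variational_capacity_ge0; rewrite -/C => C0.
move: ((1 - t) ^+ _) ((3 * n.+1)%:R) (kap n p * W) h => a m' kw h hb.
have := ler_wpM2l C0 hb; lra.
Qed.

End capacity_upper_bound.

(** * The bounds on the two capacities of a body *)

Section comparison.
Context {R : realType} {n : nat}.
Variables (sigma : probability 'rV[R]_n.+1 R) (p tau : R).
Hypotheses (n0 : (0 < n)%N) (hsigma : rotation_invariant_on_sphere sigma)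
  (p1 : 1 <= p) (pn : p < n.+1%:R) (tau1 : -1 <= tau) (tau2 : tau <= 1).
Local Notation N := (n.+1%:R : R).
Local Notation V := (@lebesgue_rV R n.+1).
Local Notation om := (@ball_volume R n).
Local Notation cp := ((1 + tau) / 2).
Local Notation cm := ((1 - tau) / 2).
Local Notation c := (direction_mean sigma p cp cm).

Let cp0 : 0 <= cp. Proof. by move: tau1; lra. Qed.
Let cm0 : 0 <= cm. Proof. by move: tau2; lra. Qed.
Let cpm : 0 < cp + cm. Proof. by rewrite -mulrDl; lra. Qed.
Let p0 : 0 < p. Proof. exact: lt_le_trans p1. Qed.
Let om0 : 0 < om. Proof. pos. Qed.

Lemma affine_energyE f : affine_energy sigma p tau f = sphere_energy sigma p cp cm f.
Proof.
have E (u : 'rV[R]_n.+1) : \int[V]_x (phi p tau (dotp u (grad f x)) `^ p) = energy p cp cm f u.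
  by rewrite /energy; congr (fine _); apply: eq_integral => x _; rewrite phi_apow.
have H : \int[sigma]_(u in unit_sphere R n.+1) ((\int[V]_x (phi p tau (dotp u (grad f x)) `^ p)) `^ (- (N / p))) =
    \int[sigma]_(u in unit_sphere R n.+1) (energy p cp cm f u `^ (- (N / p))).
  by apply: eq_Rintegral => u _; rewrite E.
exact: (congr1 (fun I => I `^ (- (p / N))) H).
Qed.

Section body.
Variables (K : set 'rV[R]_n.+1) (r D : R).
Hypotheses (cK : isconvex K) (kK : compact K) (r0 : 0 < r) (D0 : 0 < D)
  (rK : forall x, enorm x <= r -> K x) (KD : forall x, K x -> enorm x <= D).

Let admissible_pos f : admissible K f -> exists x, 0 < f x.
Proof.
move=> [_ fK]; exists 0; apply: lt_le_trans ltr01 (fK _ _).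
by apply: rK; rewrite enorm0 ltW.
Qed.

Lemma volume_bodyE : V K = (volume K)%:E.
Proof.
apply: (@lebesgue_rV_fin _ _ _ (D + 1)); first meas.
by move=> x /KD xD; rewrite /eball/=; lra.
Qed.

(** If c were 0, the sphere energy of an admissible function would be at most 0, but it is a power
    of a positive integral. *)
Lemma direction_mean_gt0 : 0 < c.
Proof.
have [f fK] := admissible_nonempty cK kK r0 D0 rK KD p1 pn; have fpos := admissible_pos fK.
have [sf _] := fK.
have := direction_mean_ge0 sigma p cp0 cm0; rewrite le_eqVlt => /orP[/eqP c0|//].
have := sphere_energy_le n0 hsigma p1 cp0 cm0 cpm sf fpos; rewrite -c0 mul0r leNgt => /negP; case.
have [a [b [L [a0 L0 aZ _]]]] := energy_sphere_bounds p1 cp0 cm0 cpm sf fpos.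
have b0 : 0 < N / p by pos.
have mZ : mfun (energy p cp cm f).
  by apply: continuous_measurable_rV; exact: energy_continuous.
by have [I0 _] := jensen_neg hsigma mZ b0 a0 aZ; exact: powR_gt0.
Qed.

Lemma affine_capacity_le : affine_capacity sigma p tau K <= c * variational_capacity p K.
Proof.
have c0 := direction_mean_gt0.
rewrite mulrC -ler_pdivrMr//; apply: lb_le_inf.
  have [f fK] := admissible_nonempty cK kK r0 D0 rK KD p1 pn.
  by exists (\int[V]_x (enorm (grad f x) `^ p)); exists f.
move=> _ [f fK <-]; rewrite ler_pdivrMr// mulrC.
have [sf _] := fK.
apply: le_trans (sphere_energy_le n0 hsigma p1 cp0 cm0 cpm sf (admissible_pos fK)).
apply: ge_inf; last by exists f; [exact: fK|exact: affine_energyE].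
by exists 0 => _ [g _ <-]; exact: powR_ge0.
Qed.

(** An admissible f is at least 1 on K, so the volume radius a of {f >= 1} satisfies a^N om >= V(K),
    and [sphere_energy_ge] applies with this a. *)
Lemma affine_capacity_ge :
  c * (kap n p * om) * (volume K / om) `^ ((N - p) / N) <= affine_capacity sigma p tau K.
Proof.
apply: lb_le_inf.
  have [f fK] := admissible_nonempty cK kK r0 D0 rK KD p1 pn.
  by exists (affine_energy sigma p tau f); exists f.
move=> _ [f fK <-]; have [sf f1] := fK; rewrite affine_energyE.
have [M M0 fM] := smooth_compact_vanishes sf.
pose A := [set x | 1 <= f x].
have mA : measurable A.
  have mf : mfun f by apply: continuous_measurable_rV; have [/(_ [::])[]] := sf.
  by rewrite -[A]setTI; apply: measurable_fun_le.
have AM : A `<=` eball n.+1 M.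
  by move=> x Ax; rewrite /eball/= ltNge; apply/negP => /fM fx; move: Ax; rewrite /A/= fx ler10.
have KA : (V K <= V A)%E by apply: le_lebesgue_rV => //; meas.
have VA : (0 < V A)%E.
  apply: lt_le_trans KA; apply: (@lebesgue_ball_gt0 R n K 0 r) => //; first meas.
  by move=> x; rewrite subr0 => /ltW; exact: rK.
have [a a0 VAa] := radius_exists mA AM VA.
have := sphere_energy_ge n0 hsigma p1 pn cp0 cm0 cpm sf (admissible_pos fK) a0 VAa.
apply: le_trans; apply: ler_wpM2l.
  by apply: mulr_ge0; [exact: direction_mean_ge0|apply/ltW/mulr_gt0 => //; exact: kap_gt0].
have -> : a `^ (N - p) = (a ^+ n.+1) `^ ((N - p) / N).
  by rewrite -powR_mulrn ?(ltW a0)// -powRrM mulrC divfK//.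
apply: le_powRl; first pos.
  by rewrite divr_ge0// fine_ge0.
rewrite ler_pdivrMr// -lee_fin -volume_bodyE -lebesgue_eballE// -VAa.
by [].
Qed.

(** The area ratio enters through k W(K) <= S_p(K) and S_p(B) <= k om, with W the slope energy, and
    cancels in the quotient. *)
Lemma variational_capacity_le_area k : 0 < k -> @cone_area_ratio R n k ->
  variational_capacity p K <= kap n p * om * (surface_area p K / surface_area p (unit_ball R n.+1)).
Proof.
move=> k0 kP; have /andP[B0 Bk] := surface_area_unit_ball p1 pn k0 kP.
have KW := surface_area_ge p1 pn k0 kP cK kK r0 D0 rK KD.
have W0 := slope_energy_ge0 p1 kK r0 rK KD.
apply: le_trans (variational_capacity_le cK kK r0 D0 rK KD p1 pn) _.
rewrite -mulrA; apply: ler_wpM2l; first exact/ltW/kap_gt0.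
rewrite mulrA (ler_pdivlMr _ _ B0).
apply: (@le_trans _ _ (slope_energy p K * (k * om))); first exact: ler_wpM2l.
by rewrite mulrCA mulrA mulrC ler_pM2l.
Qed.

End body.

End comparison.

Theorem mainTheorem2 (R : realType) (n : nat) (hn : (2 <= n)%N)
    (sigma : probability 'rV[R]_n R)
    (hsigma : rotation_invariant_on_sphere sigma)
    (K : set 'rV[R]_n) (hK : convex_body K) (hK0 : K° 0)
    (p : R) (hp1 : 1 <= p) (hpn : p < n%:R)
    (tau : R) (htau1 : -1 <= tau) (htau2 : tau <= 1) :
  let B := unit_ball R n in
  [/\ (surface_area p K / surface_area p B) `^ (n%:R - p)^-1
        >= (variational_capacity p K / variational_capacity p B)
             `^ (n%:R - p)^-1,
      (variational_capacity p K / variational_capacity p B) `^ (n%:R - p)^-1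
        >= (affine_capacity sigma p tau K / affine_capacity sigma p tau B)
             `^ (n%:R - p)^-1
    & (affine_capacity sigma p tau K / affine_capacity sigma p tau B)
        `^ (n%:R - p)^-1
        >= (volume K / volume B) `^ n%:R^-1].
Proof.
case: n hn sigma hsigma K hK hK0 hpn => [//|n] hn sigma hsigma K hK hK0 hpn B.
have n0 : (0 < n)%N by [].
have [r [D [r0 D0 rK KD]]] := convex_body_bounds hK hK0.
have cK := convex_body_isconvex hK; have [kK _ _] := hK.
have [k k0 kP] := @flat_cone_area R n n0.
pose om := @ball_volume R n; pose N : R := n.+1%:R.
have om0 : 0 < om by exact: ball_volume_gt0.
have kap0 : 0 < kap n p by exact: kap_gt0.
have BE : volume B = om by rewrite /volume lebesgue_unit_ball.
have cB := @unit_ball_convex R n; have kB := @unit_ball_compact R n.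
have B1 := @unit_ball_in R n; have B2 := @unit_ball_sub R n.
have c0 := direction_mean_gt0 n0 hsigma hp1 hpn htau1 htau2 cB kB ltr01 ltr01 B1 B2.
set c := direction_mean _ _ _ _ in c0.
have a1 := affine_capacity_le n0 hsigma hp1 hpn htau1 htau2 cK kK r0 D0 rK KD.
have a2 := affine_capacity_ge n0 hsigma hp1 hpn htau1 htau2 cK kK r0 D0 rK KD.
have a3 := variational_capacity_le_area hp1 hpn cK kK r0 D0 rK KD k0 kP.
have b1 := affine_capacity_le n0 hsigma hp1 hpn htau1 htau2 cB kB ltr01 ltr01 B1 B2.
have b2 := affine_capacity_ge n0 hsigma hp1 hpn htau1 htau2 cB kB ltr01 ltr01 B1 B2.
have b3 := variational_capacity_le_area hp1 hpn cB kB ltr01 ltr01 B1 B2 k0 kP.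
have C0 := variational_capacity_ge0 cK kK r0 D0 rK KD hp1 hpn.
have /andP[S0 _] := surface_area_unit_ball hp1 hpn k0 kP.
rewrite -/B -/c BE in a1 a2 a3 b1 b2 b3 S0 *.
rewrite divff ?gt_eqF// one_powR mulr1 in b2; rewrite divff ?gt_eqF// mulr1 in b3.
(* For B the bounds close up: c kap om <= C_{p,tau}(B) <= c C_p(B) <= c kap om. *)
have vB : variational_capacity p B = kap n p * om.
  by apply/eqP; rewrite eq_le b3 -(ler_pM2l c0) (le_trans b2 b1).
have aB : affine_capacity sigma p tau B = c * (kap n p * om).
  by apply/eqP; rewrite eq_le b2 andbT -vB.
have ko : 0 < kap n p * om by pos.
have cko : 0 < c * (kap n p * om) by pos.
have e0 : 0 <= (n.+1%:R - p)^-1 by pos.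
have A0 : 0 <= affine_capacity sigma p tau K.
  by apply: le_trans a2; rewrite mulr_ge0 ?powR_ge0// ltW.
rewrite vB aB; split.
- apply: le_powRl => //; first pos.
  by rewrite ler_pdivrMr// mulrC.
- apply: le_powRl => //; first pos.
  by rewrite invfM mulrA ler_pM2r ?invr_gt0// ler_pdivrMr// mulrC.
have -> : (volume K / om) `^ (n.+1%:R)^-1 = ((volume K / om) `^ ((n.+1%:R - p) / n.+1%:R)) `^ (n.+1%:R - p)^-1.
  by rewrite -powRrM mulrAC mulfV ?mul1r// subr_eq0 gt_eqF.
apply: le_powRl => //; first pos.
by rewrite ler_pdivlMr// mulrC.
Qed.
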